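(* Let $N\ge2$. For any $A\in M_N(\{0,1\})$, any permutative representation $({\cal H},\pi)$ of ${\cal O}_A$ is completely reducible, and its irreducible decomposition of the form $${\cal H}=\bigoplus_{J\in[1,\ldots,N]^*_A}{\cal H}_J\ \oplus\bigoplus_{K\in[1,\ldots,N]^\infty_A}{\cal H}_K,$$ $${\cal H}_J=\bigoplus_{p\ge1}\Big\{\bigoplus_{j=1}^p{\cal H}_{J,p,j}\Big\}^{\oplus\nu_{J,p}}\oplus\Big\{\int^{\oplus}_{U(1)}{\cal H}_{J,\infty,z}\,d\eta(z)\Big\}^{\oplus\nu_{J,\infty}},\qquad {\cal H}_K=\{{\cal H}_{K,0}\}^{\oplus\nu_K},$$ where ${\cal H}_{J,p,j}$, ${\cal H}_{J,\infty,z}$ and ${\cal H}_{K,0}$ are $P(J;e^{2\pi\sqrt{-1}j/p})$, $P(J;z)$ and $P(K)$, respectively, and $\nu_{J,p}$, $\nu_{J,\infty}$ and $\nu_K$ are multiplicities, is unique up to unitary equivalence.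
   Context: ${\bf N}=\{1,2,\ldots\}$, $U(1)=\{z\in{\bf C}:|z|=1\}$, $\eta$ is the Haar measure of $U(1)$. $M_N(\{0,1\})$ is the set of $N\times N$ matrices with entries in $\{0,1\}$ having no row or column identically equal to zero. For $A=(a_{ij})\in M_N(\{0,1\})$, the Cuntz-Krieger algebra ${\cal O}_A$ is the $C^*$-algebra universally generated by partial isometries $s_1,\ldots,s_N$ satisfying $s_i^*s_i=\sum_{j=1}^N a_{ij}s_js_j^*$ for $i=1,\ldots,N$ and $\sum_{i=1}^N s_is_i^*=I$. A representation is a unital $*$-representation on a complex Hilbert space. Complete reducibility here means that the representation admits a decomposition into irreducible representations of the displayed form, where direct integrals over $U(1)$ are allowed. A representation $({\cal H},\pi)$ of ${\cal O}_A$ is permutative if there are a complete orthonormal basis $\{e_n\}_{n\in\Lambda}$ of ${\cal H}$, subsets $\Lambda_1,\ldots,\Lambda_N$ of $\Lambda$ and $m_{i,n}\in\Lambda$ ($n\in\Lambda_i$) such that $\pi(s_i)e_n=e_{m_{i,n}}$ if $n\in\Lambda_i$ and $\pi(s_i)e_n=0$ otherwise. Words: $\{1,\ldots,N\}^k_{A,c}$ ($k\ge1$) is the set of $(j_1,\ldots,j_k)\in\{1,\ldots,N\}^k$ with $a_{j_{i-1}j_i}=1$ for $i=2,\ldots,k$ and $a_{j_kj_1}=1$; $\{1,\ldots,N\}^*_{A,c}=\coprod_{k\ge1}\{1,\ldots,N\}^k_{A,c}$; $\{1,\ldots,N\}^\infty_A$ is the set of sequences $(j_n)_{n\in{\bf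 N}}$ in $\{1,\ldots,N\}$ with $a_{j_{n-1}j_n}=1$ for $n\ge2$. $\cup$ denotes concatenation, $J^m$ the $m$-fold concatenation, $J^\infty=J\cup J\cup\cdots$. A nonempty finite word $J$ is periodic if $J=J_0^m$ for some nonempty finite word $J_0$ and $m\ge2$. An infinite word $J$ is eventually periodic if $J=J_0\cup J_1^\infty$ for nonempty finite words $J_0,J_1$. Finite words: $J_1\sim J_2$ if they have the same length and one is a cyclic rotation of the other. Infinite words: $J_1\sim J_2$ if $J_1=J_3\cup J_5$, $J_2=J_4\cup J_5$ for some (possibly empty) finite words $J_3,J_4$ and an infinite word $J_5$. For words of the same length $k$, $(j_1,\ldots,j_k)\prec(j'_1,\ldots,j'_k)$ if $\sum_{l=1}^k(j'_l-j_l)N^{k-l}\ge0$; a finite word $J$ is minimal if $J\prec J'$ for each $J'\sim J$. $[1,\ldots,N]^*_A$ is the set of minimal, non periodic elements of $\{1,\ldots,N\}^*_{A,c}$; $[1,\ldots,N]^\infty_A$ is the set of $\sim$-classes of words in $\{1,\ldots,N\}^\infty_A$ that are not eventually periodic (classes are identified with representatives). For $J=(j_l)_{l=1}^p$ finite and $z\in U(1)$, $({\cal H},\pi)$ is $P(J;z)$ if there is a cyclic unit vector $\Omega$ with $\pi(s_{j_1}\cdots s_{j_p})\Omega=z\Omega$ and $\{\pi(s_{j_l}\cdots s_{j_p})\Omega\}_{l=1}^p$ orthonormal. For $J=(j_n)_{n\in{\bf N}}$ infinite, $({\cal H},\pi)$ is $P(J)$ if there is a cyclic unit vector $\Omega$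 with $\{\pi(s_{j_n}^*\cdots s_{j_1}^* )\Omega\}_{n\in{\bf N}}$ orthonormal. *)

(* Defs.v *)
From HB Require Import structures.
From mathcomp Require Import all_boot all_order all_algebra sesquilinear complex.
From mathcomp Require Import all_classical all_reals all_analysis.

Set Implicit Arguments.
Unset Strict Implicit.
Unset Printing Implicit Defensive.

Import Order.TTheory GRing.Theory Num.Theory.
Import numFieldNormedType.Exports.

Local Open Scope classical_set_scope.
Local Open Scope ring_scope.

(* Inner products are linear in the first argument; R[i] is ordered by
   x <= y iff y - x is a nonnegative real. *)
Record hilbert (R : realType) := Hilbert {
  hcarrier :> lmodType R[i];
  hdot : {dot hcarrier for @Num.conj R[i]};
  hilbert_complete : forall u : nat -> hcarrier,
    let norm x := Num.sqrt (complex.Re (hdot x x)) in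
    (forall e : R, 0 < e -> exists M : nat, forall m n : nat,
       (M <= m)%N -> (M <= n)%N -> norm (u m - u n) < e) ->
    exists l : hcarrier, forall e : R, 0 < e -> exists M : nat,
      forall n : nat, (M <= n)%N -> norm (u n - l) < e }.

Section HilbertTheory.
Context {R : realType}.
Implicit Types H K : hilbert R.

Definition hnorm H (x : H) : R := Num.sqrt (complex.Re (hdot H x x)).

Definition orthonormal_family H (I : Type) (e : I -> H) : Prop :=
  (forall i, hdot H (e i) (e i) = 1) /\
  (forall i j, i <> j -> hdot H (e i) (e j) = 0).

Definition in_closed_span H (X : set H) (x : H) : Prop :=
  forall eps : R, 0 < eps ->
  exists (n : nat) (c : 'I_n -> R[i]) (v : 'I_n -> H),
    (forall i, X (v i)) /\ hnorm (x - \sum_i c i *: v i) < eps.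

Definition total_set H (X : set H) : Prop := forall x, in_closed_span X x.

(* The span of X consists of all its finite linear combinations, so this says
   that W is both linear and norm-closed. *)
Definition closed_subspace H (W : set H) : Prop :=
  forall x, in_closed_span W x -> W x.

Definition isometry_into H K (V : H -> K) : Prop :=
  (forall (c : R[i]) x y, V (c *: x + y) = c *: V x + V y) /\
  (forall x y, hdot K (V x) (V y) = hdot H x y).

End HilbertTheory.

Record cstar_algebra (R : realType) := CstarAlgebra {
  ccarrier :> algType R[i];
  cnorm : ccarrier -> R;
  star : ccarrier -> ccarrier;
  starD : forall a b, star (a + b) = star a + star b;
  starZ : forall (c : R[i]) a, star (c *: a) = Num.conj c *: star a;
  starM : forall a b, star (a * b) = star b * star a;
  starK : forall a, star (star a) = a;
  cnorm_ge0 : forall a, 0 <= cnorm a;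
  cnorm_eq0 : forall a, cnorm a = 0 -> a = 0;
  cnormD : forall a b, cnorm (a + b) <= cnorm a + cnorm b;
  cnormZ : forall (c : R[i]) a, cnorm (c *: a) = complex.Re `|c| * cnorm a;
  cnormM : forall a b, cnorm (a * b) <= cnorm a * cnorm b;
  cnorm_star : forall a, cnorm (star a * a) = cnorm a ^+ 2;
  cstar_complete : forall u : nat -> ccarrier,
    (forall e : R, 0 < e -> exists M : nat, forall m n : nat,
       (M <= m)%N -> (M <= n)%N -> cnorm (u m - u n) < e) ->
    exists l : ccarrier, forall e : R, 0 < e -> exists M : nat,
      forall n : nat, (M <= n)%N -> cnorm (u n - l) < e }.

Section CstarTheory.
Context {R : realType}.
Implicit Types O B : cstar_algebra R.

Definition star_hom O B (phi : O -> B) : Prop :=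
  [/\ forall (c : R[i]) a b, phi (c *: a + b) = c *: phi a + phi b,
      forall a b, phi (a * b) = phi a * phi b,
      phi 1 = 1
    & forall a, phi (star a) = star (phi a)].

Definition closed_star_subalgebra O (S : set O) : Prop :=
  [/\ S 1,
      forall (c : R[i]) a b, S a -> S b -> S (c *: a + b),
      forall a b, S a -> S b -> S (a * b),
      forall a, S a -> S (star a)
    & forall a,
        (forall e : R, 0 < e -> exists2 b, S b & cnorm (a - b) < e) -> S a].

Definition partial_isometry O (a : O) : Prop := a * star a * a = a.

End CstarTheory.

(* The letters 1, ..., N are encoded as the elements 0, ..., N-1 of 'I_N. *)

Definition no_zero_line N (A : 'M[bool]_N) : Prop :=
  (forall i, exists j, A i j) /\ (forall j, exists i, A i j).

Section CuntzKrieger.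
Context {R : realType} {N : nat}.

Definition ck_relations (A : 'M[bool]_N) (O : cstar_algebra R)
    (s : 'I_N -> O) : Prop :=
  [/\ forall i, partial_isometry (s i),
      forall i, star (s i) * s i =
        \sum_j ((A i j : nat)%:R : R[i]) *: (s j * star (s j))
    & \sum_i s i * star (s i) = 1].

Definition is_cuntz_krieger (A : 'M[bool]_N) (O : cstar_algebra R)
    (s : 'I_N -> O) : Prop :=
  [/\ ck_relations A s,
      forall S : set O,
        closed_star_subalgebra S -> (forall i, S (s i)) -> S = setT
    & forall (B : cstar_algebra R) (t : 'I_N -> B), ck_relations A t ->
        exists phi : O -> B, star_hom phi /\ forall i, phi (s i) = t i].

End CuntzKrieger.

Record representation (R : realType) (O : cstar_algebra R) := Representation {
  rep_space :> hilbert R;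
  act : O -> rep_space -> rep_space;
  act_linear : forall a (c : R[i]) x y,
    act a (c *: x + y) = c *: act a x + act a y;
  act_bounded : forall a, exists M : R, forall x,
    hnorm (act a x) <= M * hnorm x;
  act_linear_alg : forall (c : R[i]) a b x,
    act (c *: a + b) x = c *: act a x + act b x;
  act1 : forall x, act 1 x = x;
  actM : forall a b x, act (a * b) x = act a (act b x);
  act_star : forall a x y,
    hdot rep_space (act (star a) x) y = hdot rep_space x (act a y) }.

Section Representations.
Context {R : realType} {O : cstar_algebra R}.
Implicit Types pi rho : representation O.

Definition unitarily_equivalent pi rho : Prop :=
  exists U : pi -> rho,
    [/\ isometry_into U, forall y, exists x, U x = y
      & forall a x, U (act a x) = act a (U x)].

Definition irreducible pi : Prop :=
  (exists x : pi, x != 0) /\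
  forall W : set pi, closed_subspace W ->
    (forall a x, W x -> W (act a x)) -> W = [set 0] \/ W = setT.

Definition cyclic_vector pi (Omega : pi) : Prop :=
  forall x (eps : R), 0 < eps -> exists a, hnorm (x - act a Omega) < eps.

(* pi is, up to unitary equivalence, the Hilbert space direct sum of the rho_i: isometric intertwiners with
   mutually orthogonal ranges that together span a dense subspace. *)
Definition is_direct_sum (I : Type) (rho : I -> representation O) pi : Prop :=
  exists V : forall i, rho i -> pi,
    [/\ forall i, isometry_into (@V i),
        forall i j x y, i <> j -> hdot pi (V i x) (V j y) = 0,
        forall i a x, V i (act a x) = act a (V i x)
      & total_set [set v | exists i x, v = V i x]].

End Representations.

Definition circle (R : realType) := {z : R[i] | `|z| == 1}.

Section Circle.
Context (R : realType).

HB.instance Definition _ := Choice.on (circle R).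

Definition circle1 : circle R := exist _ 1 (introT eqP (normr1 R[i])).

HB.instance Definition _ := isPointed.Build (circle R) circle1.

Lemma circle_mul_subproof (w z : circle R) : `|val w * val z| == 1.
Proof. by rewrite normrM (eqP (valP w)) (eqP (valP z)) mulr1. Qed.

Definition circle_mul (w z : circle R) : circle R :=
  exist _ (val w * val z) (circle_mul_subproof w z).

Definition circle_open : set (set (circle R)) :=
  [set B | exists2 G : set R[i]^o, open G & B = [set z | G (val z)]].

Definition borel_circle := g_sigma_algebraType circle_open.

Definition is_haar (eta : probability borel_circle R) : Prop :=
  forall (w : borel_circle) (B : set borel_circle), measurable B ->
    eta [set circle_mul w z | z in B] = eta B.

Definition cmeasurable (f : borel_circle -> R[i]) : Prop :=
  measurable_fun setT (fun z => complex.Re (f z)) /\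
  measurable_fun setT (fun z => complex.Im (f z)).

Definition cintegral (eta : probability borel_circle R)
    (f : borel_circle -> R[i]) : R[i] :=
  Complex (\int[eta]_z complex.Re (f z)) (\int[eta]_z complex.Im (f z)).

End Circle.

(* A measurable field of representations over U(1), in the sense of Dixmier:
   [msection] is the space of measurable vector fields, [mfundamental] a
   fundamental sequence. *)
Record rep_field (R : realType) (O : cstar_algebra R) := RepField {
  fiber :> borel_circle R -> representation O;
  msection : set (forall z, fiber z);
  msection_linear : forall (c : R[i]) x y, msection x -> msection y ->
    msection (fun z => c *: x z + y z);
  msection_norm : forall x, msection x ->
    measurable_fun setT (fun z => hnorm (x z));
  msection_maximal : forall y,
    (forall x, msection x -> cmeasurable (fun z => hdot (fiber z) (x z) (y z))) ->
    msection y;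
  mfundamental : nat -> forall z, fiber z;
  mfundamentalP : forall n, msection (mfundamental n);
  mfundamental_total : forall z, total_set (range (fun n => mfundamental n z));
  msection_act : forall a x, msection x -> msection (fun z => act a (x z)) }.

Section DirectIntegral.
Context {R : realType} {O : cstar_algebra R}.

Definition L2section (eta : probability (borel_circle R) R)
    (F : rep_field O) (x : forall z, F z) : Prop :=
  msection x /\ (\int[eta]_z ((hnorm (x z)) ^+ 2)%:E < +oo)%E.

(* pi is (unitarily equivalent to) the direct integral of F: [U] induces a
   unitary from the square-integrable fields modulo null fields onto pi. *)
Definition is_direct_integral (eta : probability (borel_circle R) R)
    (F : rep_field O) (pi : representation O) : Prop :=
  exists U : (forall z, F z) -> pi,
    [/\ forall (c : R[i]) x y, L2section eta x -> L2section eta y ->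
          U (fun z => c *: x z + y z) = c *: U x + U y,
        forall x y, L2section eta x -> L2section eta y ->
          hdot pi (U x) (U y) =
          cintegral eta (fun z => hdot (F z) (x z) (y z)),
        forall v, exists2 x, L2section eta x & U x = v
      & forall a x, L2section eta x ->
          U (fun z => act a (x z)) = act a (U x)].

End DirectIntegral.

Section Words.
Context {N : nat}.
Implicit Types (A : 'M[bool]_N) (I J : seq 'I_N) (x y : nat -> 'I_N).

(* [cycle] also tests the closing pair (j_k, j_1). *)
Definition cyclic_word A J : Prop :=
  J <> [::] /\ cycle (fun i j => A i j) J.

Definition infinite_word A x : Prop := forall n : nat, A (x n) (x n.+1).

Definition wpow J (m : nat) : seq 'I_N := flatten (nseq m J).

(* The default value [i0] is irrelevant for J nonempty. *)
Definition wpow_inf (i0 : 'I_N) J : nat -> 'I_N :=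
  fun n => nth i0 J (n %% size J).

Definition wcat J x : nat -> 'I_N := fun n => nth (x (n - size J)%N) J n.

Definition periodic_word J : Prop :=
  exists (J0 : seq 'I_N) (m : nat),
    [/\ J0 <> [::], (2 <= m)%N & J = wpow J0 m].

Definition eventually_periodic x : Prop :=
  exists J0 J1 : seq 'I_N,
    [/\ J0 <> [::], J1 <> [::] & x = wcat J0 (wpow_inf (x 0%N) J1)].

Definition rotation_equiv I J : Prop := exists n : nat, J = rot n I.

Definition tail_equiv x y : Prop :=
  exists (J3 J4 : seq 'I_N) (z : nat -> 'I_N), x = wcat J3 z /\ y = wcat J4 z.

(* I \prec J, for words of the same length k *)
Definition wle k (I J : k.-tuple 'I_N) : Prop :=
  (0 <= \sum_(l < k)
     ((tnth J l : nat)%:Z - (tnth I l : nat)%:Z) * (N ^ (k - l.+1))%N%:Z)%R.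

Definition minimal_word J : Prop :=
  forall J' : (size J).-tuple 'I_N, rotation_equiv J' J -> wle (in_tuple J) J'.

Definition bracket_finite A J : Prop :=
  [/\ cyclic_word A J, minimal_word J & ~ periodic_word J].

Definition aperiodic_infinite A x : Prop :=
  infinite_word A x /\ ~ eventually_periodic x.

(* T is a system of representatives of [1,...,N]^\infty_A *)
Definition bracket_infinite A (T : set (nat -> 'I_N)) : Prop :=
  (forall x, T x -> aperiodic_infinite A x) /\
  (forall x, aperiodic_infinite A x -> exists! y, T y /\ tail_equiv x y).

End Words.

Section Permutative.
Context {R : realType} {N : nat} {O : cstar_algebra R} (s : 'I_N -> O).
Implicit Types pi : representation O.

Definition permutative pi : Prop :=
  exists (L : Type) (e : L -> pi) (D : 'I_N -> set L) (m : 'I_N -> L -> L),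
    [/\ orthonormal_family e, total_set (range e),
        forall i n, D i n -> act (s i) (e n) = e (m i n)
      & forall i n, ~ D i n -> act (s i) (e n) = 0].

Definition is_P (J : seq 'I_N) (z : R[i]) pi : Prop :=
  exists Omega : pi,
    [/\ cyclic_vector Omega, hnorm Omega = 1,
        act (\prod_(j <- J) s j) Omega = z *: Omega
      & orthonormal_family
          (fun l : 'I_(size J) => act (\prod_(j <- drop l J) s j) Omega)].

(* The n-th vector of the family is s_{j_{n+1}}^* ... s_{j_1}^* Omega. *)
Definition is_P_inf (x : nat -> 'I_N) pi : Prop :=
  exists Omega : pi,
    [/\ cyclic_vector Omega, hnorm Omega = 1
      & orthonormal_family (fun n : nat =>
          act (\prod_(j <- rev (mkseq x n.+1)) star (s j)) Omega)].

Definition circle_root (p j : nat) : R[i] :=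
  let t : R := 2 * trigo.pi * j%:R / p%:R in Complex (cos t) (sin t).

Context (A : 'M[bool]_N) (T : set (nat -> 'I_N)).

Definition fin_index := {J : seq 'I_N | bracket_finite A J}.
Definition inf_index := {x : nat -> 'I_N | T x}.

(* The indices p >= 1 and 1 <= j <= p are encoded as p.+1 and j.+1 with
   p : nat and j : 'I_p.+1; multiplicities are cardinals, given as types. *)
Record decomposition := Decomposition {
  nu_fin : fin_index -> nat -> Type;
  nu_int : fin_index -> Type;
  nu_inf : inf_index -> Type;
  H_root : fin_index -> forall p : nat, 'I_p.+1 -> representation O;
  H_field : fin_index -> rep_field O;
  H_inf : inf_index -> representation O;
  roots_sum : fin_index -> nat -> representation O;
  field_int : fin_index -> representation O;
  H_J : fin_index -> representation O;
  H_K : inf_index -> representation O }.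

Definition is_decomposition (eta : probability (borel_circle R) R)
    pi (D : decomposition) : Prop :=
  [/\ [/\ forall J p (j : 'I_p.+1),
            is_P (sval J) (circle_root p.+1 j.+1) (H_root D J j),
          forall J z, is_P (sval J) (val z) (H_field D J z)
        & forall K, is_P_inf (sval K) (H_inf D K)],
      [/\ forall J p, is_direct_sum (H_root D J (p := p)) (roots_sum D J p)
        & forall J, is_direct_integral eta (H_field D J) (field_int D J)],
      [/\ forall J, is_direct_sum
            (fun i : {p : nat & nu_fin D J p} + nu_int D J =>
               match i with
               | inl c => roots_sum D J (projT1 c)
               | inr _ => field_int D J
               end) (H_J D J)
        & forall K, is_direct_sum (fun _ : nu_inf D K => H_inf D K) (H_K D K)]
    & is_direct_sum
        (fun i : fin_index + inf_index =>
           match i with inl J => H_J D J | inr K => H_K D K end) pi].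

Definition irreducible_components (D : decomposition) : Prop :=
  [/\ forall J p (j : 'I_p.+1), irreducible (H_root D J j),
      forall J z, irreducible (H_field D J z)
    & forall K, irreducible (H_inf D K)].

Definition equipotent (X Y : Type) : Prop := exists f : X -> Y, bijective f.

(* Indices of the irreducible direct summands of H_J: (p, (j, copy)). *)
Definition root_index (D : decomposition) (J : fin_index) : Type :=
  {p : nat & 'I_p.+1 * nu_fin D J p}%type.

Definition root_component (D : decomposition) (J : fin_index)
    (i : root_index D J) : representation O :=
  H_root D J (projT2 i).1.

Definition equivalent_decompositions (D D' : decomposition) : Prop :=
  [/\ forall J, unitarily_equivalent (H_J D J) (H_J D' J),
      forall K, unitarily_equivalent (H_K D K) (H_K D' K),
      forall J, exists f : root_index D J -> root_index D' J,
        bijective f /\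
        forall i, unitarily_equivalent (root_component i) (root_component (f i)),
      forall J, [/\ equipotent (nu_int D J) (nu_int D' J),
                    unitarily_equivalent (field_int D J) (field_int D' J)
                  & forall z, unitarily_equivalent
                                (H_field D J z) (H_field D' J z)]
    & forall K, equipotent (nu_inf D K) (nu_inf D' K) /\
                unitarily_equivalent (H_inf D K) (H_inf D' K)].

End Permutative.

Arguments decomposition {R N} O A T.

(* Main.v *)
Require Import Defs.
From HB Require Import structures.
From mathcomp Require Import all_boot all_order all_algebra sesquilinear complex.
From mathcomp Require Import all_classical all_reals all_analysis.
From mathcomp Require Import measurable_realfun ring lra zify.

(** A vector is coded by an infinite word [x] if it lies in the range of the operator
    [s_w = s_(w_1) ... s_(w_k)] for each finite prefix [w] of [x]. The relations between the
    generators fix how they move such vectors. Hence all inner products in the cyclic subspace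
    of a coded vector [v] are determined by the correlations of [v] with the vectors
    [s_u s_w^* v], where [u] and [w] run through the prefixes of [x] after which the same
    word remains ([branch_correlation]), and vectors with equal correlations generate
    equivalent representations ([correlation_isometry]).
    If [x] is not eventually periodic, then [u = w] and only the norm of [v] remains: the
    unit vectors coded by [x] all generate the representation P(x). If [x] is the infinite
    power of a primitive word [J], then [s_J] is unitary on the vectors coded by [x], and the
    correlations are the moments of [s_J] at [v]; the eigenvectors of [s_J] with eigenvalue
    [z] generate P(J;z). Both are irreducible, because the projections [s_w s_w^*] for the
    prefixes [w] of [x] decrease to the projection onto the line of [v]
    ([coding_proj_line], [coded_irreducible]).

    Existence. In a permutative representation every basis vector is the image of exactly one
    basis vector under exactly one generator ([coding_map]), and going backwards spells its
    coding word. Two basis vectors generate the same cyclic subspace if their backward orbits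
    meet, and orthogonal ones otherwise, so the space splits over the orbits. Each orbit
    contains a basis vector whose word is a chosen representative of its tail class
    ([orbit_representatives]). An aperiodic representative [K] gives P(K). For a periodic one,
    [s_J] permutes the basis vectors coded by [x], and the n-th moment at such a vector is 1
    if its period [q] under this permutation divides [n], and 0 otherwise; an infinite orbit
    counts as [q = 0]. For [q > 0] these are the moments of the normalised sum of eigenvectors
    for all q-th roots of unity, which is cyclic by discrete Fourier inversion
    ([roots_cyclic]). For [q = 0] they are the moments of a section of unit eigenvectors in the
    direct integral of the P(J;z), which is cyclic because a function on the circle with
    vanishing Fourier coefficients vanishes almost everywhere ([field_cyclic]).

    Uniqueness. In any decomposition the component that belongs to a word is the closed span
    of the cyclic subspaces of all vectors coded by that word, so it depends on the
    representation only ([carried_range]). Within the component of [J] an eigenvector of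
    [s_J] is orthogonal to the direct integrals, and so the multiplicity of a root of unity is
    the dimension of an eigenspace; the complement of the eigenvectors is a multiple of the
    bilateral shift, whose multiplicity is determined by a double count of matrix entries
    ([spectral_unique], [wandering_equipotent]). Multiplicities are compared root by root,
    since the sums for different [p] share eigenvalues: an infinite [nu_(J,2)], for example,
    absorbs [nu_(J,1)].

    The summands have to be constructed. The bounded operators on a Hilbert space form a
    C*-algebra, so that the universal property turns operators with the right relations into
    a representation ([ck_rep_exists]); operators on square-summable functions on the tail
    class of [x] realise P(x) and, with a phase, P(J;z) ([model_rep]). Square-integrable
    sections of a field of Hilbert spaces form a Hilbert space by the Riesz-Fischer theorem
    ([sq_integrable_complete]), which gives direct integrals and, over a counting measure,
    direct sums. *)

Set Implicit Arguments.
Unset Strict Implicit.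
Unset Printing Implicit Defensive.
Import Order.TTheory GRing.Theory Num.Theory.
Import numFieldNormedType.Exports.
Local Open Scope classical_set_scope.
Local Open Scope ring_scope.

(** * Complex numbers and Hilbert space geometry *)

Section Complex.
Context {R : realType}.
Implicit Types (z w : R[i]) (a b : R).

Lemma Re_conj z : complex.Re (Num.conj z) = complex.Re z.
Proof. by case: z. Qed.
Lemma Im_conj z : complex.Im (Num.conj z) = - complex.Im z.
Proof. by case: z. Qed.
Lemma ReD z w : complex.Re (z + w) = complex.Re z + complex.Re w.
Proof. by case: z; case: w. Qed.
Lemma ReN z : complex.Re (- z) = - complex.Re z.
Proof. by case: z. Qed.
Lemma ImD z w : complex.Im (z + w) = complex.Im z + complex.Im w.
Proof. by case: z; case: w. Qed.
Lemma ImN z : complex.Im (- z) = - complex.Im z.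
Proof. by case: z. Qed.
Lemma ReM z w : complex.Re (z * w) =
  complex.Re z * complex.Re w - complex.Im z * complex.Im w.
Proof. by case: z; case: w. Qed.
Lemma ImM z w : complex.Im (z * w) =
  complex.Re z * complex.Im w + complex.Im z * complex.Re w.
Proof. by case: z; case: w. Qed.
Lemma complex_ext z w : complex.Re z = complex.Re w ->
  complex.Im z = complex.Im w -> z = w.
Proof. by case: z => ? ?; case: w => ? ? /= -> ->. Qed.

(** The norm on [R[i]] has values in [R[i]]; this is its real value. *)
Definition cabs z : R := complex.Re `|z|.

Lemma cabsE z : `|z| = (cabs z)%:C%C.
Proof. by case: z. Qed.
Lemma cabs_ge0 z : 0 <= cabs z.
Proof. by rewrite -(@ler0c R) -cabsE. Qed.
Lemma cabs_sq z : cabs z ^+ 2 = complex.Re z ^+ 2 + complex.Im z ^+ 2.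
Proof. by case: z => a b; rewrite /cabs /= sqr_sqrtr// addr_ge0// sqr_ge0. Qed.
Lemma cabsM z w : cabs (z * w) = cabs z * cabs w.
Proof. exact: ComplexField.Normc.normcM. Qed.
Lemma cabs0 : cabs 0 = 0.
Proof. by rewrite /cabs normr0. Qed.
Lemma cabs1 : cabs 1 = 1.
Proof. by rewrite /cabs normr1. Qed.
Lemma cabsN z : cabs (- z) = cabs z.
Proof. by rewrite /cabs normrN. Qed.
Lemma cabs_conj z : cabs (Num.conj z) = cabs z.
Proof. by rewrite /cabs norm_conjC. Qed.
Lemma cabs_eq0 z : cabs z = 0 -> z = 0.
Proof. by move=> h; apply: normr0_eq0; rewrite cabsE h. Qed.
Lemma cabsD z w : cabs (z + w) <= cabs z + cabs w.
Proof. by rewrite -lecR rmorphD /= -!cabsE ler_normD. Qed.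
Lemma cabs_RC a : cabs (a%:C)%C = `|a|.
Proof. by rewrite /cabs /= expr0n addr0 sqrtr_sqr. Qed.
Lemma mul_conj z : z * Num.conj z = (cabs z ^+ 2)%:C%C.
Proof. by rewrite -normCK cabsE -rmorphXn. Qed.
Lemma conj_mul z : Num.conj z * z = (cabs z ^+ 2)%:C%C.
Proof. by rewrite mulrC mul_conj. Qed.
Lemma ler_Re_cabs z : `|complex.Re z| <= cabs z.
Proof. by rewrite -ler_sqr ?nnegrE ?cabs_ge0// real_normK ?num_real// cabs_sq lerDl sqr_ge0. Qed.
Lemma ler_Im_cabs z : `|complex.Im z| <= cabs z.
Proof. by rewrite -ler_sqr ?nnegrE ?cabs_ge0// real_normK ?num_real// cabs_sq lerDr sqr_ge0. Qed.

Lemma small_eq0 a : 0 <= a -> (forall e : R, 0 < e -> a <= e) -> a = 0.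
Proof.
move=> a0 h; apply/eqP; rewrite eq_le a0 andbT; apply/ler_addgt0Pr => e e0.
by rewrite add0r h.
Qed.

Lemma small_lt_eq0 a (C : R) : 0 <= a ->
  (forall e : R, 0 < e -> a <= C * e) -> a = 0.
Proof.
move=> a0 h; apply: small_eq0 => // e e0.
have C1 : 0 < `|C| + 1 by rewrite ltr_wpDl.
have := h (e / (`|C| + 1)) (divr_gt0 e0 C1); move=> /le_trans; apply.
rewrite mulrCA ger_pMr// ler_pdivrMr// mul1r.
by rewrite (le_trans (ler_norm C))// lerDl.
Qed.

Lemma mulr_smallP (C e : R) : 0 < e -> 0 <= C -> exists2 d : R, 0 < d & C * d < e.
Proof.
move=> e0 C0; exists (e / (C + 1)); first by rewrite divr_gt0// ltr_wpDl.
by rewrite mulrCA gtr_pMr// ltr_pdivrMr ?ltr_wpDl// mul1r ltrDl.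
Qed.

Lemma inv_small (e : R) : 0 < e -> exists M : nat, forall n, (M <= n)%N -> n.+1%:R^-1 < e.
Proof.
move=> e0; have [M hM] : exists M : nat, e^-1 < M%:R.
  by exists (Num.bound e^-1); rewrite archi_boundP// invr_ge0 ltW.
exists M => n Mn; rewrite -(invrK e) ltf_pV2 ?posrE ?invr_gt0//.
by rewrite (lt_le_trans hM)// ler_nat (leq_trans Mn).
Qed.

End Complex.

Notation "''[' u , v ]" := (hdot _ u v) : ring_scope.

Section InnerProduct.
Context {R : realType} {H : hilbert R}.
Implicit Types (x y u v w : H) (c : R[i]).

Lemma hdotDl x y w : '[x + y, w] = '[x, w] + '[y, w].
Proof. exact: linearDl. Qed.
Lemma hdotDr x y w : '[w, x + y] = '[w, x] + '[w, y].
Proof. exact: linearDr. Qed.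
Lemma hdotZl c x w : '[c *: x, w] = c * '[x, w].
Proof. exact: linearZl_LR. Qed.
Lemma hdotZr c x w : '[w, c *: x] = Num.conj c * '[w, x].
Proof. exact: linearZr_LR. Qed.
Lemma hdotNr x w : '[w, - x] = - '[w, x].
Proof. exact: linearNr. Qed.
Lemma hdotBl x y w : '[x - y, w] = '[x, w] - '[y, w].
Proof. exact: linearBl. Qed.
Lemma hdotBr x y w : '[w, x - y] = '[w, x] - '[w, y].
Proof. exact: linearBr. Qed.
Lemma hdot0l w : '[0, w] = 0.
Proof. exact: linear0l. Qed.
Lemma hdot0r w : '[w, 0] = 0.
Proof. exact: linear0r. Qed.
Lemma hdotC x y : '[x, y] = Num.conj '[y, x].
Proof. by rewrite (hermC (hdot H) x y) expr0 mul1r. Qed.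
Lemma hdot_suml I (r : seq I) P (f : I -> H) y :
  '[\sum_(i <- r | P i) f i, y] = \sum_(i <- r | P i) '[f i, y].
Proof.
by elim/big_rec2: _ => [|i a b _ <-]; rewrite ?hdot0l// hdotDl.
Qed.
Lemma hdot_sumr I (r : seq I) P (f : I -> H) y :
  '[y, \sum_(i <- r | P i) f i] = \sum_(i <- r | P i) '[y, f i].
Proof.
by elim/big_rec2: _ => [|i a b _ <-]; rewrite ?hdot0r// hdotDr.
Qed.

Lemma hdot_ge0 x : 0 <= '[x, x].
Proof.
have [->|x0] := eqVneq x 0; first by rewrite hdot0l.
exact/ltW/neq0_dnorm_gt0.
Qed.

Lemma hdot_eq0 x : '[x, x] = 0 -> x = 0.
Proof.
move=> h; apply/eqP; case: (eqVneq x 0) => // x0.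
by have : 0 < (hdot H) x x by [exact: neq0_dnorm_gt0]; rewrite h ltxx.
Qed.

Lemma hdotxx x : '[x, x] = (hnorm x ^+ 2)%:C%C.
Proof.
have := hdot_ge0 x; rewrite lecE /hnorm => /andP[/eqP h1 h2].
by rewrite sqr_sqrtr//; apply: complex_ext.
Qed.

Lemma hnorm_ge0 x : 0 <= hnorm x.
Proof. exact: sqrtr_ge0. Qed.
Lemma hnorm_eq0 x : hnorm x = 0 -> x = 0.
Proof. by move=> h; apply: hdot_eq0; rewrite hdotxx h expr0n. Qed.
Lemma hnorm0 : hnorm (0 : H) = 0.
Proof. by rewrite /hnorm hdot0l sqrtr0. Qed.
Lemma hnorm_sq x : hnorm x ^+ 2 = complex.Re '[x, x].
Proof. by rewrite hdotxx. Qed.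
Lemma hnormZ c x : hnorm (c *: x) = cabs c * hnorm x.
Proof.
apply/eqP; rewrite -(@eqrXn2 _ 2)// ?mulr_ge0 ?cabs_ge0 ?hnorm_ge0//; apply/eqP.
by apply: (@complexI R); rewrite -hdotxx hdotZl hdotZr mulrA mul_conj hdotxx -rmorphM /= exprMn.
Qed.
Lemma hnormN x : hnorm (- x) = hnorm x.
Proof. by rewrite -scaleN1r hnormZ cabsN cabs1 mul1r. Qed.
Lemma hnormBC x y : hnorm (x - y) = hnorm (y - x).
Proof. by rewrite -hnormN opprB. Qed.

Lemma hnormD_sq x y :
  hnorm (x + y) ^+ 2 = hnorm x ^+ 2 + hnorm y ^+ 2 + 2 * complex.Re '[x, y].
Proof.
rewrite !hnorm_sq hdotDl !hdotDr !ReD (hdotC y x) Re_conj; ring.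
Qed.
Lemma hnormB_sq x y :
  hnorm (x - y) ^+ 2 = hnorm x ^+ 2 + hnorm y ^+ 2 - 2 * complex.Re '[x, y].
Proof. rewrite hnormD_sq hnormN hdotNr ReN; ring. Qed.

Lemma cauchy_schwarz x y : cabs '[x, y] <= hnorm x * hnorm y.
Proof.
have [->|y0] := eqVneq y 0; first by rewrite hdot0r cabs0 hnorm0 mulr0.
have t0 : 0 < hnorm y ^+ 2.
  rewrite exprn_gt0// lt_neqAle hnorm_ge0 andbT eq_sym; apply/eqP => h.
  by move/eqP: y0; apply; apply: hnorm_eq0.
rewrite -ler_sqr ?nnegrE ?mulr_ge0 ?cabs_ge0 ?hnorm_ge0// exprMn.
set a := '[x, y]; set t := hnorm y ^+ 2 in t0 *; set q := hnorm x ^+ 2.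
have : 0 <= hnorm (t%:C%C *: x - a *: y) ^+ 2 by rewrite sqr_ge0.
rewrite hnormB_sq !hnormZ !exprMn -/t -/q hdotZl hdotZr -/a.
rewrite conj_mul -rmorphM /= cabs_RC real_normK ?num_real//.
have -> : t ^+ 2 * q + cabs a ^+ 2 * t - 2 * (t * cabs a ^+ 2) =
  t * (q * t - cabs a ^+ 2) by ring.
by rewrite pmulr_rge0// subr_ge0.
Qed.

Lemma hnormD x y : hnorm (x + y) <= hnorm x + hnorm y.
Proof.
rewrite -ler_sqr ?nnegrE ?addr_ge0 ?hnorm_ge0// hnormD_sq.
have h1 := cauchy_schwarz x y; have h2 := ler_Re_cabs '[x, y].
by have h3 := ler_norm (complex.Re '[x, y]); lra.
Qed.

Lemma hnormB_trans x y w : hnorm (x - w) <= hnorm (x - y) + hnorm (y - w).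
Proof. by have := hnormD (x - y) (y - w); rewrite addrA subrK. Qed.

Lemma hnorm_lerB x y : `|hnorm x - hnorm y| <= hnorm (x - y).
Proof.
rewrite ler_norml; apply/andP; split.
  rewrite lerNl opprB lerBlDr hnormBC.
  by have := hnormD (y - x) x; rewrite subrK.
by rewrite lerBlDr; have := hnormD (x - y) y; rewrite subrK.
Qed.

Lemma hnorm_small x : (forall e : R, 0 < e -> hnorm x <= e) -> x = 0.
Proof. by move=> h; apply/hnorm_eq0/small_eq0 => //; exact: hnorm_ge0. Qed.

Lemma hdot_ext x y : (forall v, '[x, v] = '[y, v]) -> x = y.
Proof.
by move=> h; apply/eqP; rewrite -subr_eq0; apply/eqP/hdot_eq0; rewrite hdotBl h subrr.
Qed.

Lemma parallelogram x y :
  hnorm (x + y) ^+ 2 + hnorm (x - y) ^+ 2 = 2 * hnorm x ^+ 2 + 2 * hnorm y ^+ 2.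
Proof. rewrite hnormD_sq hnormB_sq; ring. Qed.

Definition hcauchy (u : nat -> H) := forall e : R, 0 < e -> exists M : nat,
  forall m n : nat, (M <= m)%N -> (M <= n)%N -> hnorm (u m - u n) < e.

Definition hcvg (u : nat -> H) (l : H) := forall e : R, 0 < e ->
  exists M : nat, forall n : nat, (M <= n)%N -> hnorm (u n - l) < e.

Lemma hcomplete (u : nat -> H) : hcauchy u -> exists l, hcvg u l.
Proof. exact: (@hilbert_complete R H u). Qed.

Lemma hcvg_inv (u : nat -> H) l : (forall n, hnorm (u n - l) <= n.+1%:R^-1) -> hcvg u l.
Proof.
move=> h e /inv_small[M hM]; exists M => n /hM; exact: le_lt_trans.
Qed.

End InnerProduct.

Section Subspaces.
Context {R : realType} {H : hilbert R}.
Implicit Types (x y u v w : H) (c : R[i]) (X W : set H).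

Definition lspan X : set H := [set x | exists (n : nat) (c : 'I_n -> R[i]) (v : 'I_n -> H),
  (forall i, X (v i)) /\ x = \sum_i c i *: v i].

Lemma in_closed_spanE X x : in_closed_span X x <->
  forall e : R, 0 < e -> exists2 y, lspan X y & hnorm (x - y) < e.
Proof.
split=> h e /h.
  by move=> [n [c [v [Xv hx]]]]; exists (\sum_i c i *: v i) => //; exists n, c, v.
by move=> [_ [n [c [v [Xv ->]]]] hx]; exists n, c, v.
Qed.

(** The form in which closed subspaces are checked: stability under [c x + y] and
    under approximation, without finite sums. *)
Definition csub W := [/\ W 0, forall c x y, W x -> W y -> W (c *: x + y)
  & forall x, (forall e : R, 0 < e -> exists2 y, W y & hnorm (x - y) < e) -> W x].

Lemma csub_sum W n (c : 'I_n -> R[i]) (v : 'I_n -> H) : csub W ->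
  (forall i, W (v i)) -> W (\sum_i c i *: v i).
Proof.
move=> [W0 Wl _] Wv; elim/big_rec: _ => // i x _; exact: Wl.
Qed.

Lemma csubZ W c x : csub W -> W x -> W (c *: x).
Proof. by move=> [W0 Wl _] Wx; have := Wl c x 0 Wx W0; rewrite addr0. Qed.
Lemma csubD W x y : csub W -> W x -> W y -> W (x + y).
Proof. by move=> [W0 Wl _] Wx Wy; have := Wl 1 x y Wx Wy; rewrite scale1r. Qed.
Lemma csubB W x y : csub W -> W x -> W y -> W (x - y).
Proof. by move=> [W0 Wl _] Wx Wy; have := Wl (-1) y x Wy Wx; rewrite scaleN1r addrC. Qed.

Lemma closed_subspaceP W : closed_subspace W <-> csub W.
Proof.
split=> [h|hW x /in_closed_spanE h].
  have lsp x : lspan W x -> W x.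
    by move=> Wx; apply: h; apply/in_closed_spanE => e e0; exists x; rewrite ?subrr ?hnorm0.
  have W0 : W 0 by apply: lsp; exists 0%N, (fun=> 0), (fun=> 0); rewrite big_ord0; split => // -[].
  split=> // [c x y Wx Wy|x hx].
    apply: lsp; exists 2%N, (fun i => if i == ord0 then c else 1), (fun i => if i == ord0 then x else y).
    split; first by move=> i; case: ifP.
    by rewrite big_ord_recr big_ord1 /= scale1r.
  apply: h; apply/in_closed_spanE => e /hx[y Wy yx]; exists y => //.
  exists 1%N, (fun=> 1), (fun=> y); split => //.
  by rewrite big_ord1 scale1r.
case: (hW) => _ _; apply => e /h[y [n [c [v [Wv ->]]]] hy]; exists (\sum_i c i *: v i) => //.
exact: csub_sum.
Qed.

Lemma csub_lspan X : (forall c x y, lspan X x -> lspan X y -> lspan X (c *: x + y)).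
Proof.
move=> a x y [n [c [v [Xv ->]]]] [m [d [w [Xw ->]]]].
exists (n + m)%N, (fun i => match fintype.split i with inl k => a * c k | inr k => d k end),
  (fun i => match fintype.split i with inl k => v k | inr k => w k end).
split; first by move=> i; case: (fintype.split i).
rewrite big_split_ord /= scaler_sumr; congr (_ + _); apply: eq_bigr => i _.
  by rewrite (unsplitK (inl i)) scalerA.
by rewrite (unsplitK (inr i)).
Qed.

Lemma sub_cspan X : X `<=` in_closed_span X.
Proof.
move=> x Xx; apply/in_closed_spanE => e e0; exists x; last by rewrite subrr hnorm0.
exists 1%N, (fun=> 1), (fun=> x); split => //.
by rewrite big_ord1 scale1r.
Qed.

Lemma cspan_csub X : csub (in_closed_span X).
Proof.
split.
- apply/in_closed_spanE => e e0; exists 0; last by rewrite subrr hnorm0.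
  by exists 0%N, (fun=> 0), (fun=> 0); rewrite big_ord0; split => // -[].
- move=> c x y /in_closed_spanE hx /in_closed_spanE hy; apply/in_closed_spanE => e e0.
  have e2 : 0 < e / 2 by rewrite divr_gt0.
  have [d d0 hd] := mulr_smallP e2 (cabs_ge0 c).
  have [x' Xx' xx'] := hx _ d0; have [y' Xy' yy'] := hy _ e2.
  exists (c *: x' + y'); first exact: csub_lspan.
  have -> : c *: x + y - (c *: x' + y') = c *: (x - x') + (y - y').
    by rewrite scalerBr opprD addrACA.
  apply: (le_lt_trans (hnormD _ _)); rewrite hnormZ (splitr e); apply: ltrD => //.
  by apply: le_lt_trans hd; rewrite ler_wpM2l ?cabs_ge0// ltW.
- move=> x hx; apply/in_closed_spanE => e e0; have e2 : 0 < e / 2 by rewrite divr_gt0.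
  have [y /in_closed_spanE/(_ _ e2)[z Xz yz] xy] := hx _ e2.
  exists z => //; apply: (le_lt_trans (hnormB_trans x y z)).
  by rewrite (splitr e) ltrD.
Qed.

Lemma cspan_min X W : csub W -> X `<=` W -> in_closed_span X `<=` W.
Proof.
move=> hW XW x /in_closed_spanE hx; case: (hW) => _ _; apply => e /hx[y [n [c [v [Xv ->]]]] hy].
by exists (\sum_i c i *: v i) => //; apply: csub_sum => // i; apply: XW.
Qed.

Lemma cspan_mono X Y : X `<=` in_closed_span Y -> in_closed_span X `<=` in_closed_span Y.
Proof. by apply: cspan_min; exact: cspan_csub. Qed.

Lemma total_ind X W : total_set X -> csub W -> X `<=` W -> forall x, W x.
Proof. by move=> tX hW XW x; apply: (cspan_min hW XW); exact: tX. Qed.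

Lemma csub_orth (X : set H) : csub [set x | forall y, X y -> '[x, y] = 0].
Proof.
split=> [y _|c x y hx hy z Xz|x hx y Xy]; first by rewrite hdot0l.
  by rewrite hdotDl hdotZl hx// hy// mulr0 addr0.
apply/cabs_eq0/(@small_lt_eq0 _ _ (hnorm y)); first exact: cabs_ge0.
move=> e e0; have [z hz xz] := hx _ e0.
have -> : '[x, y] = '[x - z, y] by rewrite hdotBl hz// subr0.
by apply: (le_trans (cauchy_schwarz _ _)); rewrite mulrC ler_wpM2l ?hnorm_ge0// ltW.
Qed.

Lemma csub_orthr (X : set H) : csub [set x | forall y, X y -> '[y, x] = 0].
Proof.
have -> : [set x | forall y, X y -> '[y, x] = 0] = [set x | forall y, X y -> '[x, y] = 0].
  apply/seteqP; split => x h y Xy; by rewrite hdotC h// conjC0.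
exact: csub_orth.
Qed.

Lemma csub_bigI (I : Type) (P : I -> Prop) (W : I -> set H) :
  (forall i, P i -> csub (W i)) -> csub [set x | forall i, P i -> W i x].
Proof.
move=> hW; split=> [i Pi|c x y hx hy i Pi|x hx i Pi]; case: (hW _ Pi) => a0 al ac //.
  by apply: al; [exact: hx|exact: hy].
by apply: ac => e /hx[y hy xy]; exists y => //; exact: hy.
Qed.

Lemma csub_cvg W (u : nat -> H) l : csub W -> (forall n, W (u n)) -> hcvg u l -> W l.
Proof.
move=> [_ _ c] Wu ul; apply: c => e /ul[M /(_ M (leqnn _)) h]; exists (u M) => //.
by rewrite hnormBC.
Qed.

Lemma hcvg_unique (u : nat -> H) l l' : hcvg u l -> hcvg u l' -> l = l'.
Proof.
move=> h h'; apply/eqP; rewrite -subr_eq0; apply/eqP/hnorm_small => e e0.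
have e2 : 0 < e / 2 by rewrite divr_gt0.
have [M hM] := h _ e2; have [M' hM'] := h' _ e2.
apply/ltW/(le_lt_trans (hnormB_trans l (u (maxn M M')) l')).
rewrite (splitr e) ltrD//; first by rewrite hnormBC hM// leq_maxl.
by rewrite hM'// leq_maxr.
Qed.

(** A minimising sequence in [W] for the distance to [x] is Cauchy by the
    parallelogram identity, and its limit is the orthogonal projection. *)
Lemma projection_exists W x : csub W ->
  exists y, W y /\ forall w, W w -> '[x - y, w] = 0.
Proof.
move=> hW; case: (hW) => W0 Wl Wc.
pose D := [set hnorm (x - w) | w in W].
have D0 : D !=set0 by exists (hnorm (x - 0)), 0.
have Dlb : has_lbound D by exists 0 => _ [w _ <-]; exact: hnorm_ge0.
have Dinf : has_inf D by [].
pose d := inf D.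
have d0 : 0 <= d by apply: lb_le_inf => // _ [w _ <-]; exact: hnorm_ge0.
have dle w : W w -> d <= hnorm (x - w) by move=> Ww; apply: ge_inf => //; exists w.
have near (e : R) : 0 < e -> exists2 w, W w & hnorm (x - w) ^+ 2 < d ^+ 2 + e.
  move=> e0; have := @inf_adherent _ D.
  pose f := Num.sqrt (d ^+ 2 + e).
  have df : 0 < f - d.
    rewrite subr_gt0 -ltr_sqr ?nnegrE ?sqrtr_ge0// sqr_sqrtr ?ltrDl//.
    by rewrite addr_ge0 ?sqr_ge0// ltW.
  move=> /(_ _ df Dinf)[_ [w Ww <-]]; rewrite -/d addrCA subrr addr0 => h; exists w => //.
  by rewrite -[ltRHS]sqr_sqrtr ?addr_ge0 ?sqr_ge0 ?(ltW e0)// ltr_sqr ?nnegrE ?hnorm_ge0 ?sqrtr_ge0.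
have mid u v : W u -> W v -> hnorm (u - v) ^+ 2 <=
    2 * (hnorm (x - u) ^+ 2 - d ^+ 2) + 2 * (hnorm (x - v) ^+ 2 - d ^+ 2).
  move=> Wu Wv; have := parallelogram (x - u) (x - v).
  have -> : x - u - (x - v) = v - u by rewrite opprB addrC addrA subrK.
  have -> : x - u + (x - v) = (2 : R[i]) *: (x - (2^-1 : R[i]) *: (u + v)).
    rewrite scalerBr scalerA mulfV ?pnatr_eq0// scale1r opprD addrACA; congr (_ + _).
    by rewrite scaler_nat mulr2n.
  rewrite hnormZ exprMn (hnormBC v u) (_ : cabs 2 = 2); last first.
    by rewrite (_ : 2 = (2%:R : R)%:C%C) ?rmorph_nat// -(rmorph_nat (real_complex R)) cabs_RC ger0_norm.
  have Wm : W ((2^-1 : R[i]) *: (u + v)) by apply: csubZ => //; apply: csubD.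
  have := dle _ Wm; set a := hnorm _ => da.
  have : d ^+ 2 <= a ^+ 2 by rewrite ler_sqr ?nnegrE ?hnorm_ge0.
  lra.
have inv0 n : 0 < (n.+1%:R^-1 : R) by rewrite invr_gt0.
have /choice[u hu] : forall n, exists w, W w /\ hnorm (x - w) ^+ 2 < d ^+ 2 + n.+1%:R^-1.
  by move=> n; have [w Ww hw] := near _ (inv0 n); exists w.
have [|y uy] := @hcomplete R H u.
  move=> e e0; have e4 : 0 < e ^+ 2 / 4 by rewrite divr_gt0// exprn_gt0.
  have [M hM] := inv_small e4; exists M => m n /hM hm /hM hn.
  rewrite -ltr_sqr ?nnegrE ?hnorm_ge0 ?(ltW e0)//.
  have := mid _ _ (hu m).1 (hu n).1; move: (hu m).2 (hu n).2 hm hn.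
  move: (m.+1%:R^-1) (n.+1%:R^-1) => a b; lra.
have Wy : W y by apply: csub_cvg uy => // n; exact: (hu n).1.
have xyd : hnorm (x - y) ^+ 2 <= d ^+ 2.
  rewrite ler_sqr ?nnegrE ?hnorm_ge0//; apply/ler_addgt0Pr => e e0.
  have e2 : 0 < e / 2 by rewrite divr_gt0.
  have e4 : 0 < (e / 2) ^+ 2 by rewrite exprn_gt0.
  have [M hM] := uy _ e2; have [M' hM'] := inv_small e4.
  pose n := maxn M M'; apply: (le_trans (hnormB_trans x (u n) y)).
  rewrite [e]splitr addrA lerD// ?(ltW (hM _ (leq_maxl _ _)))//.
  rewrite -ler_sqr ?nnegrE ?hnorm_ge0 ?addr_ge0 ?(ltW e2)//.
  have := (hu n).2; have := hM' n (leq_maxr _ _); move: (n.+1%:R^-1) => a.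
  have : 0 <= d * (e / 2) by rewrite mulr_ge0 ?(ltW e2).
  rewrite sqrrD; lra.
exists y; split=> // w Ww; set a := '[x - y, w].
suff : cabs a ^+ 2 = 0 by move/eqP; rewrite sqrf_eq0 => /eqP/cabs_eq0.
apply: (@small_lt_eq0 _ _ (cabs a ^+ 2 * hnorm w ^+ 2 / 2)); first exact: sqr_ge0.
move=> t t0.
have Wyt : W (y + (t%:C%C * a) *: w) by apply: csubD => //; apply: csubZ.
have := dle _ Wyt; rewrite -ler_sqr ?nnegrE ?hnorm_ge0// => h.
have := le_trans xyd h; rewrite opprD addrA [hnorm (_ - _ *: _) ^+ 2]hnormB_sq hnormZ hdotZr -/a rmorphM /=.
rewrite -mulrA conj_mul cabsM cabs_RC (ger0_norm (ltW t0)).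
have -> : Num.conj (t%:C%C) = t%:C%C :> R[i] by apply: complex_ext => //=; rewrite oppr0.
rewrite -rmorphM /= !exprMn => h2.
have : t * (2 * cabs a ^+ 2) <= t * (t * cabs a ^+ 2 * hnorm w ^+ 2).
  by move: h2; lra.
rewrite ler_pM2l//; lra.
Qed.

(** The projection onto the closed span of [X] leaves a remainder orthogonal to [X]. *)
Lemma total_orth X : (forall v, (forall x, X x -> '[v, x] = 0) -> v = 0) -> total_set X.
Proof.
move=> h x; have [y [Xy xy]] := projection_exists x (cspan_csub X).
suff /eqP : x - y = 0 by rewrite subr_eq0 => /eqP ->.
by apply: h => w Xw; apply: xy; exact: sub_cspan.
Qed.

Lemma orth_total X v : total_set X -> (forall x, X x -> '[v, x] = 0) -> v = 0.
Proof.
move=> tX h; apply: hdot_eq0; have hW : csub [set x | forall y, [set v] y -> '[y, x] = 0] by exact: csub_orthr.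
by apply: (total_ind tX hW _ _) => // x Xx _ ->; exact: h.
Qed.

End Subspaces.

(** * Bounded maps, isometries and orthonormal families *)

Section Maps.
Context {R : realType} {H K : hilbert R}.
Implicit Types (c : R[i]) (f g : H -> K).

Definition lin f := forall c x y, f (c *: x + y) = c *: f x + f y.
Definition blin f := lin f /\ exists M : R, forall x, hnorm (f x) <= M * hnorm x.

Lemma linD f x y : lin f -> f (x + y) = f x + f y.
Proof. by move=> h; have := h 1 x y; rewrite !scale1r. Qed.
Lemma lin0 f : lin f -> f 0 = 0.
Proof. by move=> h; have := linD 0 0 h; rewrite addr0 => /eqP; rewrite -subr_eq0 opprD addrA subrr sub0r oppr_eq0 => /eqP. Qed.
Lemma linZ f c x : lin f -> f (c *: x) = c *: f x.
Proof. by move=> h; have := h c x 0; rewrite !addr0 lin0// addr0. Qed.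
Lemma linB f x y : lin f -> f (x - y) = f x - f y.
Proof. by move=> h; rewrite -scaleN1r linD// linZ// scaleN1r. Qed.
Lemma lin_sum f (I : Type) (r : seq I) (P : pred I) (F : I -> H) : lin f ->
  f (\sum_(i <- r | P i) F i) = \sum_(i <- r | P i) f (F i).
Proof. by move=> h; elim/big_rec2: _ => [|i a b _ <-]; rewrite ?lin0// linD. Qed.

Lemma blin_pos f : blin f -> exists2 M : R, 0 <= M & forall x, hnorm (f x) <= M * hnorm x.
Proof.
move=> [_ [M h]]; exists `|M| => // x; apply: (le_trans (h x)).
by rewrite ler_wpM2r ?hnorm_ge0// ler_norm.
Qed.

Lemma csub_preim f (W : set K) : blin f -> csub W -> csub [set x | W (f x)].
Proof.
move=> bf [W0 Wl Wc]; have lf := bf.1; split=> [|c x y Wx Wy|x h] /=.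
- by rewrite lin0.
- by rewrite lf; exact: Wl.
- apply: Wc => e e0; have [M M0 hM] := blin_pos bf.
  have [d d0 hd] := mulr_smallP e0 M0; have [y Wy xy] := h _ d0.
  exists (f y) => //; rewrite -linB//; apply: (le_lt_trans (hM _)).
  by apply: le_lt_trans hd; rewrite ler_wpM2l// ltW.
Qed.

Lemma csub0 : csub [set (0 : K)].
Proof.
split=> [//|c x y -> ->|x h]; first by rewrite scaler0 addr0.
by apply: hnorm_small => e /h[y -> ]; rewrite subr0 => /ltW.
Qed.

Lemma blinB f g : blin f -> blin g -> blin (fun x => f x - g x).
Proof.
move=> [lf [M hM]] [lg [M' hM']]; split.
  by move=> c x y; rewrite lf lg scalerBr addrACA opprD.
exists (M + M') => x; apply: (le_trans (hnormD _ _)).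
by rewrite hnormN mulrDl lerD.
Qed.

Lemma csub_eq f g : blin f -> blin g -> csub [set x | f x = g x].
Proof.
move=> bf bg; have -> : [set x | f x = g x] = [set x | [set 0] (f x - g x)].
  by apply/seteqP; split=> x /=; [move=> ->; rewrite subrr|move/eqP; rewrite subr_eq0 => /eqP].
by apply: csub_preim; [exact: blinB|exact: csub0].
Qed.

Lemma isometry_lin (V : H -> K) : isometry_into V -> lin V.
Proof. by case. Qed.
Lemma isometry_norm (V : H -> K) x : isometry_into V -> hnorm (V x) = hnorm x.
Proof. by move=> [_ h]; rewrite /hnorm h. Qed.
Lemma isometry_blin (V : H -> K) : isometry_into V -> blin V.
Proof. by move=> h; split; [exact: isometry_lin|exists 1 => x; rewrite isometry_norm// mul1r]. Qed.
Lemma isometry_inj (V : H -> K) : isometry_into V -> injective V.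
Proof.
move=> hV x y e; apply/eqP; rewrite -subr_eq0; apply/eqP/hnorm_eq0.
by rewrite -(isometry_norm _ hV) linB ?e ?subrr ?hnorm0//; exact: isometry_lin.
Qed.

Lemma imaginary_mul_conj : Num.conj 'i%C = - 'i%C :> R[i].
Proof. by apply: complex_ext => /=; rewrite ?oppr0. Qed.

(** Polarisation recovers the inner product from the norm. *)
Lemma norm_isometry (V : H -> K) : lin V -> (forall x, hnorm (V x) = hnorm x) -> isometry_into V.
Proof.
move=> lV nV; have re x y : complex.Re '[V x, V y] = complex.Re '[x, y].
  have := hnormD_sq (V x) (V y); rewrite -linD// !nV hnormD_sq => /addrI/eqP.
  by rewrite -subr_eq0 -mulrBr mulf_eq0 (pnatr_eq0 _ 2)/= subr_eq0 => /eqP.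
split=> // x y; apply: complex_ext; first exact: re.
(* The imaginary part of an inner product is a real part after multiplication by [i]. *)
have := re x ('i%C *: y); rewrite linZ// !hdotZr imaginary_mul_conj !mulNr !ReN !ReM /=.
by rewrite !mul0r !mul1r !sub0r !opprK.
Qed.

(** Preimages of a convergent sequence are Cauchy because distances are preserved. *)
Lemma csub_range (V : H -> K) : isometry_into V -> csub (range V).
Proof.
move=> hV; have lV := isometry_lin hV; split.
- by exists 0; rewrite ?lin0.
- by move=> c _ _ [x _ <-] [y _ <-]; exists (c *: x + y); rewrite ?lV.
move=> y hy.
have /choice[u hu] : forall n, exists x, hnorm (y - V x) < n.+1%:R^-1.
  move=> n; have [|_ [x _ <-] h] := hy n.+1%:R^-1; first by rewrite invr_gt0.
  by exists x.
have [|l ul] := @hcomplete R H u.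
  move=> e e0; have e2 : 0 < e / 2 by rewrite divr_gt0.
  have [M hM] := inv_small e2; exists M => m n hm hn.
  rewrite -(isometry_norm _ hV) linB//; apply: (le_lt_trans (hnormB_trans _ y _)).
  by rewrite (splitr e) ltrD//; [rewrite hnormBC|]; apply: (lt_trans (hu _) (hM _ _)).
exists l => //; apply: (@hcvg_unique _ _ (fun n => V (u n))).
  move=> e /ul[M hM]; exists M => n /hM; by rewrite -linB// isometry_norm.
by apply: hcvg_inv => n; rewrite hnormBC ltW.
Qed.

Lemma isometry_surj (V : H -> K) X : isometry_into V -> total_set X ->
  (forall y, X y -> exists x, V x = y) -> forall y, exists x, V x = y.
Proof.
move=> hV tX hX y; have [|x _ <-] := total_ind tX (csub_range hV) _ y; last by exists x.
by move=> z /hX[x <-]; exists x.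
Qed.

(** Range and kernel of an isometry split the target orthogonally, so the
    preimage of the projection onto the range is an adjoint. *)
Lemma isometry_adjoint (V : H -> K) : isometry_into V ->
  exists W : K -> H, forall x y, '[V x, y] = '[x, W y].
Proof.
move=> hV; have /choice[W hW] : forall y, exists w, forall v, '[y - V w, V v] = 0.
  move=> y; have [_ [[w _ <-] h]] := projection_exists y (csub_range hV).
  by exists w => v; apply: h; exists v.
exists W => x y; have := hW y x; rewrite hdotBl hV.2 => /eqP; rewrite subr_eq0 => /eqP h.
by rewrite hdotC h -hdotC.
Qed.

End Maps.

Lemma lin_comp {R : realType} {H K L : hilbert R} (f : H -> K) (g : K -> L) :
  lin f -> lin g -> lin (g \o f).
Proof. by move=> lf lg c x y; rewrite /= lf lg. Qed.

Lemma blin_comp {R : realType} {H K L : hilbert R} (f : H -> K) (g : K -> L) :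
  blin f -> blin g -> blin (g \o f).
Proof.
move=> bf bg; split; first by apply: lin_comp; [exact: bf.1|exact: bg.1].
have [M M0 hM] := blin_pos bf; have [M' M'0 hM'] := blin_pos bg; exists (M' * M) => x /=.
by apply: (le_trans (hM' _)); rewrite -mulrA ler_wpM2l.
Qed.

Lemma isometry_comp {R : realType} {H K L : hilbert R} (f : H -> K) (g : K -> L) :
  isometry_into f -> isometry_into g -> isometry_into (g \o f).
Proof.
move=> [lf nf] [lg ng]; split; first exact: lin_comp.
by move=> x y /=; rewrite ng nf.
Qed.

Section Gram.
Context {R : realType} {H K : hilbert R} {I : Type} (f : I -> H) (g : I -> K).
Hypothesis fg : forall i j, '[f i, f j] = '[g i, g j].
Hypothesis ft : total_set (range f).

(** The graph of the map on finite combinations. *)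
Let comb (a : H) (b : K) := exists (n : nat) (c : 'I_n -> R[i]) (k : 'I_n -> I),
  a = \sum_i c i *: f (k i) /\ b = \sum_i c i *: g (k i).

Let comb_lin c a b a' b' : comb a b -> comb a' b' -> comb (c *: a + a') (c *: b + b').
Proof.
move=> [n [d [k [-> ->]]]] [m [d' [k' [-> ->]]]].
exists (n + m)%N, (fun i => match fintype.split i with inl j => c * d j | inr j => d' j end),
  (fun i => match fintype.split i with inl j => k j | inr j => k' j end).
rewrite !big_split_ord /= !scaler_sumr; split; congr (_ + _); apply: eq_bigr => i _;
  by rewrite ?(unsplitK (inl i)) ?(unsplitK (inr i)) ?scalerA.
Qed.

Let comb_norm a b : comb a b -> hnorm a = hnorm b.
Proof.
move=> [n [c [k [-> ->]]]]; rewrite /hnorm; congr (Num.sqrt (complex.Re _)).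
rewrite !hdot_suml; apply: eq_bigr => i _; rewrite !hdot_sumr; apply: eq_bigr => j _.
by rewrite !hdotZl !hdotZr fg.
Qed.

(** Its closure; pairs in it still have equal norms, so it is the graph of a map. *)
Let limit (x : H) (y : K) := forall e : R, 0 < e ->
  exists a b, [/\ comb a b, hnorm (x - a) < e & hnorm (y - b) < e].

Let limit_lin c x y x' y' : limit x y -> limit x' y' -> limit (c *: x + x') (c *: y + y').
Proof.
move=> h h' e e0; have e2 : 0 < e / 2 by rewrite divr_gt0.
have [d d0 hd] := mulr_smallP e2 (cabs_ge0 c).
have [a [b [ab xa yb]]] := h _ d0; have [a' [b' [ab' xa' yb']]] := h' _ e2.
exists (c *: a + a'), (c *: b + b'); split; first exact: comb_lin.
  rewrite opprD addrACA -scalerBr (splitr e); apply: (le_lt_trans (hnormD _ _)).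
  rewrite hnormZ ltrD//; apply: le_lt_trans hd; by rewrite ler_wpM2l ?cabs_ge0// ltW.
rewrite opprD addrACA -scalerBr (splitr e); apply: (le_lt_trans (hnormD _ _)).
rewrite hnormZ ltrD//; apply: le_lt_trans hd; by rewrite ler_wpM2l ?cabs_ge0// ltW.
Qed.

Let limit_norm x y : limit x y -> hnorm x = hnorm y.
Proof.
move=> h; apply/eqP; rewrite -subr_eq0 -normr_eq0; apply/eqP/(@small_lt_eq0 _ _ 2) => // e e0.
have [a [b [/comb_norm ab xa yb]]] := h _ e0.
have -> : hnorm x - hnorm y = (hnorm x - hnorm a) - (hnorm y - hnorm b) by rewrite ab; ring.
apply: (le_trans (ler_normB _ _)).
have := hnorm_lerB x a; have := hnorm_lerB y b; lra.
Qed.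

Let limit_exists x : exists y, limit x y.
Proof.
have /choice[u hu] : forall n, exists ab : H * K, comb ab.1 ab.2 /\ hnorm (x - ab.1) < n.+1%:R^-1.
  move=> n; have i0 : 0 < (n.+1%:R^-1 : R) by rewrite invr_gt0.
  have [m [c [v [hv xv]]]] := ft x i0.
  have /choice[k hk] : forall i, exists j, f j = v i by move=> i; have [j _ <-] := hv i; exists j.
  exists (\sum_i c i *: v i, \sum_i c i *: g (k i)); split=> //=; exists m, c, k; split=> //.
  by apply: eq_bigr => i _; rewrite hk.
have [|y uy] := @hcomplete R K (fun n => (u n).2).
  move=> e e0; have e2 : 0 < e / 2 by rewrite divr_gt0.
  have [M hM] := inv_small e2; exists M => m n hm hn.
  have := comb_lin (-1) (hu n).1 (hu m).1; rewrite !scaleN1r !(addrC (- _)) => /comb_norm <-.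
  apply: (le_lt_trans (hnormB_trans _ x _)).
  by rewrite (splitr e) ltrD//; [rewrite hnormBC|]; apply: (lt_trans (hu _).2 (hM _ _)).
exists y => e e0; have [M hM] := uy _ e0; have [M' hM'] := inv_small e0.
exists (u (maxn M M')).1, (u (maxn M M')).2; split; first exact: (hu _).1.
  by apply: (lt_trans (hu _).2 (hM' _ _)); rewrite leq_maxr.
by rewrite hnormBC hM// leq_maxl.
Qed.

(** Equality of the Gram matrices makes the obvious linear map between the
    spans well defined and norm preserving; completeness extends it. *)
Lemma gram_isometry : exists V : H -> K, isometry_into V /\ forall i, V (f i) = g i.
Proof.
have [V hV] := choice limit_exists.
have uniq x y y' : limit x y -> limit x y' -> y = y'.
  move=> h h'; have := limit_lin (-1) h h'; rewrite !scaleN1r addNr => /limit_norm.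
  by rewrite hnorm0 => /esym/hnorm_eq0/eqP; rewrite addrC subr_eq0 => /eqP.
exists V; split.
  apply: norm_isometry; last by move=> x; rewrite (limit_norm (hV x)).
  by move=> c x y; apply: (uniq _ _ _ (hV _)); apply: limit_lin.
move=> i; apply: (uniq _ _ _ (hV _)) => e e0; exists (f i), (g i); rewrite !subrr !hnorm0; split=> //.
by exists 1%N, (fun=> 1), (fun=> i); rewrite !big_ord1 !scale1r.
Qed.

End Gram.

Section Orthonormal.
Context {R : realType} {H : hilbert R} {I : eqType} (e : I -> H).
Hypothesis oe : orthonormal_family e.

Lemma orthonormalE i j : '[e i, e j] = (i == j)%:R.
Proof. by case: eqVneq => [->|/eqP h]; [exact: oe.1|exact: oe.2]. Qed.

Lemma hdot_orthonormal_sum (s : seq I) (c : I -> R[i]) j : uniq s ->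
  '[\sum_(i <- s) c i *: e i, e j] = if j \in s then c j else 0.
Proof.
move=> us; rewrite hdot_suml; case: ifPn => js.
  rewrite (bigD1_seq j)//= hdotZl orthonormalE eqxx mulr1 big1 ?addr0// => i ij.
  by rewrite hdotZl orthonormalE (negPf ij) mulr0.
rewrite big_seq big1// => i i_s; rewrite hdotZl orthonormalE; case: eqVneq => [ij|_]; last by rewrite mulr0.
by move: js; rewrite -ij i_s.
Qed.

Lemma hnorm_orthonormal_sum (s : seq I) (c : I -> R[i]) : uniq s ->
  hnorm (\sum_(i <- s) c i *: e i) ^+ 2 = \sum_(i <- s) cabs (c i) ^+ 2.
Proof.
move=> us; apply: (@complexI R); rewrite -hdotxx hdot_sumr rmorph_sum /=.
rewrite big_seq [RHS]big_seq; apply: eq_bigr => i i_s.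
by rewrite hdotZr hdot_orthonormal_sum// i_s conj_mul.
Qed.

(** Completing the square in each coefficient; Bessel and best approximation both
    follow. *)
Lemma orthonormal_dist (s : seq I) (c : I -> R[i]) v : uniq s ->
  hnorm (v - \sum_(i <- s) c i *: e i) ^+ 2 =
  hnorm v ^+ 2 - \sum_(i <- s) cabs '[v, e i] ^+ 2
    + \sum_(i <- s) cabs (c i - '[v, e i]) ^+ 2.
Proof.
move=> us; rewrite hnormB_sq hnorm_orthonormal_sum// hdot_sumr.
rewrite -addrA -[RHS]addrA; congr (_ + _).
rewrite [complex.Re _](_ : _ = \sum_(i <- s) complex.Re '[v, c i *: e i]); last first.
  by elim: (s) => [|a l IH]; rewrite ?big_nil// !big_cons ReD IH.
rewrite mulr_sumr -sumrN -sumrN -!big_split /=; apply: eq_bigr => i _.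
by rewrite hdotZr ReM !cabs_sq ReD ImD ReN ImN Re_conj Im_conj; ring.
Qed.

Lemma bessel (s : seq I) v : uniq s ->
  \sum_(i <- s) cabs '[v, e i] ^+ 2 <= hnorm v ^+ 2.
Proof.
move=> us; have := orthonormal_dist (fun i => '[v, e i]) v us.
rewrite [X in _ - _ + X]big1; last by move=> i _; rewrite subrr cabs0 expr0n.
by rewrite addr0 => h; rewrite -subr_ge0 -h sqr_ge0.
Qed.

Lemma orthonormal_best (s : seq I) (c : I -> R[i]) v : uniq s ->
  hnorm v ^+ 2 - \sum_(i <- s) cabs '[v, e i] ^+ 2 <= hnorm (v - \sum_(i <- s) c i *: e i) ^+ 2.
Proof. by move=> us; rewrite orthonormal_dist// lerDl sumr_ge0// => i _; rewrite sqr_ge0. Qed.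

(** Take the indices of a good finite combination; on a larger index set the Fourier
    coefficients approximate at least as well. *)
Lemma parseval_approx v (eps : R) : in_closed_span (range e) v -> 0 < eps ->
  exists2 s, uniq s & forall t, uniq t -> {subset s <= t} ->
    hnorm v ^+ 2 - eps < \sum_(i <- t) cabs '[v, e i] ^+ 2.
Proof.
move=> hv e0; pose d := Num.sqrt eps; have d0 : 0 < d by rewrite sqrtr_gt0.
have [n [c [w [hw vw]]]] := hv _ d0.
have /choice[k hk] : forall i, exists j, e j = w i by move=> i; have [j _ <-] := hw i; exists j.
exists (undup (map k (enum 'I_n))); first exact: undup_uniq.
move=> t ut st; pose a j := \sum_(i | k i == j) c i.
have E : \sum_i c i *: w i = \sum_(j <- t) a j *: e j.
  rewrite [RHS](eq_bigr (fun j => \sum_(i | k i == j) c i *: w i)); last first.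
    by move=> j _; rewrite scaler_suml; apply: eq_bigr => i /eqP <-; rewrite hk.
  rewrite (exchange_big_dep xpredT)//=; apply: eq_bigr => i _.
  rewrite -big_filter (_ : [seq j <- t | k i == j] = [:: k i]) ?big_seq1//.
  rewrite (eq_filter (a2 := pred1 (k i))); last by move=> j; rewrite /= eq_sym.
  by rewrite filter_pred1_uniq//; apply: st; rewrite mem_undup map_f// mem_enum.
rewrite ltrBlDr -ltrBlDl; apply: (le_lt_trans (orthonormal_best a v ut)).
by rewrite -E -[ltRHS](sqr_sqrtr (ltW e0)) ltr_sqr ?nnegrE ?hnorm_ge0 ?(ltW d0).
Qed.

End Orthonormal.

(** * Representations are contractive *)

Lemma expr_small {R : realType} (q e : R) : 0 <= q -> q < 1 -> 0 < e ->
  exists M : nat, forall n, (M <= n)%N -> q ^+ n < e.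
Proof.
move=> q0 q1 e0; have : (fun n => q ^+ n) @ \oo --> (0 : R).
  by apply: cvg_expr; rewrite ger0_norm.
move=> /cvgrPdist_lt/(_ _ e0)[M _ h]; exists M => n /h /=.
by rewrite sub0r normrN ger0_norm// exprn_ge0.
Qed.

Section Cstar.
Context {R : realType} {O : cstar_algebra R}.
Implicit Types (a b h : O).

Lemma star_lin (c : R[i]) a b : star (c *: a + b) = Num.conj c *: star a + star b.
Proof. by rewrite starD starZ. Qed.
Lemma starN a : star (- a) = - star a.
Proof. by rewrite -scaleN1r starZ rmorphN rmorph1 scaleN1r. Qed.
Lemma star0 : star (0 : O) = 0.
Proof. by have := starD (0 : O) 0; rewrite addr0 => /eqP; rewrite addrC -subr_eq subrr eq_sym => /eqP. Qed.
Lemma star1 : star (1 : O) = 1.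
Proof. by rewrite -[star 1]mul1r -{1}[1]starK -starM mul1r starK. Qed.

Lemma cnorm0 : cnorm (0 : O) = 0.
Proof. by rewrite -[0](scale0r (0 : O)) cnormZ normr0 mul0r. Qed.
Lemma cnormN a : cnorm (- a) = cnorm a.
Proof. by rewrite -scaleN1r cnormZ normrN normr1 mul1r. Qed.
Lemma cnormBC a b : cnorm (a - b) = cnorm (b - a).
Proof. by rewrite -cnormN opprB. Qed.
Lemma cnormB_trans a b h : cnorm (a - h) <= cnorm (a - b) + cnorm (b - h).
Proof. by have := cnormD (a - b) (b - h); rewrite addrA subrK. Qed.
Lemma cnorm_small a : (forall e : R, 0 < e -> cnorm a <= e) -> a = 0.
Proof. by move=> h; apply/cnorm_eq0/small_eq0 => //; exact: cnorm_ge0. Qed.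

Lemma cnorm_star_le a : cnorm a <= cnorm (star a).
Proof.
have [a0|a0] := eqVneq (cnorm a) 0; first by rewrite a0 cnorm_ge0.
have p : 0 < cnorm a by rewrite lt_neqAle eq_sym a0 cnorm_ge0.
by rewrite -(ler_pM2r p) -expr2 -cnorm_star cnormM.
Qed.

Lemma cnorm_starE a : cnorm (star a) = cnorm a.
Proof.
by apply/eqP; rewrite eq_le cnorm_star_le andbT -{2}(starK a) cnorm_star_le.
Qed.

(** A self-adjoint square root of [1 - h]: the root is [1 - y] where [y] is the
    fixed point of the map [y |-> (h + y ^ 2) / 2], a contraction of the ball
    of radius [cnorm h < 1]. *)
Lemma cstar_sqrt h : star h = h -> cnorm h < 1 ->
  exists b, star b = b /\ b * b = 1 - h.
Proof.
move=> sh h1; pose q := cnorm h; have q0 : 0 <= q := cnorm_ge0 h.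
pose half : R[i] := (2^-1 : R)%:C%C.
have chalf : complex.Re `|half| = 2^-1 by rewrite -/(cabs _) cabs_RC ger0_norm ?invr_ge0.
have half2 : half + half = 1.
  by apply: complex_ext; rewrite ?ReD ?ImD /= ?addr0//; lra.
pose F y := half *: (h + y * y).
have Fball y : cnorm y <= q -> cnorm (F y) <= q.
  move=> yq; rewrite cnormZ chalf; have := cnormD h (y * y); have := cnormM y y.
  have : cnorm y * cnorm y <= q * 1.
    by rewrite ler_pM ?cnorm_ge0// (le_trans yq)// ltW.
  by rewrite -/q; lra.
have Flip y z : cnorm y <= q -> cnorm z <= q -> cnorm (F y - F z) <= q * cnorm (y - z).
  move=> yq zq; rewrite -scalerBr cnormZ chalf.
  have -> : h + y * y - (h + z * z) = (y - z) * y + z * (y - z).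
    rewrite opprD addrACA subrr add0r mulrBl mulrBr addrA subrK //.
  have := cnormD ((y - z) * y) (z * (y - z)).
  have := cnormM (y - z) y; have := cnormM z (y - z).
  have : cnorm (y - z) * cnorm y <= cnorm (y - z) * q by rewrite ler_wpM2l ?cnorm_ge0.
  have : cnorm z * cnorm (y - z) <= q * cnorm (y - z) by rewrite ler_wpM2r ?cnorm_ge0.
  lra.
pose y n := iter n F 0.
have yball n : cnorm (y n) <= q by elim: n => [|n IH] /=; [rewrite cnorm0|exact: Fball].
have ycau n k : cnorm (y (n + k)%N - y n) <= q ^+ n.
  elim: n => [|n IH]; first by rewrite expr0 subr0 (le_trans (yball _))// ltW.
  by rewrite addSn /= (le_trans (Flip _ _ _ _))// exprS ler_wpM2l.
have [|l hl] := @cstar_complete R O y.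
  move=> e e0; have e2 : 0 < e / 2 by rewrite divr_gt0.
  have [M hM] := expr_small q0 h1 e2; exists M => m n Mm Mn.
  apply: (le_lt_trans (cnormB_trans _ (y M) _)); rewrite (splitr e) ltrD//.
    by rewrite -(subnKC Mm); apply: (le_lt_trans (ycau _ _)); exact: hM.
  by rewrite cnormBC -(subnKC Mn); apply: (le_lt_trans (ycau _ _)); exact: hM.
have lq : cnorm l <= q.
  apply/ler_addgt0Pr => e /hl[M /(_ M (leqnn _)) hM].
  have := cnormB_trans l (y M) 0; rewrite !subr0 cnormBC; have := yball M; lra.
have Fl : l = F l.
  apply/eqP; rewrite -subr_eq0; apply/eqP/cnorm_small => e e0.
  have e2 : 0 < e / 2 by rewrite divr_gt0.
  have [M hM] := hl _ e2; apply: (le_trans (cnormB_trans l (y M.+1) _)).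
  have := Flip _ _ (yball M) lq; have := hM M (leqnn _); have := hM M.+1 (leqnSn _).
  have : q * cnorm (y M - l) <= 1 * cnorm (y M - l) by rewrite ler_wpM2r ?cnorm_ge0 ?ltW.
  rewrite (cnormBC l) /=; lra.
have sy n : star (y n) = y n.
  elim: n => [|n IH] /=; first by rewrite star0.
  rewrite starZ starD starM sh IH; congr (_ *: _).
  by apply: complex_ext => //=; rewrite oppr0.
have sl : star l = l.
  apply/eqP; rewrite -subr_eq0; apply/eqP/cnorm_small => e e0.
  have e2 : 0 < e / 2 by rewrite divr_gt0.
  have [M /(_ M (leqnn _)) hM] := hl _ e2; apply: (le_trans (cnormB_trans _ (y M) _)).
  have -> : star l - y M = star (l - y M) by rewrite starD starN sy.
  by rewrite cnorm_starE (cnormBC l); lra.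
exists (1 - l); split; first by rewrite starD starN star1 sl.
have : l + l = h + l * l by rewrite {1 2}Fl -scalerDl half2 scale1r.
rewrite mulrBl mul1r mulrBr mulr1 opprB => E.
have -> : l * l = l + l - h by rewrite E addrAC subrr add0r.
by rewrite [l + l - h - l]addrAC addrK addrA subrK.
Qed.

End Cstar.

Section RepTheory.
Context {R : realType} {O : cstar_algebra R}.
Implicit Types (pi rho : representation O) (a b : O).

Lemma act_lin pi a : lin (act (r := pi) a).
Proof. by move=> c x y; exact: act_linear. Qed.
Lemma actD pi a b (x : pi) : act (a + b) x = act a x + act b x.
Proof. by have := @act_linear_alg _ _ pi 1 a b x; rewrite !scale1r. Qed.
Lemma act0 pi (x : pi) : act 0 x = 0.
Proof. by have := @act_linear_alg _ _ pi (-1) 0 0 x; rewrite scaler0 addr0 scaleN1r addNr. Qed.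
Lemma actZ pi (c : R[i]) a (x : pi) : act (c *: a) x = c *: act a x.
Proof. by have := @act_linear_alg _ _ pi c a 0 x; rewrite addr0 act0 addr0. Qed.
Lemma actB pi a b (x : pi) : act (a - b) x = act a x - act b x.
Proof. by rewrite -[- b]scaleN1r actD actZ scaleN1r. Qed.
Lemma act_sum pi I (r : seq I) (F : I -> O) (x : pi) :
  act (\sum_(i <- r) F i) x = \sum_(i <- r) act (F i) x.
Proof. by elim/big_rec2: _ => [|i u v _ <-]; rewrite ?act0// actD. Qed.
Lemma act_dot pi a (x y : pi) : '[act a x, y] = '[x, act (star a) y].
Proof. by rewrite -{1}(starK a) act_star. Qed.

(** If [cnorm a < 1] then [1 - star a * a] is the square of a self-adjoint
    element, so it acts as a positive operator. *)
Lemma act_contractive pi a (x : pi) : hnorm (act a x) <= cnorm a * hnorm x.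
Proof.
have small b : cnorm b < 1 -> hnorm (act b x) <= hnorm x.
  move=> b1; have [||c [sc cc]] := @cstar_sqrt R O (star b * b).
  - by rewrite starM starK.
  - by rewrite cnorm_star expr_lt1 ?cnorm_ge0.
  have : 0 <= hnorm (act c x) ^+ 2 by exact: sqr_ge0.
  rewrite hnorm_sq act_dot sc -actM cc actB act1 actM hdotBr -act_dot ReD ReN -!hnorm_sq.
  by rewrite subr_ge0 ler_sqr ?nnegrE ?hnorm_ge0.
have [x0|x0] := eqVneq (hnorm x) 0.
  by rewrite (hnorm_eq0 x0) lin0 ?hnorm0 ?mulr0//; exact: act_lin.
have xp : 0 < hnorm x by rewrite lt_neqAle eq_sym x0 hnorm_ge0.
rewrite -ler_pdivrMr//; apply/ler_addgt0Pr => e e0; rewrite ler_pdivrMr//.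
set t := cnorm a + e; have t0 : 0 < t by rewrite ltr_wpDl ?cnorm_ge0.
have := small ((t^-1)%:C%C *: a); rewrite cnormZ actZ hnormZ -/(cabs _) cabs_RC.
rewrite ger0_norm ?invr_ge0 ?(ltW t0)// mulrC ltr_pdivrMr// mul1r ltrDl => /(_ e0).
by rewrite mulrC ler_pdivrMr// mulrC.
Qed.

Lemma act_blin pi a : blin (act (r := pi) a).
Proof. by split; [exact: act_lin|exists (cnorm a) => x; exact: act_contractive]. Qed.

Lemma act_approx pi a b (x : pi) (e : R) : 0 < e -> cnorm (a - b) < e / (hnorm x + 1) ->
  hnorm (act a x - act b x) < e.
Proof.
move=> e0 ab; rewrite -actB; apply: (le_lt_trans (act_contractive _ _)).
have x1 : 0 < hnorm x + 1 by rewrite ltr_wpDl ?hnorm_ge0.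
apply: (@le_lt_trans _ _ (cnorm (a - b) * (hnorm x + 1))).
  by rewrite ler_wpM2l ?cnorm_ge0// lerDl.
by rewrite -ltr_pdivlMr.
Qed.

Definition intertwiner pi rho (V : pi -> rho) := forall a x, V (act a x) = act a (V x).

End RepTheory.

Section Generated.
Context {R : realType} {N : nat} {O : cstar_algebra R} (s : 'I_N -> O).
Hypothesis gen : forall S : set O, closed_star_subalgebra S -> (forall i, S (s i)) -> S = setT.

(** The elements [a] such that both [a] and [star a] satisfy [Q] form a closed
    star-subalgebra. *)
Lemma star_algebra_ind (Q : O -> Prop) : Q 1 ->
  (forall (c : R[i]) a b, Q a -> Q b -> Q (c *: a + b)) ->
  (forall a b, Q a -> Q b -> Q (a * b)) ->
  (forall a, (forall e : R, 0 < e -> exists2 b, Q b & cnorm (a - b) < e) -> Q a) ->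
  (forall i, Q (s i)) -> (forall i, Q (star (s i))) -> forall a, Q a.
Proof.
move=> Q1 Ql QM Qc Qs Qss a; suff : [set a | Q a /\ Q (star a)] = setT.
  by move/seteqP => [_ /(_ a I)[]].
apply: gen => //; split.
- by rewrite /= star1.
- by move=> c x y [? ?] [? ?]; rewrite /= star_lin; split; exact: Ql.
- by move=> x y [? ?] [? ?]; rewrite /= starM; split; exact: QM.
- by move=> x [? ?]; rewrite /= starK.
- move=> x h; split; apply: Qc => e /h[y [Qy Qsy] xy]; first by exists y.
  by exists (star y) => //; rewrite -starN -starD cnorm_starE.
Qed.

Lemma generated_invariant (pi : representation O) (W : set pi) : csub W ->
  (forall i x, W x -> W (act (s i) x)) -> (forall i x, W x -> W (act (star (s i)) x)) ->
  forall a x, W x -> W (act a x).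
Proof.
move=> hW Ws Wss a; case: (hW) => W0 Wl Wc; move: a.
apply: star_algebra_ind => //.
- by move=> x Wx; rewrite act1.
- by move=> c a b ha hb x Wx; rewrite act_linear_alg; apply: Wl; [exact: ha|exact: hb].
- by move=> a b ha hb x Wx; rewrite actM; apply: ha; exact: hb.
- move=> a ha x Wx; apply: Wc => e e0.
  have d0 : 0 < e / (hnorm x + 1) by rewrite divr_gt0// ltr_wpDl ?hnorm_ge0.
  have [b hb ab] := ha _ d0; exists (act b x); first exact: hb.
  exact: act_approx.
Qed.

Lemma generated_intertwiner (pi rho : representation O) (V : pi -> rho) : blin V ->
  (forall i x, V (act (s i) x) = act (s i) (V x)) ->
  (forall i x, V (act (star (s i)) x) = act (star (s i)) (V x)) -> intertwiner V.
Proof.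
move=> bV Vs Vss a; move: a; apply: star_algebra_ind => //.
- by move=> x; rewrite !act1.
- by move=> c a b ha hb x; rewrite !act_linear_alg bV.1 ha hb.
- by move=> a b ha hb x; rewrite !actM ha hb.
- move=> a ha x; apply/eqP; rewrite -subr_eq0; apply/eqP/hnorm_small => e e0.
  have e2 : 0 < e / 2 by rewrite divr_gt0.
  have [M M0 hM] := blin_pos bV; have [d d0 hd] := mulr_smallP e2 M0.
  have p (y : R) : 0 <= y -> 0 < y + 1 by move=> ?; rewrite ltr_wpDl.
  pose d' := Num.min (d / (hnorm x + 1)) ((e / 2) / (hnorm (V x) + 1)).
  have [|b hb ab] := ha d'; first by rewrite lt_min !divr_gt0// p ?hnorm_ge0.
  move: ab; rewrite lt_min => /andP[ab1 ab2].
  apply/ltW/(le_lt_trans (hnormB_trans _ (V (act b x)) _)); rewrite (splitr e) ltrD//.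
    rewrite -linB; last exact: bV.1.
    apply: (le_lt_trans (hM _)); apply: le_lt_trans hd; rewrite ler_wpM2l// ltW//.
    exact: act_approx.
  rewrite hb hnormBC; exact: act_approx.
Qed.

End Generated.

(** * Vectors with a coding word *)

Section InfiniteWords.
Context {N : nat} (A : 'M[bool]_N).
Implicit Types (x y : nat -> 'I_N) (w : seq 'I_N).

Definition wshift (k : nat) x : nat -> 'I_N := fun n => x (k + n)%N.
Definition wcons (i : 'I_N) x : nat -> 'I_N := fun n => if n is m.+1 then x m else i.
Definition wapp w x := foldr wcons x w.
Fixpoint prefix x n : seq 'I_N := if n is m.+1 then x 0%N :: prefix (wshift 1 x) m else [::].

Lemma wshift0 x : wshift 0 x = x.
Proof. by apply/funext => n. Qed.
Lemma wshiftD k l x : wshift k (wshift l x) = wshift (l + k) x.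
Proof. by apply/funext => n; rewrite /wshift addnA. Qed.
Lemma wconsK i x : wshift 1 (wcons i x) = x.
Proof. by apply/funext => n. Qed.
Lemma wcons_head x : wcons (x 0%N) (wshift 1 x) = x.
Proof. by apply/funext => -[]. Qed.
Lemma size_prefix x n : size (prefix x n) = n.
Proof. by elim: n x => //= n IH x; rewrite IH. Qed.
Lemma wapp_cat w w' x : wapp (w ++ w') x = wapp w (wapp w' x).
Proof. by rewrite /wapp foldr_cat. Qed.
Lemma wapp_prefix x n : wapp (prefix x n) (wshift n x) = x.
Proof.
elim: n x => [|n IH] x /=; first by rewrite wshift0.
by rewrite -[wshift n.+1 x](wshiftD n 1 x) IH wcons_head.
Qed.
Lemma wappK w x : wshift (size w) (wapp w x) = x.
Proof.
elim: w => [|i w IH] /=; first by rewrite wshift0.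
by rewrite -(wshiftD (size w) 1) wconsK.
Qed.
Lemma prefixD x n m : prefix x (n + m) = prefix x n ++ prefix (wshift n x) m.
Proof.
elim: n x => [|n IH] x /=; first by rewrite wshift0.
by rewrite IH wshiftD.
Qed.
Lemma prefix_wapp w x : prefix (wapp w x) (size w) = w.
Proof. by elim: w => //= i w IH; rewrite wconsK IH. Qed.
Lemma prefixS x n : prefix x n.+1 = rcons (prefix x n) (x n).
Proof. by rewrite -addn1 prefixD /= /wshift addn0 cats1. Qed.
Lemma prefixE x n : prefix x n = mkseq x n.
Proof. by elim: n => // n IH; rewrite prefixS IH /mkseq -addn1 iotaD map_cat cats1. Qed.

Lemma infinite_word_shift k x : infinite_word A x -> infinite_word A (wshift k x).
Proof. by move=> h n; rewrite /wshift addnS; exact: h. Qed.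
Lemma infinite_word_cons i x : A i (x 0%N) -> infinite_word A x -> infinite_word A (wcons i x).
Proof. by move=> hi h [|n] //=; exact: h. Qed.

End InfiniteWords.

Section Coded.
Context {R : realType} {N : nat} {A : 'M[bool]_N} {O : cstar_algebra R} {s : 'I_N -> O}.
Hypothesis ck : ck_relations A s.
Implicit Types (pi rho : representation O) (x y : nat -> 'I_N) (w : seq 'I_N).

Definition sa pi (i : 'I_N) (v : pi) := act (s i) v.
Definition sb pi (i : 'I_N) (v : pi) := act (star (s i)) v.

(** [opA w] is the operator [s_(w_1) ... s_(w_k)] and [opB w] its adjoint. *)
Definition opA pi w (v : pi) : pi := foldr (@sa pi) v w.
Definition opB pi w (v : pi) : pi := foldl (fun u i => sb i u) v w.

Lemma sa_dot pi i (v u : pi) : '[sa i v, u] = '[v, sb i u].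
Proof. exact: act_dot. Qed.
Lemma sb_dot pi i (v u : pi) : '[sb i v, u] = '[v, sa i u].
Proof. exact: act_star. Qed.
Lemma sa_lin pi i : lin (@sa pi i).
Proof. exact: act_lin. Qed.
Lemma sb_lin pi i : lin (@sb pi i).
Proof. exact: act_lin. Qed.
Lemma sa_blin pi i : blin (@sa pi i).
Proof. exact: act_blin. Qed.
Lemma sb_blin pi i : blin (@sb pi i).
Proof. exact: act_blin. Qed.
Lemma sa0 pi i : sa i (0 : pi) = 0.
Proof. exact/lin0/sa_lin. Qed.
Lemma sb0 pi i : sb i (0 : pi) = 0.
Proof. exact/lin0/sb_lin. Qed.

Lemma sa_sb_sa pi i (v : pi) : sa i (sb i (sa i v)) = sa i v.
Proof.
case: ck => h _ _; transitivity (act (s i * star (s i) * s i) v); first by rewrite !actM.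
by rewrite (h i : s i * star (s i) * s i = s i).
Qed.
Lemma sum_sa_sb pi (v : pi) : \sum_i sa i (sb i v) = v.
Proof.
case: ck => _ _ h; rewrite -[RHS](act1 v) -h act_sum; apply: eq_bigr => i _.
by rewrite actM.
Qed.
Lemma sb_saE pi i (v : pi) : sb i (sa i v) = \sum_j ((A i j : nat)%:R : R[i]) *: sa j (sb j v).
Proof.
case: ck => _ h _; rewrite /sa /sb -actM h act_sum; apply: eq_bigr => j _.
by rewrite actZ actM.
Qed.

(** The ranges of the [s_i] are orthogonal: the squared norms of the
    [s_k^* s_j v] add up to that of [s_j v], and the term [k = j] exhausts it. *)
Lemma sb_sa_neq pi i j (v : pi) : i <> j -> sb i (sa j v) = 0.
Proof.
move=> /eqP ij; set u := sa j v.
have : '[u, u] = \sum_k '[sb k u, sb k u].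
  by rewrite -{1}(sum_sa_sb u) hdot_suml; apply: eq_bigr => k _; rewrite sa_dot.
rewrite (bigD1 j)//= -sa_dot sa_sb_sa -/u -{1}['[u, u]]addr0 => /addrI/esym/eqP.
rewrite psumr_eq0; last by move=> k _; exact: hdot_ge0.
by move=> /allP/(_ i); rewrite mem_index_enum ij => /(_ isT)/eqP/hdot_eq0.
Qed.

Lemma sb_sa_sa pi i j (v : pi) : sb i (sa i (sa j v)) = (A i j : nat)%:R *: sa j v.
Proof.
rewrite sb_saE (bigD1 j)//= sa_sb_sa big1 ?addr0// => k /eqP kj.
by rewrite sb_sa_neq// sa0 scaler0.
Qed.

Lemma opA_dot pi w (v u : pi) : '[opA w v, u] = '[v, opB w u].
Proof. by elim: w v u => //= i w IH v u; rewrite sa_dot IH. Qed.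
Lemma opB_dot pi w (v u : pi) : '[opB w v, u] = '[v, opA w u].
Proof. by rewrite hdotC -opA_dot -hdotC. Qed.
Lemma opA_cat pi w w' (v : pi) : opA (w ++ w') v = opA w (opA w' v).
Proof. by rewrite /opA foldr_cat. Qed.
Lemma opB_cat pi w w' (v : pi) : opB (w ++ w') v = opB w' (opB w v).
Proof. by rewrite /opB foldl_cat. Qed.
Lemma opA_blin pi w : blin (@opA pi w).
Proof.
elim: w => [|i w IH]; first by split => //; exists 1 => x; rewrite mul1r.
exact: (blin_comp IH (sa_blin pi i)).
Qed.
Lemma opB_blin pi w : blin (@opB pi w).
Proof.
elim: w => [|i w IH]; first by split => //; exists 1 => x; rewrite mul1r.
exact: (blin_comp (sb_blin pi i) IH).
Qed.
Lemma opA0 pi w : opA w (0 : pi) = 0.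
Proof. exact/lin0/(opA_blin pi w).1. Qed.
Lemma opB0 pi w : opB w (0 : pi) = 0.
Proof. exact/lin0/(opB_blin pi w).1. Qed.
Lemma opAE pi w (v : pi) : opA w v = act (\prod_(j <- w) s j) v.
Proof. by elim: w => [|i w IH] /=; rewrite ?big_nil ?act1// big_cons actM -IH. Qed.
Lemma opBE pi w (v : pi) : opB w v = act (\prod_(j <- rev w) star (s j)) v.
Proof.
elim/last_ind: w => [|w i IH] /=; first by rewrite big_nil act1.
by rewrite rev_rcons big_cons actM -IH -cats1 opB_cat.
Qed.

(** [v] lies in the range of every [s_(x|n)]: in a permutative representation
    these are the vectors supported on the basis elements with coding word [x]. *)
Definition coded x pi (v : pi) := forall n, opA (prefix x n) (opB (prefix x n) v) = v.

Lemma coded_csub x pi : csub [set v : pi | coded x v].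
Proof.
have -> : [set v : pi | coded x v] =
    [set v | forall n, True -> [set u | opA (prefix x n) (opB (prefix x n) u) = id u] v].
  by apply/seteqP; split=> v h n; [move=> _; exact: h|exact: (h n I)].
apply: csub_bigI => n _; apply: csub_eq; first exact: (blin_comp (opB_blin _ _) (opA_blin _ _)).
by split => //; exists 1 => u; rewrite mul1r.
Qed.

Lemma coded_head x pi (v : pi) : coded x v -> sa (x 0%N) (sb (x 0%N) v) = v.
Proof. by move=> /(_ 1%N). Qed.

Lemma coded_sb x pi (v : pi) : infinite_word A x -> coded x v ->
  coded (wshift 1 x) (sb (x 0%N) v).
Proof.
move=> hx hv n; have := hv n.+1; rewrite /= => e; rewrite -{2}e.
case: n e => [|n] /= e; first by rewrite e.
by rewrite sb_sa_sa /wshift hx scale1r.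
Qed.

Lemma coded_sb_neq x pi (v : pi) k : coded x v -> k <> x 0%N -> sb k v = 0.
Proof. by move=> /coded_head <- kx; rewrite sb_sa_neq. Qed.

Lemma sb_sa_coded x pi (v : pi) k : coded x v -> sb k (sa k v) = (A k (x 0%N) : nat)%:R *: v.
Proof. by move=> /coded_head h; rewrite -h sb_sa_sa. Qed.

Lemma coded_sa x pi (v : pi) k : coded x v -> A k (x 0%N) -> coded (wcons k x) (sa k v).
Proof.
move=> hv Ak [|n] //=; rewrite (sb_sa_coded k hv) Ak scale1r wconsK; congr sa; exact: hv.
Qed.

Lemma sa_coded0 x pi (v : pi) k : coded x v -> ~~ A k (x 0%N) -> sa k v = 0.
Proof. by move=> hv /negPf Ak; rewrite -sa_sb_sa (sb_sa_coded k hv) Ak scale0r sa0. Qed.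

Lemma coded_dot_sb x pi (v u : pi) : coded x v -> '[sb (x 0%N) v, sb (x 0%N) u] = '[v, u].
Proof. by move=> hv; rewrite -sa_dot coded_head. Qed.

Lemma coded_dot_sa x pi (v u : pi) k : coded x v -> A k (x 0%N) -> '[sa k v, sa k u] = '[v, u].
Proof. by move=> hv Ak; rewrite -sb_dot (sb_sa_coded k hv) Ak scale1r. Qed.

(** At the first letter where the words differ, the vectors lie in the orthogonal
    ranges of two generators. *)
Lemma coded_orth x y pi (v u : pi) : infinite_word A x -> infinite_word A y ->
  coded x v -> coded y u -> x <> y -> '[v, u] = 0.
Proof.
move=> hx hy hv hu xy; have [n nxy] : exists n, x n <> y n.
  by apply: contra_notP xy => h; apply/funext => n; apply: contra_notP h => ?; exists n.
elim: n x y hx hy v u hv hu nxy {xy} => [|n IH] x y hx hy v u hv hu nxy.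
  by rewrite -(coded_head hv) sa_dot (coded_sb_neq hu)// hdot0r.
have [e|/eqP ne] := eqVneq (x 0%N) (y 0%N); last first.
  by rewrite -(coded_head hv) sa_dot (coded_sb_neq hu)// hdot0r.
rewrite -(coded_dot_sb _ hv) {2}e; apply: (IH _ _ _ _ _ _ (coded_sb hx hv) (coded_sb hy hu)) => //;
  exact: infinite_word_shift.
Qed.

Lemma coded_opB x pi (v : pi) n : infinite_word A x -> coded x v ->
  coded (wshift n x) (opB (prefix x n) v).
Proof.
move=> hx; elim: n x hx v => [|n IH] x hx v hv /=; first by rewrite wshift0.
rewrite -[wshift n.+1 x](wshiftD n 1 x); apply: IH; first exact: infinite_word_shift.
exact: coded_sb.
Qed.

Lemma opB_prefixS x pi (v : pi) n : opB (prefix x n.+1) v = sb (x n) (opB (prefix x n) v).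
Proof. by rewrite prefixS -cats1 opB_cat. Qed.

Lemma coded_opA x pi (v : pi) w : infinite_word A x -> coded x v ->
  opA w v = 0 \/ infinite_word A (wapp w x) /\ coded (wapp w x) (opA w v).
Proof.
move=> hx hv; elim: w => [|k w [e|[hw cw]]] /=; [by right|by left; rewrite e sa0|].
case: (boolP (A k (wapp w x 0%N))) => Ak.
  by right; split; [exact: infinite_word_cons|exact: coded_sa].
by left; exact: sa_coded0 cw Ak.
Qed.

Lemma coded0 x pi : coded x (0 : pi).
Proof. by move=> n; rewrite opB0 opA0. Qed.

Lemma coded_opB_dot x pi (v u : pi) n : coded x v ->
  '[opB (prefix x n) v, opB (prefix x n) u] = '[v, u].
Proof. by move=> hv; rewrite -opA_dot hv. Qed.

(** The vectors [s_w s_(x|m)^* v]; together with [0] they are stable under the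
    generators and their adjoints, up to scalars that depend on the word [x]
    only and not on the representation. *)
Definition branch x pi (v : pi) (w : seq 'I_N) (m : nat) := opA w (opB (prefix x m) v).

Lemma sb_branch x k w m : infinite_word A x -> exists (c : R[i]) w' m', forall pi (v : pi),
  coded x v -> sb k (branch x v w m) = c *: branch x v w' m'.
Proof.
move=> hx; case: w => [|j w].
  have [->|/eqP kx] := eqVneq k (x m).
    by exists 1, [::], m.+1 => pi v hv; rewrite scale1r /branch opB_prefixS.
  exists 0, [::], m => pi v hv; rewrite scale0r /branch /=.
  by apply: (coded_sb_neq (coded_opB m hx hv)); rewrite /wshift addn0.
have [->|/eqP kj] := eqVneq k j; last first.
  by exists 0, [::], m => pi v hv; rewrite scale0r /branch /= sb_sa_neq.
exists (A j (wapp w (wshift m x) 0%N) : nat)%:R, w, m => pi v hv; rewrite /branch /=.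
have [e|[_ h]] := coded_opA w (infinite_word_shift m hx) (coded_opB m hx hv).
  by rewrite e sa0 sb0 scaler0.
exact: sb_sa_coded.
Qed.

Lemma branch_coded x pi (v : pi) w m : infinite_word A x -> coded x v ->
  branch x v w m = 0 \/ infinite_word A (wapp w (wshift m x)) /\
                        coded (wapp w (wshift m x)) (branch x v w m).
Proof.
by move=> hx hv; exact: (coded_opA w (infinite_word_shift m hx) (coded_opB m hx hv)).
Qed.

Lemma branch_act x pi (v : pi) w m : exists a, branch x v w m = act a v.
Proof. by rewrite /branch opAE opBE; eexists; rewrite -actM. Qed.

(** Moving generators to the other side shortens the words until a correlation of two
    shifted vectors remains; it vanishes by [coded_orth] unless the shifted words
    agree. *)
Lemma branch_correlation x y rho pi (v u : rho) (v' u' : pi) :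
  infinite_word A x -> infinite_word A y ->
  coded x v -> coded y u -> coded x v' -> coded y u' ->
  (forall k m, wshift k y = wshift m x ->
    '[branch x v (prefix y k) m, u] = '[branch x v' (prefix y k) m, u']) ->
  forall w m w' m', '[branch x v w m, branch y u w' m'] = '[branch x v' w m, branch y u' w' m'].
Proof.
move=> hx hy hv hu hv' hu' h w m w' m'.
elim: w m w' m' => [|k w IH] m w' m'.
  elim: w' m m' => [|k' w' IH'] m m'.
    have [e|ne] := pselect (wshift m' y = wshift m x).
      by rewrite /branch /= -!opA_dot; exact: h.
    rewrite !(coded_orth (infinite_word_shift m hx) (infinite_word_shift m' hy)) //;
      try exact: coded_opB; by apply/nesym.
  rewrite hdotC [RHS]hdotC /branch /= !sa_dot -!hdotC.
  have [->|/eqP kx] := eqVneq k' (x m).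
    rewrite -!opB_prefixS; exact: (IH' m.+1 m').
  by rewrite !(coded_sb_neq (coded_opB m hx _))// ?hdot0l// /wshift addn0.
case: w' => [|k' w'].
  rewrite /branch /= !sa_dot; have [->|/eqP ky] := eqVneq k (y m').
    rewrite -!opB_prefixS; exact: (IH m [::] m'.+1).
  by rewrite !(coded_sb_neq (coded_opB m' hy _))// ?hdot0r// /wshift addn0.
rewrite /branch /= -!sb_dot; have [<-|/eqP kk] := eqVneq k k'; last first.
  by rewrite !sb_sa_neq ?hdot0l//; exact: nesym.
have C pi0 (z : pi0) : coded x z -> sb k (sa k (opA w (opB (prefix x m) z))) =
    (A k (wapp w (wshift m x) 0%N) : nat)%:R *: branch x z w m.
  move=> hz; have [e|[_ hh]] := coded_opA w (infinite_word_shift m hx) (coded_opB m hx hz).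
    by rewrite /branch e sa0 sb0 scaler0.
  exact: sb_sa_coded.
by rewrite !C// !hdotZl; congr (_ * _); exact: IH.
Qed.

Section Generation.
Hypothesis gen : forall S : set O, closed_star_subalgebra S -> (forall i, S (s i)) -> S = setT.

(** The span of the branches is invariant under the generators and their adjoints,
    hence under the algebra. *)
Lemma branches_span pi (I : Type) (x : I -> nat -> 'I_N) (v : I -> pi) :
  (forall i, infinite_word A (x i)) -> (forall i, coded (x i) (v i)) ->
  forall i a, in_closed_span [set u | exists j w m, u = branch (x j) (v j) w m] (act a (v i)).
Proof.
move=> hx hv i a; set X := [set u | _].
have hX : csub (in_closed_span X) := cspan_csub X.
have inX j w m : in_closed_span X (branch (x j) (v j) w m).
  by apply: sub_cspan; exists j, w, m.
apply: (generated_invariant gen hX); last exact: (inX i [::] 0%N).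
  move=> k; apply: (@cspan_min _ _ X [set u | in_closed_span X (sa k u)]).
    exact: (csub_preim (sa_blin pi k) hX).
  by move=> _ [j [w [m ->]]]; exact: (inX j (k :: w) m).
move=> k; apply: (@cspan_min _ _ X [set u | in_closed_span X (sb k u)]).
  exact: (csub_preim (sb_blin pi k) hX).
move=> _ [j [w [m ->]]] /=; have [c [w' [m' ->]]] := sb_branch k w m (hx j) => //.
exact: (csubZ c hX (inX j w' m')).
Qed.

(** Branches on both sides have equal Gram matrices, and the generators and their
    adjoints permute branches up to scalars that do not depend on the representation. *)
Lemma correlation_isometry rho pi (I : Type) (x : I -> nat -> 'I_N) (v : I -> rho) (v' : I -> pi) :
  (forall i, infinite_word A (x i)) ->
  (forall i, coded (x i) (v i)) -> (forall i, coded (x i) (v' i)) ->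
  (forall i j k m, wshift k (x j) = wshift m (x i) ->
    '[branch (x i) (v i) (prefix (x j) k) m, v j] = '[branch (x i) (v' i) (prefix (x j) k) m, v' j]) ->
  total_set [set u | exists i a, u = act a (v i)] ->
  exists V : rho -> pi, [/\ isometry_into V, intertwiner V & forall i, V (v i) = v' i].
Proof.
move=> hx hv hv' h tot.
pose f (p : I * seq 'I_N * nat) := branch (x p.1.1) (v p.1.1) p.1.2 p.2.
pose g (p : I * seq 'I_N * nat) := branch (x p.1.1) (v' p.1.1) p.1.2 p.2.
have fg p q : '[f p, f q] = '[g p, g q].
  by apply: branch_correlation => // k m; exact: h.
have ft : total_set (range f).
  move=> u; apply: (cspan_mono _ (tot u)) => _ [i [a ->]].
  apply: cspan_mono (branches_span hx hv i a) => _ [j [w [m ->]]].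
  by apply: sub_cspan; exists (j, w, m).
have [V [iV Vf]] := gram_isometry fg ft.
exists V; split=> //; last by move=> i; exact: (Vf (i, [::], 0%N)).
have bV := isometry_blin iV.
apply: (generated_intertwiner gen) => // k u.
  apply: (total_ind ft (csub_eq (blin_comp (sa_blin rho k) bV) (blin_comp bV (sa_blin pi k)))).
  by move=> _ [[[i w] m] _ <-]; rewrite /= Vf; exact: (Vf (i, k :: w, m)).
apply: (total_ind ft (csub_eq (blin_comp (sb_blin rho k) bV) (blin_comp bV (sb_blin pi k)))).
move=> _ [[[i w] m] _ <-]; rewrite /= Vf.
have [c [w' [m' E]]] := sb_branch k w m (hx i).
by rewrite E// E// linZ ?(Vf (i, w', m'))//; exact: bV.1.
Qed.

Lemma coded_act_orth x y pi (v u : pi) : infinite_word A x -> infinite_word A y ->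
  coded x v -> coded y u ->
  (forall k m, wshift k y = wshift m x -> '[branch x v (prefix y k) m, u] = 0) ->
  forall a b, '[act a v, act b u] = 0.
Proof.
move=> hx hy hv hu h a b.
have B w m w' m' : '[branch x v w m, branch y u w' m'] = 0.
  (* The pair [(v, u)] has the correlations of the pair [(v, 0)]. *)
  rewrite (@branch_correlation x y pi pi v u v 0) //; first by rewrite /branch opB0 opA0 hdot0r.
    exact: coded0.
  by move=> k l e; rewrite h// hdot0r.
have T := @branches_span pi unit (fun=> x) (fun=> v) (fun=> hx) (fun=> hv) tt a.
have T' := @branches_span pi unit (fun=> y) (fun=> u) (fun=> hy) (fun=> hu) tt b.
apply: (cspan_min (csub_orth [set act b u]) _ T) => // _ [_ [w [m ->]]] _ ->.
apply: (cspan_min (csub_orthr [set branch x v w m]) _ T') => // _ [_ [w' [m' ->]]] _ ->.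
exact: B.
Qed.

End Generation.
End Coded.

(** * Periodic and aperiodic words *)

Section Periodicity.
Context {N : nat} (i0 : 'I_N).
Implicit Types (x y z : nat -> 'I_N) (J w : seq 'I_N).

Local Notation pw := (wpow_inf i0).

(** Equality of two tails; it agrees with [tail_equiv] and avoids splitting words. *)
Definition tail_eq x y := exists k m, wshift k x = wshift m y.

Lemma tail_eq_refl x : tail_eq x x.
Proof. by exists 0%N, 0%N. Qed.
Lemma tail_eq_sym x y : tail_eq x y -> tail_eq y x.
Proof. by move=> [k [m e]]; exists m, k. Qed.
Lemma tail_eq_trans x y z : tail_eq x y -> tail_eq y z -> tail_eq x z.
Proof.
move=> [k [m e]] [k' [m' e']]; exists (k + k')%N, (m' + m)%N.
by rewrite -wshiftD e wshiftD (addnC m) -wshiftD e' wshiftD.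
Qed.
Lemma tail_eq_shift k x : tail_eq (wshift k x) x.
Proof. by exists 0%N, k; rewrite wshift0. Qed.
Lemma tail_eq_cons i x : tail_eq (wcons i x) x.
Proof. by exists 1%N, 0%N; rewrite wconsK wshift0. Qed.
Lemma wcatE J x : wcat J x = wapp J x.
Proof.
elim: J => [|i J IH]; first by apply/funext => n; rewrite /wcat /= subn0 nth_nil.
by rewrite /= -IH; apply/funext => -[|n] //=.
Qed.

Lemma tail_equivP x y : tail_equiv x y <-> tail_eq x y.
Proof.
split=> [[J3 [J4 [z [-> ->]]]]|[k [m e]]].
  by exists (size J3), (size J4); rewrite !wcatE !wappK.
exists (prefix x k), (prefix y m), (wshift k x).
by rewrite !wcatE wapp_prefix e wapp_prefix.
Qed.

Lemma wshift_mul x p k : wshift p x = x -> wshift (k * p) x = x.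
Proof.
by move=> h; elim: k => [|k IH]; rewrite ?wshift0// mulSn -wshiftD h IH.
Qed.

Lemma wshift_sub x p a b : (0 < p)%N -> wshift p x = x -> (a <= b)%N ->
  wshift a x = wshift b x -> wshift (b - a) x = x.
Proof.
move=> p0 hp ab e.
have le : (a <= a * p)%N by rewrite leq_pmulr.
have : wshift (a * p - a) (wshift a x) = wshift (a * p - a) (wshift b x) by rewrite e.
rewrite !wshiftD subnKC// wshift_mul// => {2}->.
by rewrite (_ : (b + (a * p - a) = a * p + (b - a)))%N -?wshiftD ?wshift_mul//; lia.
Qed.

Lemma wpow_inf_shift J : wshift (size J) (pw J) = pw J.
Proof. by apply/funext => n; rewrite /wshift /wpow_inf modnDl. Qed.

Lemma wpow_infE y p : (0 < p)%N -> wshift p y = y -> pw (prefix y p) = y.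
Proof.
move=> p0 hp; apply/funext => n; rewrite /wpow_inf size_prefix prefixE nth_mkseq ?ltn_mod//.
rewrite {2}(divn_eq n p); have := congr1 (fun f => f (n %% p)%N) (wshift_mul (n %/ p) hp).
by rewrite /wshift => ->.
Qed.

Lemma prefix_wpow_inf J : prefix (pw J) (size J) = J.
Proof.
apply: (@eq_from_nth _ i0); rewrite size_prefix// => n nJ.
by rewrite prefixE nth_mkseq// /wpow_inf modn_small.
Qed.

Lemma eventually_periodicP x : eventually_periodic x <->
  exists k p, (0 < p)%N /\ wshift p (wshift k x) = wshift k x.
Proof.
split=> [[J0 [J1 [n0 n1 ->]]]|[k [p [p0 h]]]].
  exists (size J0), (size J1); split; first by case: J1 n1.
  rewrite wcatE wappK; apply/funext => n; by rewrite /wshift /wpow_inf modnDl.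
exists (prefix x k.+1), (prefix (wshift k.+1 x) p).
have h1 : wshift p (wshift k.+1 x) = wshift k.+1 x.
  by rewrite -addn1 -wshiftD (wshiftD p) addnC -wshiftD h.
split=> //; first by case: p p0 {h h1}.
rewrite wcatE -[LHS](wapp_prefix x k.+1); congr wapp.
apply/funext => n; rewrite /wpow_inf size_prefix prefixE nth_mkseq ?ltn_mod//.
rewrite {1}(divn_eq n p); have := congr1 (fun f => f (n %% p)%N) (wshift_mul (n %/ p) h1).
by rewrite {1}/wshift => ->.
Qed.

Lemma size_wpow J m : size (wpow J m) = (m * size J)%N.
Proof. by rewrite /wpow size_flatten /shape map_nseq sumn_nseq mulnC. Qed.

Lemma nth_wpow J m n : (n < m * size J)%N -> nth i0 (wpow J m) n = pw J n.
Proof.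
elim: m n => [|m IH] n //=; rewrite mulSn => h; rewrite /wpow /= nth_cat.
case: ltnP => nJ; first by rewrite /wpow_inf modn_small.
rewrite IH; last by rewrite ltn_subLR.
by rewrite /wpow_inf -{2}(subnKC nJ) modnDl.
Qed.

Lemma wpow_inf_wpow J m : (0 < m)%N -> J <> [::] -> pw (wpow J m) = pw J.
Proof.
move=> m0 J0; apply/funext => n; rewrite {1}/wpow_inf nth_wpow; last first.
  by rewrite size_wpow ltn_mod muln_gt0 m0; case: (J) J0.
by rewrite /wpow_inf size_wpow modn_dvdm// dvdn_mull.
Qed.

Lemma prefix_period y q m : (0 < q)%N -> wshift q y = y -> prefix y (m * q) = wpow (prefix y q) m.
Proof.
move=> q0 h; elim: m => [|m IH] //; rewrite mulSn prefixD h IH.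
by [].
Qed.

(** Primitivity is stated through periods of the infinite power, which is how it
    enters the computation of correlations. *)
Definition primitive J := J <> [::] /\
  forall d, (0 < d)%N -> wshift d (pw J) = pw J -> (size J <= d)%N.

(** The least period of the infinite power divides the length of [J]; if it is
    smaller, [J] is a power of its prefix of that length. *)
Lemma primitiveP J : J <> [::] -> (primitive J <-> ~ periodic_word J).
Proof.
move=> J0; have sJ : (0 < size J)%N by case: (J) J0.
split=> [[_ h] [J1 [m [J10 m2 e]]]|np].
  have s1 : (0 < size J1)%N by case: (J1) J10.
  have := h _ s1; rewrite e wpow_inf_wpow ?wpow_inf_shift//; last exact: ltnW.
  by move=> /(_ erefl); rewrite size_wpow; nia.
split=> // d d0 hd; rewrite leqNgt; apply/negP => dJ; apply: np.
have exq : exists q, (0 < q)%N && `[< wshift q (pw J) = pw J >] by exists d; rewrite d0; exact/asboolP.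
pose q := ex_minn exq; have [/andP[q0 /asboolP hq] qmin] : ((0 < q)%N && `[< wshift q (pw J) = pw J >]) /\
    forall d, (0 < d)%N && `[< wshift d (pw J) = pw J >] -> (q <= d)%N.
  by rewrite /q; case: ex_minnP.
have qJ : (q %| size J)%N.
  rewrite /dvdn; apply/negPn/negP; rewrite -lt0n => r0.
  have : (q <= size J %% q)%N.
    apply: qmin; rewrite r0; apply/asboolP.
    have := wpow_inf_shift J; rewrite {1}(divn_eq (size J) q) -wshiftD wshift_mul//.
  by rewrite leqNgt ltn_mod q0.
have qd : (q <= d)%N by apply: qmin; rewrite d0; exact/asboolP.
exists (prefix (pw J) q), (size J %/ q)%N; split.
- by case: (q) q0.
- by rewrite ltn_divRL// mul1n (leq_ltn_trans qd).
- by rewrite -prefix_period// divnK// prefix_wpow_inf.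
Qed.

(** Otherwise the remainder of [b - a] would be a period shorter than [J]. *)
Lemma primitive_dvd J a b : primitive J -> wshift a (pw J) = wshift b (pw J) ->
  a = b %[mod size J].
Proof.
move=> [J0 h]; have sJ : (0 < size J)%N by case: (J) J0.
wlog ab : a b / (a <= b)%N.
  by move=> W e; case: (leqP a b) => [/W|/ltnW/W]; [exact|move=> H; apply/esym/H].
move=> e; have hd := wshift_sub sJ (wpow_inf_shift J) ab e.
suff : (size J %| b - a)%N by move=> d; apply/esym/eqP; rewrite eqn_mod_dvd.
rewrite /dvdn; apply/negPn/negP; rewrite -lt0n => r0.
suff /(h _ r0) : wshift ((b - a) %% size J) (pw J) = pw J by rewrite leqNgt ltn_mod sJ.
move: hd; rewrite {1}(divn_eq (b - a) (size J)) -wshiftD wshift_mul//; exact: wpow_inf_shift.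
Qed.

Lemma wpow_inf_rot J n : (n <= size J)%N -> pw (rot n J) = wshift n (pw J).
Proof.
case: J => [|j J]; first by rewrite leqn0 => /eqP ->; rewrite wshift0.
set K := j :: J; move=> nK; have sK : (0 < size K)%N by [].
have := wpow_infE sK _ (y := wshift n (pw K)); rewrite wshiftD addnC -wshiftD wpow_inf_shift.
move=> /(_ erefl) <-; congr wpow_inf.
apply: (@eq_from_nth _ i0); rewrite size_rot ?size_prefix// => k kK.
rewrite prefixE nth_mkseq// /wshift /wpow_inf /rot nth_cat size_drop.
case: ltnP => h; first by rewrite nth_drop modn_small//; lia.
rewrite nth_take; last by lia.
congr nth; rewrite (_ : (n + k = k - (size K - n) + size K))%N; last by lia.
by rewrite modnDr modn_small//; lia.
Qed.

Lemma primitive_rot J n : (n <= size J)%N -> primitive J -> primitive (rot n J).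
Proof.
move=> nJ [J0 h]; split; first by move=> /(congr1 size); rewrite size_rot; case: (J) J0.
move=> d d0; rewrite size_rot wpow_inf_rot// wshiftD => e; apply: h => //.
have sJ : (0 < size J)%N by case: (J) J0.
have le : (n <= n + d)%N by rewrite leq_addr.
by have := wshift_sub sJ (wpow_inf_shift J) le (esym e); rewrite addKn.
Qed.

(** The number that the word represents in base [N]; the order on words of equal
    length is the order of these numbers. *)
Fixpoint word_value J : nat := if J is i :: w then (i * N ^ size w + word_value w)%N else 0%N.

Lemma word_value_lt J : (word_value J < N ^ size J)%N.
Proof.
elim: J => //= i w IH; rewrite expnS; apply: (@leq_trans (i * N ^ size w + N ^ size w)%N).
  by rewrite ltn_add2l.
by rewrite -mulSnr leq_mul2r ltn_ord orbT.
Qed.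

Lemma word_value_inj J J' : size J = size J' -> word_value J = word_value J' -> J = J'.
Proof.
elim: J J' => [|i w IH] [|j w'] //= [ss] e.
rewrite -ss in e; have h := word_value_lt w; have := word_value_lt w'; rewrite -ss => h'.
have P : (0 < N ^ size w)%N by rewrite expn_gt0 (leq_ltn_trans _ (ltn_ord i0)).
have ij : (i : nat) = j.
  by have := congr1 (fun n => n %/ (N ^ size w))%N e; rewrite !divnMDl// !divn_small ?addn0.
by rewrite (val_inj ij) (IH w')// ; move: e; rewrite ij => /addnI.
Qed.

Lemma word_valueE J (k := size J) :
  ((word_value J)%:Z = \sum_(l < k) (tnth (in_tuple J) l : nat)%:Z * (N ^ (k - l.+1))%N%:Z)%R.
Proof.
rewrite {}/k; under eq_bigr do rewrite (tnth_nth i0) /=.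
elim: J => [|i w IH] /=; first by rewrite big_ord0.
by rewrite big_ord_recl /= PoszD PoszM IH subSS subn0; congr (_ + _).
Qed.

Lemma wleP k (I J : k.-tuple 'I_N) : wle I J <-> (word_value I <= word_value J)%N.
Proof.
rewrite /wle -lez_nat; under eq_bigr do rewrite mulrBl.
rewrite big_split /= sumrN subr_ge0.
have E (K : k.-tuple 'I_N) : (word_value K)%:Z = \sum_(l < k) (tnth K l : nat)%:Z * (N ^ (k - l.+1))%N%:Z.
  rewrite word_valueE; move: (size_tuple K); rewrite -{2 3 4}[K]/K => e.
  rewrite (reindex (cast_ord (esym e)))/=; last by exists (cast_ord e) => a _; apply: val_inj.
  by apply: eq_bigr => l _; rewrite !(tnth_nth i0) /= e.
by rewrite !E.
Qed.

End Periodicity.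

Section Classification.
Context {N : nat} (i0 : 'I_N) (A : 'M[bool]_N).
Implicit Types (x y z : nat -> 'I_N) (J w : seq 'I_N).

Local Notation pw := (wpow_inf i0).

Lemma cyclic_wordP J : cyclic_word A J <-> J <> [::] /\ infinite_word A (pw J).
Proof.
case: J => [|j J]; first by split=> -[].
set K := j :: J; have sK : (0 < size K)%N by [].
have E : path (fun i k => A i k) j (rcons J j) <-> infinite_word A (pw K).
  split=> [/(pathP i0) h n|h]; last (apply/(pathP i0) => n).
    have := h (n %% size K)%N; rewrite size_rcons ltnS => H.
    have nK : (n %% size K < size K)%N by rewrite ltn_mod.
    have := H; rewrite -[size J]/((size K).-1) -ltnS prednK// => /(_ nK).
    rewrite -rcons_cons -/K nth_rcons nK nth_rcons -[size J]/((size K).-1).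
    rewrite /wpow_inf -(addn1 n) -modnDml.
    case: ltngtP => [lt|gt|eq].
    - rewrite [((_ + 1) %% _)%N]modn_small; last by rewrite addn1 -ltn_predRL.
      by rewrite addn1.
    - by move: gt; rewrite ltnNge -ltnS prednK// nK.
    - have -> : ((n %% size K + 1) %% size K = 0)%N by rewrite eq addn1 prednK// modnn.
      by [].
  rewrite size_rcons ltnS => nJ; have := h n; rewrite /wpow_inf modn_small// -rcons_cons -/K nth_rcons ltnS nJ.
  rewrite nth_rcons; case: ltngtP nJ => // [lt _|-> _]; first by rewrite modn_small.
  by rewrite modnn.
by split=> -[_ /E h]; split.
Qed.

Lemma bracket_primitive J : bracket_finite A J -> primitive i0 J.
Proof. by move=> [[J0 _] _ np]; apply/primitiveP. Qed.

Lemma bracket_size J : bracket_finite A J -> (0 < size J)%N.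
Proof. by move=> [[J0 _] _ _]; case: J J0. Qed.

Lemma bracket_infinite_word J : bracket_finite A J -> infinite_word A (pw J).
Proof. by move=> [/cyclic_wordP[]]. Qed.

Lemma minimal_wordP J : minimal_word J <->
  forall J', rotation_equiv J' J -> (word_value J <= word_value J')%N.
Proof.
split=> [h J' r|h J' /h r]; last by apply/(wleP i0).
have sJ : size J' == size J by case: r => n ->; rewrite size_rot.
exact: (iffLR (wleP i0 (in_tuple J) (Tuple sJ)) (h (Tuple sJ) r)).
Qed.

(** Cut one least period out of the periodic tail and rotate it to the smallest value. *)
Lemma bracket_of_periodic x : infinite_word A x -> eventually_periodic x ->
  exists J, bracket_finite A J /\ tail_eq x (pw J).
Proof.
move=> hx /eventually_periodicP[k [p [p0 hp]]]; set y := wshift k x in hp.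
have exq : exists q, (0 < q)%N && `[< wshift q y = y >] by exists p; rewrite p0; exact/asboolP.
have [q /andP[q0 /asboolP hq] qmin] := ex_minnP exq.
pose J1 := prefix y q; have pJ1 : pw J1 = y by exact: wpow_infE.
have sJ1 : size J1 = q by rewrite size_prefix.
have pr1 : primitive i0 J1.
  split; first by move=> /(congr1 size); rewrite sJ1 => e; move: q0; rewrite e.
  by move=> d d0; rewrite pJ1 => hd; rewrite sJ1; apply: qmin; rewrite d0; exact/asboolP.
(* The bound [q] itself repeats the rotation by 0; it keeps the index type nonempty. *)
pose val (n : 'I_q.+1) := word_value (rot n J1).
pose n := [arg min_(n < ord0 : 'I_q.+1) val n].
have nmin : forall m, (val n <= val m)%N by rewrite /n; case: arg_minnP => // m _ h m'; exact: h.
pose J := rot n J1; have nq : (n <= size J1)%N by rewrite sJ1 -ltnS.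
have pr : primitive i0 J by exact: primitive_rot.
exists J; split; last first.
  rewrite wpow_inf_rot// pJ1; exists (k + n)%N, 0%N; by rewrite wshift0 wshiftD.
split; last by apply/(primitiveP i0) => //; case: pr.
  apply/cyclic_wordP; split; first by case: pr.
  by rewrite wpow_inf_rot// pJ1; do 2!apply: infinite_word_shift.
apply/minimal_wordP => J' [m e].
have [m' m'q ->] : exists2 m', (m' <= q)%N & J' = rot m' J1.
  have -> : J' = rotr m J by rewrite e rotK.
  have qm : (q - m <= size J1)%N by rewrite sJ1 leq_subr.
  rewrite /J /rotr size_rot sJ1 rot_add_mod//; eexists; last by reflexivity.
  by rewrite sJ1 in nq qm *; case: ifP => // _; lia.
by have := nmin (Ordinal (m'q : (m' < q.+1)%N)).
Qed.

(** The lengths divide each other, so the words are rotations of each other, and each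
    has the smallest value. *)
Lemma bracket_unique J J' : bracket_finite A J -> bracket_finite A J' ->
  tail_eq (pw J) (pw J') -> J = J'.
Proof.
move=> bJ bJ'; have pJ := bracket_primitive bJ; have pJ' := bracket_primitive bJ'.
have sJ := bracket_size bJ; have sJ' := bracket_size bJ'.
have half K K' : primitive i0 K -> (0 < size K')%N -> tail_eq (pw K) (pw K') ->
    (size K %| size K')%N.
  move=> pK sK' [k [m e]].
  have : wshift k (pw K) = wshift (k + size K') (pw K).
    by rewrite -wshiftD e wshiftD addnC -wshiftD wpow_inf_shift.
  move=> /(primitive_dvd pK)/eqP; rewrite eq_sym -{2}(addn0 k) eqn_modDl mod0n; exact.
have rotw K k : (0 < size K)%N -> exists2 n, (n <= size K)%N & prefix (wshift k (pw K)) (size K) = rot n K.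
  move=> sK; exists (k %% size K)%N; first by rewrite ltnW// ltn_mod.
  have -> : wshift k (pw K) = pw (rot (k %% size K) K).
    rewrite wpow_inf_rot; last by rewrite ltnW// ltn_mod.
    by rewrite {1}(divn_eq k (size K)) -wshiftD wshift_mul// wpow_inf_shift.
  by have := prefix_wpow_inf i0 (rot (k %% size K) K); rewrite size_rot.
move=> t; have ss : size J = size J'.
  by apply/eqP; rewrite eqn_dvd (half _ _ pJ sJ' t) (half _ _ pJ' sJ (tail_eq_sym t)).
have [k [m e]] := t; have [n nJ en] := rotw J k sJ; have [n' nJ' en'] := rotw J' m sJ'.
have e2 : rot n J = rot n' J' by rewrite -en -en' e ss.
have vle (K K' : seq 'I_N) a a' : minimal_word K -> rot a K = rot a' K' -> (a <= size K)%N -> (a' <= size K')%N ->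
    size K = size K' -> (word_value K <= word_value K')%N.
  move=> /minimal_wordP mK ee ha ha' sz; apply: mK.
  have -> : K = rotr a (rot a' K') by rewrite -ee rotK.
  rewrite /rotation_equiv /rotr size_rot.
  by rewrite rot_add_mod ?leq_subr//; eexists; reflexivity.
have [_ mJ _] := bJ; have [_ mJ' _] := bJ'.
apply: (word_value_inj i0 ss); apply/eqP; rewrite eqn_leq.
by rewrite (vle _ _ _ _ mJ e2)// (vle _ _ _ _ mJ' (esym e2)).
Qed.

Lemma aperiodic_shift x k m : ~ eventually_periodic x -> wshift k x = wshift m x -> k = m.
Proof.
move=> nx; wlog km : k m / (k <= m)%N.
  by move=> W; case: (leqP k m) => [/W|/ltnW/W] // H /esym/H.
move=> e; apply/eqP; rewrite eqn_leq km /= leqNgt; apply/negP => lt; apply: nx.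
apply/eventually_periodicP; exists k, (m - k)%N; split; first by rewrite subn_gt0.
by rewrite wshiftD subnKC.
Qed.

Context (T : set (nat -> 'I_N)).
Hypothesis hT : bracket_infinite A T.

Lemma representative_word K : T K -> infinite_word A K.
Proof. by move=> /(hT.1)[]. Qed.

Lemma representative_aperiodic K : T K -> ~ eventually_periodic K.
Proof. by move=> /(hT.1)[]. Qed.

Lemma representative_unique K K' : T K -> T K' -> tail_eq K K' -> K = K'.
Proof.
move=> tK tK' e; have [y [_ h]] := hT.2 _ (hT.1 _ tK).
rewrite -(h K); last by split=> //; apply/tail_equivP; exact: tail_eq_refl.
by rewrite (h K')//; split=> //; apply/tail_equivP.
Qed.

Lemma representative_not_periodic K J : T K -> (0 < size J)%N -> ~ tail_eq K (pw J).
Proof.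
move=> /representative_aperiodic nK sJ [k [m e]]; apply: nK; apply/eventually_periodicP.
by exists k, (size J); split=> //; rewrite e wshiftD addnC -wshiftD wpow_inf_shift.
Qed.

Lemma word_class x : infinite_word A x ->
  (exists J, bracket_finite A J /\ tail_eq x (pw J)) \/ (exists K, T K /\ tail_eq x K).
Proof.
move=> hx; have [/(bracket_of_periodic hx)|nx] := pselect (eventually_periodic x); first by left.
by right; have [y [[Ty xy] _]] := hT.2 _ (conj hx nx); exists y; split=> //; apply/tail_equivP.
Qed.

End Classification.

(** * Representations generated by a coded vector *)

Section Models.
Context {R : realType} {N : nat} {A : 'M[bool]_N} {O : cstar_algebra R} {s : 'I_N -> O}.
Hypothesis ck : ck_relations A s.
Hypothesis gen : forall S : set O, closed_star_subalgebra S -> (forall i, S (s i)) -> S = setT.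
Implicit Types (pi rho : representation O) (x y : nat -> 'I_N) (J w : seq 'I_N).

Local Notation sa := (sa (s := s)).
Local Notation sb := (sb (s := s)).
Local Notation opA := (opA (s := s)).
Local Notation opB := (opB (s := s)).
Local Notation coded := (coded (s := s)).
Local Notation branch := (branch (s := s)).

Lemma hnorm_sb_le pi i (v : pi) : hnorm (sb i v) <= hnorm v.
Proof.
rewrite -ler_sqr ?nnegrE ?hnorm_ge0// !hnorm_sq -{3}(sum_sa_sb ck v) hdot_suml.
rewrite (bigD1 i)//= ReD sa_dot lerDl; set t := \sum_(_ | _) _.
have t0 : 0 <= t by rewrite sumr_ge0// => k _; rewrite sa_dot hdot_ge0.
by move: t0; rewrite lecE => /andP[].
Qed.

Lemma hnorm_sa_le pi i (v : pi) : hnorm (sa i v) <= hnorm v.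
Proof.
have [->|h0] := eqVneq (hnorm (sa i v)) 0; first exact: hnorm_ge0.
have hp : 0 < hnorm (sa i v) by rewrite lt_neqAle eq_sym h0 hnorm_ge0.
rewrite -(ler_pM2r hp) -expr2 hnorm_sq sa_dot.
apply: (le_trans (ler_norm _)); apply: (le_trans (ler_Re_cabs _)).
by apply: (le_trans (cauchy_schwarz _ _)); rewrite ler_wpM2l ?hnorm_ge0// hnorm_sb_le.
Qed.

Lemma hnorm_opA_le pi w (v : pi) : hnorm (opA w v) <= hnorm v.
Proof. by elim: w => //= i w IH; apply: (le_trans (hnorm_sa_le _ _)). Qed.

Lemma hnorm_opB_le pi w (v : pi) : hnorm (opB w v) <= hnorm v.
Proof. by elim: w v => //= i w IH v; apply: (le_trans (IH _)); exact: hnorm_sb_le. Qed.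

(** A contraction and its adjoint: if [s_w^*] does not shorten [v], then [v]
    lies in the range of [s_w]. *)
Lemma opB_norm_full pi w (v : pi) : hnorm v <= hnorm (opB w v) -> opA w (opB w v) = v.
Proof.
move=> h; apply/eqP; rewrite -subr_eq0; apply/eqP/hnorm_eq0/eqP.
rewrite -sqrf_eq0 eq_le sqr_ge0 andbT hnormB_sq opA_dot -hnorm_sq.
have := hnorm_opA_le w (opB w v); have := hnorm_opB_le w v.
have := hnorm_ge0 v; have := hnorm_ge0 (opB w v); have := hnorm_ge0 (opA w (opB w v)).
move=> a b c d e; have E : hnorm (opB w v) = hnorm v by apply/eqP; rewrite eq_le d h.
have : hnorm (opA w (opB w v)) ^+ 2 <= hnorm v ^+ 2 by rewrite ler_sqr ?nnegrE// -E.
rewrite E; lra.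
Qed.

Definition coding_proj x pi n (v : pi) : pi := opA (prefix x n) (opB (prefix x n) v).

Lemma coding_proj_blin x pi n : blin (@coding_proj x pi n).
Proof. exact: (blin_comp (opB_blin _ _) (opA_blin _ _)). Qed.

Lemma coding_proj_norm x pi n (v : pi) : hnorm (coding_proj x n v) <= hnorm v.
Proof. exact: le_trans (hnorm_opA_le _ _) (hnorm_opB_le _ _). Qed.

Lemma coding_proj_neq x y pi (v : pi) : infinite_word A y -> coded y v -> x <> y ->
  exists M, forall n, (M <= n)%N -> coding_proj x n v = 0.
Proof.
move=> hy hv xy; have [k nxy] : exists n, x n <> y n.
  by apply: contra_notP xy => h; apply/funext => n; apply: contra_notP h => ?; exists n.
exists k.+1 => n kn; rewrite /coding_proj -(subnKC kn) prefixD opB_cat.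
suff -> : opB (prefix x k.+1) v = 0 by rewrite opB0 opA0.
elim: k x y hy v hv nxy {xy kn} => [|k IH] x y hy v hv nxy; first exact: (coded_sb_neq ck hv nxy).
have [e|/eqP ne] := eqVneq (x 0%N) (y 0%N); last first.
  rewrite -[opB _ _]/(opB (prefix (wshift 1 x) k.+1) (sb (x 0%N) v)) (coded_sb_neq ck hv ne).
  exact: opB0.
have := IH (wshift 1 x) (wshift 1 y) (infinite_word_shift _ hy) _ (coded_sb ck hy hv) nxy.
by rewrite -e.
Qed.

(** It suffices to check on a total set that a sequence of contractions moves vectors
    towards [W]. *)
Lemma csub_near (H : hilbert R) (q : nat -> H -> H) (W : set H) :
  (forall n, lin (q n)) -> (forall n v, hnorm (q n v) <= hnorm v) -> csub W ->
  csub [set v | forall e : R, 0 < e -> exists M, forall n, (M <= n)%N ->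
    exists2 y, W y & hnorm (q n v - y) < e].
Proof.
move=> lq nq hW; case: (hW) => W0 Wl Wc; split.
- by move=> e e0; exists 0%N => n _; exists 0 => //; rewrite lin0// subrr hnorm0.
- move=> c v v' hv hv' e e0; have e2 : 0 < e / 2 by rewrite divr_gt0.
  have [d d0 hd] := mulr_smallP e2 (cabs_ge0 c).
  have [M hM] := hv _ d0; have [M' hM'] := hv' _ e2; exists (maxn M M') => n.
  rewrite geq_max => /andP[/hM[y Wy vy] /hM'[y' Wy' vy']].
  exists (c *: y + y'); first exact: Wl.
  rewrite lq opprD addrACA -scalerBr (splitr e); apply: (le_lt_trans (hnormD _ _)).
  by rewrite hnormZ ltrD//; apply: le_lt_trans hd; rewrite ler_wpM2l ?cabs_ge0// ltW.
- move=> v hv e e0; have e2 : 0 < e / 2 by rewrite divr_gt0.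
  have [v' hv' vv'] := hv _ e2; have [M hM] := hv' _ e2; exists M => n /hM[y Wy vy].
  exists y => //; apply: (le_lt_trans (hnormB_trans _ (q n v') _)).
  by rewrite (splitr e) ltrD// -linB//; apply: le_lt_trans (nq _ _) _.
Qed.

(** The projections onto longer and longer prefixes of [x] fix [v] and kill the
    members of [X] with another coding word one after the other. *)
Lemma coded_span x pi (X : set pi) (v : pi) : total_set X ->
  (forall u, X u -> exists2 y, infinite_word A y & coded y u) -> coded x v ->
  in_closed_span [set u | X u /\ coded x u] v.
Proof.
move=> tX hX hv; set Y := [set u | _]; have hY := cspan_csub Y; case: (hY) => Y0 _; apply=> e e0.
have := total_ind tX (csub_near (fun n => (coding_proj_blin x pi n).1) (@coding_proj_norm x pi) hY).
move=> /(_ _ v e e0)[|M /(_ M (leqnn _))[y Yy]]; last by rewrite /coding_proj hv; exists y.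
move=> u Xu d d0; have [z hz cu] := hX _ Xu.
have [xz|xz] := pselect (x = z).
  exists 0%N => n _; exists u; last by rewrite /coding_proj xz cu subrr hnorm0.
  by apply: sub_cspan; split=> //; rewrite xz.
have [M hM] := coding_proj_neq hz cu xz; exists M => n /hM ->; exists 0 => //.
by rewrite subrr hnorm0.
Qed.

Lemma cyclic_total pi (v : pi) : cyclic_vector v ->
  total_set [set u | exists (_ : unit) a, u = act a v].
Proof.
move=> cv u; apply/in_closed_spanE => e /(cv u)[a h]; exists (act a v) => //.
exists 1%N, (fun=> 1), (fun=> act a v); split; last by rewrite big_ord1 scale1r.
by move=> _; exists tt, a.
Qed.

Lemma cyclic_coded_total x pi (v : pi) : infinite_word A x -> coded x v -> cyclic_vector v ->
  total_set [set u | exists w m, u = branch x v w m].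
Proof.
move=> hx hv cv u; apply: (cspan_mono _ (cyclic_total cv u)) => _ [_ [a ->]].
have := @branches_span _ _ _ _ _ ck gen pi unit (fun=> x) (fun=> v) (fun=> hx) (fun=> hv) tt a.
by apply: cspan_mono => _ [_ [w [m ->]]]; apply: sub_cspan; exists w, m.
Qed.

(** It suffices to check strong convergence of contractions on a total set. *)
Lemma csub_hcvg (H : hilbert R) (q : nat -> H -> H) (P : H -> H) :
  (forall n, lin (q n)) -> (forall n v, hnorm (q n v) <= hnorm v) ->
  lin P -> (forall v, hnorm (P v) <= hnorm v) ->
  csub [set v | hcvg (fun n => q n v) (P v)].
Proof.
move=> lq nq lP nP; split.
- by move=> e e0; exists 0%N => n _; rewrite (lin0 (lq n)) (lin0 lP) subrr hnorm0.
- move=> c v w hv hw e e0; have e2 : 0 < e / 2 by rewrite divr_gt0.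
  have [d d0 hd] := mulr_smallP e2 (cabs_ge0 c).
  have [M hM] := hv _ d0; have [M' hM'] := hw _ e2; exists (maxn M M') => n.
  rewrite geq_max => /andP[/hM h1 /hM' h2]; rewrite lq lP opprD addrACA -scalerBr (splitr e).
  apply: (le_lt_trans (hnormD _ _)); rewrite hnormZ ltrD//; apply: le_lt_trans hd.
  by rewrite ler_wpM2l ?cabs_ge0// ltW.
- move=> v hv e e0; have e3 : 0 < e / 3 by rewrite divr_gt0.
  have [w hw vw] := hv _ e3; have [M hM] := hw _ e3; exists M => n /hM h.
  have t1 := hnormB_trans (q n v) (q n w) (P v); have t2 := hnormB_trans (q n w) (P w) (P v).
  rewrite -linB// in t1; have t3 := nq n (v - w).
  have t4 : hnorm (P w - P v) <= hnorm (v - w) by rewrite -linB// (le_trans (nP _))// hnormBC.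
  lra.
Qed.

(** On branches of [v] the operators [s_(x|n) s_(x|n)^*] are eventually constant: zero
    on those with another coding word, the identity on those that return to [x], which
    are multiples of [v]. *)
Lemma coding_proj_line x pi (v : pi) : infinite_word A x -> coded x v -> cyclic_vector v ->
  hnorm v = 1 ->
  (forall k m, wshift k x = wshift m x -> exists c : R[i], branch x v (prefix x k) m = c *: v) ->
  forall u, hcvg (fun n => coding_proj x n u) ('[u, v] *: v).
Proof.
move=> hx hv cv v1 hb u; have vv : '[v, v] = 1 by rewrite hdotxx v1 expr1n.
have lP : lin (fun u : pi => '[u, v] *: v).
  by move=> c a b; rewrite hdotDl hdotZl scalerDl scalerA.
have nP (w : pi) : hnorm ('[w, v] *: v) <= hnorm w.
  by rewrite hnormZ v1 mulr1 (le_trans (cauchy_schwarz _ _))// v1 mulr1.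
have cs := csub_hcvg (fun n => (coding_proj_blin x pi n).1 : lin (coding_proj x n))
  (@coding_proj_norm x pi) lP nP.
apply: (total_ind (cyclic_coded_total hx hv cv) cs) => _ [w [m ->]] /=.
have cst (f : nat -> pi) l M : (forall n, (M <= n)%N -> f n = l) -> hcvg f l.
  by move=> h e e0; exists M => n /h ->; rewrite subrr hnorm0.
case: (branch_coded ck w m hx hv) => [->|[iy cy]].
  rewrite hdot0l scale0r; apply: (cst _ _ 0%N) => n _.
  by rewrite (lin0 (coding_proj_blin x pi n).1).
have [e|ne] := pselect (wapp w (wshift m x) = x).
  (* a branch that returns to [x] is a multiple of [v] *)
  have ew : w = prefix x (size w) by rewrite -[x in prefix x _]e prefix_wapp.
  have es : wshift (size w) x = wshift m x by rewrite -[x in LHS]e wappK.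
  rewrite ew; have [c ->] := hb _ _ es.
  rewrite hdotZl vv mulr1; apply: (cst _ _ 0%N) => n _.
  by rewrite linZ ?hv//; [congr (_ *: _); exact: hv|exact: (coding_proj_blin x pi n).1].
have [M hM] := coding_proj_neq iy cy (fun h => ne (esym h)).
rewrite (coded_orth ck iy hx cy hv ne) scale0r; exact: (cst _ _ M).
Qed.

(** A closed invariant subspace contains, with each of its vectors, the limit of
    the coding projections; so it is either orthogonal to [v] or contains [v]. *)
Lemma coded_irreducible x pi (v : pi) : infinite_word A x -> coded x v -> cyclic_vector v ->
  hnorm v = 1 ->
  (forall k m, wshift k x = wshift m x -> exists c : R[i], branch x v (prefix x k) m = c *: v) ->
  irreducible pi.
Proof.
move=> hx hv cv nv hb; have lim := coding_proj_line hx hv cv nv hb; split.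
  by exists v; apply/eqP => v0; move: nv; rewrite v0 hnorm0 => /eqP; rewrite eq_sym oner_eq0.
move=> W /closed_subspaceP hW Wi; have [Wv|nWv] := pselect (W v).
  right; apply/seteqP; split=> // u _; apply: (total_ind (cyclic_total cv) hW) => _ [_ [a ->]].
  exact: Wi.
left; apply/seteqP; split=> [u Wu|_ ->]; last by case: hW.
have orth (b : pi) : W b -> '[b, v] = 0.
  move=> Wb; apply/eqP/negPn/negP => wv; apply: nWv.
  have -> : v = ('[b, v])^-1 *: ('[b, v] *: v) by rewrite scalerA mulVf// scale1r.
  apply: csubZ => //; apply: (csub_cvg hW _ (lim b)) => n.
  by rewrite /coding_proj opAE opBE; exact: (Wi _ _ (Wi _ _ Wb)).
apply: (orth_total (cyclic_total cv)) => _ [_ [a ->]].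
by rewrite -act_star; apply: orth; apply: Wi.
Qed.

Lemma isometry_unitary rho pi (V : rho -> pi) (X : set pi) : isometry_into V -> intertwiner V ->
  total_set X -> (forall t, X t -> exists u, V u = t) -> unitarily_equivalent rho pi.
Proof. by move=> iV tV tX hX; exists V; split=> //; exact: isometry_surj iV tX hX. Qed.

Lemma correlation_embedding x rho pi (v : rho) (v' : pi) : infinite_word A x ->
  coded x v -> coded x v' -> cyclic_vector v ->
  (forall k m, wshift k x = wshift m x ->
    '[branch x v (prefix x k) m, v] = '[branch x v' (prefix x k) m, v']) ->
  exists V : rho -> pi, [/\ isometry_into V, intertwiner V & V v = v'].
Proof.
move=> hx hv hv' cv h.
have [|V [iV tV Vv]] := @correlation_isometry _ _ _ _ _ ck gen rho pi unit (fun=> x) (fun=> v) (fun=> v')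
  (fun=> hx) (fun=> hv) (fun=> hv') (fun _ _ => h); first exact: cyclic_total.
by exists V; split=> //; exact: (Vv tt).
Qed.

Lemma correlation_unitary x rho pi (v : rho) (v' : pi) : infinite_word A x ->
  coded x v -> coded x v' -> cyclic_vector v -> cyclic_vector v' ->
  (forall k m, wshift k x = wshift m x ->
    '[branch x v (prefix x k) m, v] = '[branch x v' (prefix x k) m, v']) ->
  unitarily_equivalent rho pi.
Proof.
move=> hx hv hv' cv cv' h; have [V [iV tV Vv]] := correlation_embedding hx hv hv' cv h.
apply: (isometry_unitary iV tV (cyclic_total cv')) => _ [_ [a ->]].
by exists (act a v); rewrite tV Vv.
Qed.

Lemma coded_isometry x rho pi (V : rho -> pi) (v : rho) : isometry_into V -> intertwiner V ->
  coded x v <-> coded x (V v).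
Proof.
move=> iV tV; split=> h n.
  by rewrite opAE opBE -!tV -opBE -opAE h.
by apply: (isometry_inj iV); rewrite opAE opBE !tV -opBE -opAE h.
Qed.

Lemma opA_intertwiner rho pi (V : rho -> pi) w (v : rho) : intertwiner V ->
  V (opA w v) = opA w (V v).
Proof. by move=> tV; rewrite !opAE tV. Qed.

Lemma opA_prefix_isometric x pi n (v u : pi) : infinite_word A x -> coded (wshift n x) v ->
  '[opA (prefix x n) v, opA (prefix x n) u] = '[v, u].
Proof.
move=> hx; elim: n x hx => [//|n IH] x hx cv /=.
have cv' : coded (wshift n (wshift 1 x)) v by rewrite wshiftD.
have hx1 := infinite_word_shift 1 hx; rewrite -(IH _ hx1 cv').
have [->|[_]] := coded_opA ck (prefix (wshift 1 x) n) (infinite_word_shift n hx1) cv'.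
  by rewrite sa0 !hdot0l.
by rewrite wapp_prefix => ca; apply: (coded_dot_sa ck _ ca); exact: hx.
Qed.

Section PeriodicWord.
Context (i0 : 'I_N) (J : seq 'I_N).
Hypothesis pJ : primitive i0 J.
Hypothesis hJ : infinite_word A (wpow_inf i0 J).
Local Notation x := (wpow_inf i0 J).

Let sJ : (0 < size J)%N.
Proof. by case: pJ; case: (J). Qed.

Lemma opA_iter pi n (v : pi) : opA (prefix x (n * size J)) v = iter n (opA J) v.
Proof.
elim: n => // n IH; rewrite mulSn prefixD prefix_wpow_inf opA_cat wpow_inf_shift IH //.
Qed.

Lemma opB_iter pi n (v : pi) : opB (prefix x (n * size J)) v = iter n (opB J) v.
Proof.
elim: n v => // n IH v; rewrite mulSn prefixD prefix_wpow_inf opB_cat wpow_inf_shift IH.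
by rewrite -iterSr.
Qed.

Lemma coded_opAJ pi (v : pi) : coded x v -> coded x (opA J v).
Proof.
move=> hv; have [->|[_]] := coded_opA ck J hJ hv; first exact: coded0.
by have := wapp_prefix x (size J); rewrite prefix_wpow_inf wpow_inf_shift => ->.
Qed.

Lemma coded_opBJ pi (v : pi) : coded x v -> coded x (opB J v).
Proof.
move=> hv; have := coded_opB ck (size J) hJ hv.
by rewrite prefix_wpow_inf wpow_inf_shift.
Qed.

Lemma opAK pi (v : pi) : coded x v -> opA J (opB J v) = v.
Proof. by move=> /(_ (size J)); rewrite prefix_wpow_inf. Qed.

Lemma opA_isometric pi (v u : pi) : coded x v -> '[opA J v, opA J u] = '[v, u].
Proof.
move=> hv; have := @opA_prefix_isometric x pi (size J) v u hJ.
by rewrite prefix_wpow_inf wpow_inf_shift; apply.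
Qed.

Lemma opBK pi (v : pi) : coded x v -> opB J (opA J v) = v.
Proof.
by move=> hv; apply: hdot_ext => u; rewrite opB_dot opA_isometric.
Qed.

Lemma coded_iterB pi n (v : pi) : coded x v -> coded x (iter n (opB J) v).
Proof. by move=> hv; elim: n => //= n; exact: coded_opBJ. Qed.

Lemma coded_iterA pi n (v : pi) : coded x v -> coded x (iter n (opA J) v).
Proof. by move=> hv; elim: n => //= n; exact: coded_opAJ. Qed.

(** As [J] is primitive, the branches that return to [x] are given by whole periods. *)
Lemma periodic_branch k m : wshift k x = wshift m x ->
  exists n, (forall pi (v : pi), coded x v -> branch x v (prefix x k) m = iter n (opA J) v) \/
            (forall pi (v : pi), coded x v -> branch x v (prefix x k) m = iter n (opB J) v).
Proof.
move=> e; have := primitive_dvd pJ e.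
have shx n : wshift (n * size J) x = x by exact: wshift_mul (wpow_inf_shift i0 J).
case: (leqP m k) => mk /eqP.
  rewrite eqn_mod_dvd// => /dvdnP[n hn]; exists n; left => pi v hv.
  by rewrite -(subnK mk) hn /branch prefixD opA_cat shx hv opA_iter.
rewrite eq_sym eqn_mod_dvd ?(ltnW mk)// => /dvdnP[n hn]; exists n; right => pi v hv.
rewrite -(subnK (ltnW mk)) hn /branch prefixD opB_cat shx opB_iter.
exact: coded_iterB.
Qed.

Lemma periodic_correlation rho pi (v u : rho) (v' u' : pi) :
  coded x v -> coded x u -> coded x v' -> coded x u' ->
  (forall n, '[iter n (opA J) v, u] = '[iter n (opA J) v', u']) ->
  (forall n, '[v, iter n (opA J) u] = '[v', iter n (opA J) u']) ->
  forall k m, wshift k x = wshift m x ->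
    '[branch x v (prefix x k) m, u] = '[branch x v' (prefix x k) m, u'].
Proof.
move=> hv hu hv' hu' h1 h2 k m /periodic_branch[n [E|E]]; rewrite !E//.
by rewrite -!opB_iter !opB_dot !opA_iter.
Qed.

(** Since [s_J^*] is a contraction, [s_J v = z v] forces [s_J^* v = conj(z) v]; hence
    no [s_w^*] with [w] a prefix of [x] shortens [v]. *)
Lemma coded_eigenvector pi (z : R[i]) (v : pi) : cabs z = 1 -> opA J v = z *: v -> coded x v.
Proof.
move=> nz ev; have zz : z * Num.conj z = 1 by rewrite mul_conj nz expr1n.
have eb : opB J v = Num.conj z *: v.
  apply/eqP; rewrite -subr_eq0; apply/eqP/hnorm_eq0/eqP.
  rewrite -sqrf_eq0 eq_le sqr_ge0 andbT hnormB_sq hdotZr conjCK opB_dot ev hdotZr mulrA zz mul1r.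
  rewrite hnormZ cabs_conj nz mul1r -hnorm_sq.
  have : hnorm (opB J v) ^+ 2 <= hnorm v ^+ 2 by rewrite ler_sqr ?nnegrE ?hnorm_ge0// hnorm_opB_le.
  lra.
move=> n; apply: opB_norm_full.
have -> : hnorm v = hnorm (opB (prefix x (n * size J)) v).
  rewrite opB_iter; elim: (n) => //= m ->.
  have -> : iter m (opB J) v = Num.conj z ^+ m *: v.
    elim: m => [|m IH]; first by rewrite expr0 scale1r.
    by rewrite /= IH linZ ?eb ?scalerA -?exprSr//; exact: (opB_blin _ _).1.
  rewrite [opB J _]linZ ?eb; last exact: (opB_blin _ _).1.
  by rewrite hnormZ [in RHS]hnormZ hnormZ cabs_conj nz mul1r.
rewrite -(@subnKC n (n * size J)) ?leq_pmulr// prefixD opB_cat.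
exact: hnorm_opB_le.
Qed.

Lemma iter_opA_eigen pi (z : R[i]) (v : pi) n : opA J v = z *: v ->
  iter n (opA J) v = z ^+ n *: v.
Proof.
move=> ev; elim: n => [|n IH]; first by rewrite expr0 scale1r.
by rewrite /= IH linZ ?ev ?scalerA -?exprSr//; exact: (opA_blin _ _).1.
Qed.

End PeriodicWord.
End Models.

(** * Multiplicity of wandering vectors *)

Section Cardinals.

Lemma bijective_of_injections (I J : Type) (f : I -> J) (g : J -> I) :
  injective f -> injective g -> equipotent I J.
Proof.
have le (X Y : Type) (h : X -> Y) : injective h -> ([set: X] #<= [set: Y])%card.
  move=> hi; apply: (@card_le_trans _ _ _ (range h)); last exact: subset_card_le.
  have : (range h #= [set: X])%card by apply: inj_card_eq => a b _ _; exact: hi.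
  by rewrite card_eq_le => /andP[].
move=> /le lf /le lg; have /card_bijP[h [k hk kh]] := Cantor_Bernstein lf lg.
exists (fun i => set_val (h (SigSub (in_setT i)))).
exists (fun j => set_val (k (SigSub (in_setT j)))) => i.
  rewrite (_ : SigSub _ = h (SigSub (in_setT i))); first by rewrite hk.
  exact: val_inj.
rewrite (_ : SigSub _ = k (SigSub (in_setT i))); first by rewrite kh.
exact: val_inj.
Qed.

(** A maximal family of disjoint injective sequences covers all of [I] but a
    finite set, and each sequence has room for countably many copies of itself. *)
Lemma infinite_mul_nat (I : Type) : infinite_set [set: I] ->
  exists f : I * nat -> I, injective f.
Proof.
move=> inf; pose P := [set F : set (nat -> I) | (forall p, F p -> injective p) /\
  (forall p q a b, F p -> F q -> p a = q b -> p = q)].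
have [|F [[F1 F2] Fmax]] := @Zorn_bigcup (nat -> I) P.
  move=> C CP Ct; split=> [p [X CX Xp]|p q a b [X CX Xp] [Y CY Yq]].
    by have [h _] := CP _ CX; exact: h.
  have [XY|YX] := Ct _ _ CX CY.
    by have [_ h] := CP _ CY; apply: h => //; exact: XY.
  by have [_ h] := CP _ CX; apply: h => //; exact: YX.
pose C := [set i : I | forall p k, F p -> p k <> i].
have Cfin : finite_set C.
  apply: contrapT => /infiniteP Cinf.
  have [q [qC qi]] : exists q : nat -> I, (forall k, C (q k)) /\ injective q.
    have /card_leP[h] := Cinf.
    exists (fun k => set_val (h (SigSub (in_setT k)))); split=> [k|k l]; first exact: set_valP.
    have hinj : {in setT &, injective h} by exact: inj.
    by move=> /val_inj/hinj => /(_ (in_setT _) (in_setT _))/(congr1 set_val).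
  have := Fmax (F `|` [set q]); apply.
    split; first by left.
    move=> /(_ q (or_intror erefl)) Fq; exact: (qC 0%N q 0%N Fq).
  split=> [p [/F1//|->//]|p p' a b [Fp|->] [Fp'|->]] //; first exact: F2.
    by move=> e; case: (qC b p a Fp).
  by move=> /esym e; case: (qC a p' b Fp').
have [p0 Fp0] : exists p, F p.
  apply: contrapT => nF; apply: inf; apply: sub_finite_set Cfin => i _ p k Fp.
  by case: nF; exists p.
have /countable_injP[c ci] := finite_set_countable Cfin.
have hp : forall i, exists pk : (nat -> I) * nat, ~ C i -> F pk.1 /\ pk.1 pk.2 = i.
  move=> i; have [Ci|/existsNP[p /existsNP[k /not_implyP[Fp /contrapT e]]]] := pselect (C i).
    by exists (p0, 0%N).
  by exists (p, k).
have [d hd] := choice hp.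
exists (fun u => if pselect (C u.1) then p0 (pickle (c u.1, u.2)).*2.+1
                 else (d u.1).1 (pickle ((d u.1).2, u.2)).*2) => -[i n] [j m] /=.
have dbl a b : a.*2.+1 <> b.*2 by move=> /(congr1 odd); rewrite /= !odd_double.
case: pselect => Ci; case: pselect => Cj.
- move=> /(F1 _ Fp0)[/double_inj/(pcan_inj pickleK)[e ->]].
  by rewrite (ci i j) ?inE.
- have [Fj _] := hd j Cj => e; have E := F2 _ _ _ _ Fp0 Fj e.
  by move: e; rewrite -E => /(F1 _ Fp0)/dbl.
- have [Fi _] := hd i Ci => e; have E := F2 _ _ _ _ Fi Fp0 e.
  by move: e; rewrite E => /(F1 _ Fp0)/esym/dbl.
- have [Fi ei] := hd i Ci; have [Fj ej] := hd j Cj => e; have E := F2 _ _ _ _ Fi Fj e.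
  move: e; rewrite -E => /(F1 _ Fi)/double_inj/(pcan_inj pickleK)[e ->].
  by rewrite -ei -ej E e.
Qed.

End Cardinals.

Section Dimension.
Context {R : realType} {H : hilbert R} {G : zmodType}.

(** By Bessel, only finitely many coefficients exceed a given bound. *)
Lemma orthonormal_countable (K : Type) (f : K -> H) (v : H) : orthonormal_family f ->
  countable [set k | '[v, f k] != 0].
Proof.
move=> of_; pose S n := [set k : {classic K} | n.+1%:R^-1 < cabs '[v, f k] ^+ 2].
have -> : [set k | '[v, f k] != 0] = \bigcup_(n in setT) S n.
  apply/seteqP; split=> k /=.
    move=> /eqP vk; have e0 : 0 < cabs '[v, f k] ^+ 2.
      rewrite exprn_gt0// lt_neqAle cabs_ge0 andbT eq_sym; apply/eqP => /cabs_eq0; exact: vk.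
    by have [M /(_ M (leqnn _)) hM] := inv_small e0; exists M.
  by move=> [n _ h]; apply/eqP => e; move: h; rewrite /S /= e cabs0 expr0n ltNge invr_ge0 ler0n.
apply: bigcup_countable => // n _; apply: finite_set_countable; apply: contrapT => inf.
have [M hM] : exists M : nat, hnorm v ^+ 2 * n.+1%:R < M%:R.
  by exists (Num.bound (hnorm v ^+ 2 * n.+1%:R)); rewrite archi_boundP// mulr_ge0// sqr_ge0.
have [B BS MB] := @infinite_set_fset {classic K} (S n) M inf.
have := @bessel R H {classic K} f of_ _ v (finmap.fset_uniq B); apply/negP; rewrite -ltNge.
apply: (@lt_le_trans _ _ (\sum_(i <- finmap.enum_fset B) n.+1%:R^-1)).
  rewrite big_const_seq count_predT iter_addr_0 -[_ *+ size _]mulr_natl ltr_pdivlMr//.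
  by apply: (lt_le_trans hM); rewrite ler_nat.
rewrite big_seq [leRHS]big_seq; apply: ler_sum => i iB.
by apply: ltW; exact: (BS i iB).
Qed.

Section Half.
Context {I J : Type} (e : I * G -> H) (f : J * G -> H).
Hypotheses (oe : orthonormal_family e) (of_ : orthonormal_family f).
Hypothesis inv : forall i j g h, '[f (j, g), e (i, h)] = '[f (j, g - h), e (i, 0)].
Hypothesis span : forall j, in_closed_span (range e) (f (j, 0)).

(** Each [f (j, 0)] has a nonzero coefficient along a translate of some [e (i, 0)],
    and each [e (i, 0)] meets only countably many of the [f (j, g)]; an infinite [I]
    absorbs the factor [nat]. *)
Lemma wandering_injection_infinite : infinite_set [set: I] -> exists h : J -> I, injective h.
Proof.
move=> /infinite_mul_nat[p pinj].
have C i := orthonormal_countable (e (i, 0)) of_.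
have /choice[c hc] : forall i, exists c : J * G -> nat,
    {in [set k | '[e (i, 0), f k] != 0] &, injective c}.
  by move=> i; have /countable_injP := C i.
have /choice[q hq] : forall j, exists ig : I * G, '[e (ig.1, 0), f (j, ig.2)] != 0.
  move=> j; apply: contrapT => /forallNP h.
  have : '[f (j, 0), f (j, 0)] = 0.
    apply: (cspan_min (csub_orth [set f (j, 0)]) _ (span j)) => // _ [[i g] _ <-] _ ->.
    have /negP/negPn/eqP := h (i, - g).
    by move=> /= e0; rewrite hdotC inv sub0r hdotC e0 !conjC0.
  by rewrite of_.1 => /eqP; rewrite oner_eq0.
exists (fun j => p ((q j).1, c (q j).1 (j, (q j).2))) => j j' /pinj[E].
rewrite -E => e2.
suff : (j, (q j).2) = (j', (q j').2) by case.
by apply: (hc (q j).1) e2; rewrite inE /=; [exact: hq|rewrite E; exact: hq].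
Qed.

(** Summing the squared matrix entries over one translation orbit of each
    [f (j, 0)] gives 1 by Parseval; exchanging the sums and translating, Bessel
    bounds the contribution of each [e (i, 0)] by 1. *)
Lemma wandering_size_le (s : seq {classic I}) (t : seq {classic J}) :
  (forall i : {classic I}, i \in s) -> uniq t -> (size t <= size s)%N.
Proof.
move=> sall ut.
(* With this precision the loss in the lower bound is less than 1, so that the integer
   inequality is exact. *)
pose eps : R := (size t).+1%:R^-1; have eps0 : 0 < eps by rewrite invr_gt0.
have /choice[u hu] : forall j : {classic J}, exists u : seq ({classic I} * G), uniq u /\
    forall u', uniq u' -> {subset u <= u'} -> 1 - eps < \sum_(k <- u') cabs '[f (j, 0), e k] ^+ 2.
  move=> j; have [u uu hu] := @parseval_approx R H ({classic I} * G)%type e oe _ _ (span j) eps0.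
  exists u; split=> // u' uu' su; have := hu _ uu' su.
  by rewrite hnorm_sq of_.1.
pose Gs := undup (flatten [seq map snd (u j) | j <- t]).
pose S := undup s; have uS : uniq S by exact: undup_uniq.
pose L := [seq (i, g) | i <- S, g <- Gs].
have uL : uniq L by apply: allpairs_uniq => //; [exact: undup_uniq|move=> [? ?] [? ?]].
have sub j : j \in t -> {subset u j <= L}.
  move=> jt [i g] ig; apply/allpairsP; exists (i, g); split=> //; first by rewrite mem_undup.
  rewrite mem_undup; apply/flatten_mapP; exists j => //.
  exact: (map_f snd ig).
have up : \sum_(j <- t) \sum_(k <- L) cabs '[f (j, 0), e k] ^+ 2 <= (size S)%:R.
  under eq_bigr do rewrite big_allpairs.
  rewrite exchange_big /=; apply: (@le_trans _ _ (\sum_(i <- S) 1)); last first.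
    by rewrite big_const_seq count_predT iter_addr_0.
  apply: ler_sum => i _.
  pose L' := [seq (j, - g) | j <- t, g <- Gs].
  have uL' : uniq L'.
    apply: allpairs_uniq => //; first exact: undup_uniq.
    by move=> [? ?] [? ?] _ _ /= [-> /oppr_inj ->].
  have := @bessel R H ({classic J} * G)%type f of_ _ (e (i, 0)) uL'.
  rewrite hnorm_sq oe.1 big_allpairs_dep; apply: le_trans; apply: ler_sum => j _; apply: ler_sum => g _.
  by rewrite inv sub0r hdotC cabs_conj.
have lo : (size t)%:R * (1 - eps) <= \sum_(j <- t) \sum_(k <- L) cabs '[f (j, 0), e k] ^+ 2.
  rewrite mulr_natl -[X in X <= _]iter_addr_0 -[size t](count_predT) -big_const_seq.
  rewrite big_seq [leRHS]big_seq; apply: ler_sum => j jt; apply/ltW.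
  by apply: (hu j).2 => //; exact: sub.
have : (size t)%:R - 1 < (size s)%:R :> R.
  apply: (@lt_le_trans _ _ (size S)%:R); last by rewrite ler_nat size_undup.
  apply: (lt_le_trans _ (le_trans lo up)).
  rewrite mulrBr mulr1 ltrD2l ltrN2 /eps ltr_pdivrMr// mul1r ltr_nat ltnSn //.
by rewrite ltrBlDr natr1 ltr_nat ltnS.
Qed.

End Half.

(** For the trivial group this is the invariance of the Hilbert dimension, for the
    integers that of the multiplicity of a bilateral shift. Infinite multiplicities are
    compared through injections, finite ones through [wandering_size_le]. *)
Theorem wandering_equipotent (I J : Type) (e : I * G -> H) (f : J * G -> H) :
  orthonormal_family e -> orthonormal_family f ->
  (forall i j g h, '[f (j, g), e (i, h)] = '[f (j, g - h), e (i, 0)]) ->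
  (forall j, in_closed_span (range e) (f (j, 0))) ->
  (forall i, in_closed_span (range f) (e (i, 0))) -> equipotent I J.
Proof.
move=> oe of_ inv spf spe.
have inv' j i g h : '[e (i, g), f (j, h)] = '[e (i, g - h), f (j, 0)].
  by rewrite hdotC inv [RHS]hdotC [in RHS]inv sub0r opprB.
have enum_fin (X : Type) : finite_set [set: X] -> exists2 s : seq {classic X}, uniq s & forall i, i \in s.
  move=> fX; have /finite_fsetP[B hB] : @finite_set {classic X} setT := fX.
  exists (finmap.enum_fset B); first exact: finmap.fset_uniq.
  by move=> i; have : [set: {classic X}] i by []; rewrite hB.
have inf_le (X Y : Type) (ee : X * G -> H) (ff : Y * G -> H) : orthonormal_family ee ->
    orthonormal_family ff ->
    (forall i j g h, '[ff (j, g), ee (i, h)] = '[ff (j, g - h), ee (i, 0)]) ->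
    (forall j, in_closed_span (range ee) (ff (j, 0))) ->
    finite_set [set: X] -> finite_set [set: Y].
  move=> o1 o2 iv sp fX; apply: contrapT => iY; have [s _ hs] := enum_fin _ fX.
  have [B _ hB] := @infinite_set_fset {classic Y} _ (size s).+1 iY.
  have := wandering_size_le o1 o2 iv sp hs (finmap.fset_uniq B).
  by rewrite leqNgt hB.
have [fI|iI] := pselect (finite_set [set: I]).
  have fJ := inf_le _ _ _ _ oe of_ inv spf fI.
  have [s us hs] := enum_fin _ fI; have [t ut ht] := enum_fin _ fJ.
  have E : size s = size t.
    apply/eqP; rewrite eqn_leq (wandering_size_le oe of_ inv spf hs ut).
    by rewrite (wandering_size_le of_ oe inv' spe ht us).
  case: s us hs E => [|i0 s] us hs E.
    case: t ht E {ut} => // ht _.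
    exists (fun i => match notF (hs i) with end).
    by exists (fun j => match notF (ht j) with end) => [i|j]; [have := hs i|have := ht j].
  case: t ut ht E => // j0 t ut ht E.
  exists (fun i => nth (j0 : {classic J}) (j0 :: t) (index (i : {classic I}) (i0 :: s))).
  exists (fun j => nth (i0 : {classic I}) (i0 :: s) (index (j : {classic J}) (j0 :: t))) => i.
    by rewrite index_uniq// -?E ?index_mem// nth_index.
  by rewrite index_uniq// ?E ?index_mem// nth_index.
have iJ : infinite_set [set: J] by move=> /(inf_le _ _ _ _ of_ oe inv' spe).
have [h hi] := wandering_injection_infinite of_ inv spf iI.
have [h' hi'] := wandering_injection_infinite oe inv' spe iJ.
exact: (bijective_of_injections hi' hi).
Qed.

End Dimension.

(** * The algebra of bounded operators *)

Lemma hcvg_dist_le {R : realType} {H : hilbert R} (u : nat -> H) (l y : H) (C : R) M :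
  hcvg u l -> (forall n, (M <= n)%N -> hnorm (y - u n) <= C) -> hnorm (y - l) <= C.
Proof.
move=> ul h; apply/ler_addgt0Pr => e /ul[M' hM'].
apply: (le_trans (hnormB_trans y (u (maxn M M')) l)); apply: lerD.
  by apply: h; rewrite leq_maxl.
by apply/ltW/hM'; rewrite leq_maxr.
Qed.

Section BoundedOperators.
Context {R : realType} {H : hilbert R}.
Implicit Types f g : H -> H.

Definition adjoint_pair f g := forall x y, '[f x, y] = '[x, g y].
Definition adjointable f := blin f /\ exists g, adjoint_pair f g.

Lemma adjoint_sym f g : adjoint_pair f g -> adjoint_pair g f.
Proof. by move=> h x y; rewrite hdotC -h -hdotC. Qed.

(** From [|g y|^2 = <f (g y), y> <= M |g y| |y|]. *)
Lemma adjoint_bound f g (M : R) : adjoint_pair f g -> 0 <= M ->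
  (forall x, hnorm (f x) <= M * hnorm x) -> forall y, hnorm (g y) <= M * hnorm y.
Proof.
move=> fg M0 hM y; have [->|g0] := eqVneq (hnorm (g y)) 0; first by rewrite mulr_ge0 ?hnorm_ge0.
have gp : 0 < hnorm (g y) by rewrite lt_neqAle eq_sym g0 hnorm_ge0.
rewrite -(ler_pM2r gp) -expr2 hnorm_sq -fg; apply: (le_trans (ler_norm _)).
apply: (le_trans (ler_Re_cabs _)); apply: (le_trans (cauchy_schwarz _ _)).
by rewrite -mulrA mulrCA mulrC ler_wpM2l ?hnorm_ge0// mulrC //; exact: hM.
Qed.

Lemma adjoint_blin f g : blin f -> adjoint_pair f g -> blin g.
Proof.
move=> bf fg; split.
  move=> c x y; apply: hdot_ext => v.
  by rewrite hdotDl hdotZl !(adjoint_sym fg) hdotDl hdotZl.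
by have [M M0 hM] := blin_pos bf; exists M; exact: adjoint_bound hM.
Qed.

Lemma adjoint_unique f g g' : adjoint_pair f g -> adjoint_pair f g' -> g = g'.
Proof.
move=> h h'; apply/funext => y; apply: hdot_ext => x.
by rewrite !(adjoint_sym h, adjoint_sym h').
Qed.

(** Operators with an adjoint. The nonzero vector is part of the type because a ring
    needs [1 != 0]. *)
Record bop (nz : exists x : H, x != 0) := Bop { bfun :> H -> H; bopP : `[< adjointable bfun >] }.

End BoundedOperators.

Section OperatorAlgebra.
Context {R : realType} {H : hilbert R} (nz : exists x : H, x != 0).
Local Notation B := (bop nz).
Implicit Types (f g h : B).

HB.instance Definition _ := [isSub for @bfun R H nz].
HB.instance Definition _ := [Choice of B by <:].

Lemma bop_ext f g : (forall x, f x = g x) -> f = g.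
Proof. by move=> h; apply: val_inj; apply/funext. Qed.
Lemma bop_adjointable f : adjointable f.
Proof. by have /asboolP := bopP f. Qed.
Lemma bop_blin f : blin f.
Proof. by have [] := bop_adjointable f. Qed.

Definition mkbop (f : H -> H) (hf : adjointable f) : B := Bop nz (introT (asboolP _) hf).

Lemma adjointable0 : adjointable (fun _ : H => 0).
Proof.
split; last by exists (fun=> 0) => x y; rewrite hdot0l hdot0r.
by split=> [c x y|]; [rewrite scaler0 addr0|exists 0 => x; rewrite hnorm0 mul0r].
Qed.
Lemma adjointable1 : adjointable (@id H).
Proof. by split; [split=> //; exists 1 => x; rewrite mul1r|exists id]. Qed.
Lemma adjointableP (c : R[i]) f g : adjointable (fun x => c *: f x + g x).
Proof.
have [[lf [M hM]] [f' hf]] := bop_adjointable f; have [[lg [M' hM']] [g' hg]] := bop_adjointable g.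
split; first split.
- move=> d x y; rewrite lf lg !scalerDr !scalerA (mulrC c) -!addrA; congr (_ + _).
  by rewrite addrCA.
- exists (cabs c * M + M') => x; apply: (le_trans (hnormD _ _)); rewrite hnormZ mulrDl lerD//.
  by rewrite -mulrA ler_wpM2l ?cabs_ge0.
exists (fun y => Num.conj c *: f' y + g' y) => x y.
by rewrite hdotDl hdotZl hdotDr hdotZr conjCK hf hg.
Qed.
Lemma adjointableM f g : adjointable (f \o g).
Proof.
have [bf [f' hf]] := bop_adjointable f; have [bg [g' hg]] := bop_adjointable g.
by split; [exact: blin_comp|exists (g' \o f') => x y /=; rewrite hf hg].
Qed.

Definition bop0 : B := mkbop adjointable0.
Definition bop1 : B := mkbop adjointable1.
Definition bopL c f g : B := mkbop (adjointableP c f g).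
Definition bopM f g : B := mkbop (adjointableM f g).
Definition bopD f g : B := bopL 1 f g.
Definition bopN f : B := bopL (-1) f bop0.
Definition bopZ c f : B := bopL c f bop0.

Let bDE f g x : bopD f g x = f x + g x. Proof. by rewrite /= scale1r. Qed.
Let bNE f x : bopN f x = - f x. Proof. by rewrite /= addr0 scaleN1r. Qed.
Let bZE c f x : bopZ c f x = c *: f x. Proof. by rewrite /= addr0. Qed.

Fact bopDA : associative bopD.
Proof. by move=> f g h; apply: bop_ext => x; rewrite !bDE addrA. Qed.
Fact bopDC : commutative bopD.
Proof. by move=> f g; apply: bop_ext => x; rewrite !bDE addrC. Qed.
Fact bop0D : left_id bop0 bopD.
Proof. by move=> f; apply: bop_ext => x; rewrite !bDE add0r. Qed.
Fact bopND : left_inverse bop0 bopN bopD.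
Proof. by move=> f; apply: bop_ext => x; rewrite !bDE bNE addNr. Qed.
HB.instance Definition _ := GRing.isZmodule.Build B bopDA bopDC bop0D bopND.

Fact bopMA : associative bopM.
Proof. by move=> f g h; apply: bop_ext. Qed.
Fact bop1M : left_id bop1 bopM.
Proof. by move=> f; apply: bop_ext. Qed.
Fact bopM1 : right_id bop1 bopM.
Proof. by move=> f; apply: bop_ext. Qed.
Fact bopMDl : left_distributive bopM bopD.
Proof. by move=> f g h; apply: bop_ext => x; rewrite bDE /= scale1r. Qed.
Fact bopMDr : right_distributive bopM bopD.
Proof. by move=> f g h; apply: bop_ext => x; rewrite bDE /= scale1r linD//; exact: (bop_blin f).1. Qed.
Fact bop1_neq0 : bop1 != 0 :> B.
Proof.
by case: nz => x x0; apply/eqP => /(congr1 (fun f : B => f x)) /= e; rewrite e eqxx in x0.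
Qed.
HB.instance Definition _ := GRing.Zmodule_isNzRing.Build B bopMA bop1M bopM1 bopMDl bopMDr bop1_neq0.

Fact bopZA c d f : bopZ c (bopZ d f) = bopZ (c * d) f.
Proof. by apply: bop_ext => x; rewrite !bZE scalerA. Qed.
Fact bop1Z : left_id 1 bopZ.
Proof. by move=> f; apply: bop_ext => x; rewrite bZE scale1r. Qed.
Fact bopZDr : right_distributive bopZ +%R.
Proof. by move=> c f g; apply: bop_ext => x; rewrite bZE !bDE !bZE scalerDr. Qed.
Fact bopZDl f : {morph bopZ^~ f : c d / c + d}.
Proof. by move=> c d; apply: bop_ext => x; rewrite bDE !bZE scalerDl. Qed.
HB.instance Definition _ := GRing.Zmodule_isLmodule.Build R[i] B bopZA bop1Z bopZDr bopZDl.
Fact bopZAl c f g : c *: (f * g) = (c *: f) * g.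
Proof. by apply: bop_ext => x; rewrite bZE /= addr0. Qed.
HB.instance Definition _ := GRing.Lmodule_isLalgebra.Build R[i] B bopZAl.
Fact bopZAr c f g : c *: (f * g) = f * (c *: g).
Proof. by apply: bop_ext => x; rewrite bZE /= addr0 linZ//; exact: (bop_blin f).1. Qed.
HB.instance Definition _ := GRing.Lalgebra_isAlgebra.Build R[i] B bopZAr.

Lemma bopDE f g x : (f + g) x = f x + g x. Proof. exact: bDE. Qed.
Lemma bopBE f g x : (f - g) x = f x - g x. Proof. by rewrite bopDE; congr (_ + _); exact: bNE. Qed.
Lemma bopZE c f x : (c *: f) x = c *: f x. Proof. exact: bZE. Qed.
Lemma bopME f g x : (f * g) x = f (g x). Proof. by []. Qed.
Lemma bop_sumE (I : Type) (r : seq I) (F : I -> B) x : (\sum_(i <- r) F i) x = \sum_(i <- r) F i x.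
Proof. by elim/big_rec2: _ => [|i y z _ <-] //; rewrite bopDE. Qed.

Definition bop_adj f : H -> H := projT1 (cid (bop_adjointable f).2).
Lemma bop_adj_pair f : adjoint_pair f (bop_adj f).
Proof. exact: projT2 (cid (bop_adjointable f).2). Qed.
Lemma bop_adj_adjointable f : adjointable (bop_adj f).
Proof.
split; first exact: adjoint_blin (bop_blin f) (bop_adj_pair f).
by exists f; apply: adjoint_sym; exact: bop_adj_pair.
Qed.
Definition bstar f : B := mkbop (bop_adj_adjointable f).
Lemma bstar_pair f : adjoint_pair f (bstar f).
Proof. exact: bop_adj_pair. Qed.
Lemma bstarE f g : adjoint_pair f g -> bstar f = g.
Proof. by move=> h; apply: bop_ext; apply/funeqP/(adjoint_unique _ h); exact: bstar_pair. Qed.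

Fact bstarD f g : bstar (f + g) = bstar f + bstar g.
Proof. by apply: bstarE => x y; rewrite !bopDE hdotDl hdotDr !bstar_pair. Qed.
Fact bstarZ c f : bstar (c *: f) = Num.conj c *: bstar f.
Proof. by apply: bstarE => x y; rewrite !bopZE hdotZl hdotZr conjCK bstar_pair. Qed.
Lemma bstarB f g : bstar (f - g) = bstar f - bstar g.
Proof. by apply: bstarE => x y; rewrite !bopBE hdotBl hdotBr !bstar_pair. Qed.
Fact bstarM f g : bstar (f * g) = bstar g * bstar f.
Proof. by apply: bstarE => x y; rewrite !bopME !bstar_pair. Qed.
Fact bstarK f : bstar (bstar f) = f.
Proof. by apply: bstarE; apply: adjoint_sym; exact: bstar_pair. Qed.

Definition opbounds f := [set M : R | 0 <= M /\ forall x, hnorm (f x) <= M * hnorm x].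
Definition opnorm f : R := inf (opbounds f).

Lemma opbounds_inf f : has_inf (opbounds f).
Proof.
split; last by exists 0 => M [].
by have [M M0 hM] := blin_pos (bop_blin f); exists M.
Qed.
Lemma opnorm_ge0 f : 0 <= opnorm f.
Proof. by apply: lb_le_inf; [exact: (opbounds_inf f).1|move=> M []]. Qed.
Lemma opnorm_min f (M : R) : 0 <= M -> (forall x, hnorm (f x) <= M * hnorm x) -> opnorm f <= M.
Proof. by move=> M0 hM; apply: ge_inf; [exact: (opbounds_inf f).2|]. Qed.
Lemma opnorm_bound f x : hnorm (f x) <= opnorm f * hnorm x.
Proof.
have [x0|x0] := eqVneq (hnorm x) 0.
  by rewrite (hnorm_eq0 x0) lin0 ?hnorm0 ?mulr0//; exact: (bop_blin f).1.
have xp : 0 < hnorm x by rewrite lt_neqAle eq_sym x0 hnorm_ge0.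
rewrite -ler_pdivrMr//; apply: lb_le_inf; first exact: (opbounds_inf f).1.
by move=> M [M0 hM]; rewrite ler_pdivrMr.
Qed.

Fact opnorm_eq0 f : opnorm f = 0 -> f = 0.
Proof.
move=> h; apply: bop_ext => x; apply: hnorm_eq0; apply/eqP.
by rewrite eq_le hnorm_ge0 andbT; have := opnorm_bound f x; rewrite h mul0r.
Qed.
Fact opnormD f g : opnorm (f + g) <= opnorm f + opnorm g.
Proof.
apply: opnorm_min; first by rewrite addr_ge0 ?opnorm_ge0.
by move=> x; rewrite bopDE mulrDl (le_trans (hnormD _ _))// lerD ?opnorm_bound.
Qed.
Fact opnormZ_le c f : opnorm (c *: f) <= cabs c * opnorm f.
Proof.
apply: opnorm_min; first by rewrite mulr_ge0 ?cabs_ge0 ?opnorm_ge0.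
by move=> x; rewrite bopZE hnormZ -mulrA ler_wpM2l ?cabs_ge0 ?opnorm_bound.
Qed.
Fact opnormZ c f : opnorm (c *: f) = complex.Re `|c| * opnorm f.
Proof.
rewrite -/(cabs c); apply/eqP; rewrite eq_le opnormZ_le andTb; have [->|c0] := eqVneq c 0.
  by rewrite cabs0 mul0r opnorm_ge0.
have := opnormZ_le c^-1 (c *: f); rewrite scalerA mulVf// scale1r.
have E : cabs c^-1 * cabs c = 1 by rewrite -cabsM mulVf// cabs1.
have cp : 0 < cabs c.
  by rewrite lt_neqAle cabs_ge0 andbT eq_sym; apply/eqP => /cabs_eq0/eqP; rewrite (negPf c0).
move=> h; rewrite mulrC -ler_pdivlMr// (le_trans h)// mulrC.
by rewrite (_ : cabs c^-1 = (cabs c)^-1)//; apply: (mulIf (lt0r_neq0 cp)); rewrite E mulVf ?lt0r_neq0.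
Qed.
Fact opnormM f g : opnorm (f * g) <= opnorm f * opnorm g.
Proof.
apply: opnorm_min; first by rewrite mulr_ge0 ?opnorm_ge0.
move=> x; rewrite bopME (le_trans (opnorm_bound _ _))// -mulrA ler_wpM2l ?opnorm_ge0//.
exact: opnorm_bound.
Qed.
Lemma opnorm_star_le f : opnorm (bstar f) <= opnorm f.
Proof.
apply: opnorm_min; first exact: opnorm_ge0.
apply: (adjoint_bound (bstar_pair f) (opnorm_ge0 f)); exact: opnorm_bound.
Qed.
Lemma opnorm_star f : opnorm (bstar f) = opnorm f.
Proof. by apply/eqP; rewrite eq_le opnorm_star_le -{1}(bstarK f) opnorm_star_le. Qed.
Fact opnorm_cstar f : opnorm (bstar f * f) = opnorm f ^+ 2.
Proof.
apply/eqP; rewrite eq_le (le_trans (opnormM _ _)) ?opnorm_star ?expr2//= -expr2.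
have [r r0 rr] : exists2 r : R, 0 <= r & r ^+ 2 = opnorm (bstar f * f).
  by exists (Num.sqrt (opnorm (bstar f * f))); [exact: sqrtr_ge0|rewrite sqr_sqrtr ?opnorm_ge0].
rewrite -rr ler_sqr ?nnegrE ?opnorm_ge0//; apply: opnorm_min => // x.
rewrite -ler_sqr ?nnegrE ?mulr_ge0 ?hnorm_ge0// exprMn rr.
rewrite {1}hnorm_sq bstar_pair (le_trans (ler_norm _))// (le_trans (ler_Re_cabs _))//.
rewrite (le_trans (cauchy_schwarz _ _))// mulrC expr2 mulrA ler_wpM2r ?hnorm_ge0//.
exact: (opnorm_bound (bstar f * f) x).
Qed.

Fact opnorm_complete (u : nat -> B) :
  (forall e : R, 0 < e -> exists M : nat, forall m n : nat,
     (M <= m)%N -> (M <= n)%N -> opnorm (u m - u n) < e) ->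
  exists l : B, forall e : R, 0 < e -> exists M : nat,
    forall n : nat, (M <= n)%N -> opnorm (u n - l) < e.
Proof.
move=> cu; have cau (v : nat -> B) : (forall m n, opnorm (v m - v n) = opnorm (u m - u n)) ->
    forall x, exists y, hcvg (fun n => v n x) y.
  move=> vu x; apply: hcomplete => e e0.
  have [d d0 hd] := mulr_smallP e0 (hnorm_ge0 x); have [M hM] := cu _ d0.
  exists M => m n Mm Mn; rewrite -bopBE; apply: (le_lt_trans (opnorm_bound _ _)).
  by apply: le_lt_trans hd; rewrite mulrC ler_wpM2l ?hnorm_ge0// vu ltW// hM.
have /choice[f hf] := cau u (fun _ _ => erefl).
have /choice[g hg] : forall x, exists y, hcvg (fun n => bstar (u n) x) y.
  by apply: (cau (fun n => bstar (u n))) => m n; rewrite -bstarB opnorm_star.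
have near (e : R) : 0 < e -> exists M, forall n, (M <= n)%N -> forall x, hnorm (u n x - f x) <= e * hnorm x.
  move=> e0; have [M hM] := cu _ e0; exists M => n Mn x; apply: (hcvg_dist_le (M := M) (hf x)) => m Mm.
  by rewrite -bopBE (le_trans (opnorm_bound _ _))// ler_wpM2r ?hnorm_ge0// ltW// hM.
have lf : lin f.
  move=> c x y; apply: (hcvg_unique (hf _)) => e e0; have e2 : 0 < e / 2 by rewrite divr_gt0.
  have [d d0 hd] := mulr_smallP e2 (cabs_ge0 c).
  have [M hM] := hf x _ d0; have [M' hM'] := hf y _ e2; exists (maxn M M') => n.
  rewrite geq_max => /andP[/hM h1 /hM' h2].
  rewrite (bop_blin (u n)).1 opprD addrACA -scalerBr (splitr e); apply: (le_lt_trans (hnormD _ _)).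
  by rewrite hnormZ ltrD//; apply: le_lt_trans hd; rewrite ler_wpM2l ?cabs_ge0// ltW.
have af : adjointable f.
  split; last first.
    exists g => x y; apply/eqP; rewrite -subr_eq0; apply/eqP/cabs_eq0.
    apply: (@small_lt_eq0 _ _ (hnorm y + hnorm x)); first exact: cabs_ge0.
    move=> e e0; have [M hM] := hf x _ e0; have [M' hM'] := hg y _ e0; pose n := maxn M M'.
    have -> : '[f x, y] - '[x, g y] = '[f x - u n x, y] + '[x, bstar (u n) y - g y].
      by rewrite hdotBl hdotBr bstar_pair addrA subrK.
    apply: (le_trans (cabsD _ _)); rewrite mulrDl lerD//.
      apply: (le_trans (cauchy_schwarz _ _)); rewrite mulrC ler_wpM2l ?hnorm_ge0// hnormBC ltW//.
      by apply: hM; rewrite leq_maxl.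
    apply: (le_trans (cauchy_schwarz _ _)); rewrite ler_wpM2l ?hnorm_ge0// ltW//.
    by apply: hM'; rewrite leq_maxr.
  split=> //; have [M /(_ M (leqnn _)) hM] := near 1 ltr01; exists (1 + opnorm (u M)) => x.
  have := hnormB_trans (f x) (u M x) 0; rewrite !subr0 mulrDl => h; apply: (le_trans h).
  by rewrite lerD ?opnorm_bound// hnormBC.
exists (mkbop af) => e e0; have e2 : 0 < e / 2 by rewrite divr_gt0.
have [M hM] := near _ e2; exists M => n Mn; apply: (@le_lt_trans _ _ (e / 2)); last first.
  by rewrite ltr_pdivrMr// ltr_pMr// ltr1n.
by apply: opnorm_min; [exact: ltW|move=> x; rewrite bopBE /=; exact: hM].
Qed.

Definition bounded_operators : cstar_algebra R :=
  @CstarAlgebra R B opnorm bstar bstarD bstarZ bstarM bstarK opnorm_ge0 opnorm_eq0 opnormD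
    opnormZ opnormM opnorm_cstar opnorm_complete.

Context {O : cstar_algebra R} (phi : O -> bounded_operators) (hphi : star_hom phi).

Definition operator_rep : representation O.
Proof.
refine (@Representation R O H (fun a x => bfun (phi a) x) _ _ _ _ _ _).
- by move=> a c x y; exact: (bop_blin (phi a : B)).1.
- by move=> a; exact: (bop_blin (phi a : B)).2.
- by case: hphi => l _ _ _ c a b x; rewrite l bopDE bopZE.
- by case: hphi => _ _ u _ x; rewrite u.
- by case: hphi => _ m _ _ a b x; rewrite m.
- case: hphi => _ _ _ st a x y; rewrite st; exact: (adjoint_sym (bstar_pair (phi a : B))).
Defined.

End OperatorAlgebra.

Section CuntzKriegerRep.
Context {R : realType} {N : nat} {A : 'M[bool]_N} {O : cstar_algebra R} {s : 'I_N -> O}.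
Hypothesis isO : is_cuntz_krieger A s.
Context {H : hilbert R} (nz : exists x : H, x != 0) (t t' : 'I_N -> H -> H).
Hypotheses (bt : forall i, blin (t i)) (tt' : forall i, adjoint_pair (t i) (t' i)).
Hypotheses (pt : forall i x, t i (t' i (t i x)) = t i x)
  (qt : forall i x, t' i (t i x) = \sum_j ((A i j : nat)%:R : R[i]) *: t j (t' j x))
  (st : forall x, \sum_i t i (t' i x) = x).

(** By the universal property, operators satisfying the Cuntz-Krieger relations
    on a given Hilbert space come from a representation on that space. *)
Lemma ck_rep_exists : exists (phi : O -> bounded_operators nz) (hphi : star_hom phi),
  (forall i x, act (r := operator_rep hphi) (s i) x = t i x) /\
  (forall i x, act (r := operator_rep hphi) (star (s i)) x = t' i x).
Proof.
have at_ i : adjointable (t i) by split=> //; exists (t' i).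
pose b i : bop nz := mkbop nz (at_ i).
have sbE i x : bstar (b i) x = t' i x.
  exact: (congr1 (fun f => f x) (adjoint_unique (bstar_pair (b i)) (tt' i))).
have [_ _ univ] := isO.
have [|phi [hphi hs]] := univ (bounded_operators nz) b.
  split.
  - move=> i; apply: bop_ext => x; change (t i (bstar (b i) (t i x)) = t i x).
    by rewrite sbE pt.
  - move=> i; apply: bop_ext => x; rewrite [RHS]bop_sumE.
    change (bstar (b i) (t i x) = \sum_j (((A i j : nat)%:R : R[i]) *: ((b j : bop nz) * bstar (b j))) x).
    by rewrite sbE qt; apply: eq_bigr => j _; rewrite bopZE bopME sbE.
  - apply: bop_ext => x; rewrite [LHS]bop_sumE -[RHS]st; apply: eq_bigr => i _.
    by change (t i (bstar (b i) x) = t i (t' i x)); rewrite sbE.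
exists phi, hphi; split=> i x; rewrite /= ?hs//.
by case: (hphi) => _ _ _ h; rewrite h hs; exact: sbE.
Qed.

End CuntzKriegerRep.

(** * The Hilbert space of a positive form *)

(** A complete semi-inner-product space, presented by the single operation
    [c x + y]; its separated quotient is a Hilbert space. *)
Record prehilbert (R : realType) := PreHilbert {
  pcarrier :> Type;
  pzero : pcarrier;
  plin : R[i] -> pcarrier -> pcarrier -> pcarrier;
  pdot : pcarrier -> pcarrier -> R[i];
  pdot_zero : forall y, pdot pzero y = 0;
  pdot_lin : forall c x y z, pdot (plin c x y) z = c * pdot x z + pdot y z;
  pdot_conj : forall x y, pdot x y = Num.conj (pdot y x);
  pdot_ge0 : forall x, 0 <= pdot x x;
  pcomplete : forall u : nat -> pcarrier,
    let q x y := complex.Re (pdot (plin (-1) y x) (plin (-1) y x)) in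
    (forall e : R, 0 < e -> exists M : nat, forall m n : nat,
       (M <= m)%N -> (M <= n)%N -> q (u m) (u n) < e) ->
    exists l : pcarrier, forall e : R, 0 < e -> exists M : nat,
      forall n : nat, (M <= n)%N -> q (u n) l < e }.

Section Separation.
Context {R : realType} (P : prehilbert R).
Implicit Types (x y z : P) (c : R[i]).

Lemma pdot_null x y : pdot x x = 0 -> pdot x y = 0.
Proof.
move=> x0; apply: cabs_eq0; apply/eqP; rewrite -sqrf_eq0; apply/eqP.
apply: (@small_lt_eq0 _ _ (complex.Re (pdot y y) / 2)); first exact: sqr_ge0.
move=> e e0; set b := pdot x y.
have h c : 0 <= 2 * complex.Re (c * b) + complex.Re (pdot y y).
  have : pdot (plin c x y) (plin c x y) = c * b + Num.conj (c * b + pdot y y).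
    rewrite pdot_lin (pdot_conj x) pdot_lin x0 mulr0 add0r -pdot_conj; congr (_ + _).
    by rewrite pdot_conj pdot_lin.
  have := pdot_ge0 (plin c x y); rewrite lecE => /andP[_ /= h0] e1; move: h0; rewrite e1.
  by rewrite ReD Re_conj ReD => h0; apply: (le_trans h0); rewrite le_eqVlt; apply/orP; left; apply/eqP; ring.
have := h (- (e^-1)%:C%C * Num.conj b).
have -> : - (e^-1)%:C%C * Num.conj b * b = (- (e^-1 * cabs b ^+ 2))%:C%C.
  by rewrite -mulrA conj_mul mulNr -rmorphM -rmorphN.
rewrite /= mulrN addrC subr_ge0 mulrCA mulrC ler_pdivrMr// => h2.
by rewrite mulrAC ler_pdivlMr// mulrC.
Qed.

Definition separated_pred : {pred (P -> R[i]^o)} := fun f => `[< exists x, f = pdot x >].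

Lemma separated_submod : submod_closed separated_pred.
Proof.
split; first by apply/asboolP; exists (pzero P); apply/funext => y; rewrite pdot_zero.
move=> c f g /asboolP[x ->] /asboolP[y ->]; apply/asboolP; exists (plin c x y).
by apply/funext => z; rewrite pdot_lin.
Qed.
HB.instance Definition _ := GRing.isSubmodClosed.Build R[i] (P -> R[i]^o) separated_pred separated_submod.

Record separated := Separated { sepval : P -> R[i]^o; sepP : sepval \in separated_pred }.
HB.instance Definition _ := [isSub for sepval].
HB.instance Definition _ := [Choice of separated by <:].
HB.instance Definition _ := [SubChoice_isSubLmodule of separated by <:].

Lemma sep_class_proof x : (pdot x : P -> R[i]^o) \in separated_pred.
Proof. by apply/asboolP; exists x. Qed.
Definition sep_class x : separated := Separated (sep_class_proof x).

Lemma sep_class_surj (f : separated) : exists x, sep_class x = f.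
Proof. by have /asboolP[x hx] := sepP f; exists x; apply: val_inj => /=; rewrite hx. Qed.

Definition sep_repr (f : separated) : P := projT1 (cid (sep_class_surj f)).
Lemma sep_reprK f : sep_class (sep_repr f) = f.
Proof. exact: projT2 (cid (sep_class_surj f)). Qed.

Lemma sep_class_lin c x y : sep_class (plin c x y) = c *: sep_class x + sep_class y.
Proof. by apply: val_inj; apply/funext => z; rewrite /= pdot_lin. Qed.

Definition sep_dot (f g : separated) : R[i] := pdot (sep_repr f) (sep_repr g).

Lemma sep_classE x y z : sep_class x = sep_class y -> pdot x z = pdot y z.
Proof. by move=> /(congr1 sepval)/(congr1 (fun f => f z)). Qed.

Lemma sep_dotE x y : sep_dot (sep_class x) (sep_class y) = pdot x y.
Proof.
rewrite /sep_dot (sep_classE _ (sep_reprK (sep_class x))) pdot_conj.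
by rewrite (sep_classE _ (sep_reprK (sep_class y))) -pdot_conj.
Qed.

Lemma sep_dotC f g : sep_dot f g = (-1) ^+ false * Num.conj (sep_dot g f).
Proof. by rewrite expr0 mul1r -(sep_reprK f) -(sep_reprK g) !sep_dotE pdot_conj. Qed.

Lemma sep_dot_linl g : GRing.linear_for *%R (sep_dot^~ g).
Proof.
move=> c f f'; rewrite -(sep_reprK f) -(sep_reprK f') -(sep_reprK g) -sep_class_lin !sep_dotE.
by rewrite pdot_lin.
Qed.

Lemma sep_dot_linr f : GRing.linear_for (Num.conj \; *%R) (sep_dot f).
Proof.
move=> c g g'; rewrite sep_dotC expr0 mul1r sep_dot_linl rmorphD rmorphM /=.
by congr (_ * _ + _); rewrite sep_dotC expr0 mul1r conjCK.
Qed.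

Lemma sep_dot_gt0 f : f != 0 -> 0 < sep_dot f f.
Proof.
move=> f0; rewrite lt_neqAle; have := pdot_ge0 (sep_repr f) => h; rewrite [_ <= _]h andbT.
apply/eqP => e; move/eqP: f0; apply; rewrite -(sep_reprK f); apply: val_inj; apply/funext => y /=.
by rewrite pdot_null// -[LHS]/(sep_dot f f) -e.
Qed.

HB.instance Definition _ := @bilinear_isBilinear.Build R[i] separated separated R[i]
  (GRing.Scale.Law.clone _ _ ( *%R ) _) (GRing.Scale.Law.clone _ _ (Num.conj \; *%R) _) sep_dot
  (sep_dot_linl, sep_dot_linr).
HB.instance Definition _ := @isHermitianSesquilinear.Build R[i] separated false Num.conj sep_dot sep_dotC.
HB.instance Definition _ := @isDotProduct.Build R[i] separated sep_dot sep_dot_gt0.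

Lemma sep_complete (u : nat -> separated) :
  let norm (f : separated) := Num.sqrt (complex.Re (sep_dot f f)) in
  (forall e : R, 0 < e -> exists M : nat, forall m n : nat,
     (M <= m)%N -> (M <= n)%N -> norm (u m - u n) < e) ->
  exists l : separated, forall e : R, 0 < e -> exists M : nat,
    forall n : nat, (M <= n)%N -> norm (u n - l) < e.
Proof.
move=> norm cu; pose v n := sep_repr (u n).
have E x y : norm (sep_class x - sep_class y) = Num.sqrt (complex.Re (pdot (plin (-1) y x) (plin (-1) y x))).
  by rewrite /norm -sep_dotE sep_class_lin scaleN1r addrC.
have sqrt_lt (a e : R) : 0 < e -> (Num.sqrt a < e) = (a < e ^+ 2).
  move=> e0; rewrite -{1}(ger0_norm (ltW e0)) -sqrtr_sqr ltr_sqrt// exprn_gt0//.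
have [|l hl] := @pcomplete R P v.
  move=> e e0; have r0 : 0 < Num.sqrt e by rewrite sqrtr_gt0.
  have [M hM] := cu _ r0; exists M => m n Mm Mn; have := hM m n Mm Mn.
  by rewrite -(sep_reprK (u m)) -(sep_reprK (u n)) E sqrt_lt// sqr_sqrtr// ltW.
exists (sep_class l) => e e0; have e2 : 0 < e ^+ 2 by rewrite exprn_gt0.
have [M hM] := hl _ e2; exists M => n /hM.
by rewrite -(sep_reprK (u n)) E sqrt_lt.
Qed.

Definition separated_hilbert : hilbert R := @Hilbert R separated sep_dot sep_complete.

End Separation.

(** * Square-integrable sections *)

Lemma funext_dep (T : Type) (U : T -> Type) (f g : forall x, U x) : (forall x, f x = g x) -> f = g.
Proof. exact: boolp.functional_extensionality_dep. Qed.

(** Fields of Hilbert spaces over a measurable space together with a space of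
    sections: [hsec_lim] and [hsec_restrict] are the closure properties which
    the Riesz-Fischer argument uses. *)
Record hfield (R : realType) (d : measure_display) (Om : measurableType d) := HField {
  hfiber :> Om -> hilbert R;
  hsec : set (forall z, hfiber z);
  hsec0 : hsec (fun z => 0);
  hsec_lin : forall (c : R[i]) x y, hsec x -> hsec y -> hsec (fun z => c *: x z + y z);
  hsec_norm : forall x, hsec x -> measurable_fun setT (fun z => hnorm (x z));
  hsec_restrict : forall (B : set Om) x, measurable B -> hsec x ->
    hsec (fun z => if z \in B then x z else 0);
  hsec_lim : forall (u : nat -> forall z, hfiber z) y, (forall n, hsec (u n)) ->
    (forall z, hcvg (fun n => u n z) (y z)) -> hsec y }.

Section SquareIntegrable.
Context {R : realType} {d : measure_display} {Om : measurableType d}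
  (mu : {measure set Om -> \bar R}) (F : hfield R Om).
Implicit Types (x y : forall z, F z) (c : R[i]).

Definition rintegrable (f : Om -> R) := mu.-integrable setT (EFin \o f).
Definition rint (f : Om -> R) : R := Rintegral mu setT f.
Definition cint (f : Om -> R[i]) : R[i] :=
  Complex (rint (fun z => complex.Re (f z))) (rint (fun z => complex.Im (f z))).
Definition cintegrable (f : Om -> R[i]) :=
  rintegrable (fun z => complex.Re (f z)) /\ rintegrable (fun z => complex.Im (f z)).

Lemma rintegrable_ext (f g : Om -> R) : (forall z, f z = g z) -> rintegrable f -> rintegrable g.
Proof. by move=> /funext ->. Qed.
Lemma rintegrableD (f g : Om -> R) : rintegrable f -> rintegrable g -> rintegrable (fun z => f z + g z).
Proof. by move=> hf hg; exact: (integrableD measurableT hf hg). Qed.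
Lemma rintegrableZ (k : R) (f : Om -> R) : rintegrable f -> rintegrable (fun z => k * f z).
Proof. by move=> hf; exact: (integrableZl measurableT k hf). Qed.
Lemma rintegrable_le (f g : Om -> R) : measurable_fun setT f -> rintegrable g ->
  (forall z, `|f z| <= g z) -> rintegrable f.
Proof.
move=> mf ig h; apply: le_integrable ig => //; first exact/measurable_EFinP.
by move=> z _; rewrite /= lee_fin (le_trans (h z))// ler_norm.
Qed.
Lemma rintD (f g : Om -> R) : rintegrable f -> rintegrable g ->
  rint (fun z => f z + g z) = rint f + rint g.
Proof. by move=> hf hg; exact: RintegralD. Qed.
Lemma rintZ (k : R) (f : Om -> R) : rintegrable f -> rint (fun z => k * f z) = k * rint f.
Proof. by move=> hf; exact: RintegralZl. Qed.
Lemma rint_le (f g : Om -> R) : rintegrable f -> rintegrable g -> (forall z, f z <= g z) -> rint f <= rint g.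
Proof. by move=> hf hg h; apply: le_Rintegral. Qed.
Lemma rint_ge0 (f : Om -> R) : (forall z, 0 <= f z) -> 0 <= rint f.
Proof. by move=> h; apply: Rintegral_ge0. Qed.
Lemma rintE (f : Om -> R) : rintegrable f -> (\int[mu]_z (f z)%:E)%E = (rint f)%:E.
Proof. by move=> hf; rewrite /rint /Rintegral fineK//; exact: integrable_fin_num hf. Qed.

Lemma cint_lin c (f g : Om -> R[i]) : cintegrable f -> cintegrable g ->
  cintegrable (fun z => c * f z + g z) /\ cint (fun z => c * f z + g z) = c * cint f + cint g.
Proof.
move=> [rf jf] [rg jg]; case: c => a b.
have eR z : complex.Re (Complex a b * f z + g z) =
    a * complex.Re (f z) + (- b) * complex.Im (f z) + complex.Re (g z).
  by rewrite ReD ReM mulNr.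
have eI z : complex.Im (Complex a b * f z + g z) =
    a * complex.Im (f z) + b * complex.Re (f z) + complex.Im (g z).
  by rewrite ImD ImM.
split; first split.
- by apply: (rintegrable_ext (fun z => esym (eR z))); do !apply: rintegrableD => //; exact: rintegrableZ.
- by apply: (rintegrable_ext (fun z => esym (eI z))); do !apply: rintegrableD => //; exact: rintegrableZ.
apply: complex_ext; rewrite ?ReD ?ImD ?ReM ?ImM /= /cint /=.
  rewrite (_ : (fun z => _) = (fun z => a * complex.Re (f z) + (- b) * complex.Im (f z) + complex.Re (g z))); last exact/funext.
  rewrite rintD//; last by apply: rintegrableD; exact: rintegrableZ.
  by rewrite rintD ?rintZ ?mulNr//; exact: rintegrableZ.
rewrite (_ : (fun z => _) = (fun z => a * complex.Im (f z) + b * complex.Re (f z) + complex.Im (g z))); last exact/funext.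
rewrite rintD//; last by apply: rintegrableD; exact: rintegrableZ.
by rewrite rintD ?rintZ//; exact: rintegrableZ.
Qed.

Definition sq_integrable x := hsec x /\ (\int[mu]_z ((hnorm (x z)) ^+ 2)%:E < +oo)%E.
Definition normsq x : R := rint (fun z => hnorm (x z) ^+ 2).

Lemma hsec_comb c x y : hsec x -> hsec y -> hsec (fun z => x z + c *: y z).
Proof.
move=> hx hy; rewrite (_ : (fun z => _) = (fun z => c *: y z + x z)); first exact: hsec_lin.
by apply/funext_dep => z; rewrite addrC.
Qed.

Lemma measurable_normsq x : hsec x -> measurable_fun setT (fun z => hnorm (x z) ^+ 2).
Proof. by move=> hx; apply: measurable_funX; exact: hsec_norm. Qed.

(** By polarisation the real part of the inner product is a combination of square
    norms of sections. *)
Lemma measurable_Re_dot x y : hsec x -> hsec y ->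
  measurable_fun setT (fun z => complex.Re '[x z, y z]).
Proof.
move=> hx hy.
rewrite (_ : (fun z => _) = (fun z => 4^-1 * (hnorm (x z + 1 *: y z) ^+ 2 - hnorm (x z + (-1) *: y z) ^+ 2))).
  apply: measurable_funM => //; apply: measurable_funB; apply: measurable_normsq; exact: hsec_comb.
by apply/funext => z; rewrite scale1r scaleN1r hnormD_sq hnormB_sq; lra.
Qed.

Lemma measurable_Im_dot x y : hsec x -> hsec y ->
  measurable_fun setT (fun z => complex.Im '[x z, y z]).
Proof.
move=> hx hy; rewrite (_ : (fun z => _) = (fun z => complex.Re '[x z, 'i%C *: y z + 0])).
  apply: (@measurable_Re_dot x (fun z => 'i%C *: y z + 0)) => //; apply: hsec_lin => //; exact: hsec0.
by apply/funext => z; rewrite addr0 hdotZr imaginary_mul_conj mulNr ReN ReM /= mul0r mul1r sub0r opprK.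
Qed.

Lemma sq_integrableP x : hsec x -> (sq_integrable x <-> rintegrable (fun z => hnorm (x z) ^+ 2)).
Proof.
move=> hx; have E : (\int[mu]_z `|(hnorm (x z) ^+ 2)%:E| = \int[mu]_z (hnorm (x z) ^+ 2)%:E)%E.
  by apply: eq_integral => z _; rewrite gee0_abs// lee_fin sqr_ge0.
split=> [[_ h]|/integrableP[_]].
  by apply/integrableP; split; [apply/measurable_EFinP; exact: measurable_normsq|rewrite /= E].
by rewrite /= E; split.
Qed.

Lemma sq_integrable_int x : sq_integrable x -> rintegrable (fun z => hnorm (x z) ^+ 2).
Proof. by move=> hx; apply/(sq_integrableP hx.1). Qed.

Lemma normsq_ge0 x : 0 <= normsq x.
Proof. by apply: rint_ge0 => z; exact: sqr_ge0. Qed.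

Lemma ler_dot_sq (H : hilbert R) (v w : H) : cabs '[v, w] <= hnorm v ^+ 2 + hnorm w ^+ 2.
Proof.
apply: (le_trans (cauchy_schwarz _ _)); have := sqr_ge0 (hnorm v - hnorm w).
have := sqr_ge0 (hnorm v); have := sqr_ge0 (hnorm w); rewrite sqrrB; lra.
Qed.

Lemma dot_cintegrable x y : sq_integrable x -> sq_integrable y -> cintegrable (fun z => '[x z, y z]).
Proof.
move=> hx hy; have ig := rintegrableD (sq_integrable_int hx) (sq_integrable_int hy).
split; apply: (rintegrable_le _ ig).
- exact: measurable_Re_dot hx.1 hy.1.
- by move=> z; apply: (le_trans (ler_Re_cabs _)); exact: ler_dot_sq.
- exact: measurable_Im_dot hx.1 hy.1.
- by move=> z; apply: (le_trans (ler_Im_cabs _)); exact: ler_dot_sq.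
Qed.

Lemma sq_integrable0 : sq_integrable (fun z => 0).
Proof.
split; first exact: hsec0.
rewrite (eq_integral (cst 0%E)) ?integral0 ?ltry// => z _.
by rewrite hnorm0 expr0n.
Qed.

Lemma sq_integrable_lin c x y : sq_integrable x -> sq_integrable y ->
  sq_integrable (fun z => c *: x z + y z).
Proof.
move=> hx hy; have hs := hsec_lin c hx.1 hy.1; apply/(sq_integrableP hs).
have ig := rintegrableD (rintegrableZ (2 * cabs c ^+ 2) (sq_integrable_int hx))
  (rintegrableZ 2 (sq_integrable_int hy)).
apply: (rintegrable_le _ ig); first exact: measurable_normsq.
move=> z; rewrite ger0_norm ?sqr_ge0//; have := parallelogram (c *: x z) (y z).
have := sqr_ge0 (hnorm (c *: x z - y z)); rewrite hnormZ exprMn; lra.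
Qed.

Lemma normsqD x y : sq_integrable x -> sq_integrable y ->
  normsq (fun z => x z + y z) <= 2 * normsq x + 2 * normsq y.
Proof.
move=> hx hy; have hxy := sq_integrable_lin 1 hx hy; rewrite /normsq.
rewrite -!rintZ ?sq_integrable_int// -rintD; try by apply: rintegrableZ; exact: sq_integrable_int.
apply: rint_le.
- by apply: rintegrable_ext (sq_integrable_int hxy) => z; rewrite scale1r.
- by apply: rintegrableD; apply: rintegrableZ; exact: sq_integrable_int.
- move=> z; have := parallelogram (x z) (y z); have := sqr_ge0 (hnorm (x z - y z)); lra.
Qed.

Lemma sq_integrableB x y : sq_integrable x -> sq_integrable y -> sq_integrable (fun z => x z - y z).
Proof.
move=> hx hy; have := sq_integrable_lin (-1) hy hx.
rewrite (_ : (fun z => _) = (fun z => x z - y z))//.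
by apply/funext_dep => z; rewrite scaleN1r addrC.
Qed.

Lemma rapid_distance (H : hilbert R) (v : nat -> H) (r : R) : 0 <= r ->
  (forall k, hnorm (v k.+1 - v k) <= r / 2 ^+ k) ->
  forall k l, (k <= l)%N -> hnorm (v l - v k) <= 2 * r / 2 ^+ k.
Proof.
move=> r0 h k l kl; suff H1 : hnorm (v l - v k) <= 2 * r / 2 ^+ k - 2 * r / 2 ^+ l.
  by apply: (le_trans H1); rewrite gerBl divr_ge0// ?mulr_ge0// exprn_ge0.
rewrite -(subnKC kl); elim: (l - k)%N => [|n IH]; first by rewrite addn0 !subrr hnorm0.
rewrite addnS; apply: (le_trans (hnormB_trans _ (v (k + n)%N) _)).
apply: (le_trans (lerD (h _) IH)); rewrite exprS invfM.
have p : (2 ^+ (k + n) : R) != 0 by rewrite expf_neq0// pnatr_eq0.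
rewrite le_eqVlt; apply/orP; left; apply/eqP; field.
by rewrite p expf_neq0// pnatr_eq0.
Qed.

(** Riesz-Fischer: along a rapidly Cauchy subsequence [v] the function
    [S = \sum_k 4^k |v_(k+1) - v_k|^2] is integrable; where it is finite the
    subsequence converges, at distance at most [2 sqrt S / 2^k] from [v_k]. *)
Lemma sq_integrable_complete (u : nat -> forall z, F z) : (forall n, sq_integrable (u n)) ->
  (forall e : R, 0 < e -> exists M : nat, forall m n : nat,
     (M <= m)%N -> (M <= n)%N -> normsq (fun z => u m z - u n z) < e) ->
  exists2 l, sq_integrable l & forall e : R, 0 < e -> exists M : nat,
      forall n : nat, (M <= n)%N -> normsq (fun z => u n z - l z) < e.
Proof.
(* The squared distances decrease fast enough for the sum of [4^k c k] to be at most 1. *)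
move=> hu cu; pose c k : R := ((2 ^ k.+1)%:R)^-1 / 4 ^+ k.
have c0 k : 0 < c k by rewrite divr_gt0// ?invr_gt0 ?ltr0n ?expn_gt0// exprn_gt0.
have /choice[n hn] := fun k => cu _ (c0 k).
pose p k := \max_(j < k.+1) n j.
have pn k j : (k <= j)%N -> (n k <= p j)%N.
  by move=> kj; rewrite -ltnS in kj; exact: (leq_bigmax (Ordinal kj)).
pose v k := u (p k); have hv k : sq_integrable (v k) by exact: hu.
pose y k z := v k.+1 z - v k z.
have hy k : sq_integrable (y k) by exact: sq_integrableB.
have yc k : normsq (y k) < c k by apply: hn; exact: pn.
pose S z := (\sum_(0 <= k <oo) (4 ^+ k * hnorm (y k z) ^+ 2)%:E)%E.
have t0 k z : (0 <= (4 ^+ k * hnorm (y k z) ^+ 2)%:E)%E by rewrite lee_fin mulr_ge0// ?sqr_ge0// exprn_ge0.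
have tm k : measurable_fun setT (fun z => (4 ^+ k * hnorm (y k z) ^+ 2)%:E).
  by apply/measurable_EFinP; apply: measurable_funM => //; apply: measurable_normsq; exact: (hy k).1.
have S0 z : (0 <= S z)%E by apply: nneseries_ge0 => k _ _; exact: t0.
have Sm : measurable_fun setT S by apply: ge0_emeasurable_sum => // k z _ _; exact: t0.
have SI : (\int[mu]_z S z <= 1%:E)%E.
  rewrite integral_nneseries//; apply: le_trans (epsilon_trick0 xpredT ler01).
  apply: lee_nneseries => [k _ _|k _]; first by apply: integral_ge0 => z _; exact: t0.
  rewrite (rintE (rintegrableZ _ (sq_integrable_int (hy k)))) lee_fin rintZ ?sq_integrable_int//.
  by rewrite mul1r mulrC -ler_pdivlMr ?exprn_gt0//; exact/ltW/yc.
pose G := [set z | (S z < +oo)%E].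
have mG : measurable G by rewrite -[G]setTI; exact: emeasurable_fun_infty_o.
have muG : mu (~` G) = 0%E.
  have /integrable_ae : mu.-integrable setT S.
    apply/integrableP; split=> //; apply: le_lt_trans (ltry 1).
    by rewrite (eq_integral S) // => z _; rewrite gee0_abs.
  move=> /(_ measurableT); rewrite /almost_everywhere => /negligibleS h.
  apply/negligibleP; first exact: measurableC.
  by apply: h => z /= nG h; apply: nG; have := h I; rewrite ge0_fin_numE.
have ss z : Num.sqrt (fine (S z)) ^+ 2 = fine (S z) by rewrite sqr_sqrtr// fine_ge0.
have ty z k : G z -> hnorm (y k z) <= Num.sqrt (fine (S z)) / 2 ^+ k.
  move=> Gz; have fS : S z \is a fin_num by rewrite ge0_fin_numE.
  have : ((4 ^+ k * hnorm (y k z) ^+ 2)%:E <= S z)%E.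
    apply: le_trans (nneseries_lim_ge (P := xpredT) k.+1 (fun j _ _ => t0 j z)).
    by rewrite big_nat_recr//= leeDr// sume_ge0.
  rewrite -{1}(fineK fS) lee_fin => h.
  rewrite -ler_sqr ?nnegrE ?divr_ge0 ?sqrtr_ge0 ?hnorm_ge0 ?exprn_ge0//.
  rewrite exprMn ss exprVn -exprM mulnC exprM ler_pdivlMr ?exprn_gt0//.
  by rewrite mulrC (_ : 2 ^+ 2 = 4 :> R)//; ring.
have dist z : G z -> forall k l, (k <= l)%N ->
    hnorm (v l z - v k z) <= 2 * Num.sqrt (fine (S z)) / 2 ^+ k.
  move=> Gz; apply: (@rapid_distance _ (fun k => v k z)); first exact: sqrtr_ge0.
  by move=> k; exact: ty.
have half0 : 0 <= (2^-1 : R) by rewrite invr_ge0.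
have half1 : (2^-1 : R) < 1 by rewrite invf_lt1// ltr1n.
have ex_lim z : exists l : F z, hcvg (fun k => if z \in G then v k z else 0) l.
  case: (boolP (z \in G)) => zG; last by exists 0 => e e0; exists 0%N => *; rewrite subrr hnorm0.
  rewrite inE in zG; apply: hcomplete => e e0.
  have e2 : 0 < e / 2 by rewrite divr_gt0.
  have [t tp ht] := @mulr_smallP R (2 * Num.sqrt (fine (S z))) _ e2 (mulr_ge0 (ler0n _ 2) (sqrtr_ge0 _)).
  have [M hM] := expr_small half0 half1 tp.
  have D k : (M <= k)%N -> hnorm (v k z - v M z) < e / 2.
    move=> Mk; apply: (le_lt_trans (dist z zG M k Mk)); apply: le_lt_trans ht.
    by rewrite ler_wpM2l ?mulr_ge0 ?sqrtr_ge0// -exprVn ltW// hM.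
  exists M => k l Mk Ml; apply: (le_lt_trans (hnormB_trans _ (v M z) _)).
  by rewrite (splitr e) ltrD ?D// hnormBC D.
pose l z : F z := projT1 (cid (ex_lim z)).
have hl z : hcvg (fun k => if z \in G then v k z else 0) (l z) by exact: projT2 (cid (ex_lim z)).
have sl : hsec l.
  apply: (hsec_lim _ hl) => k; apply: hsec_restrict => //; exact: (hv k).1.
have ptw z k : G z -> hnorm (l z - v k z) ^+ 2 <= 4 / 4 ^+ k * fine (S z).
  move=> Gz; have : hnorm (v k z - l z) <= 2 * Num.sqrt (fine (S z)) / 2 ^+ k.
    apply: (hcvg_dist_le (M := k) (hl z)) => j kj; rewrite mem_set// hnormBC; exact: dist.
  rewrite hnormBC -ler_sqr ?nnegrE ?divr_ge0 ?mulr_ge0 ?sqrtr_ge0 ?hnorm_ge0 ?exprn_ge0// => h.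
  apply: (le_trans h); rewrite exprMn exprMn ss exprVn -exprM mulnC exprM.
  by rewrite (_ : 2 ^+ 2 = 4 :> R); [rewrite mulrAC|ring].
have meas k : measurable_fun setT (fun z => (hnorm (l z - v k z) ^+ 2)%:E).
  apply/measurable_EFinP; apply: (measurable_normsq (x := fun z => l z - v k z)).
  have := hsec_comb (-1) sl (hv k).1; rewrite (_ : (fun z => _) = (fun z => l z - v k z))//.
  by apply/funext_dep => z; rewrite scaleN1r.
have Nl k : (\int[mu]_z (hnorm (l z - v k z) ^+ 2)%:E <= (4 / 4 ^+ k)%:E)%E.
  have k0 : 0 <= 4 / 4 ^+ k :> R by rewrite divr_ge0// exprn_ge0.
  rewrite (ge0_negligible_integral (measurableC mG) measurableT (meas k) _ muG); last first.
    by move=> z _; rewrite lee_fin sqr_ge0.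
  rewrite setDE setCK setTI.
  apply: (@le_trans _ _ (\int[mu]_(z in G) ((4 / 4 ^+ k)%:E * S z))%E).
    apply: ge0_le_integral => //.
    - by move=> z _; rewrite lee_fin sqr_ge0.
    - exact: measurable_funTS.
    - by apply: measurable_funTS; apply: emeasurable_funM.
    - move=> z Gz; have fS : S z \is a fin_num by rewrite ge0_fin_numE.
      by rewrite -(fineK fS) -EFinM lee_fin; exact: ptw.
  apply: (@le_trans _ _ (\int[mu]_z ((4 / 4 ^+ k)%:E * S z))%E).
    apply: ge0_subset_integral => //; first exact: emeasurable_funM.
    by move=> z _; rewrite mule_ge0// lee_fin.
  rewrite ge0_integralZl//.
  by rewrite -[leRHS]mule1 lee_pmul2l// ?lte_fin ?divr_gt0 ?exprn_gt0.
have hd k : sq_integrable (fun z => l z - v k z).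
  split; last by apply: (le_lt_trans (Nl k)); exact: ltry.
  have := hsec_comb (-1) sl (hv k).1; rewrite (_ : (fun z => _) = (fun z => l z - v k z))//.
  by apply/funext_dep => z; rewrite scaleN1r.
have hsl : sq_integrable l.
  have := sq_integrable_lin 1 (hd 0%N) (hv 0%N); rewrite (_ : (fun z => _) = l)//.
  by apply/funext_dep => z; rewrite scale1r subrK.
exists l => // e e0.
have Nd k : normsq (fun z => l z - v k z) <= 4 / 4 ^+ k.
  by rewrite -lee_fin -(rintE (sq_integrable_int (hd k))).
have e8 : 0 < e / 8 by rewrite divr_gt0.
have e16 : 0 < e / 16 by rewrite divr_gt0.
have q0 : 0 <= (4^-1 : R) by rewrite invr_ge0.
have q1 : (4^-1 : R) < 1 by rewrite invf_lt1// ltr1n.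
have [M hM] := expr_small q0 q1 e16; have [M' hM'] := cu _ e8.
pose k := maxn M M'.
pose q := maxn M' (n k); exists q => m qm.
have hvm : sq_integrable (fun z => u m z - v k z) by exact: sq_integrableB.
have hvl : sq_integrable (fun z => v k z - l z) by exact: sq_integrableB.
have := normsqD hvm hvl; rewrite (_ : (fun z => _) = (fun z => u m z - l z)); last first.
  by apply/funext_dep => z; rewrite addrA subrK.
have N1 : normsq (fun z => u m z - v k z) < c k.
  by apply: hn; [apply: leq_trans qm; rewrite leq_maxr|exact: pn].
have ck : c k <= 4^-1 ^+ k.
  rewrite /c exprVn ler_piMl ?invr_ge0 ?exprn_ge0// invf_le1 ?ltr0n ?expn_gt0//.
  by rewrite ler1n expn_gt0.
have N2 : normsq (fun z => v k z - l z) <= 4 * 4^-1 ^+ k.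
  rewrite exprVn (_ : normsq _ = normsq (fun z => l z - v k z))//.
  by rewrite /normsq; congr rint; apply/funext => z; rewrite hnormBC.
have := hM k (leq_maxl _ _); lra.
Qed.

End SquareIntegrable.

(** * Direct integrals and direct sums *)

Section L2Space.
Context {R : realType} {d : measure_display} {Om : measurableType d}
  (mu : {measure set Om -> \bar R}) (F : hfield R Om).

Local Notation L2 := {x : forall z, F z | sq_integrable mu x}.

Definition L2zero : L2 := exist _ _ (sq_integrable0 mu F).
Definition L2lin (c : R[i]) (x y : L2) : L2 :=
  exist _ _ (sq_integrable_lin c (svalP x) (svalP y)).
Definition L2dot (x y : L2) : R[i] := cint mu (fun z => '[sval x z, sval y z]).

Fact L2dot_lin c x y t : L2dot (L2lin c x y) t = c * L2dot x t + L2dot y t.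
Proof.
have [_ <-] := cint_lin c (dot_cintegrable (svalP x) (svalP t)) (dot_cintegrable (svalP y) (svalP t)).
by congr cint; apply/funext => z; rewrite hdotDl hdotZl.
Qed.
Fact L2dot_zero t : L2dot L2zero t = 0.
Proof.
have := L2dot_lin (-1) L2zero L2zero t; rewrite mulN1r addNr => <-.
by congr cint; apply/funext => z; rewrite /= scaler0 addr0.
Qed.
Fact L2dot_conj x y : L2dot x y = Num.conj (L2dot y x).
Proof.
have [rI iI] := dot_cintegrable (svalP y) (svalP x).
apply: complex_ext; rewrite ?Re_conj ?Im_conj /=; first by congr rint; apply/funext => z; rewrite hdotC Re_conj.
rewrite -mulN1r -rintZ//; congr rint; apply/funext => z.
by rewrite hdotC Im_conj mulN1r.
Qed.
Lemma L2dotxx x : L2dot x x = (normsq mu (sval x))%:C%C.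
Proof.
apply: complex_ext => /=; first by congr rint; apply/funext => z; rewrite hnorm_sq.
rewrite (_ : (fun z => _) = (fun z => 0 * hnorm (sval x z) ^+ 2)); last first.
  by apply/funext => z; rewrite hdotxx /= mul0r.
by rewrite rintZ ?mul0r//; exact: sq_integrable_int (svalP x).
Qed.
Fact L2dot_ge0 x : 0 <= L2dot x x.
Proof. by rewrite L2dotxx ler0c normsq_ge0. Qed.

Lemma L2distE x y : complex.Re (L2dot (L2lin (-1) y x) (L2lin (-1) y x)) =
  normsq mu (fun z => sval x z - sval y z).
Proof.
by rewrite L2dotxx /=; congr rint; apply/funext => z; rewrite scaleN1r addrC.
Qed.

Fact L2_complete (u : nat -> L2) :
  let q x y := complex.Re (L2dot (L2lin (-1) y x) (L2lin (-1) y x)) in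
  (forall e : R, 0 < e -> exists M : nat, forall m n : nat,
     (M <= m)%N -> (M <= n)%N -> q (u m) (u n) < e) ->
  exists l : L2, forall e : R, 0 < e -> exists M : nat,
    forall n : nat, (M <= n)%N -> q (u n) l < e.
Proof.
move=> q cu; have [|l hl ul] := @sq_integrable_complete R d Om mu F (fun n => sval (u n)) (fun n => svalP (u n)).
  by move=> e /cu[M hM]; exists M => m n Mm Mn; rewrite -L2distE; exact: hM.
exists (exist _ l hl) => e /ul[M hM]; exists M => n Mn.
by rewrite /q L2distE; exact: hM.
Qed.

Definition L2pre : prehilbert R :=
  PreHilbert L2dot_zero L2dot_lin L2dot_conj L2dot_ge0 L2_complete.

Definition L2hilbert : hilbert R := separated_hilbert L2pre.

(** Sections that are not square-integrable are sent to 0, so that the map is total. *)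
Definition L2class (x : forall z, F z) : L2hilbert :=
  if pselect (sq_integrable mu x) is left h then sep_class (P := L2pre) (exist _ x h) else 0.

Lemma L2classE x (h : sq_integrable mu x) : L2class x = sep_class (P := L2pre) (exist _ x h).
Proof. by rewrite /L2class; case: pselect => // h'; rewrite (Prop_irrelevance h' h). Qed.

Lemma L2class_lin c x y : sq_integrable mu x -> sq_integrable mu y ->
  L2class (fun z => c *: x z + y z) = c *: L2class x + L2class y.
Proof.
move=> hx hy; rewrite (L2classE hx) (L2classE hy) -(@sep_class_lin R L2pre); exact: L2classE.
Qed.

Lemma L2class_dot x y : sq_integrable mu x -> sq_integrable mu y ->
  '[L2class x, L2class y] = cint mu (fun z => '[x z, y z]).
Proof. by move=> hx hy; rewrite (L2classE hx) (L2classE hy); exact: sep_dotE. Qed.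

Lemma L2class_norm x : sq_integrable mu x -> hnorm (L2class x) ^+ 2 = normsq mu x.
Proof.
by move=> hx; rewrite hnorm_sq (L2class_dot hx hx) /=; congr rint; apply/funext => z; rewrite hnorm_sq.
Qed.

Lemma L2class_surj v : exists2 x, sq_integrable mu x & L2class x = v.
Proof. by have [[x hx] <-] := sep_class_surj v; exists x => //; rewrite L2classE. Qed.

End L2Space.

Section DirectIntegral.
Context {R : realType} {O : cstar_algebra R} {d : measure_display} {Om : measurableType d}
  (mu : {measure set Om -> \bar R}) (rho : Om -> representation O) (sec : set (forall z, rho z)).
Hypotheses (sec0 : sec (fun z => 0))
  (seclin : forall (c : R[i]) x y, sec x -> sec y -> sec (fun z => c *: x z + y z))
  (secnorm : forall x, sec x -> measurable_fun setT (fun z => hnorm (x z)))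
  (secres : forall (B : set Om) x, measurable B -> sec x -> sec (fun z => if z \in B then x z else 0))
  (seclim : forall (u : nat -> forall z, rho z) y, (forall n, sec (u n)) ->
    (forall z, hcvg (fun n => u n z) (y z)) -> sec y)
  (secact : forall a x, sec x -> sec (fun z => act a (x z))).

Let F : hfield R Om := @HField R d Om (fun z => rep_space (rho z)) sec sec0 seclin secnorm secres seclim.
Local Notation H := (L2hilbert mu F).

Let act_sq a (x : forall z, F z) : sq_integrable mu x -> sq_integrable mu (fun z => act a (x z) : F z).
Proof.
move=> hx; have hs : hsec (fun z => act a (x z) : F z) by apply: secact; exact: hx.1.
apply/(sq_integrableP mu hs); apply: (rintegrable_le (measurable_normsq hs) (rintegrableZ (cnorm a ^+ 2) (sq_integrable_int hx))).
move=> z; rewrite ger0_norm ?sqr_ge0// -exprMn ler_sqr ?nnegrE ?mulr_ge0 ?hnorm_ge0 ?cnorm_ge0//.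
exact: act_contractive.
Qed.

Let rep (v : H) : forall z, F z := projT1 (cid2 (L2class_surj v)).
Let rep_sq v : sq_integrable mu (rep v).
Proof. by rewrite /rep; case: cid2. Qed.
Let repK v : L2class mu (rep v) = v.
Proof. by rewrite /rep; case: cid2. Qed.

Let dact a (v : H) : H := L2class mu (fun z => act a (rep v z) : F z).

Let dact_dot a (x y : forall z, F z) : sq_integrable mu x -> sq_integrable mu y ->
  '[L2class mu (fun z => act a (x z) : F z), L2class mu y] =
  '[L2class mu x, L2class mu (fun z => act (star a) (y z) : F z)].
Proof.
move=> hx hy; rewrite !L2class_dot//; try exact: act_sq.
by congr cint; apply/funext => z; exact: act_dot.
Qed.

Let dactE a (x : forall z, F z) : sq_integrable mu x ->
  dact a (L2class mu x) = L2class mu (fun z => act a (x z) : F z).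
Proof.
move=> hx; apply: hdot_ext => v; have [y hy <-] := L2class_surj v.
by rewrite [LHS](dact_dot a (rep_sq (L2class mu x)) hy) repK (dact_dot a hx hy).
Qed.

(** The algebra acts fibrewise on square-integrable sections: the action is
    contractive on each fibre, so it preserves integrability and respects equality
    almost everywhere. *)
Lemma direct_integral_exists : exists (pi : representation O) (U : (forall z, rho z) -> pi),
  [/\ forall (c : R[i]) x y, sq_integrable mu (x : forall z, F z) -> sq_integrable mu (y : forall z, F z) ->
        U (fun z => c *: x z + y z) = c *: U x + U y,
      forall x y, sq_integrable mu (x : forall z, F z) -> sq_integrable mu (y : forall z, F z) ->
        hdot pi (U x) (U y) = cint mu (fun z => '[x z, y z]),
      forall v, exists2 x, sq_integrable mu (x : forall z, F z) & U x = v
    & forall a x, sq_integrable mu (x : forall z, F z) ->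
        U (fun z => act a (x z)) = act a (U x)].
Proof.
have lin_ a (c : R[i]) (v w : H) : dact a (c *: v + w) = c *: dact a v + dact a w.
  rewrite -{1}(repK v) -{1}(repK w) -(L2class_lin c (rep_sq v) (rep_sq w)).
  rewrite (dactE a (sq_integrable_lin c (rep_sq v) (rep_sq w))).
  rewrite /dact -(L2class_lin c (act_sq a (rep_sq v)) (act_sq a (rep_sq w))).
  by congr L2class; apply/funext_dep => z; rewrite act_linear.
have bnd a : exists M : R, forall v : H, hnorm (dact a v) <= M * hnorm v.
  exists (cnorm a) => v; have E1 : hnorm (dact a v) ^+ 2 = _ := L2class_norm (act_sq a (rep_sq v)).
  have E2 := L2class_norm (rep_sq v); rewrite (repK v) in E2.
  rewrite -ler_sqr ?nnegrE ?mulr_ge0 ?hnorm_ge0 ?cnorm_ge0// exprMn.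
  rewrite E1 E2 /normsq -rintZ; last exact: sq_integrable_int (rep_sq v).
  apply: rint_le; first exact: sq_integrable_int (act_sq a (rep_sq v)).
    by apply: rintegrableZ; exact: sq_integrable_int (rep_sq v).
  move=> z; rewrite -exprMn ler_sqr ?nnegrE ?mulr_ge0 ?hnorm_ge0 ?cnorm_ge0//.
  exact: act_contractive.
have linalg (c : R[i]) a b (v : H) : dact (c *: a + b) v = c *: dact a v + dact b v.
  rewrite /dact -(L2class_lin c (act_sq a (rep_sq v)) (act_sq b (rep_sq v))).
  by congr L2class; apply/funext_dep => z; rewrite act_linear_alg.
have one (v : H) : dact 1 v = v.
  rewrite -[RHS](repK v) /dact; congr L2class.
  by apply/funext_dep => z; rewrite act1.
have mul a b (v : H) : dact (a * b) v = dact a (dact b v).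
  rewrite [dact b v]/dact (dactE a (act_sq b (rep_sq v))) /dact.
  by congr L2class; apply/funext_dep => z; rewrite actM.
have adj a (v w : H) : '[dact (star a) v, w] = '[v, dact a w].
  rewrite -{1}(repK w) [LHS](dact_dot (star a) (rep_sq v) (rep_sq w)) starK.
  by rewrite -[X in _ = '[X, _]](repK v).
exists (@Representation R O H dact lin_ bnd linalg one mul adj), (@L2class R d Om mu F); split.
- by move=> c x y hx hy; exact: (L2class_lin c hx hy).
- by move=> x y hx hy; exact: (L2class_dot hx hy).
- by move=> v; exact: (L2class_surj v).
- by move=> a x hx; exact: (esym (dactE a hx)).
Qed.

End DirectIntegral.

(** The extra point makes the type pointed; in a direct sum it carries the null
    representation. *)
Definition discrete (I : Type) : Type := option I.

Section Discrete.
Context (I : Type).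
HB.instance Definition _ := Choice.copy (discrete I) {classic (option I)}.
HB.instance Definition _ := isPointed.Build (discrete I) None.
HB.instance Definition _ := @isMeasurable.Build default_measure_display (discrete I)
  setT Logic.I (fun _ _ => Logic.I) (fun _ _ => Logic.I).

End Discrete.

Section DirectSum.
Context {R : realType} {O : cstar_algebra R}.

Definition null_prehilbert : prehilbert R.
Proof.
refine (@PreHilbert R unit tt (fun _ _ _ => tt) (fun _ _ => 0) _ _ _ _ _) => //.
- by move=> c _ _ _; rewrite mulr0 addr0.
- by rewrite conjC0.
- by move=> u q _; exists tt => e e0; exists 0%N.
Defined.

Lemma null_eq (v w : separated_hilbert null_prehilbert) : v = w.
Proof.
have [x <-] := sep_class_surj v; have [y <-] := sep_class_surj w.
by case: x; case: y.
Qed.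

Definition null_rep : representation O.
Proof.
refine (@Representation R O (separated_hilbert null_prehilbert) (fun _ v => v) _ _ _ _ _ _) => //.
- by move=> _; exists 1 => x; rewrite mul1r.
- by move=> c a b x; exact: null_eq.
Defined.

Context {I : Type} (rho : I -> representation O).

Let fib (o : discrete I) : representation O := if o is Some i then rho i else null_rep.
Let mu : {measure set (discrete I) -> \bar R} := @counting (discrete I) R.

Let single i (v : rho i) : forall o, fib o :=
  fun o => match pselect (Some i = o) with left e => eq_rect (Some i) (fun p => fib p) v o e | right _ => 0 end.

Let single_same i v : @single i v (Some i) = v.
Proof. by rewrite /single; case: pselect => // e; rewrite (Prop_irrelevance e erefl). Qed.
Let single_neq i v o : Some i <> o -> @single i v o = 0.
Proof. by rewrite /single; case: pselect. Qed.

Let rint_point (f : discrete I -> R) (o : discrete I) : (forall p, o <> p -> f p = 0) ->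
  rintegrable mu f /\ rint mu f = f o.
Proof.
move=> h; pose g (p : discrete I) : R := \1_[set o] p.
have mo : mu [set o] = 1%E by rewrite /mu /= /counting asboolT// fset_set1 finmap.cardfs1.
have E : f = (fun p => f o * g p).
  apply/funext => p; rewrite /g indicE; have [->|/eqP op] := eqVneq p o.
    by rewrite mem_set ?mulr1.
  by rewrite h 1?memNset ?mulr0//; exact: nesym.
have ig : (\int[mu]_p (g p)%:E = 1)%E by rewrite integral_indic// setIT mo.
have rg : rintegrable mu g.
  apply/integrableP; split; first by [].
  rewrite (eq_integral (fun p => (g p)%:E)); first by rewrite ig ltry.
  by move=> p _; rewrite gee0_abs// lee_fin /g indicE.
rewrite E; split; first exact: rintegrableZ.
by rewrite rintZ// [rint mu g]/Rintegral ig /= /g indicE mem_set.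
Qed.

(** A direct integral for the counting measure, where every section is measurable; the
    embeddings send a vector to the section supported at one point. *)
Lemma direct_sum_exists : exists pi : representation O, is_direct_sum rho pi.
Proof.
have s0 : [set: forall o, fib o] (fun=> 0) by [].
have s1 : forall (c : R[i]) (x y : forall o, fib o), setT x -> setT y -> [set: forall o, fib o] (fun z => c *: x z + y z) by [].
have s2 : forall x : forall o, fib o, setT x -> measurable_fun setT (fun z => hnorm (x z)) by [].
have s3 : forall (B : set (discrete I)) (x : forall o, fib o), measurable B -> setT x ->
   [set: forall o, fib o] (fun z => if z \in B then x z else 0) by [].
have s4 : forall (u : nat -> forall o, fib o) y, (forall n, setT (u n)) ->
    (forall z, hcvg (fun n => u n z) (y z)) -> [set: forall o, fib o] y by [].
have s5 : forall a (x : forall o, fib o), setT x -> [set: forall o, fib o] (fun z => act a (x z)) by [].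
have [pi [U [Ul Ud Us Ua]]] := @direct_integral_exists R O _ (discrete I) mu fib setT s0 s1 s2 s3 s4 s5.
exists pi.
pose F : hfield R (discrete I) := @HField R _ (discrete I) (fun z => rep_space (fib z)) setT s0 s1 s2 s3 s4.
have sing i v : sq_integrable mu (@single i v : forall o, F o).
  apply/sq_integrableP => //; have [] := @rint_point (fun o => hnorm (single v o) ^+ 2) (Some i) => //.
  by move=> p /(@single_neq i v) ->; rewrite hnorm0 expr0n.
have dot i v y : sq_integrable mu (y : forall o, F o) -> '[U (@single i v), U y] = '[v, y (Some i)].
  move=> hy; rewrite Ud//; apply: complex_ext => /=.
    have [|_ ->] := @rint_point (fun o => complex.Re '[single v o, y o]) (Some i); last by rewrite single_same.
    by move=> p /(@single_neq i v) ->; rewrite hdot0l.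
  have [|_ ->] := @rint_point (fun o => complex.Im '[single v o, y o]) (Some i); last by rewrite single_same.
  by move=> p /(@single_neq i v) ->; rewrite hdot0l.
exists (fun i v => U (@single i v)); split.
- move=> i; split=> [c v w|v w]; last by rewrite dot// single_same.
  rewrite -Ul//; congr U; apply/funext_dep => o.
  have [<-|io] := pselect (Some i = o); first by rewrite !single_same.
  by rewrite !single_neq// scaler0 addr0.
- by move=> i j v w ij; rewrite dot// single_neq ?hdot0r// => -[]; exact: nesym.
- move=> i a v; rewrite -Ua//; congr U; apply/funext_dep => o.
  have [<-|io] := pselect (Some i = o); first by rewrite !single_same.
  by rewrite !single_neq// lin0//; exact: act_lin.
apply: total_orth => v hv; have [y hy yv] := Us v.
have y0 o : y o = 0.
  case: o => [i|]; last exact: null_eq.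
  apply: hdot_eq0; rewrite -dot// hdotC yv hv ?conjC0//; by exists i, (y (Some i)).
apply: hdot_eq0; rewrite -yv Ud//; apply: complex_ext => /=.
  have [|_ ->] := @rint_point (fun o => complex.Re '[y o, y o]) None; last by rewrite y0 hdot0l.
  by move=> p _; rewrite y0 hdot0l.
have [|_ ->] := @rint_point (fun o => complex.Im '[y o, y o]) None; last by rewrite y0 hdot0l.
by move=> p _; rewrite y0 hdot0l.
Qed.

End DirectSum.

(** * Square-summable functions on a tail class *)

Section ComplexHilbert.
Context {R : realType}.

Lemma real_cauchy (u : nat -> R) :
  (forall e : R, 0 < e -> exists M : nat, forall m n, (M <= m)%N -> (M <= n)%N -> `|u m - u n| < e) ->
  exists l, forall e : R, 0 < e -> exists M : nat, forall n, (M <= n)%N -> `|u n - l| < e.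
Proof.
move=> cu; have : cauchy (u @ \oo).
  apply: cauchy_exP => e e0; have [M hM] := cu _ e0; exists (u M).
  by exists M => // n /= Mn; rewrite /ball /=; exact: hM.
move=> /cauchy_cvg/cvg_ex[l /cvgrPdist_lt hl]; exists l => e e0.
by have [M _ hM] := hl _ e0; exists M => n Mn; rewrite distrC; exact: hM.
Qed.

Lemma cabs_le_ReIm (z : R[i]) : cabs z <= `|complex.Re z| + `|complex.Im z|.
Proof.
rewrite -ler_sqr ?nnegrE ?cabs_ge0 ?addr_ge0// cabs_sq sqrrD !real_normK ?num_real//.
by rewrite lerD2r lerDl mulrn_wge0// mulr_ge0.
Qed.

Definition complex_prehilbert : prehilbert R.
Proof.
refine (@PreHilbert R R[i] 0 (fun c x y => c * x + y) (fun x y => x * Num.conj y) _ _ _ _ _).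
- by move=> y; rewrite mul0r.
- by move=> c x y z; rewrite mulrDl mulrA.
- by move=> x y; rewrite rmorphM /= conjCK mulrC.
- by move=> x; rewrite mul_conjC_ge0.
move=> u q cu.
have qE x y : q x y = cabs (x - y) ^+ 2.
  by rewrite /q mulN1r addrC mul_conj.
have [|a ha] := @real_cauchy (fun n => complex.Re (u n)).
  move=> e e0; have [M hM] := cu _ (exprn_gt0 2 e0); exists M => m n Mm Mn.
  have := hM m n Mm Mn; rewrite qE ltr_sqr ?nnegrE ?cabs_ge0 ?(ltW e0)// => h.
  by apply: le_lt_trans h; rewrite -ReN -ReD; exact: ler_Re_cabs.
have [|b hb] := @real_cauchy (fun n => complex.Im (u n)).
  move=> e e0; have [M hM] := cu _ (exprn_gt0 2 e0); exists M => m n Mm Mn.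
  have := hM m n Mm Mn; rewrite qE ltr_sqr ?nnegrE ?cabs_ge0 ?(ltW e0)// => h.
  by apply: le_lt_trans h; rewrite -ImN -ImD; exact: ler_Im_cabs.
exists (Complex a b) => e e0; have r0 : 0 < Num.sqrt e / 2 by rewrite divr_gt0// sqrtr_gt0.
have [M hM] := ha _ r0; have [M' hM'] := hb _ r0; exists (maxn M M') => n.
rewrite geq_max => /andP[/hM h1 /hM' h2]; rewrite qE -[ltRHS](sqr_sqrtr (ltW e0)).
rewrite ltr_sqr ?nnegrE ?cabs_ge0 ?sqrtr_ge0//; apply: (le_lt_trans (cabs_le_ReIm _)).
by rewrite ReD ImD ReN ImN /= (splitr (Num.sqrt e)) ltrD.
Defined.

(** The direct sum of copies of the complex line, regarded as a representation of its
    own operators. *)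
Lemma l2_space_exists (X : Type) : exists (H : hilbert R) (e : X -> H),
  orthonormal_family e /\ total_set (range e).
Proof.
pose C := separated_hilbert complex_prehilbert.
pose o : C := sep_class (P := complex_prehilbert) (1 : R[i]).
have oo : '[o, o] = 1 by rewrite [LHS](@sep_dotE R complex_prehilbert) /= conjC1 mulr1.
have nz : exists x : C, x != 0.
  by exists o; apply/eqP => o0; move: oo; rewrite o0 hdot0l => /eqP; rewrite eq_sym oner_eq0.
have idh : star_hom (@id (bounded_operators nz)) by split.
have [pi [V [iV oV tV sV]]] := direct_sum_exists (fun _ : X => operator_rep idh).
exists pi, (fun x => V x o); split.
  by split=> [x|x y xy]; [rewrite (iV x).2|rewrite oV].
apply: total_orth => v hv; apply: (orth_total sV) => _ [x [c ->]].
have [t <-] := sep_class_surj c.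
have -> : (sep_class (P := complex_prehilbert) t : C) = (t : R[i]) *: o.
  rewrite -[RHS]addr0 (_ : 0 = sep_class (P := complex_prehilbert) (0 : R[i])).
    by rewrite -(@sep_class_lin R complex_prehilbert) /= mulr1 addr0.
  apply: esym; apply: (@hdot_eq0 R C).
  by rewrite [LHS](@sep_dotE R complex_prehilbert) /= mul0r.
by rewrite linZ; [rewrite hdotZr hv ?mulr0//; exists x|exact: (iV x).1].
Qed.

End ComplexHilbert.

Section ModelRepresentations.
Context {R : realType} {N : nat} {A : 'M[bool]_N} {O : cstar_algebra R} {s : 'I_N -> O}.
Hypothesis isO : is_cuntz_krieger A s.
Context (x : nat -> 'I_N).
Hypothesis hx : infinite_word A x.

(** The labels of the canonical basis of P(x). *)
Definition tail_class : Type := {y : nat -> 'I_N | infinite_word A y /\ tail_eq y x}.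

Lemma tail_class_base_proof : infinite_word A x /\ tail_eq x x.
Proof. by split=> //; exact: tail_eq_refl. Qed.
Definition tail_class_base : tail_class := exist _ x tail_class_base_proof.

Lemma tail_class_shift_proof (y : tail_class) : infinite_word A (wshift 1 (sval y)) /\ tail_eq (wshift 1 (sval y)) x.
Proof.
case: y => y [hy ty] /=; split; first exact: infinite_word_shift.
exact: tail_eq_trans (tail_eq_shift 1 y) ty.
Qed.
Definition tail_class_shift (y : tail_class) : tail_class := exist _ _ (tail_class_shift_proof y).

Lemma tail_class_ext (y z : tail_class) : sval y = sval z -> y = z.
Proof. by case: y => y hy; case: z => z hz /= e; subst z; rewrite (Prop_irrelevance hy hz). Qed.

Context {H : hilbert R} (e : tail_class -> H).
Hypotheses (oe : orthonormal_family e) (te : total_set (range e)).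

Lemma model_nonzero : exists v : H, v != 0.
Proof.
exists (e tail_class_base); apply/eqP => h.
by have := oe.1 tail_class_base; rewrite h hdot0l => /eqP; rewrite eq_sym oner_eq0.
Qed.

Lemma basis_ext (v w : H) : (forall y, '[v, e y] = '[w, e y]) -> v = w.
Proof.
move=> h; apply/eqP; rewrite -subr_eq0; apply/eqP; apply: (orth_total te) => _ [y _ <-].
by rewrite hdotBl h subrr.
Qed.

Lemma isometry_adjoint_blin (K : hilbert R) (V : H -> K) (W : K -> H) : isometry_into V ->
  (forall u v, '[V u, v] = '[u, W v]) -> blin W.
Proof.
move=> iV VW; have WV v t : '[W v, t] = '[v, V t] by rewrite hdotC -VW -hdotC.
split; first by move=> c u v; apply: hdot_ext => t; rewrite hdotDl hdotZl !WV hdotDl hdotZl.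
exists 1 => u; rewrite mul1r; have [->|h0] := eqVneq (hnorm (W u)) 0; first exact: hnorm_ge0.
have hp : 0 < hnorm (W u) by rewrite lt_neqAle eq_sym h0 hnorm_ge0.
rewrite -(ler_pM2l hp) -expr2 hnorm_sq -VW; apply: (le_trans (ler_norm _)).
apply: (le_trans (ler_Re_cabs _)); apply: (le_trans (cauchy_schwarz _ _)).
by rewrite isometry_norm.
Qed.

Context (c : (nat -> 'I_N) -> R[i]).
Hypothesis c1 : forall w, cabs (c w) = 1.

(** The generators are compressions: [V i] sends a basis vector [y] to the word
    [i y], admissible or not, in the space on all words, and the adjoint of the
    inclusion removes the words outside the tail class. *)
Lemma model_operators : exists S S' : 'I_N -> H -> H,
  [/\ forall i, blin (S i), forall i, adjoint_pair (S i) (S' i),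
      forall i y, A i (sval y 0%N) -> forall z, sval z = wcons i (sval y) -> S i (e y) = c (sval z) *: e z,
      forall i y, ~~ A i (sval y 0%N) -> S i (e y) = 0
    & forall i y, S' i (e y) = if i == sval y 0%N then Num.conj (c (sval y)) *: e (tail_class_shift y) else 0].
Proof.
have [K [f [of_ tf]]] := @l2_space_exists R (nat -> 'I_N).
have fE y z : '[f y, f z] = `[< y = z >]%:R.
  by case: asboolP => [->|]; [exact: of_.1|exact: of_.2].
have eE y z : '[e y, e z] = `[< sval y = sval z >]%:R.
  case: asboolP => [/tail_class_ext ->|yz]; first exact: oe.1.
  by apply: oe.2 => yz'; apply: yz; rewrite yz'.
have cc w : c w * Num.conj (c w) = 1 by rewrite mul_conj c1 expr1n.
have [|iota [ii iE]] := @gram_isometry R H K tail_class e (fun y => f (sval y)) _ te.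
  by move=> y z; rewrite eE fE.
have /choice[V hV] : forall i, exists V : H -> K, isometry_into V /\
    forall y, V (e y) = c (wcons i (sval y)) *: f (wcons i (sval y)).
  move=> i; apply: (@gram_isometry R H K tail_class e (fun y => c (wcons i (sval y)) *: f (wcons i (sval y))) _ te).
  move=> y z; rewrite hdotZl hdotZr eE fE; case: asboolP => [->|yz].
    by rewrite asboolT// mulr1 cc.
  rewrite asboolF ?mulr0// => h; apply: yz.
  by have := congr1 (wshift 1) h; rewrite !wconsK.
have [iota' i'E] := isometry_adjoint ii.
have /choice[V' hV'] : forall i, exists V' : K -> H, forall u v, '[V i u, v] = '[u, V' v].
  by move=> i; exact: isometry_adjoint (hV i).1.
exists (fun i v => iota' (V i v)), (fun i v => V' i (iota v)).
have pair i : adjoint_pair (fun v => iota' (V i v)) (fun v => V' i (iota v)).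
  by move=> u v; rewrite hdotC -i'E -hdotC hV'.
have mat i y z : '[iota' (V i (e y)), e z] = c (wcons i (sval y)) * `[< wcons i (sval y) = sval z >]%:R.
  by rewrite hdotC -i'E -hdotC iE (hV i).2 hdotZl fE.
split=> //.
- move=> i; apply: (@blin_comp R H K H); first exact/isometry_blin/(hV i).1.
  exact: isometry_adjoint_blin ii i'E.
- move=> i y Aiy z ez; apply: basis_ext => t; rewrite mat hdotZl eE ez.
  by congr (_ * _%:R); apply: asbool_equiv_eq.
- move=> i y Aiy; apply: basis_ext => t; rewrite mat hdot0l asboolF ?mulr0// => h.
  have [ht _] := svalP t; have := ht 0%N; rewrite -h /=; exact/negP.
- move=> i y; apply: basis_ext => t; rewrite (adjoint_sym (pair i)) hdotC mat rmorphM /= rmorph_nat.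
  case: eqP => [iy|iy].
    rewrite hdotZl eE; have -> : (wcons i (sval t) = sval y) = (wshift 1 (sval y) = sval t).
      apply/propext; split=> [<-|<-]; first by rewrite wconsK.
      by rewrite iy wcons_head.
    by case: asboolP => [h|_]; rewrite ?mulr0// -h iy wcons_head.
  by rewrite hdot0l asboolF ?mulr0// => h; apply: iy; rewrite -h.
Qed.

Lemma blin_sum (I : Type) (r : seq I) (F : I -> H -> H) : (forall i, blin (F i)) ->
  blin (fun v => \sum_(i <- r) F i v).
Proof.
move=> hF; elim: r => [|i r IH].
  split=> [d u v|]; first by rewrite !big_nil scaler0 addr0.
  by exists 0 => u; rewrite big_nil hnorm0 mul0r.
have [lI [M hM]] := hF i; have [lr [M' hM']] := IH; split.
  by move=> d u v; rewrite !big_cons lI lr scalerDr addrACA.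
exists (M + M') => u; rewrite big_cons mulrDl; apply: (le_trans (hnormD _ _)).
by rewrite lerD.
Qed.

Lemma blinZ (k : R[i]) (F : H -> H) : blin F -> blin (fun v => k *: F v).
Proof.
move=> [lF [M hM]]; split=> [d u v|]; first by rewrite lF scalerDr !scalerA mulrC.
by exists (cabs k * M) => u; rewrite hnormZ -mulrA ler_wpM2l ?cabs_ge0.
Qed.

(** The Cuntz-Krieger relations are checked on basis vectors. *)
Lemma model_rep : exists (phi : O -> bounded_operators model_nonzero) (hphi : star_hom phi),
  let rho := operator_rep hphi in
  [/\ forall i y, A i (sval y 0%N) -> forall z, sval z = wcons i (sval y) ->
        act (r := rho) (s i) (e y) = c (sval z) *: e z
    & forall i y, act (r := rho) (star (s i)) (e y) =
        if i == sval y 0%N then Num.conj (c (sval y)) *: e (tail_class_shift y) else 0].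
Proof.
have [S [S' [bS SS' S1 S0 S'E]]] := model_operators.
have bS' i : blin (S' i) by exact: adjoint_blin (bS i) (SS' i).
have bid : blin (@id H) by split=> //; exists 1 => u; rewrite mul1r.
have cc w : Num.conj (c w) * c w = 1 by rewrite conj_mul c1 expr1n.
have consP i (y : tail_class) : A i (sval y 0%N) -> exists z : tail_class, sval z = wcons i (sval y).
  move=> Aiy; have h : infinite_word A (wcons i (sval y)) /\ tail_eq (wcons i (sval y)) x.
    have [hy ty] := svalP y; split; first exact: infinite_word_cons.
    exact: tail_eq_trans (tail_eq_cons i _) ty.
  by exists (exist (fun w => infinite_word A w /\ tail_eq w x) _ h).
have SS i (y : tail_class) : S' i (S i (e y)) = (A i (sval y 0%N) : nat)%:R *: e y.
  case: (boolP (A i (sval y 0%N))) => Aiy; last by rewrite S0// lin0 ?scale0r//; exact: (bS' i).1.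
  have [z ez] := consP _ _ Aiy; rewrite (S1 _ _ Aiy _ ez) linZ ?S'E ?ez /=; last exact: (bS' i).1.
  rewrite eqxx scalerA mulrC -ez cc !scale1r; congr e; apply: tail_class_ext.
  by rewrite /= ez wconsK.
have S'S i (y : tail_class) : S i (S' i (e y)) = (i == sval y 0%N)%:R *: e y.
  rewrite S'E; case: eqP => [iy|_]; last by rewrite lin0 ?scale0r//; exact: (bS i).1.
  have Aiy : A i (sval (tail_class_shift y) 0%N).
    by rewrite iy; have [hy _] := svalP y; exact: hy.
  have ey : sval y = wcons i (sval (tail_class_shift y)) by rewrite iy wcons_head.
  by rewrite linZ ?(S1 _ _ Aiy _ ey) ?scalerA ?cc ?scale1r//; exact: (bS i).1.
have [||| phi [hphi [h1 h2]]] := @ck_rep_exists R N A O s isO H model_nonzero S S' bS SS'.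
- move=> i v; apply: (total_ind te (csub_eq (blin_comp (blin_comp (bS i) (bS' i)) (bS i)) (bS i))).
  move=> _ [y _ <-] /=; rewrite SS; case: (boolP (A i (sval y 0%N))) => Aiy; first by rewrite scale1r.
  by rewrite scale0r S0// lin0//; exact: (bS i).1.
- move=> i v.
  have b2 : blin (fun v => \sum_j ((A i j : nat)%:R : R[i]) *: S j (S' j v)).
    by apply: blin_sum => j; apply: blinZ; exact: (blin_comp (bS' j) (bS j)).
  apply: (total_ind te (csub_eq (blin_comp (bS i) (bS' i)) b2)) => _ [y _ <-] /=.
  rewrite SS (bigD1 (sval y 0%N))//= S'S eqxx scale1r big1 ?addr0// => j jy.
  by rewrite S'S (negPf jy) scale0r scaler0.
- move=> v; have b2 : blin (fun v => \sum_j S j (S' j v)).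
    by apply: blin_sum => j; exact: (blin_comp (bS' j) (bS j)).
  apply: (total_ind te (csub_eq b2 bid)) => _ [y _ <-] /=.
  rewrite (bigD1 (sval y 0%N))//= S'S eqxx scale1r big1 ?addr0// => j jy.
  by rewrite S'S (negPf jy) scale0r.
exists phi, hphi; split=> [i y Aiy z ez|i y]; first by rewrite h1; exact: S1.
by rewrite h2; exact: S'E.
Qed.

End ModelRepresentations.

(** * The representations P(J;z) and P(K) *)

Section CyclicModels.
Context {R : realType} {N : nat} {A : 'M[bool]_N} {O : cstar_algebra R} {s : 'I_N -> O}.
Hypothesis ck : ck_relations A s.
Hypothesis gen : forall S : set O, closed_star_subalgebra S -> (forall i, S (s i)) -> S = setT.
Implicit Types (pi rho : representation O) (x y : nat -> 'I_N) (J w : seq 'I_N).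
Local Notation opA := (opA (s := s)).
Local Notation opB := (opB (s := s)).
Local Notation coded := (coded (s := s)).
Local Notation branch := (branch (s := s)).

Lemma unit_neq0 pi (v : pi) : hnorm v = 1 -> v <> 0.
Proof. by move=> h v0; move: h; rewrite v0 hnorm0 => /eqP; rewrite eq_sym oner_eq0. Qed.

Lemma hdot_unit pi (v : pi) : hnorm v = 1 -> '[v, v] = 1.
Proof. by move=> h; rewrite hdotxx h expr1n. Qed.

Section Periodic.
Context (i0 : 'I_N) (J : seq 'I_N).
Hypothesis pJ : primitive i0 J.
Hypothesis hJ : infinite_word A (wpow_inf i0 J).
Local Notation x := (wpow_inf i0 J).

Lemma opB_eigen pi (z : R[i]) (v : pi) : coded x v -> cabs z = 1 -> opA J v = z *: v ->
  opB J v = Num.conj z *: v.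
Proof.
move=> hv nz ev; rewrite -[in RHS](opBK ck hJ hv) ev linZ; last exact: (opB_blin _ _).1.
by rewrite scalerA conj_mul nz expr1n scale1r.
Qed.

Lemma iter_opB_eigen pi (z : R[i]) (v : pi) n : coded x v -> cabs z = 1 -> opA J v = z *: v ->
  iter n (opB J) v = Num.conj z ^+ n *: v.
Proof.
move=> hv nz ev; elim: n => [|n IH]; first by rewrite expr0 scale1r.
rewrite /= IH linZ ?(opB_eigen hv nz ev) ?scalerA -?exprSr//; exact: (opB_blin _ _).1.
Qed.

Lemma eigen_branch pi (z : R[i]) (v : pi) k m : coded x v -> cabs z = 1 -> opA J v = z *: v ->
  wshift k x = wshift m x -> exists c : R[i], branch x v (prefix x k) m = c *: v.
Proof.
move=> hv nz ev /(periodic_branch ck pJ hJ)[n [h|h]]; [exists (z ^+ n)|exists (Num.conj z ^+ n)]; rewrite h//.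
  exact: iter_opA_eigen.
exact: iter_opB_eigen.
Qed.

(** The vectors [s_(j_l) ... s_(j_p) v] are coded by the rotated words, which differ
    because [J] is primitive; hence the orthonormality required of P(J;z). *)
Lemma coded_rotation pi (v : pi) (z : R[i]) l : cabs z = 1 -> coded x v -> hnorm v = 1 -> opA J v = z *: v ->
  (l <= size J)%N -> coded (wshift l x) (opA (drop l J) v) /\ hnorm (opA (drop l J) v) = 1.
Proof.
move=> nz hv v1 ev lJ; have n1 : hnorm (opA (drop l J) v) = 1.
  apply: le_anti; rewrite -[X in (_ <= X) && _]v1 (hnorm_opA_le ck)/=.
  have h : hnorm (opA (take l J) (opA (drop l J) v)) = 1.
    by rewrite -opA_cat cat_take_drop ev hnormZ nz v1 mulr1.
  by rewrite -[X in X <= _]h; exact: (hnorm_opA_le ck).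
have xE : wapp (drop l J) x = wshift l x.
  rewrite -[in RHS](wapp_prefix x (size J)) prefix_wpow_inf wpow_inf_shift.
  have := wappK (take l J) (wapp (drop l J) x); rewrite size_takel// -wapp_cat cat_take_drop.
  by move=> ->.
split=> //; case: (coded_opA ck (drop l J) hJ hv) => [/(unit_neq0 n1)//|[_]].
by rewrite xE.
Qed.

Lemma eigen_is_P pi (v : pi) (z : R[i]) : cyclic_vector v -> hnorm v = 1 -> coded x v ->
  cabs z = 1 -> opA J v = z *: v -> is_P s J z pi.
Proof.
move=> cv v1 hv nz ev; exists v; split=> //; first by rewrite -opAE.
split=> [l|l m lm]; rewrite -!opAE.
  by have [_ n1] := coded_rotation nz hv v1 ev (ltnW (ltn_ord l)); rewrite hdot_unit.
have [cl _] := coded_rotation nz hv v1 ev (ltnW (ltn_ord l)).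
have [cm _] := coded_rotation nz hv v1 ev (ltnW (ltn_ord m)).
apply: (coded_orth ck _ _ cl cm); [exact: infinite_word_shift|exact: infinite_word_shift|].
move=> /(primitive_dvd pJ); rewrite !modn_small// => lm'; apply: lm; exact: val_inj.
Qed.

Lemma is_P_eigen pi (z : R[i]) : cabs z = 1 -> is_P s J z pi ->
  exists v : pi, [/\ cyclic_vector v, hnorm v = 1, coded x v & opA J v = z *: v].
Proof.
move=> nz [v [cv v1 ev _]]; have ev' : opA J v = z *: v by rewrite opAE.
by exists v; split=> //; exact: (coded_eigenvector ck pJ nz ev').
Qed.

Lemma is_P_irreducible pi (z : R[i]) : cabs z = 1 -> is_P s J z pi -> irreducible pi.
Proof.
move=> nz /(is_P_eigen nz)[v [cv v1 hv ev]]; apply: (coded_irreducible ck gen hJ hv cv v1) => k m.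
exact: (eigen_branch hv nz ev).
Qed.

Lemma iter_correlation_unitary rho pi (v : rho) (v' : pi) : coded x v -> coded x v' ->
  cyclic_vector v -> cyclic_vector v' ->
  (forall n, '[iter n (opA J) v, v] = '[iter n (opA J) v', v']) -> unitarily_equivalent rho pi.
Proof.
move=> hv hv' cv cv' h; apply: (correlation_unitary ck gen hJ hv hv' cv cv') => k m.
apply: (periodic_correlation ck pJ hJ) => // n; rewrite hdotC h -hdotC//.
Qed.

Lemma iter_correlation_embedding rho pi (v : rho) (v' : pi) : coded x v -> coded x v' ->
  cyclic_vector v -> (forall n, '[iter n (opA J) v, v] = '[iter n (opA J) v', v']) ->
  exists V : rho -> pi, [/\ isometry_into V, intertwiner V & V v = v'].
Proof.
move=> hv hv' cv h; apply: (correlation_embedding ck gen hJ hv hv' cv) => k m.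
apply: (periodic_correlation ck pJ hJ) => // n; rewrite hdotC h -hdotC//.
Qed.

Lemma is_P_unique rho pi (z : R[i]) : cabs z = 1 -> is_P s J z rho -> is_P s J z pi ->
  unitarily_equivalent rho pi.
Proof.
move=> nz /(is_P_eigen nz)[v [cv v1 hv ev]] /(is_P_eigen nz)[v' [cv' v1' hv' ev']].
apply: (iter_correlation_unitary hv hv' cv cv') => n.
by rewrite !(@iter_opA_eigen _ _ _ _ _ _ z)// !hdotZl !hdot_unit.
Qed.

End Periodic.

Section Aperiodic.
Context (x : nat -> 'I_N).
Hypothesis hx : infinite_word A x.
Hypothesis ax : ~ eventually_periodic x.

Lemma aperiodic_is_P pi (v : pi) : cyclic_vector v -> hnorm v = 1 -> coded x v -> is_P_inf s x pi.
Proof.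
move=> cv v1 hv; exists v; split=> //; split=> [n|n m nm]; rewrite -!opBE -!prefixE.
  by rewrite coded_opB_dot// hdot_unit.
apply: (coded_orth ck _ _ (coded_opB ck n.+1 hx hv) (coded_opB ck m.+1 hx hv)).
- exact: infinite_word_shift.
- exact: infinite_word_shift.
- by move=> /(aperiodic_shift ax)[].
Qed.

Lemma is_P_inf_coded pi : is_P_inf s x pi ->
  exists v : pi, [/\ cyclic_vector v, hnorm v = 1 & coded x v].
Proof.
move=> [v [cv v1 [on _]]]; exists v; split=> // -[//|n].
apply: (opB_norm_full ck); rewrite v1 opBE prefixE.
rewrite -ler_sqr ?nnegrE ?hnorm_ge0// expr1n hnorm_sq on //=.
Qed.

Lemma aperiodic_branch pi (v : pi) k m : coded x v -> wshift k x = wshift m x ->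
  branch x v (prefix x k) m = v.
Proof. by move=> hv /(aperiodic_shift ax) ->; exact: hv. Qed.

Lemma is_P_inf_irreducible pi : is_P_inf s x pi -> irreducible pi.
Proof.
move=> /is_P_inf_coded[v [cv v1 hv]]; apply: (coded_irreducible ck gen hx hv cv v1) => k m e.
by exists 1; rewrite scale1r aperiodic_branch.
Qed.

Lemma aperiodic_embedding rho pi (v : rho) (v' : pi) : coded x v -> coded x v' ->
  cyclic_vector v -> '[v, v] = '[v', v'] ->
  exists V : rho -> pi, [/\ isometry_into V, intertwiner V & V v = v'].
Proof.
move=> hv hv' cv h; apply: (correlation_embedding ck gen hx hv hv' cv) => k m e.
by rewrite !aperiodic_branch.
Qed.

Lemma is_P_inf_unique rho pi : is_P_inf s x rho -> is_P_inf s x pi -> unitarily_equivalent rho pi.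
Proof.
move=> /is_P_inf_coded[v [cv v1 hv]] /is_P_inf_coded[v' [cv' v1' hv']].
apply: (correlation_unitary ck gen hx hv hv' cv cv') => k m e.
by rewrite !aperiodic_branch// !hdot_unit.
Qed.

End Aperiodic.
End CyclicModels.

Lemma total_cyclic {R : realType} {O : cstar_algebra R} (pi : representation O) (v : pi) (X : set pi) :
  total_set X -> (forall u, X u -> exists a, u = act a v) -> cyclic_vector v.
Proof.
move=> tX hX x e e0; have [n [c [u [Xu h]]]] := tX x e e0.
have [a ha] := choice (fun i => hX _ (Xu i)).
exists (\sum_i c i *: a i); rewrite act_sum (_ : \sum_i _ = \sum_i c i *: u i)//.
by apply: eq_bigr => i _; rewrite actZ ha.
Qed.

Section ModelVectors.
Context {R : realType} {N : nat} {A : 'M[bool]_N} {O : cstar_algebra R} {s : 'I_N -> O}.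
Hypothesis isO : is_cuntz_krieger A s.
Context {x : nat -> 'I_N}.
Hypothesis hx : infinite_word A x.
Local Notation opA := (opA (s := s)).
Local Notation opB := (opB (s := s)).
Local Notation coded := (coded (s := s)).

(** The generators on basis vectors labelled by words; the action of [s i] itself
    is determined by that of its adjoint. *)
Definition word_model (rho : representation O) (e : tail_class (A := A) x -> rho)
    (c : (nat -> 'I_N) -> R[i]) :=
  [/\ orthonormal_family e, total_set (range e)
    & forall i y, act (star (s i)) (e y) =
        if i == sval y 0%N then Num.conj (c (sval y)) *: e (tail_class_shift y) else 0].

Lemma word_model_exists (c : (nat -> 'I_N) -> R[i]) : (forall w, cabs (c w) = 1) ->
  exists rho e, @word_model rho e c.
Proof.
move=> c1; have [H [e [oe te]]] := @l2_space_exists R (tail_class (A := A) x).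
have [phi [hphi [_ h2]]] := model_rep isO hx oe te c1.
by exists (operator_rep hphi), e; split.
Qed.

Section Model.
Context {rho : representation O} {e : tail_class (A := A) x -> rho} {c : (nat -> 'I_N) -> R[i]}.
Hypothesis me : word_model e c.
Hypothesis c1 : forall w, cabs (c w) = 1.
Let ck : ck_relations A s. Proof. by case: isO. Qed.

Lemma model_opB n (y z : tail_class (A := A) x) : sval z = wshift n (sval y) ->
  opB (prefix (sval y) n) (e y) = Num.conj (\prod_(k < n) c (wshift k (sval y))) *: e z.
Proof.
have [_ _ h] := me; elim: n y => [|n IH] y ez.
  by rewrite big_ord0 rmorph1 scale1r /=; congr e; apply: tail_class_ext; rewrite ez.
rewrite big_ord_recl rmorphM -scalerA /= /opB /= /sb h eqxx.
rewrite -/(opB _ _) linZ; last exact: (opB_blin _ _).1.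
rewrite wshift0; congr (_ *: _).
have -> : wshift 1 (sval y) = sval (tail_class_shift y) by [].
rewrite IH; last by rewrite ez /= wshiftD.
congr (Num.conj _ *: _); apply: eq_bigr => k _; rewrite /= wshiftD//.
Qed.

Lemma tail_class_shiftn n (y : tail_class (A := A) x) : exists z : tail_class (A := A) x, sval z = wshift n (sval y).
Proof.
elim: n => [|n [z hz]]; first by exists y; rewrite wshift0.
by exists (tail_class_shift z); rewrite /= hz wshiftD addn1.
Qed.

Lemma model_norm y : hnorm (e y) = 1.
Proof. by have [[h _] _ _] := me; apply/eqP; rewrite -sqrp_eq1 ?hnorm_ge0// hnorm_sq h. Qed.

Lemma cabs_prod n (f : 'I_n -> R[i]) : (forall k, cabs (f k) = 1) -> cabs (\prod_k f k) = 1.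
Proof.
move=> h; elim/big_ind: _ => [|a b ha hb|//]; first exact: cabs1.
by rewrite cabsM ha hb mulr1.
Qed.

Lemma model_coded y : coded (sval y) (e y).
Proof.
move=> n; apply: (opB_norm_full ck); have [z hz] := tail_class_shiftn n y.
by rewrite (model_opB hz) hnormZ cabs_conj cabs_prod ?mul1r ?model_norm.
Qed.

Lemma model_opA n (y z : tail_class (A := A) x) : sval z = wshift n (sval y) ->
  opA (prefix (sval y) n) (e z) = (\prod_(k < n) c (wshift k (sval y))) *: e y.
Proof.
move=> hz; have := model_coded y n; rewrite (model_opB hz) linZ; last exact: (opA_blin _ _).1.
move=> <-; rewrite scalerA mul_conj cabs_prod// expr1n scale1r//.
Qed.

(** Going down the common tail and up again leads from the base word to any other word
    of the class, up to a phase. *)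
Lemma model_cyclic : cyclic_vector (e (tail_class_base hx)).
Proof.
have [_ te _] := me; apply: (total_cyclic te) => _ [z _ <-].
have [_ [k [m km]]] := svalP z; have [t ht] := tail_class_shiftn m (tail_class_base hx).
have hb := model_opB ht; have ha := model_opA (etrans ht (esym km)).
have [a ea] := branch_act (s := s) x (e (tail_class_base hx)) (prefix (sval z) k) m.
rewrite /= in hb; move: ea; rewrite /branch hb linZ ?ha ?scalerA; last exact: (opA_blin _ _).1.
set d := (X in X *: _ = _) => ea; exists (d^-1 *: a); rewrite actZ -ea scalerA mulVf ?scale1r//.
apply/eqP => d0; have : cabs d = 1 by rewrite cabsM cabs_conj !cabs_prod ?mulr1.
by rewrite d0 cabs0 => /eqP; rewrite eq_sym oner_eq0.
Qed.

End Model.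

(** The phase is put on the single edge that leaves the base word [x]: going once
    around its period then multiplies by [z]. *)
Definition base_phase (z : R[i]) (w : nat -> 'I_N) : R[i] := if `[< w = x >] then z else 1.

Lemma base_phase1 z w : cabs z = 1 -> cabs (base_phase z w) = 1.
Proof. by rewrite /base_phase; case: asboolP => // _ _; exact: cabs1. Qed.

End ModelVectors.

Section ModelClasses.
Context {R : realType} {N : nat} {A : 'M[bool]_N} {O : cstar_algebra R} {s : 'I_N -> O}.
Hypothesis isO : is_cuntz_krieger A s.
Context {i0 : 'I_N}.
Let ck : ck_relations A s. Proof. by case: isO. Qed.

Lemma word_model_is_P J z (rho : representation O) (e : tail_class (A := A) (wpow_inf i0 J) -> rho) :
  primitive i0 J -> infinite_word A (wpow_inf i0 J) -> cabs z = 1 ->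
  word_model (s := s) e (base_phase (x := wpow_inf i0 J) z) -> is_P s J z rho.
Proof.
move=> pJ hJ nz me; pose b := tail_class_base hJ.
have c1 w : cabs (base_phase (x := wpow_inf i0 J) z w) = 1 by exact: base_phase1.
apply: (eigen_is_P ck pJ hJ (model_cyclic isO hJ me c1) (model_norm me b) (model_coded isO me c1 b) nz).
have := @model_opA _ _ _ _ _ isO _ _ _ _ me c1 (size J) b b (esym (wpow_inf_shift i0 J)).
rewrite /= prefix_wpow_inf => ->; congr (_ *: _).
have : (0 < size J)%N by case: pJ => + _; case: (J).
case: (size J) (pJ.2) => // n h _.
(* By primitivity only the first of the words met in one period is the base word. *)
rewrite big_ord_recl wshift0 {1}/base_phase asboolT// big1 ?mulr1// => k _.
rewrite /base_phase asboolF// => hk.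
by have := h (lift ord0 k) isT hk; rewrite lift0 ltnS leqNgt ltn_ord.
Qed.

Lemma word_model_is_P_inf (x : nat -> 'I_N) : infinite_word A x -> ~ eventually_periodic x ->
  exists rho : representation O, is_P_inf s x rho.
Proof.
move=> hx ax; have c1 (w : nat -> 'I_N) : cabs (1 : R[i]) = 1 by exact: cabs1.
have [rho [e me]] := @word_model_exists _ _ _ _ _ isO x hx (fun _ => 1) c1.
exists rho; apply: (aperiodic_is_P ck hx ax (model_cyclic isO hx me c1) (model_norm me _)).
exact: (model_coded isO me c1 (tail_class_base hx)).
Qed.

End ModelClasses.

(** * Measurability on the circle *)

Section CircleMeasurability.
Context {R : realType}.
Local Notation Cir := (borel_circle R).
Implicit Types (f : R[i] -> R).

Lemma circle_open_measurable (G : set R[i]^o) : open G -> measurable [set z : Cir | G (val z)].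
Proof. by move=> oG; apply: sub_sigma_algebra; exists G. Qed.

Definition nonexpansive f := forall z w, `|f z - f w| <= cabs (z - w).

Lemma Re_nonexpansive : nonexpansive (@complex.Re R).
Proof. by move=> z w; rewrite -ReN -ReD ler_Re_cabs. Qed.

Lemma Im_nonexpansive : nonexpansive (@complex.Im R).
Proof. by move=> z w; rewrite -ImN -ImD ler_Im_cabs. Qed.

Lemma complex_ballP (z w : R[i]^o) (e : R) : ball z (e%:C)%C w <-> cabs (z - w) < e.
Proof. by rewrite /ball /= cabsE ltcR. Qed.

Lemma nonexpansive_open f a : nonexpansive f -> open [set z : R[i]^o | a < f z].
Proof.
move=> hf; rewrite openE => z /= az; apply/nbhs_ballP; exists ((f z - a)%:C)%C.
  by rewrite /= ltcR subr_gt0.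
move=> w /complex_ballP h /=; have := le_lt_trans (hf z w) h; have := ler_norm (f z - f w); lra.
Qed.

Lemma nonexpansive_measurable f : nonexpansive f -> measurable_fun setT (fun z : Cir => f (val z)).
Proof.
move=> hf; apply: (measurability (RGenOInfty.G (R := R))) => [|_ [B [a ->] <-]].
  exact: RGenOInfty.measurableE.
rewrite setTI (_ : _ @^-1` _ = [set z : Cir | a < f (val z)]).
  apply: (@circle_open_measurable [set w : R[i]^o | a < f w]); exact: nonexpansive_open.
by apply/funext => z; rewrite /preimage /= in_itv /= andbT.
Qed.

Lemma cabs_circle (z : circle R) : cabs (val z) = 1.
Proof. by rewrite /cabs (eqP (valP z)). Qed.

Lemma circle_mul_measurable (w : Cir) : measurable_fun setT (circle_mul w : Cir -> Cir).
Proof.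
apply: (@measurability _ _ Cir Cir setT (circle_mul w : Cir -> Cir) (@circle_open R)) => // _ [B [G oG ->] <-].
rewrite setTI (_ : _ @^-1` _ = [set z : Cir | [set u : R[i]^o | G (val w * u)] (val z)])//.
apply: circle_open_measurable; rewrite openE => u /= Gu.
move: oG; rewrite openE => /(_ _ Gu)/nbhs_ballP[e e0 he]; apply/nbhs_ballP; exists e => // v uv.
by apply: he; move: uv; rewrite /ball /= -mulrBr normrM (eqP (valP w)) mul1r.
Qed.

Lemma circle_conj_subproof (w : circle R) : `|Num.conj (val w)| == 1.
Proof. by rewrite norm_conjC (valP w). Qed.
Definition circle_conj (w : circle R) : circle R := exist _ (Num.conj (val w)) (circle_conj_subproof w).

Lemma circle_mulK (w z : circle R) : circle_mul w (circle_mul (circle_conj w) z) = z.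
Proof. by apply: val_inj; rewrite /= mulrA mul_conj cabs_circle expr1n mul1r. Qed.

Lemma circle_mulKV (w z : circle R) : circle_mul (circle_conj w) (circle_mul w z) = z.
Proof. by apply: val_inj; rewrite /= mulrA conj_mul cabs_circle expr1n mul1r. Qed.

Lemma measurable_ReIm_pow (k l : nat) :
  let w (z : Cir) := val z ^+ k * Num.conj (val z) ^+ l in
  measurable_fun setT (fun z => complex.Re (w z)) /\ measurable_fun setT (fun z => complex.Im (w z)).
Proof.
pose mz (g : Cir -> R[i]) := measurable_fun setT (fun z => complex.Re (g z)) /\
  measurable_fun setT (fun z => complex.Im (g z)).
have mM g h : mz g -> mz h -> mz (fun z => g z * h z).
  move=> [g1 g2] [h1 h2]; split.
    rewrite (_ : (fun z => _) = (fun z => complex.Re (g z) * complex.Re (h z) - complex.Im (g z) * complex.Im (h z))).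
      by apply: measurable_funB; exact: measurable_funM.
    by apply/funext => z; rewrite ReM.
  rewrite (_ : (fun z => _) = (fun z => complex.Re (g z) * complex.Im (h z) + complex.Im (g z) * complex.Re (h z))).
    by apply: measurable_funD; exact: measurable_funM.
  by apply/funext => z; rewrite ImM.
have m1 : mz (fun=> 1) by split; exact: measurable_cst.
have mv : mz (fun z => val z).
  by split; [exact: (nonexpansive_measurable Re_nonexpansive)|exact: (nonexpansive_measurable Im_nonexpansive)].
have mc : mz (fun z => Num.conj (val z)).
  case: mv => [v1 v2]; split.
    by rewrite (_ : (fun z => _) = (fun z : Cir => complex.Re (val z)))//; apply/funext => z; rewrite Re_conj.
  rewrite (_ : (fun z => _) = (fun z : Cir => - complex.Im (val z))); first exact: measurableT_comp.
  by apply/funext => z; rewrite Im_conj.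
have mX g n : mz g -> mz (fun z => g z ^+ n).
  move=> hg; elim: n => [|n IH].
    by rewrite (_ : (fun z => _) = (fun=> 1))//; apply/funext => z; rewrite expr0.
  rewrite (_ : (fun z => _) = (fun z => g z * g z ^+ n)); first exact: mM.
  by apply/funext => z; rewrite exprS.
by apply: mM; exact: mX.
Qed.

End CircleMeasurability.

Section ComplexIntegral.
Context {R : realType} {d : measure_display} {Om : measurableType d} (mu : {finite_measure set Om -> \bar R}).
Implicit Types (f g : Om -> R[i]) (m : Om -> R).

Lemma rintegrable_bounded m (K : R) (g : Om -> R) : measurable_fun setT m -> (forall z, `|m z| <= K) ->
  rintegrable mu g -> rintegrable mu (fun z => m z * g z).
Proof.
move=> mm hm ig; have mg : measurable_fun setT g.
  by apply/measurable_EFinP; exact: measurable_int ig.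
apply: (@rintegrable_le _ _ _ _ _ (fun z => K * `|g z|)).
- exact: measurable_funM.
- apply: rintegrableZ; exact: integrable_abse ig.
- by move=> z; rewrite normrM ler_wpM2r.
Qed.

Lemma rintegrable_cst (K : R) : rintegrable mu (fun=> K).
Proof. exact: finite_measure_integrable_cst. Qed.

Lemma cintegrable_bounded f g (K : R) : measurable_fun setT (fun z => complex.Re (f z)) ->
  measurable_fun setT (fun z => complex.Im (f z)) -> (forall z, cabs (f z) <= K) ->
  cintegrable mu g -> cintegrable mu (fun z => f z * g z).
Proof.
move=> m1 m2 hK [g1 g2].
have b1 z : `|complex.Re (f z)| <= K by apply: le_trans (hK z); exact: ler_Re_cabs.
have b2 z : `|complex.Im (f z)| <= K by apply: le_trans (hK z); exact: ler_Im_cabs.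
have hh := rintegrable_bounded m1 b1; have hh' := rintegrable_bounded m2 b2.
split.
  apply: (@rintegrable_ext _ _ _ _ (fun z => complex.Re (f z) * complex.Re (g z) + -1 * (complex.Im (f z) * complex.Im (g z)))).
    by move=> z; rewrite ReM mulN1r.
  by apply: rintegrableD; [exact: hh|apply: rintegrableZ; exact: hh'].
apply: (@rintegrable_ext _ _ _ _ (fun z => complex.Re (f z) * complex.Im (g z) + complex.Im (f z) * complex.Re (g z))).
  by move=> z; rewrite ImM.
by apply: rintegrableD; [exact: hh|exact: hh'].
Qed.

(** Dominated convergence. *)
Lemma rint_limit0 (m : nat -> Om -> R) (l : Om -> R) (K : R) (g : Om -> R) :
  (forall n, measurable_fun setT (m n)) -> (forall n z, `|m n z| <= K) ->
  (forall z, m n z @[n --> \oo] --> l z) -> rintegrable mu g ->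
  (forall n, rint mu (fun z => m n z * g z) = 0) -> rint mu (fun z => l z * g z) = 0.
Proof.
move=> mm hK ml ig h0; have mg : measurable_fun setT g.
  by apply/measurable_EFinP; exact: measurable_int ig.
have ib : mu.-integrable setT (fun z => (K * `|g z|)%:E).
  by apply: rintegrableZ; exact: integrable_abse ig.
have := @dominated_cvg _ _ _ mu setT measurableT (fun n z => (m n z * g z)%:E)
  (fun z => (l z * g z)%:E) (fun z => (K * `|g z|)%:E).
move=> /(_ _ _ _ ib _) h.
have {h} : (\int[mu]_z (m n z * g z)%:E)%E @[n --> \oo] --> (\int[mu]_z (l z * g z)%:E)%E.
  apply: h => //.
  - by move=> n; apply/measurable_EFinP; exact: measurable_funM.
  - by move=> z _; apply: cvg_EFin; [exact: nearW|apply: cvgM => //; exact: cvg_cst].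
  - by move=> n z _; rewrite lee_fin normrM ler_wpM2r.
rewrite (_ : (fun n => _) = (fun=> 0%E)).
  move=> /cvg_unique/(_ (cvg_cst _)) h.
  by rewrite /rint /Rintegral h.
apply/funext => n; rewrite rintE ?h0//.
exact: (rintegrable_bounded (mm n) (hK n)).
Qed.

End ComplexIntegral.

(** * Haar measure and Fourier multipliers *)

Section RootsOfUnity.
Context {R : realType}.

Definition expi (t : R) : R[i] := Complex (cos t) (sin t).

Lemma expiD a b : expi (a + b) = expi a * expi b.
Proof. by apply: complex_ext; rewrite ?ReM ?ImM /= ?cosD ?sinD// addrC. Qed.

Lemma expi0 : expi 0 = 1.
Proof. by apply: complex_ext; rewrite /= ?cos0 ?sin0. Qed.

Lemma expiX t n : expi (t * n%:R) = expi t ^+ n.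
Proof. by elim: n => [|n IH]; rewrite ?mulr0 ?expi0 ?expr0// mulrSr mulrDr mulr1 expiD IH exprSr. Qed.

Lemma cabs_expi t : cabs (expi t) = 1.
Proof. by apply/eqP; rewrite -sqrp_eq1 ?cabs_ge0// cabs_sq /= cos2Dsin2. Qed.

Lemma expi_pi : expi (trigo.pi : R) = -1.
Proof. by apply: complex_ext; rewrite ?ReN ?ImN /= ?cospi ?sinpi ?oppr0. Qed.

Lemma norm_cabs (z : R[i]) : cabs z = 1 -> `|z| == 1.
Proof. by rewrite cabsE => ->. Qed.

Lemma circle_nonroot (n : nat) : (0 < n)%N -> exists w : circle R, val w ^+ n = -1.
Proof.
move=> n0; exists (exist (fun z : R[i] => `|z| == 1) (expi (trigo.pi / n%:R)) (norm_cabs (cabs_expi _))).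
by rewrite /= -expiX divfK ?expi_pi// pnatr_eq0 -lt0n.
Qed.

End RootsOfUnity.

Lemma eps_cvg {R : realType} (u : nat -> R) (l : R) :
  (forall e : R, 0 < e -> exists M : nat, forall n, (M <= n)%N -> `|u n - l| < e) ->
  u n @[n --> \oo] --> l.
Proof.
by move=> h; apply/cvgrPdist_lt => e e0; have [M hM] := h e e0; exists M => // n /= /hM; rewrite distrC.
Qed.

Lemma cint0 {R : realType} {d : measure_display} {Om : measurableType d} (mu : {measure set Om -> \bar R}) :
  cint mu (fun=> 0) = 0.
Proof.
have h : rint mu (fun=> 0) = 0 by rewrite /rint /Rintegral integral0.
by apply: complex_ext; rewrite /cint [LHS]h.
Qed.

Section Haar.
Context {R : realType} (eta : probability (borel_circle R) R).
Hypothesis haar : is_haar eta.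
Local Notation Cir := (borel_circle R).

Lemma haar_rint (w : Cir) (f : Cir -> R) : rintegrable eta f -> rintegrable eta (fun z => f (circle_mul w z)) ->
  rint eta (fun z => f (circle_mul w z)) = rint eta f.
Proof.
move=> hf hf'; have mf : measurable_fun setT f by apply/measurable_EFinP; exact: measurable_int hf.
suff : (\int[eta]_z (f z)%:E)%E = (\int[eta]_z (f (circle_mul w z))%:E)%E by rewrite !rintE// => -[->].
have := @integral_pushforward _ _ _ _ _ _ (circle_mul_measurable w) eta setT (EFin \o f).
rewrite preimage_setT => <-//; last exact/measurable_EFinP.
apply: eq_measure_integral => [|? B mB _]; first exact: circle_mul_measurable.
transitivity (eta [set circle_mul (circle_conj w) z | z in B]); first exact/esym/haar.
rewrite /= /pushforward; congr (eta _).
apply/seteqP; split=> z /= => [[u Bu <-]|Bz]; first by rewrite circle_mulK.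
by exists (circle_mul w z) => //; rewrite circle_mulKV.
Qed.

(** Rotation by [w] with [w^n = -1] changes the sign of the integrand. *)
Lemma haar_moment n : (0 < n)%N -> cint eta (fun z => val z ^+ n) = 0.
Proof.
move=> n0; have [w hw] := @circle_nonroot R n n0.
have ig g : cintegrable eta (fun z : Cir => g * val z ^+ n).
  have [m1 m2] := @measurable_ReIm_pow R n 0.
  have h := @cintegrable_bounded _ _ _ eta (fun z : Cir => val z ^+ n * Num.conj (val z) ^+ 0) (fun=> g) 1 m1 m2.
  have {h} [] := h.
  - by move=> z; rewrite expr0 mulr1; elim: (n) => [|k IH]; rewrite ?expr0 ?cabs1// exprS cabsM cabs_circle mul1r.
  - by split; exact: rintegrable_cst.
  by move=> h1 h2; split; [move: h1|move: h2]; apply: rintegrable_ext => z; rewrite expr0 mulr1 mulrC.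
have ig1 : cintegrable eta (fun z : Cir => val z ^+ n).
  by have [h1 h2] := ig 1; split; [move: h1|move: h2]; apply: rintegrable_ext => z; rewrite mul1r.
have [igw1 igw2] : cintegrable eta (fun z : Cir => val (circle_mul w z) ^+ n).
  by have [h1 h2] := ig (-1); split; [move: h1|move: h2]; apply: rintegrable_ext => z; rewrite /= exprMn hw.
have E : cint eta (fun z => val (circle_mul w z) ^+ n) = cint eta (fun z => val z ^+ n).
  have [ig11 ig12] := ig1.
  by apply: complex_ext; [have := haar_rint ig11 igw1|have := haar_rint ig12 igw2].
have ig0 : cintegrable eta (fun _ : Cir => 0 : R[i]) by split; exact: rintegrable_cst.
have [_] := @cint_lin _ _ _ eta (-1) _ _ ig1 ig0.
rewrite cint0 addr0 => h.
have : cint eta (fun z => val z ^+ n) = -1 * cint eta (fun z => val z ^+ n).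
  by rewrite -h -[LHS]E; congr cint; apply/funext => z; rewrite /= exprMn hw addr0.
move/eqP; rewrite mulN1r -subr_eq0 opprK -mulr2n -[_ *+ 2]mulr_natr mulf_eq0 pnatr_eq0 orbF.
by move/eqP.
Qed.

End Haar.

Section FourierUniqueness.
Context {R : realType} (eta : probability (borel_circle R) R).
Local Notation Cir := (borel_circle R).
Implicit Types (f g : Cir -> R[i]) (m : Cir -> R).

Definition monomial k l (z : Cir) : R[i] := val z ^+ k * Num.conj (val z) ^+ l.

Lemma cabs_monomial k l z : cabs (monomial k l z) = 1.
Proof.
have h (u : R[i]) n : cabs u = 1 -> cabs (u ^+ n) = 1.
  by move=> u1; elim: n => [|n IH]; rewrite ?expr0 ?cabs1// exprS cabsM u1 IH mulr1.
by rewrite cabsM !h ?mulr1// ?cabs_conj cabs_circle.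
Qed.

Lemma cintegrable_monomial k l f : cintegrable eta f -> cintegrable eta (fun z => monomial k l z * f z).
Proof.
move=> hf; have [m1 m2] := @measurable_ReIm_pow R k l.
by apply: (cintegrable_bounded (K := 1) m1 m2) => // z; rewrite cabs_monomial.
Qed.

(** All Fourier coefficients vanish, written without negative exponents. *)
Definition moments0 f := cintegrable eta f /\
  forall k l, cint eta (fun z => monomial k l z * f z) = 0.

Lemma moments0_lin c f g : moments0 f -> moments0 g -> moments0 (fun z => c * f z + g z).
Proof.
move=> [f1 f2] [g1 g2]; split; first exact: (cint_lin c f1 g1).1.
move=> k l; rewrite (_ : (fun z => _) = (fun z => c * (monomial k l z * f z) + monomial k l z * g z)).
  by rewrite (cint_lin _ (cintegrable_monomial k l f1) (cintegrable_monomial k l g1)).2 f2 g2 mulr0 addr0.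
by apply/funext => z; rewrite mulrDr mulrCA.
Qed.

Lemma moments0_monomial k l f : moments0 f -> moments0 (fun z => monomial k l z * f z).
Proof.
move=> [f1 f2]; split=> [|k' l']; first exact: cintegrable_monomial.
rewrite -[RHS](f2 (k' + k)%N (l' + l)%N); congr cint; apply/funext => z.
by rewrite /monomial !exprD mulrA; congr (_ * _); rewrite mulrACA.
Qed.

(** Bounded multipliers that preserve the vanishing of all Fourier coefficients:
    an algebra closed under bounded pointwise limits that contains the
    coordinate functions, hence all Borel indicators. *)
Definition multiplier m := [/\ measurable_fun setT m, exists K, forall z, `|m z| <= K
  & forall f, moments0 f -> moments0 (fun z => (m z)%:C%C * f z)].

Lemma multiplier_ext m m' : (forall z, m z = m' z) -> multiplier m -> multiplier m'.
Proof. by move=> /funext ->. Qed.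

Lemma moments0Z c f : moments0 f -> moments0 (fun z => c * f z).
Proof.
move=> hf; have := moments0_lin (c - 1) hf hf.
by rewrite (_ : (fun z => _) = (fun z => c * f z))//; apply/funext => z; rewrite mulrBl mul1r subrK.
Qed.

Lemma multiplier_cst a : multiplier (fun=> a).
Proof. by split=> [||f]; [exact: measurable_cst|exists (`|a|)|exact: moments0Z]. Qed.

Lemma multiplier_lin a m m' : multiplier m -> multiplier m' -> multiplier (fun z => a * m z + m' z).
Proof.
move=> [h1 [K h2] h3] [g1 [K' g2] g3]; split.
- by apply: measurable_funD => //; exact: measurable_funM.
- by exists (`|a| * K + K') => z; rewrite (le_trans (ler_normD _ _))// lerD// normrM ler_wpM2l.
move=> f hf; have := moments0_lin (a%:C)%C (h3 _ hf) (g3 _ hf).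
rewrite (_ : (fun z => _) = (fun z => ((a * m z + m' z)%:C)%C * f z))//.
by apply/funext => z; rewrite rmorphD rmorphM /= mulrDl mulrA.
Qed.

Lemma multiplierM m m' : multiplier m -> multiplier m' -> multiplier (fun z => m z * m' z).
Proof.
move=> [h1 [K h2] h3] [g1 [K' g2] g3]; split.
- exact: measurable_funM.
- by exists (K * K') => z; rewrite normrM ler_pM.
move=> f hf; have := h3 _ (g3 _ hf).
rewrite (_ : (fun z => _) = (fun z => ((m z * m' z)%:C)%C * f z))//.
by apply/funext => z; rewrite rmorphM /= mulrA.
Qed.

Lemma conj_sum (u : R[i]) : 2^-1 * (u + Num.conj u) = (complex.Re u)%:C%C.
Proof.
apply: (@mulfI _ 2); first by rewrite pnatr_eq0.
rewrite mulVKf ?pnatr_eq0// mulr_natl mulr2n.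
by apply: complex_ext; rewrite ?ReD ?ImD ?Re_conj ?Im_conj /= ?subrr ?addr0.
Qed.

Lemma conj_diff (u : R[i]) : (- 'i%C / 2) * (u + - 1 * Num.conj u) = (complex.Im u)%:C%C.
Proof.
rewrite mulrAC -mulrA [_ / 2]mulrC mulrCA; apply: (@mulfI _ 2); first by rewrite pnatr_eq0.
rewrite mulVKf ?pnatr_eq0// mulr_natl mulr2n mulN1r.
by apply: complex_ext; rewrite ?ReM ?ImM ?ReN ?ImN ?ReD ?ImD ?ReN ?ImN ?Re_conj ?Im_conj /=; ring.
Qed.

Lemma moments0_val f : moments0 f -> moments0 (fun z => val z * f z).
Proof.
move=> /(moments0_monomial 1 0); rewrite (_ : (fun z => _) = (fun z : Cir => val z * f z))//.
by apply/funext => z; rewrite /monomial expr1 expr0 mulr1.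
Qed.

Lemma moments0_conj f : moments0 f -> moments0 (fun z => Num.conj (val z) * f z).
Proof.
move=> /(moments0_monomial 0 1); rewrite (_ : (fun z => _) = (fun z : Cir => Num.conj (val z) * f z))//.
by apply/funext => z; rewrite /monomial expr1 expr0 mul1r.
Qed.

Lemma multiplier_Re : multiplier (fun z => complex.Re (val z)).
Proof.
split; first exact: (nonexpansive_measurable Re_nonexpansive).
  by exists 1 => z; rewrite -(cabs_circle z) ler_Re_cabs.
move=> f hf; have := moments0Z 2^-1 (moments0_lin 1 (moments0_val hf) (moments0_conj hf)).
rewrite (_ : (fun z => _) = (fun z => ((complex.Re (val z))%:C)%C * f z))//.
by apply/funext => z; rewrite mul1r -mulrDl mulrA conj_sum.
Qed.

Lemma multiplier_Im : multiplier (fun z => complex.Im (val z)).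
Proof.
split; first exact: (nonexpansive_measurable Im_nonexpansive).
  by exists 1 => z; rewrite -(cabs_circle z) ler_Im_cabs.
move=> f hf; have := moments0Z (- 'i%C / 2) (moments0_lin (-1) (moments0_conj hf) (moments0_val hf)).
rewrite (_ : (fun z => _) = (fun z => ((complex.Im (val z))%:C)%C * f z))//.
by apply/funext => z; rewrite [_ + val z * _]addrC mulrA -mulrDl mulrA conj_diff.
Qed.

(** Dominated convergence, applied to each Fourier coefficient. *)
Lemma multiplier_limit (m : nat -> Cir -> R) (l : Cir -> R) (K : R) : (forall n, multiplier (m n)) ->
  (forall n z, `|m n z| <= K) -> (forall z, m n z @[n --> \oo] --> l z) -> multiplier l.
Proof.
move=> hm hK ml; have ms n : measurable_fun setT (m n) by have [] := hm n.
have mml : measurable_fun setT l by apply: (measurable_fun_cvg ms) => z _; exact: ml.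
have lK z : `|l z| <= K.
  by apply: (cvgr_to_le (cvg_norm (ml z))); apply: nearW => n; exact: hK.
split=> //; first by exists K.
move=> f [f1 f2]; split=> [|k k'].
  apply: (@cintegrable_bounded _ _ _ eta (fun z => (l z)%:C%C) f K) => //.
  by move=> z; rewrite cabs_RC.
have [g1 g2] := cintegrable_monomial k k' f1; set g := (fun z => monomial k k' z * f z) in g1 g2.
have hn n := (let: And3 _ _ h := hm n in h) _ (conj f1 f2).
have hn0 n := (hn n).2 k k'.
have E (a : Cir -> R) z : monomial k k' z * ((a z)%:C%C * f z) =
    Complex (a z * complex.Re (g z)) (a z * complex.Im (g z)).
  rewrite mulrCA -/(g z); apply: complex_ext; rewrite ?ReM ?ImM /= mul0r ?subr0 ?addr0//.
apply: complex_ext; rewrite /cint /=.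
  rewrite (_ : (fun z => _) = (fun z => l z * complex.Re (g z))); last by apply/funext => z; rewrite E.
  apply: (@rint_limit0 _ _ _ eta m l K _ ms hK ml g1) => n.
  have := congr1 (@complex.Re R) (hn0 n); rewrite /cint /= => <-; congr (rint eta _).
  by apply/funext => z; rewrite E.
rewrite (_ : (fun z => _) = (fun z => l z * complex.Im (g z))); last by apply/funext => z; rewrite E.
apply: (@rint_limit0 _ _ _ eta m l K _ ms hK ml g2) => n.
have := congr1 (@complex.Im R) (hn0 n); rewrite /cint /= => <-; congr (rint eta _).
by apply/funext => z; rewrite E.
Qed.

(** Iterating [3 t^2 - 2 t^3] pushes [0, 1] to the fixed points 0 and 1, away
    from the repelling fixed point 1/2. *)
Definition smoothstep (t : R) : R := 3 * t ^+ 2 - 2 * t ^+ 3.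

Lemma smoothstep_sym t : smoothstep (1 - t) = 1 - smoothstep t.
Proof. by rewrite /smoothstep; ring. Qed.

Lemma smoothstep01 t : 0 <= t <= 1 -> 0 <= smoothstep t <= 1.
Proof.
move=> /andP[h1 h2].
have p1 : smoothstep t = t ^+ 2 * (3 - 2 * t) by rewrite /smoothstep; ring.
have p2 : 1 - smoothstep t = (1 - t) ^+ 2 * (1 + 2 * t) by rewrite /smoothstep; ring.
have a1 : 0 <= smoothstep t by rewrite p1 mulr_ge0 ?sqr_ge0//; lra.
have a2 : 0 <= 1 - smoothstep t by rewrite p2 mulr_ge0 ?sqr_ge0//; lra.
lra.
Qed.

Lemma iter_smoothstep01 n t : 0 <= t <= 1 -> 0 <= iter n smoothstep t <= 1.
Proof. by move=> h; elim: n => //= n; exact: smoothstep01. Qed.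

Lemma smoothstep_above (e t : R) : 0 <= e -> 2^-1 + e <= t <= 1 -> 
  2^-1 + e <= smoothstep t <= 1 /\ 1 - smoothstep t <= (1 - e) * (1 - t).
Proof.
move=> e0 /andP[h1 h2].
have p1 : smoothstep t - t = t * (1 - t) * (2 * t - 1) by rewrite /smoothstep; ring.
have p2 : 1 - smoothstep t = (1 - t) * ((1 - t) * (1 + 2 * t)) by rewrite /smoothstep; ring.
have a1 : 0 <= t * (1 - t) * (2 * t - 1) by rewrite !mulr_ge0//; lra.
have a2 : 0 <= (1 - t) * ((1 - t) * (1 + 2 * t)) by rewrite !mulr_ge0//; lra.
have a3 : (1 - t) * (1 + 2 * t) <= 1 - e by nra.
split; first lra.
by rewrite p2 mulrC ler_wpM2r//; lra.
Qed.

Lemma iter_smoothstep_above t : 2^-1 < t <= 1 -> iter n smoothstep t @[n --> \oo] --> (1 : R).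
Proof.
move=> /andP[h1 h2]; set e := t - 2^-1; have e0 : 0 < e by rewrite subr_gt0.
have H n : 2^-1 + e <= iter n smoothstep t <= 1 /\ 1 - iter n smoothstep t <= (1 - e) ^+ n.
  elim: n => [|n [IH1 IH2]] /=; first by rewrite expr0 /e; lra.
  have [g1 g2] := smoothstep_above (ltW e0) IH1; split=> //.
  by rewrite exprS (le_trans g2)// ler_wpM2l// /e; lra.
apply: eps_cvg => d d0; have [||M hM] := @expr_small R (1 - e) d _ _ d0; [rewrite /e; lra|rewrite /e; lra|].
exists M => n /hM hn; have [/andP[_ g1] g2] := H n.
by rewrite distrC ger0_norm ?subr_ge0//; exact: le_lt_trans hn.
Qed.

Lemma iter_smoothstep_limit t : 0 <= t <= 1 ->
  iter n smoothstep t @[n --> \oo] --> (if 2^-1 < t then 1 else if t < 2^-1 then 0 else 2^-1 : R).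
Proof.
move=> t01; case: ifPn => [h|h]; first by apply: iter_smoothstep_above; lra.
case: ifPn => [h'|h'].
  have E n : iter n smoothstep t = 1 - iter n smoothstep (1 - t).
    by elim: n => [|n IH] /=; [rewrite subKr|rewrite IH smoothstep_sym].
  rewrite (_ : (fun n => _) = (fun n => 1 - iter n smoothstep (1 - t))); last exact/funext.
  rewrite -[X in _ --> X](subrr 1); apply: cvgB; first exact: cvg_cst.
  by apply: iter_smoothstep_above; lra.
have -> : t = 2^-1 by lra.
rewrite (_ : (fun n => _) = (fun=> 2^-1)); first exact: cvg_cst.
by apply/funext; elim=> //= n ->; rewrite /smoothstep; field.
Qed.

(** The iterates of [smoothstep] at [m] converge to a function [t] which is the
    indicator except where [m = 1/2]; there it equals 1/2, and [t (2 t - 1)] corrects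
    this value to 0. *)
Lemma multiplier_threshold m : multiplier m -> (forall z, 0 <= m z <= 1) ->
  multiplier (fun z => if (2^-1 < m z)%R then 1 else 0).
Proof.
move=> hm m01; pose l (t : R) : R := if 2^-1 < t then 1 else if t < 2^-1 then 0 else 2^-1.
have hl : multiplier (fun z => l (m z)).
  apply: (@multiplier_limit (fun n z => iter n smoothstep (m z)) _ 1).
  - elim=> //= n IH; have I2 := multiplierM IH IH.
    apply: multiplier_ext (multiplier_lin 3 I2 (multiplier_lin (- 2) (multiplierM IH I2) (multiplier_cst 0))).
    by move=> z; rewrite /= /smoothstep; ring.
  - by move=> n z; have := iter_smoothstep01 n (m01 z) => /andP[h1 h2]; rewrite ger0_norm.
  - by move=> z; exact: iter_smoothstep_limit.
apply: multiplier_ext (multiplierM hl (multiplier_lin 2 hl (multiplier_cst (- 1)))) => z.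
by rewrite /l; case: ifP => _ /=; [|case: ifP => _]; lra.
Qed.

End FourierUniqueness.

(** * Functions with vanishing Fourier coefficients *)

Section BorelMultipliers.
Context {R : realType} (eta : probability (borel_circle R) R).
Local Notation Cir := (borel_circle R).
Local Notation multiplier := (multiplier eta).

Definition multiplier_set (B : set Cir) := multiplier (fun z => if z \in B then 1 else 0).

Lemma multiplier_setP (B : set Cir) (P : Cir -> bool) : (forall z, B z <-> P z) ->
  multiplier (fun z => if P z then 1 else 0) -> multiplier_set B.
Proof.
move=> h; apply: multiplier_ext => z; have -> : (z \in B) = P z by apply/idP/idP => [/set_mem/h|/h/mem_set].
by [].
Qed.

Lemma multiplier_setC B : multiplier_set B -> multiplier_set (~` B).
Proof.
move=> h; apply: multiplier_ext (multiplier_lin (- 1) h (multiplier_cst eta 1)) => z.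
by rewrite in_setC; case: (z \in B) => /=; ring.
Qed.

Lemma multiplier_setI B B' : multiplier_set B -> multiplier_set B' -> multiplier_set (B `&` B').
Proof.
move=> h h'; apply: multiplier_ext (multiplierM h h') => z.
by rewrite in_setI; case: (z \in B); case: (z \in B') => /=; ring.
Qed.

Lemma multiplier_setT : multiplier_set setT.
Proof. by apply: multiplier_ext (multiplier_cst eta 1) => z; rewrite in_setT. Qed.

Lemma multiplier_set_bigcap (F : nat -> set Cir) : (forall n, multiplier_set (F n)) ->
  multiplier_set (\bigcap_n F n).
Proof.
move=> hF; pose G n := [set z | forall k, (k < n)%N -> F k z].
have hG n : multiplier_set (G n).
  elim: n => [|n IH]; first by rewrite (_ : G 0%N = setT); [exact: multiplier_setT|exact/seteqP].
  rewrite (_ : G n.+1 = G n `&` F n); first exact: multiplier_setI.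
  apply/seteqP; split=> z /= h; first by split=> [k kn|]; apply: h => //; exact: ltnW.
  by move=> k; rewrite ltnS leq_eqVlt => /orP[/eqP ->|]; [exact: h.2|exact: h.1].
apply: (multiplier_limit (K := 1) hG) => [n z|z]; first by case: ifP; rewrite ?normr1 ?normr0.
apply: eps_cvg => e e0; case: ifPn => [/set_mem h|h].
  by exists 0%N => n _; rewrite mem_set ?subrr ?normr0// => k _; exact: h.
have [k hk] : exists k, ~ F k z.
  by apply/existsNP => h'; move/negP: h; apply; apply/mem_set => k _; exact: h'.
exists k.+1 => n kn; case: ifPn => [/set_mem/(_ k kn)//|_]; by rewrite subrr normr0.
Qed.

Lemma multiplier_set_bigcup (F : nat -> set Cir) : (forall n, multiplier_set (F n)) ->
  multiplier_set (\bigcup_n F n).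
Proof.
move=> hF; rewrite -[X in multiplier_set X]setCK setC_bigcup; apply: multiplier_setC.
by apply: multiplier_set_bigcap => n; exact: multiplier_setC.
Qed.

Lemma multiplier_set_gt (m : Cir -> R) a : multiplier m -> (forall z, `|m z| <= 1) ->
  multiplier_set [set z | a < m z].
Proof.
(* The affine map takes the values of [m] into [0, 1] and sends [a] to the threshold 1/2. *)
move=> hm m1; set k := (2 * (1 + `|a|))^-1 : R.
have k0 : 0 < k by rewrite invr_gt0 mulr_gt0// ltr_pwDl.
have kE : k * (2 * (1 + `|a|)) = 1 by rewrite mulVf// gt_eqF// mulr_gt0// ltr_pwDl.
apply: (@multiplier_setP _ (fun z => 2^-1 < k * m z + (2^-1 - k * a))).
  move=> z /=; rewrite addrCA ltrDl -mulrBr pmulr_rgt0// subr_gt0; by [].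
apply: multiplier_threshold => [|z].
  exact: multiplier_ext (multiplier_lin k hm (multiplier_cst eta (2^-1 - k * a))).
have := m1 z; rewrite ler_norml => /andP[h1 h2].
have [h3 h4] : a <= `|a| /\ - `|a| <= a by split; [exact: ler_norm|exact: lerNnormlW].
apply/andP; split; nra.
Qed.

Lemma multiplier_set_lt (m : Cir -> R) a : multiplier m -> (forall z, `|m z| <= 1) ->
  multiplier_set [set z | m z < a].
Proof.
move=> hm m1; have hN := multiplier_lin (- 1) hm (multiplier_cst eta 0).
have := @multiplier_set_gt _ (- a) hN; rewrite (_ : [set z | _] = [set z | m z < a]).
  by apply=> z; rewrite addr0 mulN1r normrN.
by apply/seteqP; split=> z /=; rewrite addr0 mulN1r ltrN2.
Qed.

Lemma Re_circle1 (z : Cir) : `|complex.Re (val z)| <= 1.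
Proof. by rewrite -(cabs_circle z) ler_Re_cabs. Qed.

Lemma Im_circle1 (z : Cir) : `|complex.Im (val z)| <= 1.
Proof. by rewrite -(cabs_circle z) ler_Im_cabs. Qed.

Definition square (p : rat * rat * nat) : set R[i] := [set u |
  `|complex.Re u - ratr p.1.1| < p.2.+1%:R^-1 /\ `|complex.Im u - ratr p.1.2| < p.2.+1%:R^-1].

Lemma multiplier_square p : multiplier_set [set z : Cir | square p (val z)].
Proof.
have X := multiplier_Re eta; have Y := multiplier_Im eta.
pose a := ratr p.1.1 : R; pose b := ratr p.1.2 : R; pose d := p.2.+1%:R^-1 : R.
have -> : [set z : Cir | square p (val z)] =
    ([set z : Cir | a - d < complex.Re (val z)] `&` [set z : Cir | complex.Re (val z) < a + d]) `&`
    ([set z : Cir | b - d < complex.Im (val z)] `&` [set z : Cir | complex.Im (val z) < b + d]).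
  apply/seteqP; split=> z; rewrite /square /= !ltr_distl -/a -/b -/d.
    by move=> [/andP[-> ->] /andP[-> ->]].
  by move=> [[-> ->] [-> ->]].
apply: multiplier_setI; apply: multiplier_setI.
- exact: (multiplier_set_gt _ X Re_circle1).
- exact: (multiplier_set_lt _ X Re_circle1).
- exact: (multiplier_set_gt _ Y Im_circle1).
- exact: (multiplier_set_lt _ Y Im_circle1).
Qed.

Lemma square_code : exists (enc : rat * rat * nat -> nat) (dec : nat -> option (rat * rat * nat)),
  forall p, dec (enc p) = Some p.
Proof. by exists pickle, unpickle; exact: pickleK. Qed.

(** An open set is the union of the squares with rational data that it contains. *)
Lemma multiplier_open (B : set Cir) : circle_open B -> multiplier_set B.
Proof.
move=> [G oG ->]; have [enc [dec encK]] := square_code.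
pose F n : set Cir := if dec n is Some p then
  if `[< square p `<=` G >] then [set z : Cir | square p (val z)] else set0 else set0.
have h0 : multiplier_set set0 by rewrite -setCT; exact/multiplier_setC/multiplier_setT.
have hF n : multiplier_set (F n).
  rewrite /F; case: (dec n) => [p|]; last exact: h0.
  by case: asboolP => _; [exact: multiplier_square|exact: h0].
rewrite (_ : [set z | _] = \bigcup_n F n); first exact: multiplier_set_bigcup.
apply/seteqP; split=> z /=; last first.
  by move=> [n _]; rewrite /F; case: (dec n) => // p; case: asboolP => // h /h.
move=> Gz; move: oG; rewrite openE => /(_ _ Gz)/nbhs_ballP[e e0 he].
have [r re] : exists r : R, e = (r%:C)%C.
  by case: e e0 {he} => a b /=; rewrite ltcE /= => /andP[/eqP ib _]; exists a; apply: complex_ext => //=.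
move: e0 he; rewrite re /= ltcR => r0 he.
have [n hn] := inv_small (divr_gt0 r0 (ltr0n _ 4)); have dn := hn n (leqnn n).
set d := n.+1%:R^-1 in dn; have d0 : 0 < d by rewrite invr_gt0.
have near c : exists q : rat, `|c - ratr q| < d.
  have [|q] := @rat_in_itvoo R (c - d) (c + d); first by rewrite ltrD2l gtrN.
  by rewrite in_itv /= -ltr_distlC => h; exists q.
have [q1 n1] := near (complex.Re (val z)); have [q2 n2] := near (complex.Im (val z)).
exists (enc (q1, q2, n)) => //; rewrite /F encK asboolT /square /=; first by split.
move=> u /= [k1 k2]; apply: he; apply/complex_ballP; apply: (le_lt_trans (cabs_le_ReIm _)).
rewrite ReD ImD ReN ImN.
have t1 := ler_distD (ratr q1) (complex.Re (val z)) (complex.Re u).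
have t2 := ler_distD (ratr q2) (complex.Im (val z)) (complex.Im u).
rewrite distrC in k1; rewrite distrC in k2; rewrite -/d in k1 k2.
move: t1 t2 n1 n2 k1 k2 dn r0; clear; lra.
Qed.

Lemma multiplier_measurable (B : set Cir) : measurable B -> multiplier_set B.
Proof.
apply: smallest_sub; last exact: multiplier_open.
split.
- by rewrite -setCT; exact/multiplier_setC/multiplier_setT.
- by move=> C hC; rewrite setTD; exact: multiplier_setC.
- exact: multiplier_set_bigcup.
Qed.

(** On the set where [g] is positive the integral vanishes, and [|g| = 2 g^+ - g]; so
    [|g|] has integral 0. *)
Lemma ae_eq0_of_integrals (g : Cir -> R) : rintegrable eta g ->
  (forall B, measurable B -> rint eta (fun z => (if z \in B then 1 else 0) * g z) = 0) ->
  \forall z \ae eta, g z = 0.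
Proof.
move=> ig h; have mg : measurable_fun setT g by apply/measurable_EFinP; exact: measurable_int ig.
have mB : measurable [set z | 0 < g z].
  rewrite (_ : [set z | _] = setT `&` g @^-1` `]0, +oo[%classic); first exact: mg.
  by apply/seteqP; split=> z; rewrite /preimage /= in_itv /= andbT => // -[].
set B := [set z | 0 < g z] in mB.
have i1 : rintegrable eta (fun z => (if z \in B then 1 else 0) * g z).
  apply: (@rintegrable_bounded _ _ _ eta _ 1 _ _ _ ig) => [|z]; last by case: ifP; rewrite ?normr1 ?normr0.
  rewrite (_ : (fun z => _) = \1_B); first exact: measurable_indic.
  by apply/funext => z; rewrite indicE; case: ifP.
have E z : `|g z| = 2 * ((if z \in B then 1 else 0) * g z) + -1 * g z.
  case: ifPn => [/set_mem|/negP]; first by move=> /= g0; rewrite gtr0_norm//; lra.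
  move=> nB; rewrite ler0_norm; first lra.
  by rewrite leNgt; apply/negP => g0; apply: nB; exact/mem_set.
have h1 : rint eta g = 0.
  by have := h _ measurableT; congr (_ = _); congr (rint eta _); apply/funext => z; rewrite in_setT mul1r.
have i2 : rintegrable eta (fun z => `|g z|).
  by apply: (rintegrable_ext (fun z => esym (E z))); apply: rintegrableD; exact: rintegrableZ.
have r0 : rint eta (fun z => `|g z|) = 0.
  rewrite (_ : (fun z => _) = (fun z => 2 * ((if z \in B then 1 else 0) * g z) + -1 * g z)); last exact/funext.
  by rewrite rintD ?rintZ ?h ?h1 ?mulr0 ?addr0//; exact: rintegrableZ.
have /(ae_eq_integral_abs eta measurableT)[+ _] : measurable_fun setT (EFin \o g) by exact/measurable_EFinP.
rewrite (_ : (\int[eta]_x `|(EFin \o g) x|)%E = (\int[eta]_x (`|g x|)%:E)%E)//.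
rewrite rintE// r0 => /(_ erefl); apply: filterS => z /(_ Logic.I) /= [].
by [].
Qed.

(** All Borel indicators are multipliers, so [f] has integral 0 over every Borel set. *)
Theorem fourier_uniqueness (f : Cir -> R[i]) : moments0 eta f -> \forall z \ae eta, f z = 0.
Proof.
move=> hf; have [[f1 f2] _] := hf.
have h B : measurable B -> cint eta (fun z => ((if z \in B then 1 else 0)%:C)%C * f z) = 0.
  move=> mB; have [_ _ /(_ f hf)[_ /(_ 0%N 0%N)]] := multiplier_measurable mB.
  rewrite (_ : (fun z => _) = (fun z => ((if z \in B then 1 else 0)%:C)%C * f z))//.
  by apply/funext => z; rewrite /monomial !expr0 !mul1r.
have R0 : \forall z \ae eta, complex.Re (f z) = 0.
  apply: ae_eq0_of_integrals => // B mB; apply: etrans (congr1 (@complex.Re R) (h _ mB)); rewrite /cint /=.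
  by congr (rint eta _); apply/funext => z; rewrite ReM /= mul0r subr0.
have I0 : \forall z \ae eta, complex.Im (f z) = 0.
  apply: ae_eq0_of_integrals => // B mB; apply: etrans (congr1 (@complex.Im R) (h _ mB)); rewrite /cint /=.
  by congr (rint eta _); apply/funext => z; rewrite ImM /= mul0r addr0.
by apply: filterS2 R0 I0 => z r i; apply: complex_ext.
Qed.

End BorelMultipliers.

(** * Measurable fields of representations *)

Lemma hcvg_dot {R : realType} {H : hilbert R} (u : nat -> H) (l y : H) : hcvg u l ->
  (complex.Re '[u n, y] @[n --> \oo] --> complex.Re '[l, y]) /\
  (complex.Im '[u n, y] @[n --> \oo] --> complex.Im '[l, y]).
Proof.
move=> ul; have h e : 0 < e -> exists M : nat, forall n, (M <= n)%N -> cabs ('[u n, y] - '[l, y]) < e.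
  move=> e0; have [d d0 hd] := mulr_smallP e0 (hnorm_ge0 y); have [M hM] := ul d d0; exists M => n /hM hn.
  rewrite -hdotBl; apply: (le_lt_trans (cauchy_schwarz _ _)); rewrite mulrC; apply: le_lt_trans hd.
  by rewrite ler_wpM2l ?hnorm_ge0 ?ltW.
split; apply: eps_cvg => e /h[M hM]; exists M => n /hM; apply: le_lt_trans.
  by rewrite -ReN -ReD ler_Re_cabs.
by rewrite -ImN -ImD ler_Im_cabs.
Qed.

Section CMeasurable.
Context {R : realType}.
Local Notation Cir := (borel_circle R).
Implicit Types (f g : Cir -> R[i]).

Lemma cmeasurableM f g : cmeasurable f -> cmeasurable g -> cmeasurable (fun z => f z * g z).
Proof.
move=> [f1 f2] [g1 g2]; split.
  rewrite (_ : (fun z => _) = (fun z => complex.Re (f z) * complex.Re (g z) - complex.Im (f z) * complex.Im (g z))).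
    by apply: measurable_funB; exact: measurable_funM.
  by apply/funext => z; rewrite ReM.
rewrite (_ : (fun z => _) = (fun z => complex.Re (f z) * complex.Im (g z) + complex.Im (f z) * complex.Re (g z))).
  by apply: measurable_funD; exact: measurable_funM.
by apply/funext => z; rewrite ImM.
Qed.

Lemma cmeasurableD f g : cmeasurable f -> cmeasurable g -> cmeasurable (fun z => f z + g z).
Proof.
move=> [f1 f2] [g1 g2]; split.
  by rewrite (_ : (fun z => _) = (fun z => complex.Re (f z) + complex.Re (g z)));
    [exact: measurable_funD|apply/funext => z; rewrite ReD].
by rewrite (_ : (fun z => _) = (fun z => complex.Im (f z) + complex.Im (g z)));
  [exact: measurable_funD|apply/funext => z; rewrite ImD].
Qed.

Lemma cmeasurable_conj f : cmeasurable f -> cmeasurable (fun z => Num.conj (f z)).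
Proof.
move=> [f1 f2]; split.
  by rewrite (_ : (fun z => _) = (fun z => complex.Re (f z)))//; apply/funext => z; rewrite Re_conj.
rewrite (_ : (fun z => _) = (fun z => - complex.Im (f z))); first exact: measurableT_comp.
by apply/funext => z; rewrite Im_conj.
Qed.

Lemma cmeasurable_cst (c : R[i]) : cmeasurable (fun=> c).
Proof. by split; exact: measurable_cst. Qed.

Lemma cmeasurable_real (f : Cir -> R) : measurable_fun setT f -> cmeasurable (fun z => (f z)%:C%C).
Proof. by move=> mf; split=> //=; exact: measurable_cst. Qed.

Lemma cmeasurable_val : cmeasurable (fun z : Cir => val z).
Proof.
by split; [exact: (nonexpansive_measurable Re_nonexpansive)|exact: (nonexpansive_measurable Im_nonexpansive)].
Qed.

Lemma cmeasurable_limit (H : Cir -> hilbert R) (u : nat -> forall z, H z) (l y : forall z, H z) :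
  (forall n, cmeasurable (fun z => '[u n z, y z])) -> (forall z, hcvg (fun n => u n z) (l z)) ->
  cmeasurable (fun z => '[l z, y z]).
Proof.
move=> mu ul; split.
  by apply: (measurable_fun_cvg (fun n => (mu n).1)) => z _; exact: (hcvg_dot (y z) (ul z)).1.
by apply: (measurable_fun_cvg (fun n => (mu n).2)) => z _; exact: (hcvg_dot (y z) (ul z)).2.
Qed.

End CMeasurable.

Section FieldSections.
Context {R : realType} {O : cstar_algebra R} (F : rep_field O).
Local Notation Cir := (borel_circle R).
Implicit Types (x y : forall z, F z).

(** By polarisation, as only norms of sections are measurable by assumption. *)
Lemma msection_dot x y : msection x -> msection y -> cmeasurable (fun z => '[x z, y z]).
Proof.
have mRe x' y' : msection x' -> msection y' -> measurable_fun setT (fun z => complex.Re '[x' z, y' z]).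
  move=> hx hy; have hc c : measurable_fun setT (fun z => hnorm (c *: y' z + x' z) ^+ 2).
    by apply: measurable_funX; exact: (msection_norm (msection_linear c hy hx)).
  rewrite (_ : (fun z => _) = (fun z => 4^-1 * (hnorm (1 *: y' z + x' z) ^+ 2 - hnorm ((-1) *: y' z + x' z) ^+ 2))).
    by apply: measurable_funM => //; exact: measurable_funB.
  by apply/funext => z; rewrite scale1r scaleN1r ![_ + x' z]addrC hnormD_sq hnormB_sq; lra.
move=> hx hy; split; first exact: mRe.
have h0 : msection (fun z => 0 : F z).
  have := msection_linear (-1) hx hx.
  by rewrite (_ : (fun z => _) = (fun z => 0))//; apply: funext_dep => z; rewrite scaleN1r addNr.
have := mRe _ _ hx (msection_linear 'i%C hy h0); congr (measurable_fun _ _); apply/funext => z.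
by rewrite addr0 hdotZr imaginary_mul_conj mulNr ReN ReM /= mul0r mul1r sub0r opprK.
Qed.

Lemma msection0 : msection (fun z => 0 : F z).
Proof. by apply: msection_maximal => x hx; rewrite (_ : (fun z => _) = (fun=> 0)); [exact: cmeasurable_cst|apply/funext => z; rewrite hdot0r]. Qed.

Lemma msection_scale (f : Cir -> R) x : measurable_fun setT f -> msection x ->
  msection (fun z => (f z)%:C%C *: x z).
Proof.
move=> mf hx; apply: msection_maximal => y hy.
rewrite (_ : (fun z => _) = (fun z => Num.conj ((f z)%:C)%C * '[y z, x z])).
  by apply: cmeasurableM; [exact/cmeasurable_conj/cmeasurable_real|exact: msection_dot].
by apply/funext => z; rewrite hdotZr.
Qed.

Lemma msection_limit (u : nat -> forall z, F z) y : (forall n, msection (u n)) ->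
  (forall z, hcvg (fun n => u n z) (y z)) -> msection y.
Proof.
move=> hu uy; apply: msection_maximal => x hx.
rewrite (_ : (fun z => _) = (fun z => Num.conj '[y z, x z])).
  apply: cmeasurable_conj; apply: (@cmeasurable_limit _ (fun z => F z) u y x) => // n; exact: msection_dot.
by apply/funext => z; rewrite -hdotC.
Qed.

Lemma msection_restrict (B : set Cir) x : measurable B -> msection x ->
  msection (fun z => if z \in B then x z else 0).
Proof.
move=> mB hx; have := msection_scale (@measurable_indic _ _ R setT _ mB) hx.
rewrite (_ : (fun z => _) = (fun z => if z \in B then x z else 0))//.
by apply: funext_dep => z; rewrite indicE; case: ifP; rewrite ?scale1r ?scale0r.
Qed.

Definition section_field : hfield R Cir :=
  @HField R _ Cir (fun z => rep_space (F z)) (msection (r := F)) msection0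
    (@msection_linear R O F) (@msection_norm R O F) msection_restrict msection_limit.

Lemma field_integral_exists (eta : probability Cir R) : exists pi, is_direct_integral eta F pi.
Proof.
have [pi [U [U1 U2 U3 U4]]] := direct_integral_exists eta msection0 (@msection_linear R O F)
  (@msection_norm R O F) msection_restrict msection_limit (@msection_act R O F).
by exists pi, U; split.
Qed.

End FieldSections.

Section ConstantField.
Context {R : realType} {N : nat} {A : 'M[bool]_N} {O : cstar_algebra R} {s : 'I_N -> O}.
Hypothesis isO : is_cuntz_krieger A s.
Context (i0 : 'I_N) (J : seq 'I_N).
Hypothesis pJ : primitive i0 J.
Local Notation x := (wpow_inf i0 J).
Hypothesis hJ : infinite_word A x.
Local Notation Cir := (borel_circle R).
Let ck : ck_relations A s. Proof. by case: isO. Qed.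
Let gen : forall S : set O, closed_star_subalgebra S -> (forall i, S (s i)) -> S = setT.
Proof. by case: isO. Qed.
Local Notation words := (tail_class (A := A) x).

(** A word of the class is a finite word followed by a shift of [x], so the class is
    countable. *)
Lemma words_code : exists (code : words -> nat) (dec : nat -> option words),
  (forall y, dec (code y) = Some y) /\ forall n y, dec n = Some y -> code y = n.
Proof.
have /choice[wm hwm] : forall y : words, exists p : seq 'I_N * nat, sval y = wapp p.1 (wshift p.2 x).
  by move=> y; have [_ [k [m e]]] := svalP y; exists (prefix (sval y) k, m); rewrite /= -e wapp_prefix.
pose code y := pickle (wm y).
have cI : injective code.
  by move=> y y' /(pcan_inj pickleK) e; apply: tail_class_ext; rewrite !hwm e.
exists code, (fun n => if pselect (exists y, code y = n) is left h then Some (projT1 (cid h)) else None).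
split=> [y|n y]; case: pselect => [h|h].
- by congr Some; apply: cI; exact: projT2 (cid h).
- by exfalso; apply: h; exists y.
- by move=> [<-]; exact: projT2 (cid h).
- by [].
Qed.

(** All fibers live on the same space of square-summable functions on the tail
    class, so the measurable fields are the fields with measurable coordinates. *)
Theorem constant_field_exists : exists F : rep_field O, forall z, is_P s J (val z) (F z).
Proof.
have [H [e [oe te]]] := @l2_space_exists R words.
pose c (z : Cir) := base_phase (x := x) (val z).
have c1 z w : cabs (c z w) = 1 by apply: base_phase1; exact: cabs_circle.
pose B := bounded_operators (model_nonzero hJ oe).
have /choice[phi hphi] : forall z, exists phi : {phi : O -> B | star_hom phi},
    forall i (y : words), act (r := operator_rep (svalP phi)) (star (s i)) (e y) =
        if i == sval y 0%N then Num.conj (c z (sval y)) *: e (tail_class_shift y) else 0.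
  by move=> z; have [p [hp [_ h]]] := model_rep isO hJ oe te (c1 z); exists (exist _ p hp).
pose F z : representation O := operator_rep (svalP (phi z)).
have me z : word_model (s := s) (rho := F z) e (c z).
  by split; [exact: oe|exact: te|exact: hphi].
pose sec : set (forall z, F z) := [set v | forall y : words, cmeasurable (fun z => '[v z, e y : F z])].
have [code [dec [codeK decK]]] := words_code.
have seclin (k : R[i]) (v v' : forall z, F z) : sec v -> sec v' -> sec (fun z => k *: v z + v' z).
  move=> hv hv'; rewrite /sec /= => w; rewrite (_ : (fun z => _) = (fun z => k * '[v z, e w] + '[v' z, e w])).
    by apply: cmeasurableD => //; apply: cmeasurableM => //; exact: cmeasurable_cst.
  by apply/funext => z; rewrite hdotDl hdotZl.
have seclim (u : nat -> forall z, F z) (v : forall z, F z) : (forall n, sec (u n)) ->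
    (forall z, hcvg (fun n => u n z) (v z)) -> sec v.
  by move=> hu uv y; apply: (@cmeasurable_limit _ (fun z => F z) u v (fun=> e y)) => // n; exact: hu.
have secnorm (v : forall z, F z) : sec v -> measurable_fun setT (fun z => hnorm (v z)).
  move=> hv; pose t n : seq {classic words} := pmap dec (iota 0 n).
  have ut n : uniq (t n).
    apply: (@pmap_uniq nat {classic words} (dec : nat -> option {classic words}) (code : {classic words} -> nat)); last exact: iota_uniq.
    by move=> k; case E: (dec k) => [y|] //=; rewrite (decK _ _ E).
  have tP n (y : words) : (code y < n)%N -> (y : {classic words}) \in t n.
    by move=> h; rewrite mem_pmap; apply/mapP; exists (code y); rewrite ?mem_iota// codeK.
  have sq : measurable_fun setT (fun z => hnorm (v z) ^+ 2).
    apply: (@measurable_fun_cvg _ _ _ _ (fun n z => \sum_(y <- t n) cabs '[v z, e y : F z] ^+ 2)) => [n|z _].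
      apply: measurable_sum => y; have [h1 h2] := hv y.
      rewrite (_ : (fun z => _) = (fun z => complex.Re '[v z, e y : F z] ^+ 2 + complex.Im '[v z, e y : F z] ^+ 2)).
        by apply: measurable_funD; exact: measurable_funX.
      by apply/funext => z; rewrite cabs_sq.
    have oec : orthonormal_family (fun y : {classic words} => e y : F z) by [].
    apply: eps_cvg => d d0; have [s' us' hs'] := parseval_approx oec (te (v z)) d0.
    exists (\max_(y <- s') (code y).+1)%N => n hn.
    have st : {subset s' <= t n}.
      move=> y ys; apply: tP; apply: leq_trans hn.
      by rewrite (@leq_bigmax_seq _ s' (fun=> true) (fun y => (code y).+1) y).
    have := hs' _ (ut n) st; have := bessel oec (v z) (ut n).
    rewrite ltr_distl => h1 h2; apply/andP; split; lra.
  rewrite (_ : (fun z => _) = Num.sqrt \o (fun z => hnorm (v z) ^+ 2)).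
    by apply: measurableT_comp sq; apply: continuous_measurable_fun; exact: sqrt_continuous.
  by apply/funext => z; rewrite /= sqrtr_sqr ger0_norm ?hnorm_ge0.
have sece y : sec (fun=> e y).
  by move=> y'; exact: (cmeasurable_cst '[e y, e y']).
have secmax (v : forall z, F z) :
    (forall w, sec w -> cmeasurable (fun z => hdot (F z) (w z) (v z))) -> sec v.
  move=> h y; rewrite (_ : (fun z => _) = (fun z => Num.conj '[e y : F z, v z])).
    exact/cmeasurable_conj/(h _ (sece y)).
  by apply/funext => z; rewrite -hdotC.
pose fund n z : F z := if dec n is Some y then e y else 0.
have secfund n : sec (fund n).
  rewrite /fund; case: (dec n) => [y|]; first exact: sece.
  by move=> y; rewrite (_ : (fun z => _) = (fun=> 0)); [exact: cmeasurable_cst|apply/funext => z; rewrite hdot0l].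
have totfund z : total_set (range (fun n => fund n z)).
  move=> v; apply: (cspan_mono _ (te v)) => _ [y _ <-]; apply: sub_cspan.
  by exists (code y) => //; rewrite /fund codeK.
have mc y : cmeasurable (fun z => c z y).
  rewrite /c /base_phase; case: asboolP => _; [exact: cmeasurable_val|exact: cmeasurable_cst].
have secact a (v : forall z, F z) : sec v -> sec (fun z => act a (v z)).
  move: a v; apply: (star_algebra_ind gen).
  - move=> v hv; rewrite (_ : (fun z => _) = v)//; apply: funext_dep => z; exact: act1.
  - move=> k a b ha hb v hv; rewrite (_ : (fun z => _) = (fun z => k *: act a (v z) + act b (v z))).
      by apply: seclin; [exact: ha|exact: hb].
    by apply: funext_dep => z; exact: act_linear_alg.
  - move=> a b ha hb v hv; rewrite (_ : (fun z => _) = (fun z => act a (act b (v z)))).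
      by apply: ha; exact: hb.
    by apply: funext_dep => z; exact: actM.
  - move=> a ha v hv; have /choice[b hb] : forall n : nat, exists b, (forall v, sec v -> sec (fun z => act b (v z))) /\
        cnorm (a - b) < n.+1%:R^-1.
      by move=> n; have [|b] := ha n.+1%:R^-1; [rewrite invr_gt0|exists b].
    apply: (seclim (fun n z => act (b n) (v z))) => [n|z]; first exact: (hb n).1.
    move=> d d0; have [q q0 hq] := mulr_smallP d0 (hnorm_ge0 (v z)); have [M hM] := inv_small q0.
    exists M => n /hM hn; rewrite -actB; apply: (le_lt_trans (act_contractive _ _)).
    rewrite mulrC; apply: le_lt_trans hq; rewrite ler_wpM2l ?hnorm_ge0//.
    by rewrite cnormBC (le_trans (ltW (hb n).2))// ltW.
  - move=> i v hv y; rewrite (_ : (fun z => _) = (fun z => if i == sval y 0%N then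
        c z (sval y) * '[v z, e (tail_class_shift y) : F z] else 0)).
      case: eqP => _; last exact: cmeasurable_cst.
      by apply: cmeasurableM; [exact: mc|exact: hv].
    apply/funext => z; rewrite act_dot (let: And3 _ _ h := me z in h); case: eqP => _; last by rewrite hdot0r.
    by rewrite hdotZr conjCK.
  - move=> i v hv y; case: (boolP (A i (sval y 0%N))) => Aiy.
      have h : infinite_word A (wcons i (sval y)) /\ tail_eq (wcons i (sval y)) x.
        have [hy ty] := svalP y; split; first exact: infinite_word_cons.
        exact: tail_eq_trans (tail_eq_cons i _) ty.
      pose t : words := exist (fun w => infinite_word A w /\ tail_eq w x) _ h.
      have ht : sval y = wshift 1 (sval t) by rewrite /= wconsK.
      rewrite (_ : (fun z => _) = (fun z => Num.conj (c z (sval t)) * '[v z, e t : F z])).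
        by apply: cmeasurableM; [exact/cmeasurable_conj/mc|exact: hv].
      apply/funext => z; rewrite act_dot starK.
      have h1 := model_opA isO (me z) (c1 z) ht; rewrite big_ord1 wshift0 in h1.
      by rewrite (h1 : act (s i) (e y : F z) = _) hdotZr.
    rewrite (_ : (fun z => _) = (fun=> 0)); first exact: cmeasurable_cst.
    apply/funext => z; rewrite act_dot starK.
    have -> : act (s i) (e y : F z) = 0.
      exact: (sa_coded0 ck (model_coded isO (me z) (c1 z) y) Aiy).
    by rewrite hdot0r.
exists (@RepField R O F sec seclin secnorm secmax fund secfund totfund secact) => z.
exact: (word_model_is_P isO pJ hJ (cabs_circle z) (me z)).
Qed.

End ConstantField.

(** * The cyclic vector of a direct integral *)

Lemma rint_probability {R : realType} {d : measure_display} {T : measurableType d}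
  (mu : probability T R) (k : R) : rint mu (fun=> k) = k.
Proof.
rewrite /rint Rintegral_cst//= (_ : mu setT = 1%E) ?mulr1//; exact: probability_setT.
Qed.

Section FieldCyclic.
Context {R : realType} {N : nat} {A : 'M[bool]_N} {O : cstar_algebra R} {s : 'I_N -> O}.
Hypothesis ck : ck_relations A s.
Hypothesis gen : forall S : set O, closed_star_subalgebra S -> (forall i, S (s i)) -> S = setT.
Context (eta : probability (borel_circle R) R).
Hypothesis haar : is_haar eta.
Context (i0 : 'I_N) (J : seq 'I_N).
Hypothesis pJ : primitive i0 J.
Local Notation x := (wpow_inf i0 J).
Hypothesis hJ : infinite_word A x.
Local Notation Cir := (borel_circle R).
Local Notation opA := (opA (s := s)).
Local Notation opB := (opB (s := s)).
Local Notation coded := (coded (s := s)).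
Local Notation branch := (branch (s := s)).
Context (F : rep_field O).
Hypothesis hF : forall z, is_P s J (val z) (F z).

(** A measurable choice of the eigenvectors: project the fundamental sequence onto
    the eigenlines and normalise, at each point of the circle, the first
    projection that does not vanish. *)
Lemma eigenvector_section : exists e : forall z, F z, msection e /\
  forall z, [/\ cyclic_vector (e z), hnorm (e z) = 1, coded x (e z) & opA J (e z) = val z *: e z].
Proof.
pose Om z := projT1 (cid (is_P_eigen ck pJ (cabs_circle z) (hF z))).
have hOm z : [/\ cyclic_vector (Om z), hnorm (Om z) = 1, coded x (Om z) & opA J (Om z) = val z *: Om z].
  exact: projT2 (cid (is_P_eigen ck pJ (cabs_circle z) (hF z))).
pose p n z : F z := '[mfundamental F n z, Om z] *: Om z.
have mp n : msection (p n).
  apply: (msection_limit (u := fun k z => coding_proj (s := s) x k (mfundamental F n z))) => [k|z].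
    have := msection_act (\prod_(j <- prefix x k) s j * \prod_(j <- rev (prefix x k)) star (s j)) (mfundamentalP F n).
    rewrite (_ : (fun z => _) = (fun z => coding_proj (s := s) x k (mfundamental F n z)))//.
    by apply: funext_dep => z; rewrite actM /coding_proj opAE opBE.
  have [h1 h2 h3 h4] := hOm z; apply: (coding_proj_line ck gen hJ h3 h1 h2) => k m.
  exact: (eigen_branch ck pJ hJ h3 (cabs_circle z) h4).
(* A measurable function that agrees with the inverse on positive reals. *)
pose inv (t : R) : R := expR (- ln t).
have minv : measurable_fun setT inv.
  apply: measurableT_comp; first exact: measurable_expR.
  by apply: measurableT_comp => //; exact: measurable_ln.
(* While [v] vanishes, the step adds the normalised n-th projection; a unit vector stays
   fixed. *)
pose step (n : nat) (v : forall z, F z) : forall z, F z :=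
  fun z => ((1 - hnorm (v z)) * inv (hnorm (p n z)))%:C%C *: p n z + v z.
pose u n : forall z, F z := iteri n step (fun z => 0).
have mu n : msection (u n).
  elim: n => [|n IH]; first exact: msection0.
  have := msection_linear 1 (msection_scale (f := fun z => (1 - hnorm (u n z)) * inv (hnorm (p n z))) _ (mp n)) IH.
  rewrite (_ : (fun z => 1 *: _ + _) = u n.+1).
    apply; apply: measurable_funM; first by apply: measurable_funB => //; exact: msection_norm.
    by apply: measurableT_comp minv _; exact: (msection_norm (mp n)).
  by apply: funext_dep => z; rewrite scale1r.
have uS n z : u n.+1 z = ((1 - hnorm (u n z)) * inv (hnorm (p n z)))%:C%C *: p n z + u n z by [].
have stepP n z : (hnorm (u n z) = 1 -> u n.+1 z = u n z) /\
    (u n z = 0 -> if p n z == 0 then u n.+1 z = 0 else hnorm (u n.+1 z) = 1).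
  split=> [h|h]; first by rewrite uS h subrr mul0r rmorph0 scale0r add0r.
  rewrite uS h hnorm0 subr0 mul1r addr0; case: eqP => [->|/eqP pn]; first by rewrite scaler0.
  have p0 : 0 < hnorm (p n z).
    by rewrite lt_neqAle eq_sym hnorm_ge0 andbT; apply/eqP => /hnorm_eq0/eqP; exact/negP.
  by rewrite hnormZ cabs_RC /inv ger0_norm ?expR_ge0// expRN lnK ?posrE// mulVf// gt_eqF.
have uline n z : exists c : R[i], u n z = c *: Om z.
  elim: n => [|n [c hc]]; first by exists 0; rewrite scale0r.
  by rewrite uS hc /p scalerA -scalerDl; eexists.
have stable z n k : hnorm (u n z) = 1 -> u (k + n)%N z = u n z.
  move=> h; elim: k => // k IH; rewrite addSn (stepP _ _).1//; by rewrite IH.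
have reach z : exists n, hnorm (u n z) = 1.
  have [_ n1 _ _] := hOm z.
  have [n pn] : exists n, p n z != 0.
    apply: contrapT => /forallNP h; apply: (unit_neq0 n1); apply: (orth_total (@mfundamental_total _ _ F z)) => _ [n _ <-].
    have := h n; move=> /negP; rewrite negbK scaler_eq0 => /orP[/eqP d0|/eqP o0].
      by rewrite hdotC d0 conjC0.
    by case: (unit_neq0 n1).
  have alt k : (exists m, hnorm (u m z) = 1) \/ u k z = 0.
    elim: k => [|k [|hk]]; [by right|by left|].
    have := (stepP k z).2 hk; case: eqP => _; [by right|by left; exists k.+1].
  case: (alt n) => // un; have := (stepP n z).2 un; rewrite (negPf pn) => h; by exists n.+1.
have [e he] : {e : forall z, F z | forall z, exists n, hnorm (u n z) = 1 /\ e z = u n z}.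
  exists (fun z => u (projT1 (cid (reach z))) z) => z; exists (projT1 (cid (reach z))).
  by split=> //; exact: projT2 (cid (reach z)).
exists e; split=> [|z].
  apply: (msection_limit mu) => z; have [n [hn ->]] := he z.
  move=> d d0; exists n => m nm; by rewrite -(subnK nm) stable// subrr hnorm0.
have [n [hn ->]] := he z; have [c hc] := uline n z; have [cO O1 xO eO] := hOm z.
have c0 : c != 0 by apply/eqP => c0; apply: (unit_neq0 hn); rewrite hc c0 scale0r.
split=> //; rewrite hc.
- move=> v d d0; have [a ha] := cO v d d0; exists (c^-1 *: a).
  by rewrite actZ (linZ _ _ (act_lin a (pi := F z))) scalerA mulVf// scale1r.
- by apply: csubZ xO; exact: (coded_csub x (F z)).
- by rewrite (linZ _ _ (opA_blin (s := s) (F z) J).1) eO !scalerA mulrC.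
Qed.

(** If a section [y] is orthogonal to all [a e] then, for each [a], the function [<a
    e(z), y(z)>] has vanishing Fourier coefficients, because [s_J] multiplies [e(z)]
    by [z]. It vanishes almost everywhere, for countably many [a] at once, and these
    suffice to span each fibre. *)
Lemma field_cyclic (pi : representation O) : is_direct_integral eta F pi ->
  exists e : pi, [/\ cyclic_vector e, coded x e & forall n, '[iter n (opA J) e, e] = (n == 0%N)%:R].
Proof.
move=> [U [U1 U2 U3 U4]]; have [e [me he]] := eigenvector_section.
have e1 z : hnorm (e z) = 1 by have [] := he z.
have hv z : coded x (e z) by have [] := he z.
have ev z : opA J (e z) = val z *: e z by have [] := he z.
have Le : L2section eta e.
  split=> //; rewrite (_ : (fun z => _) = cst 1%E) ?integral_cst// ?mul1e.
    by apply: (@le_lt_trans _ _ 1%E); [exact: probability_le1|exact: ltry].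
  by apply/funext => z; rewrite e1 expr1n.
have La a : L2section eta (fun z => act a (e z)).
  have [ma] : sq_integrable eta (F := section_field F) (fun z => act a (e z)).
    apply/sq_integrableP; first exact: (msection_act a me).
    apply: (@rintegrable_le _ _ _ eta _ (fun=> (cnorm a) ^+ 2)); last first.
    - by move=> z; rewrite ger0_norm ?sqr_ge0// ler_sqr ?nnegrE ?hnorm_ge0 ?cnorm_ge0// (le_trans (act_contractive _ _))// e1 mulr1.
    - exact: rintegrable_cst.
    - by apply: measurable_funX; exact: (msection_norm (msection_act a me)).
  by split=> //; exact: msection_act.
pose eps := U e.
have UA w : U (fun z => opA w (e z)) = opA w eps.
  by rewrite opAE -U4//; congr U; apply: funext_dep => z; rewrite opAE.
have ce : coded x eps.
  move=> n; rewrite opAE opBE -actM -U4//; congr U; apply: funext_dep => z.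
  by rewrite actM -opBE -opAE; exact: hv.
have iterA n : iter n (opA J) eps = U (fun z => iter n (opA J) (e z)).
  rewrite -(opA_iter (s := s) i0 J n eps) -UA; congr U; apply: funext_dep => z.
  by rewrite -(opA_iter (s := s) i0 J n (e z)).
exists eps; split=> //.
- apply: (total_cyclic (X := [set v | exists a, v = act a eps])) => //.
  apply: total_orth => v hvo; have [y Ly Uy] := U3 v.
  have [m1 _] := Ly; have sy : sq_integrable eta (F := section_field F) y by exact: Ly.
  pose g a z : R[i] := '[act a (e z), y z].
  have cg a : cint eta (g a) = 0.
    have -> : cint eta (g a) = '[U (fun z => act a (e z)), U y] by rewrite U2.
    by rewrite U4// Uy hdotC hvo ?conjC0//; exists a.
  have g0 a : \forall z \ae eta, g a z = 0.
    apply: fourier_uniqueness; split.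
      by apply: (dot_cintegrable (F := section_field F)) sy; exact: (La a).
    move=> k l.
    rewrite -[RHS](cg (a * (\prod_(j <- prefix x (k * size J)) s j * \prod_(j <- rev (prefix x (l * size J))) star (s j)))).
    congr cint; apply/funext => z; rewrite /g !actM -opBE -opAE opB_iter opA_iter.
    rewrite (iter_opB_eigen ck hJ _ (hv z) (cabs_circle z) (ev z)).
    rewrite -(opA_iter (s := s) i0) linZ; last exact: (opA_blin _ _).1.
    rewrite opA_iter (iter_opA_eigen _ (ev z)) scalerA linZ; last exact: act_lin.
    by rewrite hdotZl /monomial [val z ^+ k * _]mulrC.
  pose word_op (q : seq 'I_N * nat) : O := \prod_(j <- q.1) s j * \prod_(j <- rev (prefix x q.2)) star (s j).
  (* The branches of [e z] are given by countably many algebra elements, the same for all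
     [z]. *)
  have : \forall z \ae eta, forall n : nat, if unpickle n is Some q then g (word_op q) z = 0 else True.
    apply: ae_foralln => n; case: (unpickle n) => [q|]; first exact: g0.
    exact: filterE.
  move=> aeg; have ae0 : \forall z \ae eta, (hnorm (y z) ^+ 2)%:E = 0%E :> \bar R.
    apply: filterS aeg => z hz; congr EFin.
    have [cz _ _ _] := he z.
    rewrite (_ : y z = 0) ?hnorm0 ?expr0n//.
    apply: (orth_total (cyclic_coded_total ck gen hJ (hv z) cz)) => _ [w [m ->]].
    have := hz (pickle (w, m)); rewrite pickleK /g /word_op /= actM -opBE -opAE => h.
    by rewrite hdotC h conjC0.
  apply: hdot_eq0; rewrite -Uy U2//.
  have -> : cintegral eta (fun z => '[y z, y z]) = (rint eta (fun z => hnorm (y z) ^+ 2))%:C%C.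
    apply: complex_ext; rewrite /cintegral /= /rint.
      by congr (Rintegral eta _ _); apply/funext => z; rewrite hdotxx.
    rewrite (_ : (fun z => _) = (fun=> 0)); first by rewrite Rintegral_cst ?mul0r.
    by apply/funext => z; rewrite hdotxx.
  rewrite /rint /Rintegral (@ae_eq_integral _ _ _ eta setT (cst 0%E)) ?integral0//.
  + by apply/measurable_EFinP; exact: (@measurable_normsq _ _ _ (section_field F)).
  + by apply: filterS ae0 => z h _.
- move=> n; rewrite iterA U2//; last first.
    rewrite (_ : (fun z => _) = (fun z => act (\prod_(j <- prefix x (n * size J)) s j) (e z)))//.
    by apply: funext_dep => z; rewrite -opAE opA_iter.
  have -> : cintegral eta (fun z => '[iter n (opA J) (e z), e z]) = cint eta (fun z => val z ^+ n).
    rewrite /cintegral /cint; congr (Complex (Rintegral eta _ _) (Rintegral eta _ _)); apply/funext => z;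
      by rewrite (iter_opA_eigen _ (ev z)) hdotZl (hdot_unit (e1 z)) mulr1.
  case: n => [|n]; last by rewrite haar_moment.
  rewrite (_ : (fun z : Cir => val z ^+ 0) = (fun=> 1)); last by apply/funext => z; rewrite expr0.
  by apply: complex_ext; rewrite /cint [LHS]rint_probability.
Qed.

End FieldCyclic.

(** * Orthogonal cyclic subspaces *)

Section SpanOrthogonality.
Context {R : realType} {H : hilbert R}.
Implicit Types (X : set H) (u v : H).

Lemma csub_dot0r v : csub [set u | '[v, u] = 0].
Proof.
have := csub_orthr [set v]; congr csub; apply/seteqP.
by split=> u /= h => [|_ ->//]; exact: h.
Qed.

Lemma cspan_orthr X v u : in_closed_span X u -> (forall x, X x -> '[v, x] = 0) -> '[v, u] = 0.
Proof. by move=> hu h; exact: (cspan_min (csub_dot0r v) h hu). Qed.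

Lemma cspan_orthl X v u : in_closed_span X u -> (forall x, X x -> '[x, v] = 0) -> '[u, v] = 0.
Proof. by move=> hu h; rewrite hdotC (cspan_orthr hu) ?conjC0// => x /h hx; rewrite hdotC hx conjC0. Qed.

End SpanOrthogonality.

Section DirectSums.
Context {R : realType} {O : cstar_algebra R}.
Implicit Types (pi rho : representation O).

Lemma same_range_equivalent rho rho' pi (V : rho -> pi) (V' : rho' -> pi) :
  isometry_into V -> intertwiner V -> isometry_into V' -> intertwiner V' ->
  (forall v, (exists u, V u = v) <-> (exists u, V' u = v)) -> unitarily_equivalent rho rho'.
Proof.
move=> iV tV iV' tV' h.
have /choice[U hU] : forall u, exists u', V' u' = V u by move=> u; apply/h; exists u.
have inj := isometry_inj iV'; exists U; split.
- split=> [c u v|u v]; last by rewrite -iV'.2 !hU iV.2.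
  by apply: inj; rewrite iV'.1 !hU iV.1.
- move=> u'; have [u hu] : exists u, V u = V' u' by apply/h; exists u'.
  by exists u; apply: inj; rewrite hU hu.
- by move=> a u; apply: inj; rewrite hU tV tV' hU.
Qed.

Lemma direct_sum_transport (I : Type) (rho : I -> representation O) pi pi' :
  is_direct_sum rho pi -> unitarily_equivalent pi pi' -> is_direct_sum rho pi'.
Proof.
move=> [V [iV oV tV sV]] [U [iU sU tU]]; exists (fun i u => U (V i u)); split.
- by move=> i; exact: (isometry_comp (iV i) iU).
- by move=> i j u v ij; rewrite iU.2 oV.
- by move=> i a u; rewrite tV tU.
- apply: total_orth => w hw; have [t ht] := sU w; rewrite -ht.
  rewrite (_ : t = 0) ?(lin0 (isometry_lin iU))//; apply: (orth_total sV) => _ [i [u ->]].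
  by rewrite -iU.2 ht; apply: hw; exists i, u.
Qed.

Definition generates pi (I : Type) (g : I -> pi) :=
  (forall i j a b, i <> j -> '[act a (g i), act b (g j)] = 0) /\
  total_set [set u | exists i a, u = act a (g i)].

Lemma sum_generates (I : Type) (rho : I -> representation O) pi (V : forall i, rho i -> pi)
  (X : I -> Type) (g : forall i, X i -> rho i) :
  (forall i, isometry_into (V i)) -> (forall i j u v, i <> j -> '[V i u, V j v] = 0) ->
  (forall i, intertwiner (V i)) -> total_set [set v | exists i u, v = V i u] ->
  (forall i, generates (g i)) ->
  generates (fun p : {i & X i} => V (projT1 p) (g (projT1 p) (projT2 p))).
Proof.
move=> iV oV tV sV hg; split=> [[i c] [j d] a b /= ne|].
  rewrite -!tV; have [ij|ij] := pselect (i = j); last exact: oV.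
  by subst j; rewrite (iV i).2 (hg i).1// => cd; apply: ne; rewrite cd.
apply: total_orth => v hv; apply: (orth_total sV) => _ [i [u ->]].
have cs := csub_preim (isometry_blin (iV i)) (csub_dot0r v).
apply: (total_ind (hg i).2 cs) => _ [c [a ->]] /=.
by rewrite tV; apply: hv; exists (existT _ i c), a.
Qed.

Lemma cyclic_generates (I : Type) (rho : I -> representation O) pi (V : forall i, rho i -> pi)
  (g : forall i, rho i) :
  (forall i, isometry_into (V i)) -> (forall i j u v, i <> j -> '[V i u, V j v] = 0) ->
  (forall i, intertwiner (V i)) -> total_set [set v | exists i u, v = V i u] ->
  (forall i, cyclic_vector (g i)) -> generates (fun i => V i (g i)).
Proof.
move=> iV oV tV sV cg; have hg i : generates (fun _ : unit => g i).
  by split=> [[] [] a b //|]; exact: cyclic_total.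
have [h1 h2] := sum_generates iV oV tV sV hg; split=> [i j a b ij|].
  by apply: (h1 (existT (fun=> unit) i tt) (existT (fun=> unit) j tt)) => -[].
by apply: total_orth => v hv; apply: (orth_total h2) => _ [p [a ->]]; apply: hv; exists (projT1 p), a.
Qed.

Lemma span_complement {H : hilbert R} (S1 S2 : set H) v :
  (forall u w, S1 u -> S2 w -> '[u, w] = 0) -> in_closed_span (S1 `|` S2) v ->
  (forall w, S2 w -> '[v, w] = 0) -> in_closed_span S1 v.
Proof.
move=> o12 hv ov; have [y [hy oy]] := projection_exists v (cspan_csub S1).
suff -> : v = y by [].
apply/eqP; rewrite -subr_eq0; apply/eqP; apply: hdot_eq0.
have oyS2 w : S2 w -> '[y, w] = 0.
  by move=> hw; apply: (cspan_orthl hy) => u hu; exact: o12.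
have h u : in_closed_span (S1 `|` S2) u -> '[v - y, u] = 0.
  move=> hu; apply: (cspan_orthr hu) => w [hw|hw]; first by apply: oy; exact: sub_cspan.
  by rewrite hdotBl ov// oyS2// subrr.
apply: h; apply: (csubB (cspan_csub _)) => //; apply: cspan_mono hy => u hu.
by apply: sub_cspan; left.
Qed.

End DirectSums.

(** Choose a bijection on each fibre of the labels. *)
Lemma glue_bijections (X X' L : Type) (l : X -> L) (l' : X' -> L) :
  (forall c, equipotent {x | l x = c} {x | l' x = c}) ->
  exists f : X -> X', bijective f /\ forall x, l' (f x) = l x.
Proof.
move=> h; have H c : exists fg : ({x | l x = c} -> {x | l' x = c}) * ({x | l' x = c} -> {x | l x = c}),
    cancel fg.1 fg.2 /\ cancel fg.2 fg.1.
  by have [f [g fK gK]] := h c; exists (f, g).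
pose fg c := projT1 (cid (H c)); have hfg c : cancel (fg c).1 (fg c).2 /\ cancel (fg c).2 (fg c).1.
  exact: projT2 (cid (H c)).
pose f x := sval ((fg (l x)).1 (exist _ x erefl)); pose g x := sval ((fg (l' x)).2 (exist _ x erefl)).
have fE x : l' (f x) = l x by exact: svalP ((fg (l x)).1 (exist _ x erefl)).
have gS c (y : {x | l' x = c}) : g (sval y) = sval ((fg c).2 y) by case: y => y e; subst c.
have fS c (y : {x | l x = c}) : f (sval y) = sval ((fg c).1 y) by case: y => y e; subst c.
exists f; split=> //; exists g => x; first by rewrite /f gS (hfg _).1.
by rewrite /g fS (hfg _).2.
Qed.

Section Spectral.
Context {R : realType} {N : nat} {A : 'M[bool]_N} {O : cstar_algebra R} {s : 'I_N -> O}.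
Hypothesis ck : ck_relations A s.
Hypothesis gen : forall S : set O, closed_star_subalgebra S -> (forall i, S (s i)) -> S = setT.
Local Notation opA := (opA (s := s)).
Local Notation opB := (opB (s := s)).
Local Notation coded := (coded (s := s)).
Local Notation branch := (branch (s := s)).
Implicit Types (pi rho : representation O).

Lemma coded_image x rho pi (V : rho -> pi) (v : rho) : isometry_into V -> intertwiner V ->
  coded x v -> coded x (V v).
Proof. by move=> iV tV; exact: (coded_isometry (s := s) x v iV tV).1. Qed.

Definition carried x rho := total_set [set u : rho | exists v a, coded x v /\ u = act a v].

Lemma generates_carried x rho (I : Type) (g : I -> rho) : generates g -> (forall i, coded x (g i)) ->
  carried x rho.
Proof.
move=> [_ tg] cg; apply: total_orth => v hv; apply: (orth_total tg) => _ [i [a ->]].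
by apply: hv; exists (g i), a.
Qed.

(** A vector coded by [w i] is orthogonal to the components of the other words, so it
    lies in the i-th one; these vectors generate the i-th component by assumption. The
    right-hand side mentions the ambient representation only. *)
Lemma carried_range (I : Type) (rho : I -> representation O) (w : I -> nat -> 'I_N) pi
  (V : forall i, rho i -> pi) :
  (forall i, infinite_word A (w i)) -> (forall i j, i <> j -> ~ tail_eq (w i) (w j)) ->
  (forall i, isometry_into (V i)) -> (forall i j u v, i <> j -> '[V i u, V j v] = 0) ->
  (forall i, intertwiner (V i)) -> total_set [set v | exists i u, v = V i u] ->
  (forall i, carried (w i) (rho i)) ->
  forall i v, (exists u, V i u = v) <-> in_closed_span [set u | exists t a, coded (w i) t /\ u = act a t] v.
Proof.
move=> iw nw iV oV tV sV cV i v; split=> [[u <-]|].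
  apply: (total_ind (cV i) (csub_preim (isometry_blin (iV i)) (cspan_csub _))) => _ [t [a [ct ->]]] /=.
  apply: sub_cspan; exists (V i t), a; split; last exact: tV.
  exact: (coded_image (iV i) (tV i)).
move=> hv; suff [u _ hu] : range (V i) v by exists u.
apply: (cspan_min (csub_range (iV i)) _ hv) => {hv} _ [t [a [ct ->]]].
suff [u hu] : exists u, V i u = t by exists (act a u) => //; rewrite tV hu.
have [y [[u _ uy] oy]] := projection_exists t (csub_range (iV i)).
exists u; rewrite uy; apply/eqP; rewrite eq_sym -subr_eq0; apply/eqP.
apply: (orth_total sV) => _ [j [u' ->]]; have [ij|ij] := pselect (i = j).
  by subst j; apply: oy; exists u'.
rewrite hdotBl -uy oV// subr0.
have cs := csub_preim (isometry_blin (iV j)) (csub_dot0r t).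
apply: (total_ind (cV j) cs) => _ [z [b [cz ->]]] /=.
rewrite tV -[t]act1; apply: (coded_act_orth ck gen (iw i) (iw j) ct).
  exact: (coded_image (iV j) (tV j)).
by move=> k m e; exfalso; apply: (nw _ _ ij); exists m, k.
Qed.

Lemma carried_sum_unique (I : Type) (rho rho' : I -> representation O) (w : I -> nat -> 'I_N) pi :
  (forall i, infinite_word A (w i)) -> (forall i j, i <> j -> ~ tail_eq (w i) (w j)) ->
  is_direct_sum rho pi -> is_direct_sum rho' pi ->
  (forall i, carried (w i) (rho i)) -> (forall i, carried (w i) (rho' i)) ->
  forall i, unitarily_equivalent (rho i) (rho' i).
Proof.
move=> iw nw [V [iV oV tV sV]] [V' [iV' oV' tV' sV']] cV cV' i.
have h := carried_range iw nw iV oV tV sV cV i; have h' := carried_range iw nw iV' oV' tV' sV' cV' i.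
by apply: (same_range_equivalent (iV i) (tV i) (iV' i) (tV' i)) => v; rewrite h h'.
Qed.

(** The branches of the generators that do not return to [x] are orthogonal to the
    vectors coded by [x]. *)
Lemma coded_span_return x pi (I : Type) (g : I -> pi) v : infinite_word A x ->
  (forall i, coded x (g i)) -> total_set [set u | exists i a, u = act a (g i)] -> coded x v ->
  in_closed_span [set u | exists i k m, wshift k x = wshift m x /\ u = branch x (g i) (prefix x k) m] v.
Proof.
move=> hx cg tg cv; set S := [set u | _]; pose X := [set u | exists i w m, u = branch x (g i) w m].
have tX : total_set X.
  apply: total_orth => t ht; apply: (orth_total tg) => _ [i [a ->]].
  have := branches_span ck gen (fun=> hx) cg i a.
  by move=> h; apply: (cspan_orthr h) => u hu; exact: ht.
have hX u : X u -> exists2 y, infinite_word A y & coded y u.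
  move=> [i [w [m ->]]]; case: (branch_coded ck w m hx (cg i)) => [->|[h1 h2]].
    by exists x => //; exact: coded0.
  by exists (wapp w (wshift m x)).
apply: cspan_mono (coded_span ck tX hX cv) => _ [[i [w [m ->]]] cu].
case: (branch_coded ck w m hx (cg i)) => [->|[h1 h2]].
  by have [h0 _ _] := cspan_csub S.
have [e|ne] := pselect (wapp w (wshift m x) = x).
  apply: sub_cspan; exists i, (size w), m.
  have ew : w = prefix x (size w) by rewrite -[x in prefix x _]e prefix_wapp.
  by split; [rewrite -[x in LHS]e wappK|rewrite -ew].
have -> : branch x (g i) w m = 0 by apply: hdot_eq0; exact: (coded_orth ck h1 hx h2 cu ne).
by have [h0 _ _] := cspan_csub S.
Qed.

End Spectral.

(** * Spectral multiplicities *)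

Section SpectralUniqueness.
Context {R : realType} {N : nat} {A : 'M[bool]_N} {O : cstar_algebra R} {s : 'I_N -> O}.
Hypothesis ck : ck_relations A s.
Hypothesis gen : forall S : set O, closed_star_subalgebra S -> (forall i, S (s i)) -> S = setT.
Context (i0 : 'I_N) (J : seq 'I_N).
Hypothesis pJ : primitive i0 J.
Local Notation x := (wpow_inf i0 J).
Hypothesis hJ : infinite_word A x.
Local Notation opA := (opA (s := s)).
Local Notation opB := (opB (s := s)).
Local Notation coded := (coded (s := s)).
Local Notation branch := (branch (s := s)).
Context {tau : representation O}.
Implicit Types (u v w : tau).

(** On the vectors coded by [x] the operator [opB J] is the inverse of [opA J], so these
    are the integer powers of a unitary. *)
Definition zpow (n : int) v : tau := match n with Posz k => iter k (opA J) v | Negz k => iter k.+1 (opB J) v end.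

Lemma zpow_coded n v : coded x v -> coded x (zpow n v).
Proof. by case: n => n cv; [exact: (coded_iterA ck hJ)|exact: (coded_iterB ck hJ)]. Qed.

Lemma zpowS n v : coded x v -> zpow (n + 1) v = opA J (zpow n v).
Proof.
move=> cv; case: n => [n|[|n]]; first by rewrite (_ : Posz n + 1 = Posz n.+1)//; lia.
  by rewrite (_ : Negz 0 + 1 = Posz 0)//= (opAK cv).
rewrite (_ : Negz n.+1 + 1 = Negz n); last by rewrite !NegzE; lia.
by rewrite /zpow [in RHS]iterS (opAK (coded_iterB ck hJ n.+1 cv)).
Qed.

Lemma zpow_act n : exists a, forall v, zpow n v = act a v.
Proof.
case: n => n; eexists=> v; first by rewrite /= -(opA_iter (s := s) i0) opAE.
by rewrite /zpow -(opB_iter (s := s) i0) opBE.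
Qed.

Lemma zpow_dotS g h u v : coded x u -> coded x v -> '[zpow (g + 1) u, zpow (h + 1) v] = '[zpow g u, zpow h v].
Proof. by move=> cu cv; rewrite !zpowS// (opA_isometric ck hJ)//; exact: zpow_coded. Qed.

Lemma zpow_dot g h u v : coded x u -> coded x v -> '[zpow g u, zpow h v] = '[zpow (g - h) u, v].
Proof.
move=> cu cv; elim/int_rect: h g => [|n IH|n IH] g; first by rewrite subr0.
  rewrite (_ : (n.+1 : int) = n%:Z + 1); last by lia.
  by rewrite -[in LHS](subrK 1 g) zpow_dotS// IH; congr '[zpow _ _, _]; lia.
by rewrite -zpow_dotS// (_ : - n.+1%:Z + 1 = - n%:Z) ?IH; [congr '[zpow _ _, _]; lia|lia].
Qed.

(** The translates of [v] under the unitary form an orthonormal family indexed by the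
    integers. *)
Definition wandering v := coded x v /\ forall n, '[iter n (opA J) v, v] = (n == 0%N)%:R.
Definition eigenvector (z : R[i]) v := [/\ coded x v, cabs z = 1 & opA J v = z *: v].

Lemma wandering_zpow n v : wandering v -> '[zpow n v, v] = (n == 0)%:R.
Proof.
move=> [cv wv]; case: n => n; first exact: wv.
have -> : zpow (Negz n) v = zpow (Posz 0 - Posz n.+1) v by congr zpow; rewrite NegzE; lia.
by rewrite -zpow_dot// hdotC wv conjC0.
Qed.

Lemma wandering_orthonormal v : wandering v -> orthonormal_family (fun n : int => zpow n v).
Proof.
move=> wv; have [cv _] := wv; split=> [n|n m nm]; rewrite zpow_dot// wandering_zpow//.
  by rewrite subrr.
by rewrite subr_eq0; case: eqP.
Qed.

(** The coefficients of an eigenvector along the translates of a wandering vector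
    have constant modulus, and their squares are summable. *)
Lemma eigen_wandering_orth z u v n : eigenvector z u -> wandering v -> '[u, zpow n v] = 0.
Proof.
move=> [cu nz eu] wv; have [cv _] := wv.
have abs k : cabs '[u, zpow (Posz k) v] = cabs '[u, v].
  have := zpow_dot (Posz k) (Posz k) cu cv; rewrite subrr /= => <-.
  rewrite (iter_opA_eigen _ eu) hdotZl cabsM (_ : cabs (z ^+ k) = 1) ?mul1r//.
  by elim: (k) => [|l IH]; rewrite ?expr0 ?cabs1// exprS cabsM nz IH mulr1.
have uv0 : '[u, v] = 0.
  apply: cabs_eq0; apply/eqP; rewrite -sqrf_eq0; apply/eqP.
  (* Bessel for the first M+1 translates bounds (M+1) |<u, v>|^2 by |u|^2. *)
  apply: (@small_lt_eq0 _ _ (hnorm u ^+ 2)); first exact: sqr_ge0.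
  move=> e e0; have [M /(_ M (leqnn M)) hM] := inv_small e0.
  have us : uniq [seq Posz k | k <- iota 0 M.+1] by rewrite map_inj_uniq ?iota_uniq// => a b [].
  have := bessel (wandering_orthonormal wv) u us; rewrite big_map.
  rewrite (eq_bigr (fun=> cabs '[u, v] ^+ 2)); last by move=> k _; rewrite abs.
  rewrite big_const_seq count_predT size_iota iter_addr_0 -mulr_natl -ler_pdivlMl// => h.
  by apply: (le_trans h); rewrite mulrC ler_wpM2l ?sqr_ge0// ltW.
case: n => n; first by apply: cabs_eq0; rewrite abs uv0 cabs0.
have [a ha] : exists a : R[i], zpow (Posz n.+1) u = a *: u by exists (z ^+ n.+1); exact: iter_opA_eigen.
have -> : '[u, zpow (Negz n) v] = '[zpow (Posz 0) u, zpow (Negz n) v] by [].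
rewrite zpow_dot// (_ : Posz 0 - Negz n = Posz n.+1) ?ha ?hdotZl ?uv0 ?mulr0//.
Qed.

(** A system of generators that splits the unitary into eigenvectors and copies of the
    bilateral shift. *)
Definition spectral (Y C : Type) (lam : Y -> R[i]) (f : Y -> tau) (h : C -> tau) :=
  [/\ forall y, eigenvector (lam y) (f y) /\ hnorm (f y) = 1, forall c, wandering (h c)
    & generates (fun i : Y + C => match i with inl y => f y | inr c => h c end)].

Section OneFamily.
Context {Y C : Type} {lam : Y -> R[i]} {f : Y -> tau} {h : C -> tau}.
Hypothesis sp : spectral lam f h.

Lemma spectral_span v : coded x v ->
  in_closed_span (range f `|` [set u | exists c n, u = zpow n (h c)]) v.
Proof.
move=> cv; have [hf hh [_ tg]] := sp; set S := (S in in_closed_span S).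
have cg i : coded x (match i with inl y => f y | inr c => h c end).
  by case: i => [y|c]; [have [[]] := hf y|have [] := hh c].
apply: cspan_mono (coded_span_return ck gen hJ cg tg cv) => _ [i [k [m [e ->]]]].
have := cg i; case: i => [y|c] ci.
  have [[_ nz ev] _] := hf y; have [d ->] := eigen_branch ck pJ hJ ci nz ev e.
  by apply: (csubZ d (cspan_csub S)); apply: sub_cspan; left; exists y.
apply: sub_cspan; right; exists c; have [n [->//|->//]] := periodic_branch ck pJ hJ e.
  by exists (Posz n).
by case: n => [|n]; [exists (Posz 0)|exists (Negz n)].
Qed.

Lemma spectral_orth_ff y y' : y <> y' -> '[f y, f y'] = 0.
Proof.
by move=> ne; have [_ _ [/(_ (inl y) (inl y') 1 1) o _]] := sp; rewrite !act1 in o; apply: o => -[].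
Qed.

(** Eigenvectors with different eigenvalues are orthogonal, and all are orthogonal to
    the translates of wandering vectors. *)
Lemma eigen_in_span z v : eigenvector z v -> in_closed_span [set u | exists2 y, lam y = z & u = f y] v.
Proof.
move=> ev; have [cv nz uv] := ev; have [hf hh [og _]] := sp.
apply: (@span_complement _ _ _ [set u | (exists2 y, lam y <> z & u = f y) \/ exists c n, u = zpow n (h c)]).
- move=> _ _ [y yz ->] [[y' yz' ->]|[c [n ->]]].
    by apply: spectral_orth_ff => e; apply: yz'; rewrite -e.
  by apply: (eigen_wandering_orth _ (hf y).1).
- apply: cspan_mono (spectral_span cv) => u [[y _ <-]|hu]; apply: sub_cspan; last by right; right.
  by have [e|e] := pselect (lam y = z); [left; exists y|right; left; exists y].
- move=> _ [[y yz ->]|[c [n ->]]]; last exact: (eigen_wandering_orth _ ev).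
  have [[cf nf ef] _] := hf y; have := opA_isometric ck hJ (f y) cv.
  rewrite uv ef hdotZl hdotZr mulrA => e.
  have : (z * Num.conj (lam y) - 1) * '[v, f y] = 0 by rewrite mulrBl mul1r e subrr.
  move/eqP; rewrite mulf_eq0 => /orP[|/eqP//]; rewrite subr_eq0 => /eqP e1.
  exfalso; apply: yz; apply: esym; rewrite -[z]mulr1 -[1](_ : Num.conj (lam y) * lam y = 1).
    by rewrite mulrA e1 mul1r.
  by rewrite conj_mul nf expr1n.
Qed.

Lemma wandering_in_span v : wandering v -> in_closed_span [set u | exists c n, u = zpow n (h c)] v.
Proof.
move=> wv; have [cv _] := wv; have [hf hh _] := sp.
apply: (@span_complement _ _ _ (range f)).
- by move=> _ _ [c [n ->]] [y _ <-]; rewrite hdotC (eigen_wandering_orth _ (hf y).1 (hh c)) conjC0.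
- by rewrite setUC; exact: spectral_span.
- by move=> _ [y _ <-]; rewrite hdotC (eigen_wandering_orth 0 (hf y).1 wv) conjC0.
Qed.

Lemma eigen_orthonormal z : orthonormal_family (fun p : {y | lam y = z} * 'I_1 => f (sval p.1)).
Proof.
have [hf _ _] := sp; split=> [p|[[y hy] i] [[y' hy'] i'] /= ne]; first by rewrite hdot_unit ?(hf _).2.
apply: spectral_orth_ff => e; apply: ne; subst y'.
by rewrite (Prop_irrelevance hy hy') (ord1 i) (ord1 i').
Qed.

Lemma translates_orthonormal : orthonormal_family (fun p : C * int => zpow p.2 (h p.1)).
Proof.
have [_ hh [og _]] := sp; split=> [[c n]|[c n] [c' n'] /= ne].
  exact: (wandering_orthonormal (hh c)).1.
have [e|e] := pselect (c = c').
  by subst c'; apply: (wandering_orthonormal (hh c)).2 => nn; apply: ne; rewrite nn.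
have [a ->] := zpow_act n; have [b ->] := zpow_act n'.
by apply: (og (inr c) (inr c')) => -[].
Qed.

End OneFamily.

(** The eigenspaces and the span of the wandering translates do not depend on the
    system of generators, so both are compared by [wandering_equipotent], with the
    trivial group and with the integers. *)
Theorem spectral_unique (Y Y' C C' : Type) (lam : Y -> R[i]) (lam' : Y' -> R[i]) f f' (h : C -> tau) (h' : C' -> tau) :
  spectral lam f h -> spectral lam' f' h' ->
  (exists F : Y -> Y', bijective F /\ forall y, lam' (F y) = lam y) /\ equipotent C C'.
Proof.
move=> sp sp'; split.
  apply: glue_bijections => z; have [hf _ _] := sp; have [hf' _ _] := sp'.
  apply: (wandering_equipotent (eigen_orthonormal sp z) (eigen_orthonormal sp' z)) => // -[y hy] /=.
    have ev : eigenvector z (f' y) by rewrite -hy; exact: (hf' y).1.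
    apply: cspan_mono (eigen_in_span sp ev) => _ [y' hy' ->].
    by apply: sub_cspan; exists (exist _ y' hy', ord0).
  have ev : eigenvector z (f y) by rewrite -hy; exact: (hf y).1.
  apply: cspan_mono (eigen_in_span sp' ev) => _ [y' hy' ->].
  by apply: sub_cspan; exists (exist _ y' hy', ord0).
have [_ hh _] := sp; have [_ hh' _] := sp'.
apply: (wandering_equipotent (translates_orthonormal sp) (translates_orthonormal sp')) => [i j g k|j|j] /=.
- by rewrite zpow_dot//; [exact: (hh' _).1|exact: (hh _).1].
- apply: cspan_mono (wandering_in_span sp (hh' j)) => _ [c [n ->]].
  by apply: sub_cspan; exists (c, n).
- apply: cspan_mono (wandering_in_span sp' (hh j)) => _ [c [n ->]].
  by apply: sub_cspan; exists (c, n).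
Qed.

End SpectralUniqueness.

Section AperiodicUniqueness.
Context {R : realType} {N : nat} {A : 'M[bool]_N} {O : cstar_algebra R} {s : 'I_N -> O}.
Hypothesis ck : ck_relations A s.
Hypothesis gen : forall S : set O, closed_star_subalgebra S -> (forall i, S (s i)) -> S = setT.
Context (x : nat -> 'I_N).
Hypothesis hx : infinite_word A x.
Hypothesis ax : ~ eventually_periodic x.
Local Notation coded := (coded (s := s)).
Context {tau : representation O}.

Definition coded_generators (C : Type) (g : C -> tau) :=
  (forall c, coded x (g c) /\ hnorm (g c) = 1) /\ generates g.

Lemma coded_generators_span (C : Type) (g : C -> tau) v : coded_generators g -> coded x v ->
  in_closed_span (range (fun p : C * 'I_1 => g p.1)) v.
Proof.
move=> [hg [_ tg]] cv; apply: cspan_mono (coded_span_return ck gen hx (fun c => (hg c).1) tg cv) => _ [c [k [m [e ->]]]].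
rewrite (aperiodic_branch ax)//; last exact: (hg c).1.
by apply: sub_cspan; exists (c, ord0).
Qed.

Lemma coded_generators_orthonormal (C : Type) (g : C -> tau) : coded_generators g ->
  orthonormal_family (fun p : C * 'I_1 => g p.1).
Proof.
move=> [hg [og _]]; split=> [p|[c i] [c' i'] /= ne]; first by rewrite hdot_unit ?(hg _).2.
have := og c c' 1 1; rewrite !act1; apply=> e; apply: ne.
by rewrite e (ord1 i) (ord1 i').
Qed.

Theorem coded_generators_unique (C C' : Type) (g : C -> tau) (g' : C' -> tau) :
  coded_generators g -> coded_generators g' -> equipotent C C'.
Proof.
move=> hg hg'; apply: (wandering_equipotent (coded_generators_orthonormal hg) (coded_generators_orthonormal hg')) => //.
  by move=> c; apply: coded_generators_span => //; exact: (hg'.1 c).1.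
by move=> c; apply: coded_generators_span => //; exact: (hg.1 c).1.
Qed.

End AperiodicUniqueness.

(** * Uniqueness of the decomposition *)

Lemma generates_reindex {R : realType} {O : cstar_algebra R} (tau : representation O) (I I' : Type) (g : I -> tau)
  (r : I' -> I) : generates g -> injective r -> (forall i, exists i', r i' = i) -> generates (fun i => g (r i)).
Proof.
move=> [og tg] ir sr; split=> [i j a b ij|]; first by apply: og => /ir.
apply: total_orth => v hv; apply: (orth_total tg) => _ [i [a ->]]; apply: hv.
by have [i' <-] := sr i; exists i', a.
Qed.

Lemma generates_ext {R : realType} {O : cstar_algebra R} (tau : representation O) (I : Type) (g g' : I -> tau) :
  (forall i, g i = g' i) -> generates g -> generates g'.
Proof. by move=> /funext ->. Qed.

Section Components.
Context {R : realType} {N : nat} {A : 'M[bool]_N} {O : cstar_algebra R} {s : 'I_N -> O}.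
Hypothesis isO : is_cuntz_krieger A s.
Context {eta : probability (borel_circle R) R}.
Hypothesis haar : is_haar eta.
Context (i0 : 'I_N).
Let ck : ck_relations A s. Proof. by case: isO. Qed.
Let gen : forall S : set O, closed_star_subalgebra S -> (forall i, S (s i)) -> S = setT.
Proof. by case: isO. Qed.

Lemma circle_root_unit p j : cabs (circle_root (R := R) p j) = 1.
Proof. exact: cabs_expi. Qed.

Definition root_eigenvalue (nu : nat -> Type) (y : {q : {p & nu p} & 'I_(projT1 q).+1}) : R[i] :=
  circle_root (R := R) (projT1 (projT1 y)).+1 (projT2 y).+1.

(** Each sum over roots contributes its eigenvectors, and each direct integral the
    wandering vector of [field_cyclic]. *)
Lemma sum_spectral J (nu : nat -> Type) (C : Type) (Hr : forall p, 'I_p.+1 -> representation O)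
  (F : rep_field O) (rs : nat -> representation O) (fi M : representation O) :
  primitive i0 J -> infinite_word A (wpow_inf i0 J) ->
  (forall p (j : 'I_p.+1), is_P s J (circle_root (R := R) p.+1 j.+1) (Hr p j)) ->
  (forall z, is_P s J (val z) (F z)) ->
  (forall p, is_direct_sum (Hr p) (rs p)) -> is_direct_integral eta F fi ->
  is_direct_sum (fun i : {p & nu p} + C => match i with inl c => rs (projT1 c) | inr _ => fi end) M ->
  exists f h, spectral (s := s) (tau := M) i0 J (root_eigenvalue (nu := nu)) f (h : C -> M).
Proof.
move=> pJ hJ hr hF drs dfi [V [iV oV tV sV]].
have Hg p : exists g : 'I_p.+1 -> rs p, (forall j : 'I_p.+1, eigenvector (s := s) i0 J (circle_root (R := R) p.+1 j.+1) (g j) /\ hnorm (g j) = 1) /\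
    generates g.
  have [W [iW oW tW sW]] := drs p.
  pose Om (j : 'I_p.+1) := projT1 (cid (is_P_eigen ck pJ (circle_root_unit p.+1 j.+1) (hr p j))).
  have hOm (j : 'I_p.+1) : [/\ cyclic_vector (Om j), hnorm (Om j) = 1, coded (s := s) (wpow_inf i0 J) (Om j)
      & opA (s := s) J (Om j) = circle_root (R := R) p.+1 j.+1 *: Om j].
    exact: projT2 (cid (is_P_eigen ck pJ (circle_root_unit p.+1 j.+1) (hr p j))).
  exists (fun j => W j (Om j)); split=> [j|].
    have [_ n1 cO eO] := hOm j; split; last by rewrite (isometry_norm _ (iW j)).
    split; [exact: (coded_image (iW j) (tW j))|exact: circle_root_unit|].
    rewrite -(opA_intertwiner (s := s) J (Om j) (tW j)) eO.
    exact: (linZ _ _ (isometry_lin (iW j))).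
  by apply: cyclic_generates => // j; have [] := hOm j.
pose g p := projT1 (cid (Hg p)).
have hg p : (forall j : 'I_p.+1, eigenvector (s := s) i0 J (circle_root (R := R) p.+1 j.+1) (g p j) /\ hnorm (g p j) = 1) /\
    generates (g p) by exact: projT2 (cid (Hg p)).
have [e [ce he we]] := field_cyclic ck gen haar pJ hJ hF dfi.
pose X (i : {p & nu p} + C) : Type := match i with inl c => 'I_(projT1 c).+1 | inr _ => unit end.
pose G i : X i -> (match i with inl c => rs (projT1 c) | inr _ => fi end : representation O) :=
  match i with inl c => g (projT1 c) | inr _ => fun _ => e end.
have hG i : generates (G i).
  case: i => [c|c]; first exact: (hg (projT1 c)).2.
  by split=> [[] [] a b //|]; exact: cyclic_total.
have hgen := sum_generates iV oV tV sV hG.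
exists (fun y => V (inl (projT1 y)) (g (projT1 (projT1 y)) (projT2 y))), (fun c => V (inr c) e); split.
- move=> y; have [[cg ng eg] n1] := (hg (projT1 (projT1 y))).1 (projT2 y); split; last first.
    by rewrite (isometry_norm _ (iV _)).
  split=> //; first exact: (coded_image (iV (inl (projT1 y))) (tV (inl (projT1 y)))).
  rewrite -(opA_intertwiner (s := s) J _ (tV (inl (projT1 y)))) eg.
  exact: (linZ _ _ (isometry_lin (iV (inl (projT1 y))))).
- move=> c; split; first exact: (coded_image (iV (inr c)) (tV (inr c))).
  move=> n; rewrite -we -(iV (inr c)).2 -!(opA_iter (s := s) i0 J n).
  by rewrite -(opA_intertwiner (s := s) _ _ (tV (inr c))).
pose r (i : {q : {p & nu p} & 'I_(projT1 q).+1} + C) : {i & X i} :=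
  match i with inl y => existT X (inl (projT1 y)) (projT2 y) | inr c => existT X (inr c) tt end.
pose r' (p : {i & X i}) : {q : {p & nu p} & 'I_(projT1 q).+1} + C :=
  match p with existT (inl q) j => inl (existT _ q j) | existT (inr c) _ => inr c end.
apply: (generates_ext _ (generates_reindex (r := r) hgen _ _)).
- by move=> [y|c].
- by apply: (can_inj (g := r')) => -[[q j]|c].
- by move=> [[q|c] j]; [exists (inl (existT _ q j))|exists (inr c); case: j].
Qed.

Lemma sum_coded_generators (K : nat -> 'I_N) (C : Type) (Hk M : representation O) :
  infinite_word A K -> is_P_inf s K Hk -> is_direct_sum (fun _ : C => Hk) M ->
  exists g : C -> M, coded_generators (s := s) K g.
Proof.
move=> hK /(is_P_inf_coded ck)[v [cv v1 hv]] [V [iV oV tV sV]].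
exists (fun c => V c v); split; last exact: cyclic_generates.
move=> c; split; last by rewrite (isometry_norm _ (iV c)).
exact: (coded_image (iV c) (tV c)).
Qed.

End Components.

Section DecompositionUniqueness.
Context {R : realType} {N : nat} {A : 'M[bool]_N} {O : cstar_algebra R} {s : 'I_N -> O}.
Hypothesis isO : is_cuntz_krieger A s.
Context {eta : probability (borel_circle R) R}.
Hypothesis haar : is_haar eta.
Context (i0 : 'I_N) {T : set (nat -> 'I_N)}.
Hypothesis hT : bracket_infinite A T.
Let ck : ck_relations A s. Proof. by case: isO. Qed.
Let gen : forall S : set O, closed_star_subalgebra S -> (forall i, S (s i)) -> S = setT.
Proof. by case: isO. Qed.
Local Notation index := (fin_index A + inf_index T)%type.

Definition index_word (i : index) : nat -> 'I_N :=
  match i with inl J => wpow_inf i0 (sval J) | inr K => sval K end.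

Lemma index_word_infinite i : infinite_word A (index_word i).
Proof. by case: i => -[w hw] /=; [exact: bracket_infinite_word|exact: (representative_word hT hw)]. Qed.

Lemma index_primitive (J : fin_index A) : primitive i0 (sval J).
Proof. by case: J => J hJ; exact: (bracket_primitive i0 hJ). Qed.

Lemma index_aperiodic (K : inf_index T) : ~ eventually_periodic (sval K).
Proof. by case: K => K hK; exact: (representative_aperiodic hT hK). Qed.

Lemma index_word_inj i j : tail_eq (index_word i) (index_word j) -> i = j.
Proof.
case: i j => [[J hJ]|[K hK]] [[J' hJ']|[K' hK']] /= e.
- have E : J = J' by exact: bracket_unique hJ hJ' e.
  by subst J'; rewrite (Prop_irrelevance hJ hJ').
- by case: (representative_not_periodic hT hK' (bracket_size hJ) (tail_eq_sym e)).
- by case: (representative_not_periodic hT hK (bracket_size hJ') e).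
- have E : K = K' by exact: (representative_unique hT hK hK' e).
  by subst K'; rewrite (Prop_irrelevance hK hK').
Qed.

Context {tau : representation O}.
Implicit Types (D : decomposition O A T).

Lemma decomposition_irreducible D : is_decomposition s eta tau D -> irreducible_components D.
Proof.
move=> [[h1 h2 h3] _ _ _]; split.
- move=> J p j; apply: (is_P_irreducible ck gen (index_primitive J) (index_word_infinite (inl J)) (circle_root_unit _ _) (h1 J p j)).
- move=> J z; apply: (is_P_irreducible ck gen (index_primitive J) (index_word_infinite (inl J)) (cabs_circle z) (h2 J z)).
- move=> K; exact: (is_P_inf_irreducible ck gen (index_word_infinite (inr K)) (@index_aperiodic K) (h3 K)).
Qed.

Lemma decomposition_carried D : is_decomposition s eta tau D -> forall i : index,
  carried (s := s) (index_word i) (match i with inl J => H_J D J | inr K => H_K D K end).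
Proof.
move=> [[h1 h2 h3] [h4 h5] [h6 h7] _] [J|K] /=.
  have [f [h [hf hh hg]]] := sum_spectral isO haar (index_primitive J) (index_word_infinite (inl J)) (h1 J) (h2 J) (h4 J) (h5 J) (h6 J).
  by apply: (generates_carried hg) => -[y|c]; [have [[]] := hf y|have [] := hh c].
have [g [hg gg]] := sum_coded_generators isO (index_word_infinite (inr K)) (h3 K) (h7 K).
by apply: (generates_carried gg) => c; have [] := hg c.
Qed.

Lemma decomposition_equivalence D D' : is_decomposition s eta tau D -> is_decomposition s eta tau D' ->
  forall i : index, unitarily_equivalent (match i with inl J => H_J D J | inr K => H_K D K end)
    (match i with inl J => H_J D' J | inr K => H_K D' K end).
Proof.
move=> dD dD'; have [_ _ _ h] := dD; have [_ _ _ h'] := dD'.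
apply: (carried_sum_unique ck gen index_word_infinite _ h h' (decomposition_carried dD) (decomposition_carried dD')).
by move=> i j ij /index_word_inj.
Qed.

Theorem decomposition_unique D D' : is_decomposition s eta tau D -> is_decomposition s eta tau D' ->
  equivalent_decompositions D D'.
Proof.
move=> dD dD'; have eqv := decomposition_equivalence dD dD'; have eqv' := decomposition_equivalence dD' dD.
have [[h1 h2 h3] [h4 h5] [h6 h7] _] := dD; have [[h1' h2' h3'] [h4' h5'] [h6' h7'] _] := dD'.
have spectra J : (exists f : root_index D J -> root_index D' J,
        bijective f /\ forall i, unitarily_equivalent (root_component i) (root_component (f i))) /\
    equipotent (nu_int D J) (nu_int D' J).
  have pJ := index_primitive J; have hJ := index_word_infinite (inl J).
  have [f [h sp]] := sum_spectral isO haar pJ hJ (h1 J) (h2 J) (h4 J) (h5 J) (h6 J).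
  have sum' := direct_sum_transport (h6' J) (eqv' (inl J)).
  have [f' [h' sp']] := sum_spectral isO haar pJ hJ (h1' J) (h2' J) (h4' J) (h5' J) sum'.
  have [[F [bF lF]] eqC] := spectral_unique ck gen pJ hJ sp sp'; split=> //.
  pose toY (D0 : decomposition O A T) (i : root_index D0 J) :
      {q : {p & nu_fin D0 J p} & 'I_(projT1 q).+1} :=
    existT _ (existT _ (projT1 i) (projT2 i).2) (projT2 i).1.
  pose ofY (D0 : decomposition O A T) (y : {q : {p & nu_fin D0 J p} & 'I_(projT1 q).+1}) : root_index D0 J :=
    existT _ (projT1 (projT1 y)) (projT2 y, projT2 (projT1 y)).
  have toK D0 : cancel (@toY D0) (@ofY D0) by case=> p [j c].
  have ofK D0 : cancel (@ofY D0) (@toY D0) by case=> -[p c] j.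
  exists (fun i => ofY D' (F (toY D i))); split=> [|i].
    have [G FK GK] := bF; exists (fun i => ofY D (G (toY D' i))) => i.
      by rewrite ofK FK toK.
    by rewrite ofK GK toK.
  have e := lF (toY D i); rewrite /root_eigenvalue in e.
  apply: (is_P_unique ck gen pJ hJ (circle_root_unit _ _) (h1 J _ (projT2 i).1)).
  have := h1' J (projT1 (ofY D' (F (toY D i)))) (projT2 (ofY D' (F (toY D i)))).1.
  by rewrite /= e.
split.
- by move=> J; exact: (eqv (inl J)).
- by move=> K; exact: (eqv (inr K)).
- by move=> J; exact: (spectra J).1.
- move=> J; have pJ := index_primitive J; have hJ := index_word_infinite (inl J); split.
  + exact: (spectra J).2.
  + have [e [ce he we]] := field_cyclic ck gen haar pJ hJ (h2 J) (h5 J).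
    have [e' [ce' he' we']] := field_cyclic ck gen haar pJ hJ (h2' J) (h5' J).
    by apply: (iter_correlation_unitary ck gen pJ hJ he he' ce ce') => n; rewrite we we'.
  + by move=> z; exact: (is_P_unique ck gen pJ hJ (cabs_circle z) (h2 J z) (h2' J z)).
- move=> K; have hK := index_word_infinite (inr K); have aK := @index_aperiodic K; split.
    have [g hg] := sum_coded_generators isO hK (h3 K) (h7 K).
    have sum' := direct_sum_transport (h7' K) (eqv' (inr K)).
    have [g' hg'] := sum_coded_generators isO hK (h3' K) sum'.
    exact: (coded_generators_unique ck gen hK aK hg hg').
  exact: (is_P_inf_unique ck gen hK aK (h3 K) (h3' K)).
Qed.

End DecompositionUniqueness.

(** * Sums over roots of unity *)

Section EmbeddedSum.
Context {R : realType} {O : cstar_algebra R} {tau : representation O}.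
Context (I : Type) (rho : I -> representation O) (g : forall i, rho i) (t : I -> tau).
Hypothesis cg : forall i, cyclic_vector (g i).
Hypothesis orth : forall i j a b, i <> j -> '[act a (t i), act b (t j)] = 0.
Hypothesis emb : forall i, exists V : rho i -> tau, [/\ isometry_into V, intertwiner V & V (g i) = t i].

(** Cyclic subspaces of [tau] with orthogonal generators: the direct sum of abstract
    copies embeds, with range the span of the orbits of the [t i]. *)
Lemma embed_sum : exists (M : representation O) (W : M -> tau),
  [/\ is_direct_sum rho M, isometry_into W, intertwiner W, forall i, exists u, W u = t i
    & forall u, in_closed_span [set v | exists i a, v = act a (t i)] (W u)].
Proof.
pose V' i := projT1 (cid (emb i)).
have hV' i : [/\ isometry_into (V' i), intertwiner (V' i) & V' i (g i) = t i] by exact: projT2 (cid (emb i)).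
have spV i u : in_closed_span [set v | exists a, v = act a (t i)] (V' i u).
  have [iV tV gV] := hV' i.
  set S := [set v | _]; have cs := csub_preim (isometry_blin iV) (cspan_csub S).
  apply: (total_ind (cyclic_total (@cg i)) cs) => _ [_ [a ->]] /=.
  by apply: sub_cspan; exists a; rewrite tV gV.
have [M [V [iV oV tV sV]]] := direct_sum_exists rho.
have [||W [iW WV]] := @gram_isometry R M tau {i & rho i} (fun p => V (projT1 p) (projT2 p)) (fun p => V' (projT1 p) (projT2 p)).
- move=> [i u] [j v] /=; have [ij|ij] := pselect (i = j).
    by subst j; rewrite (iV i).2; have [[_ ->]] := hV' i.
  rewrite oV//; apply: esym; apply: (cspan_orthl (spV i u)) => _ [a ->].
  by apply: (cspan_orthr (spV j v)) => _ [b ->]; exact: orth.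
- apply: total_orth => v hv; apply: (orth_total sV) => _ [i [u ->]]; apply: hv.
  by exists (existT _ i u).
have WV' i u : W (V i u) = V' i u := WV (existT _ i u).
exists M, W; split=> //; first by exists V.
- move=> a v; have cs := csub_eq (blin_comp (act_blin M a) (isometry_blin iW)) (blin_comp (isometry_blin iW) (act_blin tau a)).
  apply: (total_ind sV cs) => _ [i [u ->]] /=; have [_ tV' _] := hV' i.
  by rewrite -tV !WV' tV'.
- by move=> i; exists (V i (g i)); rewrite WV'; have [] := hV' i.
- set S := [set v | _]; have cs := csub_preim (isometry_blin iW) (cspan_csub S).
  move=> v; apply: (total_ind sV cs) => _ [i [u ->]] /=.
  rewrite WV'; apply: cspan_mono (spV i u) => _ [a ->].
  by apply: sub_cspan; exists i, a.
Qed.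

End EmbeddedSum.

Section RootsOfUnitySums.
Context {R : realType}.
Local Notation root P j := (circle_root (R := R) P j).

Lemma circle_rootE P j : root P j = root P 1 ^+ j.
Proof. by rewrite -expiX; congr expi; rewrite mulr1 mulrAC. Qed.

(** An n-th power equal to 1 makes the angle a multiple of a full turn. *)
Lemma circle_root_order P n : (0 < P)%N -> (root P 1 ^+ n == 1) = (P %| n)%N.
Proof.
move=> P0; have P1 : P%:R != 0 :> R by rewrite pnatr_eq0 -lt0n.
have rP : root P 1 ^+ P = 1.
  rewrite -circle_rootE -[LHS]/(expi (2 * trigo.pi * P%:R / P%:R)) mulfK// mulrC.
  by rewrite expiX expi_pi sqrrN expr1n.
rewrite {1}(divn_eq n P) exprD mulnC exprM rP expr1n mul1r /dvdn.
have := ltn_pmod n P0; case: (n %% P)%N => [|k] kP; first by rewrite expr0 !eqxx.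
apply/eqP => h; have : complex.Re (root P 1 ^+ k.+1) = 1 by rewrite h.
(* The cosine of twice [a] is 1 while [0 < a < pi]. *)
rewrite -circle_rootE /= => c1; set a := trigo.pi * k.+1%:R / P%:R : R.
have sa : 0 < sin a.
  apply: sin_gt0_pi; rewrite /a divr_gt0 ?mulr_gt0 ?pi_gt0 ?ltr0n//=.
  by rewrite ltr_pdivrMr ?ltr0n// ltr_pM2l ?pi_gt0// ltr_nat.
have : cos (a + a) = 1 by rewrite -c1 /a -mulrDl -mulrDl -mulr2n mulr_natl.
have := cos2Dsin2 a; rewrite cosD; nra.
Qed.

Lemma geometric_zero (z : R[i]) P : z ^+ P = 1 -> z != 1 -> \sum_(n < P) z ^+ n = 0.
Proof.
move=> zP z1; have /eqP : (z - 1) * \sum_(n < P) z ^+ n = 0 by rewrite -subrX1 zP subrr.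
by rewrite mulf_eq0 subr_eq0 (negPf z1) => /eqP.
Qed.

Lemma circle_root_power_sum p n : \sum_(j < p.+1) root p.+1 j.+1 ^+ n = (if (p.+1 %| n)%N then p.+1%:R else 0).
Proof.
rewrite (eq_bigr (fun j : 'I_p.+1 => root p.+1 1 ^+ n * (root p.+1 1 ^+ n) ^+ j)); last first.
  by move=> j _; rewrite circle_rootE -!exprM -exprD; congr (_ ^+ _); lia.
rewrite -mulr_sumr -circle_root_order//; case: eqP => [->|/eqP ne].
  rewrite mul1r (eq_bigr (fun=> 1)); last by move=> j _; rewrite expr1n.
  by rewrite big_const_ord iter_addr_0.
rewrite geometric_zero ?mulr0// -exprM mulnC exprM.
by have /eqP -> : root p.+1 1 ^+ p.+1 == 1; [rewrite circle_root_order|rewrite expr1n].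
Qed.

Lemma circle_root_orthogonality p (i j : 'I_p.+1) :
  \sum_(n < p.+1) root p.+1 i.+1 ^+ n * Num.conj (root p.+1 j.+1) ^+ n = (if i == j then p.+1%:R else 0).
Proof.
set r := fun i : 'I_p.+1 => root p.+1 i.+1.
have r1 k : r k * Num.conj (r k) = 1 by rewrite mul_conj cabs_expi expr1n.
rewrite (eq_bigr (fun n : 'I_p.+1 => (r i * Num.conj (r j)) ^+ n)); last by move=> n _; rewrite exprMn.
case: eqP => [->|/eqP ij].
  by rewrite r1 (eq_bigr (fun=> 1)) ?big_const_ord ?iter_addr_0// => n _; rewrite expr1n.
have rP k : r k ^+ p.+1 = 1.
  by apply/eqP; rewrite /r circle_rootE -exprM circle_root_order// dvdn_mull.
apply: geometric_zero; first by rewrite exprMn -rmorphXn /= !rP rmorph1 mulr1.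
apply/eqP => e; have {e} rij : r i = r j.
  by rewrite -[r j]mul1r -e -mulrA [Num.conj _ * _]mulrC r1 mulr1.
wlog ltij : i j ij rij / (i < j)%N.
  move=> H; have := ij; rewrite -(inj_eq val_inj) neq_ltn => /orP[h|h]; first exact: (H i j).
  by apply: (H j i) => //; rewrite eq_sym.
have : root p.+1 1 ^+ (j - i) = 1.
  apply: (@mulfI _ (r i)); first by apply/eqP => h; have := r1 i; rewrite h mul0r => /eqP; rewrite eq_sym oner_eq0.
  by rewrite mulr1 [RHS]rij /r (circle_rootE _ i.+1) (circle_rootE _ j.+1) -exprD; congr (_ ^+ _); lia.
move/eqP; rewrite circle_root_order// => /dvdn_leq; rewrite subn_gt0 ltij => /(_ isT).
by have := ltn_ord j; lia.
Qed.

End RootsOfUnitySums.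

Section RootsCyclic.
Context {R : realType} {N : nat} {A : 'M[bool]_N} {O : cstar_algebra R} {s : 'I_N -> O}.
Hypothesis ck : ck_relations A s.
Context (i0 : 'I_N) (J : seq 'I_N).
Hypothesis pJ : primitive i0 J.
Local Notation x := (wpow_inf i0 J).
Local Notation opA := (opA (s := s)).
Local Notation coded := (coded (s := s)).
Local Notation root P j := (circle_root (R := R) P j).

(** The equidistributed combination of the eigenvectors for all [p.+1]-th roots
    of unity is cyclic, and the unitary moves it through an orthonormal cycle of length
    [p.+1]: this is the discrete Fourier transform. *)
Lemma roots_cyclic p (Hr : 'I_p.+1 -> representation O) (rs : representation O) :
  (forall j : 'I_p.+1, is_P s J (root p.+1 j.+1) (Hr j)) -> is_direct_sum Hr rs ->
  exists w : rs, [/\ cyclic_vector w, coded x w & forall n, '[iter n (opA J) w, w] = (p.+1 %| n)%N%:R].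
Proof.
move=> hr [V [iV oV tV sV]].
pose Om (j : 'I_p.+1) := projT1 (cid (is_P_eigen ck pJ (cabs_expi _) (hr j))).
have hOm (j : 'I_p.+1) : [/\ cyclic_vector (Om j), hnorm (Om j) = 1, coded x (Om j) & opA J (Om j) = root p.+1 j.+1 *: Om j].
  exact: projT2 (cid (is_P_eigen ck pJ (cabs_expi _) (hr j))).
pose f (j : 'I_p.+1) := V j (Om j).
have ef (j : 'I_p.+1) : opA J (f j) = root p.+1 j.+1 *: f j.
  have [_ _ _ eO] := hOm j; rewrite -(opA_intertwiner (s := s) J (Om j) (tV j)) eO.
  exact: (linZ _ _ (isometry_lin (iV j))).
have cf (j : 'I_p.+1) : coded x (f j) by have [_ _ cO _] := hOm j; exact: (coded_image (iV j) (tV j)).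
have ff i j : '[f i, f j] = (i == j)%:R.
  case: eqP => [->|ij]; last exact: oV.
  by rewrite (iV j).2 hdot_unit//; have [] := hOm j.
(* The normalisation that makes [w] a unit vector. *)
pose q : R[i] := ((Num.sqrt p.+1%:R)^-1)%:C%C.
have qq : q * Num.conj q = p.+1%:R^-1.
  rewrite mul_conj cabs_RC ger0_norm ?invr_ge0 ?sqrtr_ge0// exprVn sqr_sqrtr ?ler0n//.
  by rewrite fmorphV rmorph_nat.
pose w := \sum_(j < p.+1) q *: f j.
have iw n : iter n (opA J) w = \sum_(j < p.+1) (q * root p.+1 j.+1 ^+ n) *: f j.
  elim: n => [|n IH]; first by apply: eq_bigr => j _; rewrite expr0 mulr1.
  rewrite iterS IH (lin_sum _ _ _ (opA_blin (s := s) rs J).1); apply: eq_bigr => j _.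
  by rewrite (linZ _ _ (opA_blin (s := s) rs J).1) ef scalerA -mulrA -exprSr.
exists w; split.
- apply: (total_cyclic (X := [set v | exists a, v = act a w])) => //.
  apply: total_orth => v hv.
  have [_ tf] := cyclic_generates iV oV tV sV (fun j => (let: And4 h _ _ _ := hOm j in h)).
  apply: (orth_total tf) => _ [j [a ->]]; rewrite -/(f j).
  have h n : '[v, act a (iter n (opA J) w)] = 0.
    by rewrite -(opA_iter (s := s) i0) opAE -actM; apply: hv; eexists.
  have E n : '[v, act a (iter n (opA J) w)] = \sum_(i < p.+1) Num.conj (q * root p.+1 i.+1 ^+ n) * '[v, act a (f i)].
    rewrite iw (lin_sum _ _ _ (act_lin a)) hdot_sumr; apply: eq_bigr => i _.
    by rewrite (linZ _ _ (act_lin a)) hdotZr.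
  (* Inverse discrete Fourier transform: this combination isolates the j-th summand. *)
  have : \sum_(n < p.+1) root p.+1 j.+1 ^+ n * '[v, act a (iter n (opA J) w)] = 0.
    by rewrite big1// => n _; rewrite h mulr0.
  under eq_bigr do rewrite E mulr_sumr.
  rewrite exchange_big /= (eq_bigr (fun i : 'I_p.+1 => if i == j then Num.conj q * p.+1%:R * '[v, act a (f i)] else 0)).
    rewrite -big_mkcond big_pred1_eq => /eqP; rewrite !mulf_eq0 pnatr_eq0 orbF => /orP[/eqP q0|/eqP//].
    by have := qq; rewrite q0 mulr0 => /eqP; rewrite eq_sym invr_eq0 pnatr_eq0.
  move=> i _; rewrite (eq_bigr (fun n : 'I_p.+1 => Num.conj q * '[v, act a (f i)] *
      (root p.+1 j.+1 ^+ n * Num.conj (root p.+1 i.+1) ^+ n))); last first.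
    by move=> n _; rewrite rmorphM rmorphXn /=; ring.
  rewrite -mulr_sumr circle_root_orthogonality eq_sym; case: eqP => _; last by rewrite mulr0.
  by rewrite mulrAC.
- have cx := coded_csub (s := s) x rs; apply: (csub_sum (fun=> q) cx) => j; exact: cf.
- move=> n; rewrite iw hdot_suml.
  rewrite (eq_bigr (fun j : 'I_p.+1 => p.+1%:R^-1 * root p.+1 j.+1 ^+ n)); last first.
    move=> j _; rewrite hdotZl hdot_sumr (bigD1 j)//= big1 => [|i ij].
      by rewrite hdotZr ff eqxx mulr1 addr0 mulrAC qq.
    by rewrite hdotZr ff eq_sym (negPf ij) mulr0.
  rewrite -mulr_sumr circle_root_power_sum; case: ifP => _; last by rewrite mulr0.
  by rewrite mulVf// pnatr_eq0.
Qed.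

End RootsCyclic.

(** * Orbits of a permutative representation *)

Section PermutativeBasis.
Context {R : realType} {N : nat} {A : 'M[bool]_N} {O : cstar_algebra R} {s : 'I_N -> O}.
Hypothesis ck : ck_relations A s.
Hypothesis gen : forall S : set O, closed_star_subalgebra S -> (forall i, S (s i)) -> S = setT.
Local Notation opA := (opA (s := s)).
Local Notation opB := (opB (s := s)).
Local Notation sa := (sa (s := s)).
Local Notation sb := (sb (s := s)).
Local Notation coded := (coded (s := s)).
Local Notation branch := (branch (s := s)).

(** The ranges of the generators span the space, so every basis vector is hit; it is hit
    once, because its source is its image under an adjoint generator and the ranges are
    orthogonal. *)
Lemma coding_map (tau : representation O) : permutative s tau ->
  exists (L : Type) (e : L -> tau) (c : L -> 'I_N) (sigma : L -> L),
    [/\ orthonormal_family e, total_set (range e), forall k, sa (c k) (e (sigma k)) = e k,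
        forall k, sb (c k) (e k) = e (sigma k)
      & forall i k, sa i (e k) = 0 \/ exists k', sa i (e k) = e k'].
Proof.
move=> [L [e [D [m [oe te h1 h0]]]]].
have {}h1 i n : D i n -> sa i (e n) = e (m i n) by exact: h1.
have {}h0 i n : ~ D i n -> sa i (e n) = 0 by exact: h0.
have e1 k : hnorm (e k) = 1 by apply/eqP; rewrite -sqrp_eq1 ?hnorm_ge0// hnorm_sq oe.1.
have back i n : D i n -> sb i (e (m i n)) = e n.
  move=> Din; rewrite -(h1 _ _ Din).
  have n1 : hnorm (sa i (e n)) = 1 by rewrite h1.
  apply/eqP; rewrite -subr_eq0; apply/eqP/hnorm_eq0/eqP; rewrite -sqrf_eq0 eq_le sqr_ge0 andbT.
  rewrite hnormB_sq sb_dot -hnorm_sq n1 e1.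
  have : hnorm (sb i (sa i (e n))) ^+ 2 <= 1 ^+ 2.
    by rewrite ler_sqr ?nnegrE ?hnorm_ge0// -n1 (hnorm_sb_le ck).
  lra.
have src k : exists in_ : 'I_N * L, D in_.1 in_.2 /\ m in_.1 in_.2 = k.
  apply: contrapT => /forallNP h.
  have z i : sb i (e k) = 0.
    apply: (orth_total te) => _ [n _ <-]; rewrite sb_dot.
    have [Din|Din] := pselect (D i n); last by rewrite h0// hdot0r.
    rewrite h1//; apply: oe.2 => km; exact: (h (i, n)).
  have := sum_sa_sb ck (e k); rewrite big1 => [ek0|i _]; last by rewrite z sa0.
  by have := e1 k; rewrite -ek0 hnorm0 => /eqP; rewrite eq_sym oner_eq0.
have [f hf] := choice src.
exists L, e, (fun k => (f k).1), (fun k => (f k).2); split=> //.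
- by move=> k; rewrite h1 ?(hf k).2//; exact: (hf k).1.
- by move=> k; have [Dk mk] := hf k; have := back _ _ Dk; rewrite mk.
- move=> i k; have [Dik|Dik] := pselect (D i k); last by left; exact: h0.
  by right; exists (m i k); exact: h1.
Qed.

Section Basis.
Context {tau : representation O} {L : Type} {e : L -> tau} {c : L -> 'I_N} {sigma : L -> L}.
Hypotheses (oe : orthonormal_family e)
  (saE : forall k, sa (c k) (e (sigma k)) = e k) (sbE : forall k, sb (c k) (e k) = e (sigma k))
  (sa_basis : forall i k, sa i (e k) = 0 \/ exists k', sa i (e k) = e k').

Definition code k : nat -> 'I_N := fun n => c (iter n sigma k).

Lemma basis_neq0 k : e k <> 0.
Proof. by move=> h; have := oe.1 k; rewrite h hdot0l => /eqP; rewrite eq_sym oner_eq0. Qed.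

Lemma basis_inj k l : e k = e l -> k = l.
Proof.
move=> h; apply: contrapT => /(oe.2 k l); rewrite h oe.1 => /eqP; by rewrite oner_eq0.
Qed.

Lemma code_shift n k : wshift n (code k) = code (iter n sigma k).
Proof. by apply/funext => l; rewrite /wshift /code addnC iterD. Qed.

Lemma basis_opB n k : opB (prefix (code k) n) (e k) = e (iter n sigma k).
Proof. by elim: n => // n IH; rewrite opB_prefixS IH sbE. Qed.

Lemma basis_opA n k : opA (prefix (code k) n) (e (iter n sigma k)) = e k.
Proof.
elim: n k => // n IH k; rewrite iterSr /= -[RHS]saE -[in RHS]IH.
by rewrite -(code_shift 1).
Qed.

Lemma basis_coded k : coded (code k) (e k).
Proof. by move=> n; rewrite basis_opB basis_opA. Qed.

Lemma code_infinite k : infinite_word A (code k).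
Proof.
move=> n; apply/negPn/negP => h.
have := sa_coded0 ck (basis_coded (iter n.+1 sigma k)) h.
by rewrite {1}/code iterS saE; exact: basis_neq0.
Qed.

Lemma code_unique k y : infinite_word A y -> coded y (e k) -> code k = y.
Proof.
move=> hy cy; apply: contrapT => ne; apply: (@basis_neq0 k); apply: hdot_eq0.
exact: (coded_orth ck (code_infinite k) hy (basis_coded k) cy ne).
Qed.

Lemma basis_sa i k : sa i (e k) = 0 \/ exists2 k', sa i (e k) = e k' & sigma k' = k.
Proof.
have [->|[k' hk']] := sa_basis i k; first by left.
right; exists k' => //; apply: basis_inj; rewrite -sbE -hk'.
have ic : c k' = i.
  apply: contrapT => ne; apply: (@basis_neq0 (sigma k')).
  by rewrite -sbE -hk' (sb_sa_neq ck)//.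
rewrite ic (sb_sa_coded ck i (basis_coded k)); case: (boolP (A i (code k 0%N))) => h; first by rewrite scale1r.
by have := sa_coded0 ck (basis_coded k) h; rewrite hk' => /basis_neq0.
Qed.

Lemma basis_opA_word w k : opA w (e k) = 0 \/ exists2 k', opA w (e k) = e k' & iter (size w) sigma k' = k.
Proof.
elim: w k => [|i w IH] k; first by right; exists k.
have [h|[k' h hk']] := IH k; first by left; rewrite /= h sa0.
have [h'|[k'' h' hk'']] := basis_sa i k'; first by left; rewrite /= h.
by right; exists k''; rewrite /= ?h// -iterS iterSr hk''.
Qed.

Lemma basis_branch k w m : branch (code k) (e k) w m = 0 \/
  exists2 k', branch (code k) (e k) w m = e k' & iter (size w) sigma k' = iter m sigma k.
Proof. by rewrite -[branch _ _ _ _]/(opA w (opB (prefix (code k) m) (e k))) basis_opB; exact: basis_opA_word. Qed.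

Definition same_orbit k l := exists a b, iter a sigma k = iter b sigma l.

Lemma same_orbit_sym k l : same_orbit k l -> same_orbit l k.
Proof. by move=> [a [b h]]; exists b, a. Qed.

Lemma same_orbit_trans k l m : same_orbit k l -> same_orbit l m -> same_orbit k m.
Proof.
move=> [a [b h]] [a' [b' h']]; exists (a' + a)%N, (b + b')%N.
by rewrite iterD h -iterD addnC iterD h' -iterD.
Qed.

Lemma basis_orbit_act k l : same_orbit k l -> exists a, e k = act a (e l).
Proof.
move=> [a [b h]]; have [a' ha'] := branch_act (s := s) (code l) (e l) (prefix (code k) a) b.
by exists a'; rewrite -ha' -[branch _ _ _ _]/(opA (prefix (code k) a) (opB (prefix (code l) b) (e l))) basis_opB -h basis_opA.
Qed.

Lemma basis_orbit_orth k l a b : ~ same_orbit k l -> '[act a (e k), act b (e l)] = 0.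
Proof.
move=> ne; apply: (coded_act_orth ck gen (code_infinite k) (code_infinite l) (basis_coded k) (basis_coded l)).
move=> p m _; have [->|[k' -> hk']] := basis_branch k (prefix (code l) p) m; first by rewrite hdot0l.
by apply: oe.2 => kl; subst k'; apply: ne; exists m; eexists; exact: esym hk'.
Qed.

(** Shift down to the common tail of the two words and follow the prefix of [y] back up:
    the generators do not kill the basis vector on the way, since [y] is admissible. *)
Lemma orbit_with_code k y : infinite_word A y -> tail_eq (code k) y ->
  exists l, same_orbit l k /\ code l = y.
Proof.
move=> hy [a [b h]]; have cb : coded (wshift b y) (e (iter a sigma k)).
  by rewrite -h code_shift; exact: basis_coded.
have n1 := opA_prefix_isometric ck (n := b) (e (iter a sigma k)) hy cb.
have [h0|[l hl sl]] := basis_opA_word (prefix y b) (iter a sigma k).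
  by move: n1; rewrite h0 hdot0l oe.1 => /eqP; rewrite eq_sym oner_eq0.
exists l; split; first by rewrite size_prefix in sl; exists b, a.
apply: code_unique => //; rewrite -hl.
have [h0|[_]] := coded_opA ck (prefix y b) (infinite_word_shift b hy) cb.
  by rewrite h0; exact: coded0.
by rewrite wapp_prefix.
Qed.

Section Representatives.
Context (I : Type) (w : I -> nat -> 'I_N).
Hypotheses (iw : forall i, infinite_word A (w i))
  (cw : forall x, infinite_word A x -> exists i, tail_eq x (w i)).

(** By choice of one label per orbit among those whose code is standard. *)
Lemma orbit_representatives : exists C : L -> Prop,
  [/\ forall k, C k -> exists i, code k = w i, forall k l, C k -> C l -> same_orbit k l -> k = l
    & forall k, exists2 l, C l & same_orbit k l].
Proof.
pose P k := [set l | same_orbit l k /\ exists i, code l = w i].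
have neP k : exists l, P k l.
  have [i hi] := cw (code_infinite k); have [l [lk ll]] := orbit_with_code (iw i) hi.
  by exists l; split=> //; exists i.
pose rep k := projT1 (cid (neP k)).
have hrep k : P k (rep k) by exact: projT2 (cid (neP k)).
have rep_eq k l : same_orbit k l -> rep k = rep l.
  move=> kl; have PE : P k = P l.
    apply/seteqP; split=> m [mk hm]; split=> //; first exact: same_orbit_trans mk kl.
    exact: same_orbit_trans mk (same_orbit_sym kl).
  rewrite /rep; move: (neP k) (neP l); rewrite PE => h h'; by rewrite (Prop_irrelevance h h').
exists (fun k => rep k = k); split.
- by move=> k <-; have [_ h] := hrep k.
- by move=> k l hk hl kl; rewrite -hk -hl; exact: rep_eq.
- move=> k; have [rk _] := hrep k; exists (rep k); first by apply: rep_eq.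
  exact: same_orbit_sym.
Qed.

End Representatives.

Section Periods.
Context (i0 : 'I_N) (J : seq 'I_N).
Local Notation x := (wpow_inf i0 J).
Let psi := iter (size J) sigma.

(** The period of a label under the return map; 0 for an infinite orbit. *)
Definition has_period k q := forall n, iter n psi k = k <-> (q %| n)%N.

Lemma has_period_exists k : exists q, has_period k q.
Proof.
have [[n n0 hn]|h] := pselect (exists2 n, (0 < n)%N & iter n psi k = k); last first.
  exists 0%N => n; rewrite dvd0n; split=> [hn|/eqP -> //].
  by apply/eqP; case: n hn => // n hn; exfalso; apply: h; exists n.+1.
have ex : exists n, (0 < n)%N && `[< iter n psi k = k >] by exists n; rewrite n0; exact/asboolP.
have [q /andP[q0 /asboolP hq] minq] := ex_minnP ex.
have hqm j : iter (j * q) psi k = k.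
  by elim: j => // j IH; rewrite mulSn iterD IH.
exists q => m; split=> [hm|/dvdnP[j ->]]; last exact: hqm.
have hr : iter (m %% q) psi k = k by rewrite -[in RHS]hm {2}(divn_eq m q) addnC iterD hqm.
rewrite /dvdn; case: (posnP (m %% q)) => [//|r0].
have := minq (m %% q)%N; rewrite r0 /= => /(_ _) H.
by have := H (introT (asboolP _) hr); rewrite leqNgt ltn_pmod.
Qed.

Lemma has_period_unique k q q' : has_period k q -> has_period k q' -> q = q'.
Proof.
move=> h h'; apply/eqP; rewrite eqn_dvd; apply/andP; split.
  by apply/h; apply/h'.
by apply/h'; apply/h.
Qed.

Lemma period_correlation k q : code k = x -> has_period k q ->
  forall n, '[iter n (opA J) (e k), e k] = (q %| n)%N%:R.
Proof.
move=> ck_ hq n; rewrite -(opA_iter (s := s) i0) opA_dot -ck_ basis_opB iterM.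
have -> : iter n (iter (size J) sigma) k = iter n psi k by [].
case: (boolP (q %| n)%N) => [/hq ->|h]; first exact: oe.1.
by apply: oe.2 => hk; move/negP: h; apply; apply/hq.
Qed.

End Periods.
End Basis.
End PermutativeBasis.

(** * Existence of the decomposition *)

Section PeriodicComponents.
Context {R : realType} {N : nat} {A : 'M[bool]_N} {O : cstar_algebra R} {s : 'I_N -> O}.
Hypothesis isO : is_cuntz_krieger A s.
Context (eta : probability (borel_circle R) R).
Hypothesis haar : is_haar eta.
Context (i0 : 'I_N) (J : seq 'I_N).
Hypothesis pJ : primitive i0 J.
Local Notation x := (wpow_inf i0 J).
Hypothesis hJ : infinite_word A x.
Let ck : ck_relations A s. Proof. by case: isO. Qed.
Let gen : forall S : set O, closed_star_subalgebra S -> (forall i, S (s i)) -> S = setT.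
Proof. by case: isO. Qed.
Local Notation opA := (opA (s := s)).
Local Notation coded := (coded (s := s)).
Context (tau : representation O).

(** The fields of a decomposition at one periodic word, gathered so that they can be
    chosen together, with an embedding of their sum into [tau]. *)
Record periodic_component := PeriodicComponent {
  c_root : forall p, 'I_p.+1 -> representation O;
  c_field : rep_field O;
  c_sum : nat -> representation O;
  c_int : representation O;
  c_rep : representation O;
  c_embed : c_rep -> tau }.

Definition component_spec (nuf : nat -> Type) (nui : Type) (t : {p & nuf p} + nui -> tau)
    (q : periodic_component) : Prop :=
  [/\ [/\ forall p (j : 'I_p.+1), is_P s J (circle_root (R := R) p.+1 j.+1) (c_root q j),
          forall z, is_P s J (val z) (c_field q z),
          forall p, is_direct_sum (c_root q (p := p)) (c_sum q p)
        & is_direct_integral eta (c_field q) (c_int q)],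
      is_direct_sum (fun i : {p & nuf p} + nui =>
        match i with inl c => c_sum q (projT1 c) | inr _ => c_int q end) (c_rep q)
    & [/\ isometry_into (@c_embed q), intertwiner (@c_embed q), forall i, exists u, @c_embed q u = t i
        & forall u, in_closed_span [set v | exists i a, v = act a (t i)] (@c_embed q u)]].

Lemma is_P_exists (z : R[i]) : cabs z = 1 -> exists rho : representation O, is_P s J z rho.
Proof.
move=> nz; have c1 w : cabs (base_phase (x := x) z w) = 1 by exact: base_phase1.
have [rho [e me]] := word_model_exists isO hJ c1.
by exists rho; exact: (word_model_is_P isO pJ hJ nz me).
Qed.

Lemma periodic_component_exists (nuf : nat -> Type) (nui : Type) (t : {p & nuf p} + nui -> tau) :
  (forall i, coded x (t i)) ->
  (forall i n, '[iter n (opA J) (t i), t i] =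
     ((match i with inl c => (projT1 c).+1 | inr _ => 0 end) %| n)%N%:R) ->
  (forall i j a b, i <> j -> '[act a (t i), act b (t j)] = 0) ->
  exists q, component_spec t q.
Proof.
move=> ct wt ot.
have Hr p (j : 'I_p.+1) : exists rho : representation O, is_P s J (circle_root (R := R) p.+1 j.+1) rho.
  by apply: is_P_exists; exact: cabs_expi.
pose r p (j : 'I_p.+1) := projT1 (cid (Hr p j)).
have hr p (j : 'I_p.+1) : is_P s J (circle_root (R := R) p.+1 j.+1) (r p j) by exact: projT2 (cid (Hr p j)).
pose S p := projT1 (cid (direct_sum_exists (r p))).
have hS p : is_direct_sum (r p) (S p) by exact: projT2 (cid (direct_sum_exists (r p))).
have [F hF] := constant_field_exists isO pJ hJ.
have [fi hfi] := field_integral_exists F eta.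
have [e [ce he we]] := field_cyclic ck gen haar pJ hJ hF hfi.
pose w p := projT1 (cid (roots_cyclic ck pJ (hr p) (hS p))).
have hw p : [/\ cyclic_vector (w p), coded x (w p) & forall n, '[iter n (opA J) (w p), w p] = (p.+1 %| n)%N%:R].
  exact: projT2 (cid (roots_cyclic ck pJ (hr p) (hS p))).
pose rho (i : {p & nuf p} + nui) := match i with inl c => S (projT1 c) | inr _ => fi end.
pose g (i : {p & nuf p} + nui) : rho i := match i with inl c => w (projT1 c) | inr _ => e end.
have hg i : [/\ cyclic_vector (g i), coded x (g i) & forall n, '[iter n (opA J) (g i), g i] =
     ((match i with inl c => (projT1 c).+1 | inr _ => 0 end) %| n)%N%:R].
  case: i => [c|c]; first exact: hw.
  by split=> //= n; rewrite dvd0n.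
have [||M [W [sM iW tW tIn spW]]] := @embed_sum R O tau _ rho g t _ ot.
- by move=> i; have [] := hg i.
- move=> i; have [cg xg wg] := hg i.
  by apply: (iter_correlation_embedding ck gen pJ hJ xg (ct i) cg) => n; rewrite wg wt.
by exists (@PeriodicComponent r F S fi M W).
Qed.

End PeriodicComponents.

Section DecompositionExistence.
Context {R : realType} {N : nat} {A : 'M[bool]_N} {O : cstar_algebra R} {s : 'I_N -> O}.
Hypothesis isO : is_cuntz_krieger A s.
Context {eta : probability (borel_circle R) R}.
Hypothesis haar : is_haar eta.
Context (i0 : 'I_N) {T : set (nat -> 'I_N)}.
Hypothesis hT : bracket_infinite A T.
Let ck : ck_relations A s. Proof. by case: isO. Qed.
Let gen : forall S : set O, closed_star_subalgebra S -> (forall i, S (s i)) -> S = setT.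
Proof. by case: isO. Qed.
Local Notation index := (fin_index A + inf_index T)%type.
Local Notation index_word := (index_word i0 (A := A) (T := T)).

Lemma index_word_cover y : infinite_word A y -> exists i : index, tail_eq y (index_word i).
Proof.
move=> /(word_class i0 hT)[[J [hJ e]]|[K [hK e]]].
  by exists (inl (exist _ J hJ)).
by exists (inr (exist _ K hK)).
Qed.

(** One summand for each orbit: those with word [J^oo] are sorted by the period of
    their representative under the return map, and those with aperiodic word [K] give
    the copies of P(K). *)
Theorem decomposition_exists (tau : representation O) : permutative s tau ->
  exists D : decomposition O A T, is_decomposition s eta tau D.
Proof.
move=> /(coding_map ck)[L [e [c [sigma [oe te saE sbE sab]]]]].
have iw := index_word_infinite i0 hT.
have [C [Cw Cinj Ccov]] := orbit_representatives ck oe saE sbE sab iw index_word_cover.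
pose cd := @code N L c sigma.
have Corth k l a b : C k -> C l -> k <> l -> '[act a (e k), act b (e l)] = 0.
  by move=> hk hl kl; apply: (basis_orbit_orth ck gen oe saE sbE sab) => /(Cinj _ _ hk hl).
(* Chosen labels with word [J^oo], sorted by period. *)
pose per (J : fin_index A) k q := [/\ C k, cd k = wpow_inf i0 (sval J) & @has_period N L sigma (sval J) k q].
pose nuf J p := {k | per J k p.+1}; pose nui J := {k | per J k 0%N}.
pose nuK (K : inf_index T) := {k | C k /\ cd k = sval K}.
pose t J (i : {p & nuf J p} + nui J) : tau :=
  match i with inl q => e (sval (projT2 q)) | inr q => e (sval q) end.
pose period J (i : {p & nuf J p} + nui J) : nat := match i with inl q => (projT1 q).+1 | inr _ => 0 end.
have tE J i : exists k, t J i = e k /\ per J k (period J i).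
  by case: i => [[p [k hk]]|[k hk]]; exists k.
have t_inj J i j : (exists k, t J i = e k /\ t J j = e k) -> i = j.
  have [k [ek pk]] := tE J i; have [k' [ek' pk']] := tE J j.
  move=> [l []]; rewrite ek ek' => /(basis_inj oe) E /(basis_inj oe) E'; subst l k'.
  have [_ _ h1] := pk; have [_ _ h2] := pk'; have := has_period_unique h1 h2.
  move: ek ek' => {pk pk' h1 h2}.
  case: i => [[p [l hl]]|[l hl]]; case: j => [[p' [l' hl']]|[l' hl']] //=.
  - move=> /(basis_inj oe) E /(basis_inj oe) E' [pp]; subst l l' p'.
    by rewrite (Prop_irrelevance hl hl').
  - move=> /(basis_inj oe) E /(basis_inj oe) E' _; subst l l'.
    by rewrite (Prop_irrelevance hl hl').
have qJ (J : fin_index A) : exists q, component_spec (s := s) eta (sval J) (t J) q.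
  apply: (periodic_component_exists isO haar (index_primitive i0 J) (iw (inl J))) => [i|i n|i j a b ij].
  - by have [k [-> [_ h _]]] := tE J i; rewrite -h; exact: (basis_coded saE sbE).
  - by have [k [-> [_ h hp]]] := tE J i; exact: (period_correlation oe sbE h hp).
  - have [k [ek [hk _ _]]] := tE J i; have [l [el [hl _ _]]] := tE J j.
    by rewrite ek el; apply: Corth => // kl; apply: ij; apply: t_inj; exists k; rewrite ek el kl.
pose q J := projT1 (cid (qJ J)).
have hq J : component_spec (s := s) eta (sval J) (t J) (q J) by exact: projT2 (cid (qJ J)).
have HK (K : inf_index T) : exists rho : representation O, is_P_inf s (sval K) rho.
  exact: (word_model_is_P_inf isO (iw (inr K)) (index_aperiodic hT (K := K))).
pose hK K := projT1 (cid (HK K)).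
have hKP K : is_P_inf s (sval K) (hK K) by exact: projT2 (cid (HK K)).
have MK K : exists M : {M : representation O & M -> tau},
    [/\ is_direct_sum (fun _ : nuK K => hK K) (projT1 M), isometry_into (projT2 M), intertwiner (projT2 M),
        forall i : nuK K, exists u, projT2 M u = e (sval i)
      & forall u, in_closed_span [set v | exists (i : nuK K) a, v = act a (e (sval i))] (projT2 M u)].
  have [v [cv v1 hv]] := is_P_inf_coded ck (hKP K).
  have [|i j a b ij||M [W hW]] := @embed_sum R O tau (nuK K) (fun=> hK K) (fun=> v) (fun i => e (sval i)).
  - by [].
  - apply: Corth; [exact: (svalP i).1|exact: (svalP j).1|move=> h; apply: ij].
    by case: i j h => [k hk] [l hl] /= kl; subst l; rewrite (Prop_irrelevance hk hl).
  - move=> [k [hk ek]]; apply: (aperiodic_embedding ck gen (iw (inr K)) (index_aperiodic hT (K := K)) hv _ cv).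
      by rewrite /= -ek; exact: (basis_coded saE sbE).
    by rewrite hdot_unit//= oe.1.
  by exists (existT _ M W).
pose mK K := projT1 (cid (MK K)).
have hmK K : [/\ is_direct_sum (fun _ : nuK K => hK K) (projT1 (mK K)), isometry_into (projT2 (mK K)),
        intertwiner (projT2 (mK K)), forall i : nuK K, exists u, projT2 (mK K) u = e (sval i)
      & forall u, in_closed_span [set v | exists (i : nuK K) a, v = act a (e (sval i))] (projT2 (mK K) u)].
  exact: projT2 (cid (MK K)).
pose D : decomposition O A T := @Decomposition R N O A T nuf nui nuK (fun J => @c_root _ _ _ (q J))
  (fun J => c_field (q J)) hK (fun J => c_sum (q J)) (fun J => c_int (q J)) (fun J => c_rep (q J))
  (fun K => projT1 (mK K)).
exists D; split.
- split=> [J p j|J z|K]; last exact: hKP.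
    by have [[h _ _ _] _ _] := hq J; exact: h.
  by have [[_ h _ _] _ _] := hq J; exact: h.
- by split=> [J p|J]; [have [[_ _ h _] _ _] := hq J; exact: h|have [[_ _ _ h] _ _] := hq J].
- by split=> [J|K]; [have [_ h _] := hq J|have [h _ _ _ _] := hmK K].
pose W (i : index) : (match i with inl J => H_J D J | inr K => H_K D K end : representation O) -> tau :=
  match i with inl J => @c_embed _ _ _ (q J) | inr K => projT2 (mK K) end.
pose Sp (i : index) : set tau := [set v | exists k a, [/\ C k, cd k = index_word i & v = act a (e k)]].
have hW i : [/\ isometry_into (W i), intertwiner (W i),
    forall k, C k -> cd k = index_word i -> exists u, W i u = e k & forall u, in_closed_span (Sp i) (W i u)].
  case: i => [J|K].
    have [_ _ [h1 h2 h3 h4]] := hq J; split=> // [k hk ek|u].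
      have [[|p] hp] := @has_period_exists N L sigma (sval J) k.
        have pk : per J k 0%N by [].
        exact: (h3 (inr (exist _ k pk))).
      have pk : per J k p.+1 by [].
      exact: (h3 (inl (existT _ p (exist _ k pk)))).
    apply: cspan_mono (h4 u) => _ [i [a ->]]; have [k [-> [hk ek _]]] := tE J i.
    by apply: sub_cspan; exists k, a.
  have [_ h1 h2 h3 h4] := hmK K; split=> // [k hk ek|u].
    by have pk : C k /\ cd k = sval K by []; exact: (h3 (exist _ k pk)).
  apply: cspan_mono (h4 u) => _ [[k [hk ek]] [a ->]].
  by apply: sub_cspan; exists k, a.
exists W; split.
- by move=> i; have [] := hW i.
- move=> i j u v ij; have [_ _ _ hi] := hW i; have [_ _ _ hj] := hW j.
  apply: (cspan_orthl (hi u)) => _ [k [a [hk ek ->]]].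
  apply: (cspan_orthr (hj v)) => _ [l [b [hl el ->]]].
  apply: Corth => // kl; apply: ij; apply: (index_word_inj (i0 := i0) hT).
  by rewrite -ek -el kl; exact: tail_eq_refl.
- by move=> i; have [] := hW i.
- apply: total_orth => v hv; apply: (orth_total te) => _ [k _ <-].
  have [l hl kl] := Ccov k; have [i hi] := Cw _ hl; have [_ tW hWi _] := hW i.
  have [u hu] := hWi l hl hi; have [a ->] := basis_orbit_act saE sbE kl.
  by rewrite -hu -tW; apply: hv; exists i, (act a u).
Qed.

End DecompositionExistence.

Theorem proposition5p8 (R : realType) (N : nat) (A : 'M[bool]_N)
  (O : cstar_algebra R) (s : 'I_N -> O)
  (eta : probability (borel_circle R) R)
  (T : set (nat -> 'I_N)) (pi : representation O) :
  (2 <= N)%N ->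
  no_zero_line A ->
  is_cuntz_krieger A s ->
  is_haar eta ->
  bracket_infinite A T ->
  permutative s pi ->
  [/\ exists D : decomposition O A T, is_decomposition s eta pi D,
      forall D : decomposition O A T,
        is_decomposition s eta pi D -> irreducible_components D
    & forall D D' : decomposition O A T,
        is_decomposition s eta pi D -> is_decomposition s eta pi D' ->
        equivalent_decompositions D D'].
Proof.
move=> N2 _ isO haar hT perm.
have N0 : (0 < N)%N by exact: leq_trans N2.
pose i0 : 'I_N := Ordinal N0; split.
- exact: (decomposition_exists isO haar i0 hT perm).
- by move=> D; exact: (decomposition_irreducible isO i0 hT).
- by move=> D D'; exact: (decomposition_unique isO haar i0 hT).
Qed.
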